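(* Let $f\in L_2(\Omega)$ be given, let $L(z,\mathbf\Theta):=-(f,z)$, and let $\mathbf u\in\mathcal U$ be the solution of $b(\mathbf u,\mathbf v)=L(\mathbf v)$ for all $\mathbf v\in\mathcal V$. For any finite-dimensional subspace $\mathcal U_h\subset\mathcal U$ there exists a unique $\mathbf u_h\in\mathcal U_h$ such that $$b(\mathbf u_h,\mathrm T\boldsymbol\delta)=L(\mathrm T\boldsymbol\delta)\qquad\forall\boldsymbol\delta\in\mathcal U_h,$$ where $\mathrm T:\mathcal U\to\mathcal V$ is the trial-to-test operator. It satisfies the quasi-optimal error estimate $$\|\mathbf u-\mathbf u_h\|_{\mathcal U}\le c\,\|\mathbf u-\mathbf w\|_{\mathcal U}\qquad\forall\mathbf w\in\mathcal U_h$$ with a constant $c>0$ that is independent of $f$, $\mathcal T$ and $\mathcal U_h$.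
   Context: Let $d\in\{2,3\}$ and let $\Omega\subset\mathbb R^d$ be a bounded simply connected Lipschitz domain. $\mathcal T$ is a (finite) mesh of $\Omega$ consisting of pairwise non-intersecting open Lipschitz elements $T$ whose closures cover $\overline\Omega$; $\mathcal S=\{\partial T: T\in\mathcal T\}$ is its skeleton. Differential operators: $\mathrm{div}$ is the divergence of vector fields, $\mathbf{div}$ the row-wise divergence of tensors, $\boldsymbol\varepsilon(\boldsymbol w)=\frac12(\nabla\boldsymbol w+(\nabla\boldsymbol w)^T)$, so $\boldsymbol\varepsilon\nabla z$ is the Hessian of $z$. An index $\mathcal T$ (as in $\boldsymbol\varepsilon_{\mathcal T}\nabla_{\mathcal T}$, $\mathrm{div}_{\mathcal T}\mathbf{div}_{\mathcal T}$) means that the operator is taken element by element. $(\cdot,\cdot)_T,\|\cdot\|_T$ are the $L_2(T)$ inner product and norm of scalar or tensor functions; without index they refer to $\Omega$. $\mathbb L_2^s(\Omega)$ is the space of symmetric $d\times d$ tensor functions with $L_2(\Omega)$ components. Constitutive tensor: $\mathcal C\boldsymbol\kappa=D[\nu\,\mathrm{tr}(\boldsymbol\kappa)\mathbf I+(1-\nu)\boldsymbol\kappa]$ with $D=\frac{Et^3}{12(1-\nu^2)}$, with fixed $E>0$, $t>0$, $\nu\in(-1,1/2]$ such that $\mathcal C$ is positive definite; it induces a self-adjoint isomorphism of $\mathbb L_2^s(\Omega)$. Spaces: $H^2(T)$ is the closure of the smooth functions on $\overline T$ w.r.t. $\|z\|_{2,T}^2=\|z\|_T^2+\|\boldsymbol\varepsilon\nabla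 z\|_T^2$; $H(\mathrm{div}\,\mathbf{div},T)$ is the closure of the smooth symmetric tensors on $\overline T$ w.r.t. $\|\mathbf\Theta\|_{\mathrm{div}\,\mathbf{div},T}^2=\|\mathbf\Theta\|_T^2+\|\mathrm{div}\,\mathbf{div}\,\mathbf\Theta\|_T^2$. $H^2(\mathcal T)=\{z\in L_2(\Omega): z|_T\in H^2(T)\ \forall T\in\mathcal T\}$ and $H(\mathrm{div}\,\mathbf{div},\mathcal T)=\{\mathbf\Theta\in\mathbb L_2^s(\Omega):\mathbf\Theta|_T\in H(\mathrm{div}\,\mathbf{div},T)\ \forall T\in\mathcal T\}$, with product norms $\|\cdot\|_{2,\mathcal T}$, $\|\cdot\|_{\mathrm{div}\,\mathbf{div},\mathcal T}$ (square roots of sums of squares of element norms). $H^2_0(\Omega)$ is the closure of $C_c^\infty(\Omega)$ w.r.t. $\|z\|_2^2=\|z\|^2+\|\boldsymbol\varepsilon\nabla z\|^2$, and $H(\mathrm{div}\,\mathbf{div},\Omega)$ the closure of the smooth symmetric tensors on $\overline\Omega$ w.r.t. $\|\mathbf\Theta\|_{\mathrm{div}\,\mathbf{div}}^2=\|\mathbf\Theta\|^2+\|\mathrm{div}\,\mathbf{div}\,\mathbf\Theta\|^2$. Traces: $\mathrm{tr}^{\mathrm{dDiv}}_T:H(\mathrm{div}\,\mathbf{div},T)\to H^2(T)'$ and $\mathrm{tr}^{\mathrm{Ggrad}}_T:H^2(T)\to H(\mathrm{div}\,\mathbf{div},T)'$ are defined by $$\langle\mathrm{tr}^{\mathrm{dDiv}}_T(\mathbf\Theta),z\rangle_{\partial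 T}=\langle\mathrm{tr}^{\mathrm{Ggrad}}_T(z),\mathbf\Theta\rangle_{\partial T}=(\mathrm{div}\,\mathbf{div}\,\mathbf\Theta,z)_T-(\mathbf\Theta,\boldsymbol\varepsilon\nabla z)_T .$$ $\mathrm{tr}^{\mathrm{dDiv}}(\mathbf\Theta)=(\mathrm{tr}^{\mathrm{dDiv}}_T(\mathbf\Theta))_{T}$ for $\mathbf\Theta\in H(\mathrm{div}\,\mathbf{div},\Omega)$, with range $\mathbf H^{-3/2,-1/2}(\mathcal S)$, and $\mathrm{tr}^{\mathrm{Ggrad}}(z)=(\mathrm{tr}^{\mathrm{Ggrad}}_T(z))_{T}$ for $z\in H^2_0(\Omega)$, with range $\mathbf H^{3/2,1/2}_{00}(\mathcal S)$. Dualities: $\langle\boldsymbol q,z\rangle_{\mathcal S}=\sum_T\langle\boldsymbol q_T,z\rangle_{\partial T}$ for $\boldsymbol q=(\boldsymbol q_T)_T\in\mathbf H^{-3/2,-1/2}(\mathcal S)$, $z\in H^2(\mathcal T)$, and $\langle\boldsymbol v,\mathbf\Theta\rangle_{\mathcal S}=\sum_T\langle\boldsymbol v_T,\mathbf\Theta\rangle_{\partial T}$ for $\boldsymbol v=(\boldsymbol v_T)_T\in\mathbf H^{3/2,1/2}_{00}(\mathcal S)$, $\mathbf\Theta\in H(\mathrm{div}\,\mathbf{div},\mathcal T)$. Norms: $$\|\boldsymbol q\|_{-3/2,-1/2,\mathcal S}=\sup_{0\ne z\in H^2(\mathcal T)}\frac{\langle\boldsymbol q,z\rangle_{\mathcal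 S}}{\|z\|_{2,\mathcal T}},\qquad \|\boldsymbol v\|_{3/2,1/2,00,\mathcal S}=\sup_{0\ne\mathbf\Theta\in H(\mathrm{div}\,\mathbf{div},\mathcal T)}\frac{\langle\boldsymbol v,\mathbf\Theta\rangle_{\mathcal S}}{\|\mathbf\Theta\|_{\mathrm{div}\,\mathbf{div},\mathcal T}} .$$ Variational setting: $\mathcal U=L_2(\Omega)\times\mathbb L_2^s(\Omega)\times\mathbf H^{3/2,1/2}_{00}(\mathcal S)\times\mathbf H^{-3/2,-1/2}(\mathcal S)$ with norm $\|(u,\mathbf M,\widehat{\boldsymbol u},\widehat{\boldsymbol q})\|_{\mathcal U}^2=\|u\|^2+\|\mathbf M\|^2+\|\widehat{\boldsymbol u}\|_{3/2,1/2,00,\mathcal S}^2+\|\widehat{\boldsymbol q}\|_{-3/2,-1/2,\mathcal S}^2$; $\mathcal V=H^2(\mathcal T)\times H(\mathrm{div}\,\mathbf{div},\mathcal T)$ with norm $\|(z,\mathbf\Theta)\|_{\mathcal V}^2=\|z\|_{2,\mathcal T}^2+\|\mathbf\Theta\|_{\mathrm{div}\,\mathbf{div},\mathcal T}^2$ and the inner product $\langle\!\langle\cdot,\cdot\rangle\!\rangle_{\mathcal V}$ inducing this norm; for $\mathbf u=(u,\mathbf M,\widehat{\boldsymbol u},\widehat{\boldsymbol q})\in\mathcal U$ and $\mathbf v=(z,\mathbf\Theta)\in\mathcal V$, $$b(\mathbf u,\mathbf v)=(\mathbf M,\boldsymbol\varepsilon_{\mathcal T}\nabla_{\mathcal T}z+\mathcal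 C^{-1}\mathbf\Theta)+(u,\mathrm{div}_{\mathcal T}\mathbf{div}_{\mathcal T}\mathbf\Theta)+\langle\widehat{\boldsymbol q},z\rangle_{\mathcal S}-\langle\widehat{\boldsymbol u},\mathbf\Theta\rangle_{\mathcal S}.$$ The trial-to-test operator $\mathrm T:\mathcal U\to\mathcal V$ is defined by $\langle\!\langle\mathrm T(\mathbf u),\mathbf v\rangle\!\rangle_{\mathcal V}=b(\mathbf u,\mathbf v)$ for all $\mathbf v\in\mathcal V$. *)

(* Defs.v *)
From HB Require Import structures.
From mathcomp Require Import all_boot all_order all_algebra.
From mathcomp Require Import all_classical all_reals all_analysis.
Set Implicit Arguments.
Unset Strict Implicit.
Unset Printing Implicit Defensive.
Import Order.TTheory GRing.Theory Num.Theory.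
Import numFieldNormedType.Exports.
Local Open Scope classical_set_scope.
Local Open Scope ring_scope.

Definition matrix_display : measure_display. Proof. exact. Qed.

Section measurable_matrix.
Context (R : realType) (m n : nat).

Definition mx_sigma_algebra : set (set 'M[R]_(m, n)) :=
  <<s \bigcup_(p in [set: 'I_m * 'I_n])
        preimage_set_system setT (fun A : 'M[R]_(m, n) => A p.1 p.2)
          (@measurable _ R) >>.

Let mx_set0 : mx_sigma_algebra set0.
Proof. exact: sigma_algebra0. Qed.

Let mx_setC A : mx_sigma_algebra A -> mx_sigma_algebra (~` A).
Proof. exact: sigma_algebraC. Qed.

Let mx_bigcup (F : (set 'M[R]_(m, n))^nat) :
  (forall i, mx_sigma_algebra (F i)) -> mx_sigma_algebra (\bigcup_i (F i)).
Proof. exact: sigma_algebra_bigcup. Qed.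

HB.instance Definition _ := @isMeasurable.Build matrix_display
  'M[R]_(m, n) mx_sigma_algebra mx_set0 mx_setC mx_bigcup.

Lemma measurable_coord (i : 'I_m) (j : 'I_n) :
  measurable_fun setT (fun A : 'M[R]_(m, n) => A i j).
Proof.
move=> _ B mB; apply: sub_sigma_algebra.
by exists (i, j) => //; exists B.
Qed.

Lemma measurable_fun_mx d (T : measurableType d) (f : T -> 'M[R]_(m, n)) :
  (forall i j, measurable_fun setT (fun x => f x i j)) ->
  measurable_fun setT f.
Proof.
move=> mf; apply: (@measurability _ _ _ _ setT f _ erefl).
move=> _ [_ [p _ [B mB <-]] <-]; rewrite !setTI.
by have := mf p.1 p.2 measurableT B mB; rewrite setTI.
Qed.

End measurable_matrix.

Section lebesgue_rV.
Context (R : realType).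

Definition rV_cons n (p : R * 'rV[R]_n) : 'rV[R]_n.+1 :=
  row_mx (p.1%:M : 'M[R]_1) p.2.

Definition rV_uncons n (v : 'rV[R]_n.+1) : R * 'rV[R]_n :=
  (v ord0 ord0, @rsubmx R 1 1 n v).

Lemma rV_consl n p i : rV_cons p i (@lshift 1 n ord0) = p.1.
Proof. by apply: etrans (row_mxEl _ _ _ _) _; rewrite mxE !ord1 eqxx. Qed.

Lemma rV_consr n p i (j : 'I_n) : rV_cons p i (@rshift 1 n j) = p.2 i j.
Proof. exact: row_mxEr. Qed.

Lemma rV_consK n : cancel (@rV_cons n) (@rV_uncons n).
Proof.
move=> [a v]; rewrite /rV_uncons (_ : ord0 = @lshift 1 n ord0) ?rV_consl.
  by congr pair; exact: row_mxKr.
exact: val_inj.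
Qed.

Lemma measurable_rV_cons n : measurable_fun setT (@rV_cons n).
Proof.
apply: measurable_fun_mx => i j.
case: (@split_ordP 1 n j) => k ->.
  rewrite !ord1 (_ : (fun _ => _) = fst) ?measurable_fst//.
  by apply/funext => p; exact: rV_consl.
rewrite (_ : (fun _ => _) = (fun v : 'rV[R]_n => v i k) \o snd).
  exact: measurableT_comp (measurable_coord _ _) measurable_snd.
by apply/funext => p; exact: rV_consr.
Qed.

Lemma measurable_rV_uncons n : measurable_fun setT (@rV_uncons n).
Proof.
apply/measurable_fun_pairP; split; first exact: measurable_coord.
apply: measurable_fun_mx => i j.
under eq_fun do rewrite /= mxE.
exact: measurable_coord.
Qed.

Section step.
Context n (mu : {sigma_finite_measure set 'rV[R]_n -> \bar R}).

Definition lebesgue_step : set 'rV[R]_n.+1 -> \bar R :=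
  pushforward (@lebesgue_measure R \x mu)%E (@rV_cons n).

Let step0 : lebesgue_step set0 = 0%E.
Proof. by rewrite /lebesgue_step /pushforward preimage_set0 measure0. Qed.

Let step_ge0 A : (0 <= lebesgue_step A)%E.
Proof. by rewrite /lebesgue_step /pushforward measure_ge0. Qed.

Let step_sigma_additive : semi_sigma_additive lebesgue_step.
Proof.
move=> F mF tF _; rewrite /lebesgue_step /pushforward preimage_bigcup.
apply: measure_sigma_additive.
  by move=> i; rewrite -[X in measurable X]setTI; exact: measurable_rV_cons.
by move=> i j _ _ [p [Fi Fj]]; apply: tF => //; exists (rV_cons p).
Qed.

HB.instance Definition _ := isMeasure.Build _ _ _ lebesgue_step
  step0 step_ge0 step_sigma_additive.

Let lebesgue_step_sigma_finite : sigma_finite setT lebesgue_step.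
Proof.
have /sigma_finiteP[F [F_T F_nd F_oo]] := sigma_finiteT (@lebesgue_measure R).
have /sigma_finiteP[G [G_T G_nd G_oo]] := sigma_finiteT mu.
exists (fun k => @rV_uncons n @^-1` (F k `*` G k)).
  rewrite -preimage_bigcup (_ : \bigcup_k _ = setT) ?preimage_setT//.
  apply/seteqP; split => // -[x v] _.
  have [i _ Fix] : (\bigcup_i F i) x by rewrite -F_T.
  have [j _ Gjv] : (\bigcup_j G j) v by rewrite -G_T.
  exists (maxn i j) => //; split => /=.
    by move: Fix; apply/subsetPset/F_nd/leq_maxl.
  by move: Gjv; apply/subsetPset/G_nd/leq_maxr.
move=> k; have [mF Foo] := F_oo k; have [mG Goo] := G_oo k.
have mFG : measurable (F k `*` G k) by exact: measurableX.
split; first by rewrite -[X in measurable X]setTI; exact: measurable_rV_uncons.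
rewrite /lebesgue_step /pushforward -comp_preimage.
rewrite (_ : _ \o _ = id); last by apply/funext => p; rewrite /= rV_consK.
by rewrite preimage_id product_measure1E// lte_mul_pinfty// ge0_fin_numE.
Qed.

HB.instance Definition _ :=
  Measure_isSigmaFinite.Build _ _ _ lebesgue_step lebesgue_step_sigma_finite.

End step.

(* Iterated product of the one-dimensional Lebesgue measure, transported along
   [R * 'rV_n ~ 'rV_n.+1]. *)
Fixpoint lebesgue_rV n : {sigma_finite_measure set 'rV[R]_n -> \bar R} :=
  match n with
  | 0 => \d_(0 : 'rV[R]_0)
  | n'.+1 => lebesgue_step (lebesgue_rV n')
  end.

End lebesgue_rV.
Arguments lebesgue_rV {R} n.

Section geometry.
Context (R : realType) (d : nat).
Implicit Types A Omega : set 'rV[R]_d.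

(* Near each boundary point and up to an orthogonal change of coordinates
   [x *m Q], [A] is the strict epigraph, in the direction of the [i]-th
   coordinate, of a Lipschitz function of the other [d.-1] coordinates. *)
Definition lipschitz_boundary A : Prop :=
  forall p, (closure A `\` A) p ->
  exists (Q : 'M[R]_d) (i : 'I_d) (gamma : 'rV[R]_d.-1 -> R),
    [/\ Q *m Q^T = 1%:M, lipschitz gamma &
        \forall x \near p,
          A x <-> gamma (col' i (x *m Q)) < (x *m Q) ord0 i].

(* Path-connectedness is not required separately: it follows from connectedness
   for the open sets considered here. *)
Definition simply_connected A : Prop :=
  connected A /\
  forall gamma : R -> 'rV[R]_d,
    {within `[0, 1], continuous gamma} ->
    gamma @` `[0, 1] `<=` A -> gamma 0 = gamma 1 ->
    exists H : R * R -> 'rV[R]_d,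
      [/\ {within `[0, 1] `*` `[0, 1], continuous H},
          H @` (`[0, 1] `*` `[0, 1]) `<=` A,
          forall r, r \in `[0, 1] -> H (0, r) = gamma r /\ H (1, r) = gamma 0 &
          forall s, s \in `[0, 1] -> H (s, 0) = gamma 0 /\ H (s, 1) = gamma 0].

Definition plate_domain Omega : Prop :=
  [/\ open Omega, Omega !=set0, bounded_set Omega, lipschitz_boundary Omega
    & simply_connected Omega].

Definition is_mesh Omega N (T : 'I_N -> set 'rV[R]_d) : Prop :=
  [/\ forall k, [/\ open (T k), T k !=set0 & lipschitz_boundary (T k)],
      forall k, T k `<=` Omega,
      forall k l, k != l -> T k `&` T l = set0
    & \bigcup_k closure (T k) = closure Omega].

End geometry.

Section calculus.
Context {R : realType} {d : nat}.
Local Notation pt := 'rV[R]_d.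

Definition partial (i : 'I_d) (f : pt -> R) : pt -> R :=
  fun x => 'D_(delta_mx ord0 i) f x.

Definition grad (f : pt -> R) (x : pt) : 'rV[R]_d := \row_i partial i f x.

Definition jacobian (w : pt -> 'rV[R]_d) (x : pt) : 'M[R]_d :=
  \matrix_(i, j) partial j (fun y => w y ord0 i) x.

Definition eps (w : pt -> 'rV[R]_d) (x : pt) : 'M[R]_d :=
  2^-1 *: (jacobian w x + (jacobian w x)^T).

Definition div (w : pt -> 'rV[R]_d) (x : pt) : R :=
  \sum_i partial i (fun y => w y ord0 i) x.

Definition rowdiv (Th : pt -> 'M[R]_d) (x : pt) : 'rV[R]_d :=
  \row_i div (fun y => row i (Th y)) x.

(* Arbitrary iterated partial derivatives exist and are continuous. Smooth
   functions on the closure of a set are taken to be the restrictions of smooth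
   functions on the whole space. *)
Definition smooth (f : pt -> R) : Prop :=
  forall s : seq 'I_d, continuous (foldr partial f s) /\
    forall i x, derivable (foldr partial f s) x (delta_mx ord0 i).

Definition smooth_sym (Th : pt -> 'M[R]_d) : Prop :=
  (forall i j, smooth (fun x => Th x i j)) /\ (forall x, (Th x)^T = Th x).

Definition test_function (Omega : set pt) (f : pt -> R) : Prop :=
  [/\ smooth f, compact (closure [set x | f x != 0])
    & closure [set x | f x != 0] `<=` Omega].

End calculus.

(* Elements of the [L_2]-type spaces are represented by Borel functions defined
   everywhere, of which only the restriction to the given set matters. *)
Section L2.
Context {R : realType} {d : nat}.
Local Notation pt := 'rV[R]_d.
Local Notation mu := (@lebesgue_rV R d).
Implicit Types A : set pt.

Definition frob (M M' : 'M[R]_d) : R := \sum_i \sum_j M i j * M' i j.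

Definition L2 A (f : pt -> R) : Prop :=
  measurable_fun A f /\ mu.-integrable A (fun x => (f x ^+ 2)%:E).

Definition L2sym A (M : pt -> 'M[R]_d) : Prop :=
  [/\ measurable_fun A M, forall x, A x -> (M x)^T = M x
    & mu.-integrable A (fun x => (frob (M x) (M x))%:E)].

(* Real-valued integrals: these are meaningful because they are only applied to
   square integrable functions ([A] is always a bounded set). *)
Definition ip A (f g : pt -> R) : R := \int[mu]_(x in A) (f x * g x).
Definition ipM A (M M' : pt -> 'M[R]_d) : R :=
  \int[mu]_(x in A) frob (M x) (M' x).

Definition nrm A f : R := Num.sqrt (ip A f f).
Definition nrmM A M : R := Num.sqrt (ipM A M M).

End L2.

Section spaces.
Context {R : realType} {d : nat}.
Local Notation pt := 'rV[R]_d.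
Implicit Types (A : set pt) (z : pt -> R) (Th H : pt -> 'M[R]_d).

(* [z] is the limit, and [H] the limit of the Hessians, of functions in [D]. *)
Definition hess_closure (D : set (pt -> R)) A z H : Prop :=
  [/\ L2 A z, L2sym A H &
      exists phi : nat -> pt -> R,
        [/\ forall n, D (phi n),
            nrm A (phi n - z) @[n --> \oo] --> (0 : R)
          & nrmM A (eps (grad (phi n)) - H) @[n --> \oo] --> (0 : R)]].

Definition ddiv_closure A Th (g : pt -> R) : Prop :=
  [/\ L2sym A Th, L2 A g &
      exists Phi : nat -> pt -> 'M[R]_d,
        [/\ forall n, smooth_sym (Phi n),
            nrmM A (Phi n - Th) @[n --> \oo] --> (0 : R)
          & nrm A (div (rowdiv (Phi n)) - g) @[n --> \oo] --> (0 : R)]].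

Definition H2 A : set (pt -> R) :=
  [set z | exists H, hess_closure smooth A z H].
Definition H20 A : set (pt -> R) :=
  [set z | exists H, hess_closure (test_function A) A z H].
Definition Hdivdiv A : set (pt -> 'M[R]_d) :=
  [set Th | exists g, ddiv_closure A Th g].

(* [eps grad z] and [div div Th] for [z] in [H2 A] and [Th] in [Hdivdiv A]: for
   open [A] such limits are unique up to a.e. equality, and one is chosen. *)
Definition hess A z : pt -> 'M[R]_d := xget 0 [set H | hess_closure smooth A z H].
Definition divdiv A Th : pt -> R := xget 0 [set g | ddiv_closure A Th g].

Definition ip2 A z z' : R := ip A z z' + ipM A (hess A z) (hess A z').
Definition ipdd A Th Th' : R := ipM A Th Th' + ip A (divdiv A Th) (divdiv A Th').

Definition trace_form A Th z : R :=
  ip A (divdiv A Th) z - ipM A Th (hess A z).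

(* Functionals on [H2 A] and [Hdivdiv A] are extended by zero, so that their
   equality is Leibniz equality. *)
Definition tr_dDiv A Th : (pt -> R) -> R :=
  fun z => if `[< H2 A z >] then trace_form A Th z else 0.
Definition tr_Ggrad A z : (pt -> 'M[R]_d) -> R :=
  fun Th => if `[< Hdivdiv A Th >] then trace_form A Th z else 0.

End spaces.

Section constitutive.
Context {R : realType} {d : nat}.

Definition Ctens (E t nu : R) (K : 'M[R]_d) : 'M[R]_d :=
  (E * t ^+ 3 / (12 * (1 - nu ^+ 2))) *: ((nu * \tr K)%:M + (1 - nu) *: K).

Definition Ctens_posdef (E t nu : R) : Prop :=
  forall K : 'M[R]_d, K^T = K -> K != 0 -> 0 < frob (Ctens E t nu K) K.

Definition Cinv (E t nu : R) (M : 'M[R]_d) : 'M[R]_d :=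
  xget 0 [set K | K^T = K /\ Ctens E t nu K = M].

End constitutive.

Section setting.
Context {R : realType} {d : nat}.
Local Notation pt := 'rV[R]_d.
Local Notation mu := (@lebesgue_rV R d).
Context (Omega : set pt) {N : nat} (T : 'I_N -> set pt).

Definition H2b : set (pt -> R) :=
  [set z | L2 Omega z /\ forall k, H2 (T k) z].
Definition Hdivdivb : set (pt -> 'M[R]_d) :=
  [set Th | L2sym Omega Th /\ forall k, Hdivdiv (T k) Th].

Definition ip2b z z' : R := \sum_k ip2 (T k) z z'.
Definition ipddb Th Th' : R := \sum_k ipdd (T k) Th Th'.
Definition nrm2b z : R := Num.sqrt (ip2b z z).
Definition nrmddb Th : R := Num.sqrt (ipddb Th Th).

Definition hessb (z : pt -> R) : pt -> 'M[R]_d :=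
  fun x => \sum_k \1_(T k) x *: hess (T k) z x.
Definition divdivb (Th : pt -> 'M[R]_d) : pt -> R :=
  fun x => \sum_k \1_(T k) x * divdiv (T k) Th x.

Definition Hm32 : set ('I_N -> (pt -> R) -> R) :=
  [set q | exists2 Th, Hdivdiv Omega Th & q = fun k => tr_dDiv (T k) Th].
Definition H32 : set ('I_N -> (pt -> 'M[R]_d) -> R) :=
  [set v | exists2 z, H20 Omega z & v = fun k => tr_Ggrad (T k) z].

Definition pairing (X : Type) (q : 'I_N -> X -> R) (z : X) : R :=
  \sum_k q k z.

(* The suprema are real-valued: on [Hm32] and [H32] the quotients are bounded,
   by the graph norms of the functions that define the traces. *)
Definition nrm_m32 (q : 'I_N -> (pt -> R) -> R) : R :=
  sup [set r | exists z, [/\ H2b z, ~ ae_eq mu Omega z 0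
                           & r = pairing q z / nrm2b z]].
Definition nrm_32 (v : 'I_N -> (pt -> 'M[R]_d) -> R) : R :=
  sup [set r | exists Th, [/\ Hdivdivb Th, ~ ae_eq mu Omega Th 0
                            & r = pairing v Th / nrmddb Th]].

Definition trial : Type :=
  ((pt -> R) * (pt -> 'M[R]_d) *
   ('I_N -> (pt -> 'M[R]_d) -> R) * ('I_N -> (pt -> R) -> R))%type.
HB.instance Definition _ := GRing.Lmodule.on trial.

Definition test : Type := ((pt -> R) * (pt -> 'M[R]_d))%type.
HB.instance Definition _ := GRing.Lmodule.on test.

Definition tr_u (w : trial) := w.1.1.1.
Definition tr_M (w : trial) := w.1.1.2.
Definition tr_uhat (w : trial) := w.1.2.
Definition tr_qhat (w : trial) := w.2.

Definition Uspace : set trial :=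
  [set w | [/\ L2 Omega (tr_u w), L2sym Omega (tr_M w),
               H32 (tr_uhat w) & Hm32 (tr_qhat w)]].

(* Equality in the trial space: a.e. equality of the field components. *)
Definition Ueq (w w' : trial) : Prop :=
  [/\ ae_eq mu Omega (tr_u w) (tr_u w'), ae_eq mu Omega (tr_M w) (tr_M w'),
      tr_uhat w = tr_uhat w' & tr_qhat w = tr_qhat w'].

Definition nrmU (w : trial) : R :=
  Num.sqrt (nrm Omega (tr_u w) ^+ 2 + nrmM Omega (tr_M w) ^+ 2 +
            nrm_32 (tr_uhat w) ^+ 2 + nrm_m32 (tr_qhat w) ^+ 2).

(* The span of finitely many elements of the trial space, which is also closed
   under [Ueq]. *)
Definition fin_dim_subspace (Uh : set trial) : Prop :=
  exists (n : nat) (e : 'I_n -> trial),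
    (forall i, Uspace (e i)) /\
    Uh = [set w | Uspace w /\
                  exists a : 'I_n -> R, Ueq w (\sum_i a i *: e i)].

Definition Vspace : set test := [set v | H2b v.1 /\ Hdivdivb v.2].

Definition ipV (v v' : test) : R := ip2b v.1 v'.1 + ipddb v.2 v'.2.

Context (E t nu : R).

Definition bform (w : trial) (v : test) : R :=
  ipM Omega (tr_M w) (fun x => hessb v.1 x + Cinv E t nu (v.2 x)) +
  ip Omega (tr_u w) (divdivb v.2) +
  pairing (tr_qhat w) v.1 - pairing (tr_uhat w) v.2.

Definition load (f : pt -> R) (v : test) : R := - ip Omega f v.1.

(* The Riesz representative, unique up to a.e. equality. *)
Definition trial_to_test (w : trial) : test :=
  xget 0 [set s | Vspace s /\ forall v, Vspace v -> ipV s v = bform w v].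

Definition is_solution (f : pt -> R) (w : trial) : Prop :=
  Uspace w /\ forall v, Vspace v -> bform w v = load f v.

Definition is_dpg_solution (f : pt -> R) (Uh : set trial) (w : trial) : Prop :=
  Uh w /\ forall delta, Uh delta ->
    bform w (trial_to_test delta) = load f (trial_to_test delta).

End setting.
Arguments trial R d N : clear implicits.
Arguments test R d : clear implicits.

(* Main.v *)
From HB Require Import structures.
Require Import Defs.
From mathcomp Require Import all_boot all_order all_algebra.
From mathcomp Require Import all_classical all_reals all_analysis.
From mathcomp Require Import measurable_realfun ring lra.
Set Implicit Arguments.
Unset Strict Implicit.
Unset Printing Implicit Defensive.
Import Order.TTheory GRing.Theory Num.Theory.
Import numFieldNormedType.Exports.
Local Open Scope classical_set_scope.
Local Open Scope ring_scope.

(** The trial-to-test operator is the Riesz isomorphism of the test space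
    composed with the bilinear form: [b(w, T delta)] is the inner product of
    [T w] and [T delta]. If [l] represents the load in the same way, a discrete
    solution is an element [uh] for which the residual [l - T uh] is orthogonal
    to [T Uh], so that the projection onto a finite-dimensional space
    ([finite_projection]) gives existence. Moreover [l = T u] for the exact
    solution [u], hence [uh] is a best approximation of [u] in the energy norm
    [|T w|]. Uniqueness and quasi-optimality follow once the energy norm is
    equivalent to the norm of the trial space, with constants that depend only
    on [Omega] and on the constitutive tensor.

    That the energy norm is bounded by the norm of the trial space is the
    Cauchy-Schwarz inequality ([bform_bound]). The converse is the inf-sup
    condition ([infsup]). Let [|b(w, v)| <= K |v|] for all [v], with
    [w = (u, M, uhat, qhat)]. On conforming test functions both trace terms
    vanish. Let [S] be the representative in [H(div div, Omega)] of the
    functional [Th |-> (M, C^-1 Th) + (u, div div Th)]; its norm is at most [K],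
    and [u1 = u - div div S] satisfies
    [(u1, div div Th) = (S - C^-1 M, Th)] for all smooth symmetric tensors [Th].
    As these are arbitrary at the boundary, this means that [u1] belongs to
    [H^2_0] with Hessian [S - C^-1 M] ([weak_hess_H20]). So [(u1, 0)] is a
    conforming test function, which yields
    [(M, C^-1 M) <= |M| K + K |u1|_2]; the inequality of Poincare bounds
    [|u1|_2] by [|S - C^-1 M|], and since the compliance tensor is coercive,
    [M] and then [u] are bounded by a multiple of [K]. The norms of the traces
    are bounded by testing with broken functions one component of which is zero.

    The analytic core is [weak_hess_H20], a density theorem on Lipschitz
    domains. Extended by zero, [u1] has a weak Hessian on the whole space. It is
    mollified, cut into finitely many pieces by a partition of unity, and each
    piece is pushed into the domain in a direction that points inwards
    ([lipschitz_inward]), which makes its support a compact subset of the domain.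
    The errors tend to zero since translations are continuous in the mean;
    the first derivatives, which the product rule brings in, are controlled by
    the interpolation inequality [|d_i f|^2 <= |f| |d_i d_i f|].

    All spaces consist of functions rather than of classes of functions, so the
    Hilbert space arguments are carried out for complete semi-inner products,
    and the spaces of functions with a Hessian or a double divergence are domains
    of closures of graphs. Such an operator is closable, i.e. well defined up to
    null functions, by the fundamental lemma of the calculus of variations.
    Integrals over [Omega] split into sums over the elements because the
    boundary of a Lipschitz element is a null set: infinitely many disjoint
    translates of a piece of it fit into the bounded element
    ([inward_local_null]). *)

(** * Complete semi-inner products *)

Lemma natSinv_small (R : realType) (e : R) : 0 < e ->
  exists N, forall n, (N <= n)%N -> n.+1%:R^-1 < e.
Proof.
move=> e0; have [N _ NP] := near_infty_natSinv_lt (PosNum e0).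
by exists N => n Nn; exact: (NP n Nn).
Qed.

Section semi_inner_product.
Context {R : realType} {V : lmodType R}.
Implicit Types (S D : set V) (b : V -> V -> R).

Definition subspace S : Prop :=
  S 0 /\ forall (a : R) x y, S x -> S y -> S (a *: x + y).

(** The elements of the spaces below are functions, not classes modulo null
    functions, so that nonzero vectors may have norm zero. *)
Record semi_ip S b : Prop := SemiIp {
  sip_sub : subspace S;
  sipC : forall x y, S x -> S y -> b x y = b y x;
  sipL : forall (a : R) x y z, S x -> S y -> S z ->
    b (a *: x + y) z = a * b x z + b y z;
  sip_ge0 : forall x, S x -> 0 <= b x x }.

Definition sip_cauchy b (x : nat -> V) : Prop := forall e : R, 0 < e ->
  exists N, forall m n, (N <= m)%N -> (N <= n)%N ->
    b (x m - x n) (x m - x n) < e.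

Definition sip_cvg b (x : nat -> V) (l : V) : Prop := forall e : R, 0 < e ->
  exists N, forall n, (N <= n)%N -> b (x n - l) (x n - l) < e.

Definition sip_complete S b : Prop := forall x, (forall n, S (x n)) ->
  sip_cauchy b x -> exists2 l, S l & sip_cvg b x l.

Lemma subspaceZ S a x : subspace S -> S x -> S (a *: x).
Proof. by move=> [S0 SL] Sx; have := SL a x 0 Sx S0; rewrite addr0. Qed.

Lemma subspaceD S x y : subspace S -> S x -> S y -> S (x + y).
Proof. by move=> [S0 SL] Sx Sy; have := SL 1 x y Sx Sy; rewrite scale1r. Qed.

Lemma subspaceN S x : subspace S -> S x -> S (- x).
Proof. by move=> hS Sx; rewrite -scaleN1r; apply: subspaceZ. Qed.

Lemma subspaceB S x y : subspace S -> S x -> S y -> S (x - y).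
Proof. by move=> hS Sx Sy; apply: subspaceD => //; apply: subspaceN. Qed.

Lemma subspace_sum S n (v : 'I_n -> V) : subspace S -> (forall i, S (v i)) ->
  S (\sum_i v i).
Proof.
move=> hS Sv; apply: (big_ind S) => [||//]; first exact: hS.1.
by move=> x y; exact: subspaceD.
Qed.

Section theory.
Variables (S : set V) (b : V -> V -> R).
Hypothesis hb : semi_ip S b.
Let hS : subspace S := sip_sub hb.
Let S0 : S 0 := hS.1.

Lemma sipDl x y z : S x -> S y -> S z -> b (x + y) z = b x z + b y z.
Proof. by move=> Sx Sy Sz; rewrite -{1}[x]scale1r (sipL hb)// mul1r. Qed.

Lemma sip0l z : S z -> b 0 z = 0.
Proof.
move=> Sz; have := sipDl S0 S0 Sz; rewrite addr0 => /eqP.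
by rewrite -subr_eq0 opprD addrA subrr add0r oppr_eq0 => /eqP.
Qed.

Lemma sipZl a x z : S x -> S z -> b (a *: x) z = a * b x z.
Proof. by move=> Sx Sz; rewrite -[a *: x]addr0 (sipL hb)// sip0l// addr0. Qed.

Lemma sipNl x z : S x -> S z -> b (- x) z = - b x z.
Proof. by move=> Sx Sz; rewrite -scaleN1r sipZl// mulN1r. Qed.

Lemma sipBl x y z : S x -> S y -> S z -> b (x - y) z = b x z - b y z.
Proof. by move=> Sx Sy Sz; rewrite sipDl ?sipNl//; exact: subspaceN. Qed.

Lemma sipDr x y z : S x -> S y -> S z -> b z (x + y) = b z x + b z y.
Proof.
move=> Sx Sy Sz; have Sxy := subspaceD hS Sx Sy.
by rewrite (sipC hb Sz Sxy) sipDl// (sipC hb Sx Sz) (sipC hb Sy Sz).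
Qed.

Lemma sipZr a x z : S x -> S z -> b z (a *: x) = a * b z x.
Proof.
move=> Sx Sz; have Sax := subspaceZ a hS Sx.
by rewrite (sipC hb Sz Sax) sipZl// (sipC hb Sx Sz).
Qed.

Lemma sipBr x y z : S x -> S y -> S z -> b z (x - y) = b z x - b z y.
Proof.
move=> Sx Sy Sz; have Sxy := subspaceB hS Sx Sy.
by rewrite (sipC hb Sz Sxy) sipBl// (sipC hb Sx Sz) (sipC hb Sy Sz).
Qed.

Lemma sip_suml n (v : 'I_n -> V) z : (forall i, S (v i)) -> S z ->
  b (\sum_i v i) z = \sum_i b (v i) z.
Proof.
move=> Sv Sz; pose P x s := S x /\ b x z = s.
suff [] : P (\sum_i v i) (\sum_i b (v i) z) by [].
apply: (big_ind2 P) => //; first by split => //; exact: sip0l.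
by move=> x s y u [Sx <-] [Sy <-]; split; [exact: subspaceD|exact: sipDl].
Qed.

Lemma sip_sqrD a x y : S x -> S y ->
  b (x + a *: y) (x + a *: y) = b x x + 2 * a * b x y + a ^+ 2 * b y y.
Proof.
move=> Sx Sy; have Say := subspaceZ a hS Sy; have Sxy := subspaceD hS Sx Say.
rewrite sipDl// !sipDr// !sipZl// ?sipZr// (sipC hb Sy Sx)//; ring.
Qed.

Lemma sip_sqrB x y : S x -> S y -> b (x - y) (x - y) = b x x - 2 * b x y + b y y.
Proof. by move=> Sx Sy; rewrite -scaleN1r sip_sqrD//; ring. Qed.

Lemma sip_symB x y : S x -> S y -> b (x - y) (x - y) = b (y - x) (y - x).
Proof. by move=> Sx Sy; rewrite !sip_sqrB// (sipC hb Sx Sy)//; ring. Qed.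

Lemma sip_CS2 x y : S x -> S y -> b x y ^+ 2 <= b x x * b y y.
Proof.
move=> Sx Sy; have [y0|y0] := ltP 0 (b y y).
  have Sz : S (x + (- (b x y / b y y)) *: y).
    by apply: subspaceD => //; apply: subspaceZ.
  have := sip_ge0 hb Sz; rewrite sip_sqrD//.
  rewrite (_ : _ + _ = b x x - b x y ^+ 2 / b y y); last by field; rewrite gt_eqF.
  by rewrite subr_ge0 ler_pdivrMr.
have by0 : b y y = 0 by apply/eqP; rewrite eq_le y0 (sip_ge0 hb).
rewrite by0 mulr0; have [->|bn] := eqVneq (b x y) 0; first by rewrite expr0n.
pose a := - (b x x + 1) / (2 * b x y).
have Sz : S (x + a *: y) by apply: subspaceD => //; apply: subspaceZ.
have := sip_ge0 hb Sz; rewrite sip_sqrD// by0 (_ : _ + _ = - 1); last by rewrite /a; field.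
by rewrite lerNr oppr0 ler10.
Qed.

Lemma sip_CS x y : S x -> S y -> `|b x y| <= Num.sqrt (b x x) * Num.sqrt (b y y).
Proof.
move=> Sx Sy; rewrite -sqrtrM ?(sip_ge0 hb)// -sqrtr_sqr.
by rewrite ler_sqrt ?mulr_ge0 ?(sip_ge0 hb)// sip_CS2.
Qed.

Lemma sip_null x y : S x -> S y -> b x x = 0 -> b x y = 0.
Proof.
move=> Sx Sy xx; have := sip_CS2 Sx Sy; rewrite xx mul0r.
by rewrite exprn_even_le0//= => /eqP.
Qed.

Lemma sip_sqr_triangle x y : S x -> S y ->
  b (x + y) (x + y) <= 2 * b x x + 2 * b y y.
Proof.
move=> Sx Sy; have := sip_ge0 hb (subspaceB hS Sx Sy).
have -> : x + y = x + 1 *: y by rewrite scale1r.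
by rewrite sip_sqrD// sip_sqrB//; lra.
Qed.

Lemma sip_triangle x y : S x -> S y ->
  Num.sqrt (b (x + y) (x + y)) <= Num.sqrt (b x x) + Num.sqrt (b y y).
Proof.
move=> Sx Sy; rewrite -[leRHS]ger0_norm ?addr_ge0 ?sqrtr_ge0//.
rewrite -[leRHS]sqrtr_sqr ler_wsqrtr//.
have -> : x + y = x + 1 *: y by rewrite scale1r.
rewrite sip_sqrD// sqrrD !sqr_sqrtr ?(sip_ge0 hb)//.
rewrite mulr1 expr1n mul1r lerD2r lerD2l mulr_natl lerMn2r/=.
exact: le_trans (ler_norm _) (sip_CS Sx Sy).
Qed.

Lemma sip_cvg_ge x l : (forall n, S (x n)) -> S l -> sip_cvg b x l ->
  forall y, S y -> forall c, (forall n, b (x n) y <= c) -> b l y <= c.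
Proof.
move=> Sx Sl xl y Sy c xc; apply/ler_addgt0Pr => e e0.
pose q := b y y + 1; have q0 : 0 < q.
  by rewrite ltr_pwDr// (sip_ge0 hb).
have [N /(_ N (leqnn _)) xN] := xl (e ^+ 2 / q) (divr_gt0 (exprn_gt0 _ e0) q0).
have Sd : S (x N - l) by exact: subspaceB.
have : `|b (x N - l) y| <= e.
  rewrite -(@ler_pXn2r _ 2) ?nnegrE ?normr_ge0 ?(ltW e0)//.
  rewrite real_normK ?num_real//.
  apply: le_trans (sip_CS2 Sd Sy) _.
  apply: (@le_trans _ _ (e ^+ 2 / q * q)); last by rewrite divfK ?gt_eqF.
  by apply: ler_pM; rewrite ?(sip_ge0 hb) ?(ltW xN)// /q lerDl.
rewrite sipBl// ler_norml => /andP[h _]; have := xc N; lra.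
Qed.

Lemma sip_cvg_cauchy x l : (forall n, S (x n)) -> S l -> sip_cvg b x l ->
  sip_cauchy b x.
Proof.
move=> Sx Sl xl e e0; have e4 : 0 < e / 4 by lra.
have [N xN] := xl _ e4; exists N => m n Nm Nn.
rewrite (_ : x m - x n = (x m - l) + (l - x n)); last by rewrite addrA subrK.
apply: le_lt_trans (sip_sqr_triangle _ _) _; try exact: subspaceB.
rewrite (sip_symB Sl)//; have := xN _ Nm; have := xN _ Nn; lra.
Qed.

(** A nearest element of [D] may not exist, but along a minimizing sequence the
    residuals form a Cauchy sequence by the parallelogram law, and their limit
    is orthogonal to [D]. *)
Lemma orthogonal_residual D x : sip_complete S b -> subspace D -> D `<=` S ->
  S x -> exists r, [/\ S r, forall d, D d -> b r d = 0 &
    forall e : R, 0 < e -> exists2 d, D d & b (x - r - d) (x - r - d) < e].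
Proof.
move=> cS hD DS Sx.
pose E := [set s | exists2 d, D d & s = b (x - d) (x - d)].
have E0 : E !=set0 by exists (b (x - 0) (x - 0)); exists 0 => //; exact: hD.1.
have lbE : lbound E 0.
  by move=> _ [d Dd ->]; apply: (sip_ge0 hb); apply: subspaceB => //; exact: DS.
have hasE : has_inf E by split => //; exists 0.
pose del := inf E.
have delP d : D d -> del <= b (x - d) (x - d).
  by move=> Dd; apply: ge_inf => //; [exists 0|exists d].
have /choice[d dP] : forall n : nat, exists d, D d /\ b (x - d) (x - d) < del + n.+1%:R^-1.
  move=> n; have n0 : 0 < n.+1%:R^-1 :> R by rewrite invr_gt0.
  by have [_ [d Dd ->] lt] := inf_adherent n0 hasE; exists d.
pose r n := x - d n.
have Sr n : S (r n) by apply: subspaceB => //; apply: DS; exact: (dP n).1.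

have [|l Sl rl] := cS r Sr.
  move=> e e0; have e4 : 0 < e / 4 by lra.
  have [N NP] := natSinv_small e4; exists N => m n Nm Nn.
  have Dh : D (2^-1 *: (d m + d n)).
    by apply: subspaceZ => //; apply: subspaceD => //; exact: (dP _).1.
  have := delP _ Dh; have [_] := dP m; have [_] := dP n.
  have := NP _ Nm; have := NP _ Nn; rewrite -!/(r _).
  have -> : x - 2^-1 *: (d m + d n) = 2^-1 *: (r m + r n).
    rewrite /r addrACA -opprD scalerBr; congr (_ - _).
    by rewrite -[x + x]mulr2n -[x *+ 2]scaler_nat scalerA mulVf ?scale1r// pnatr_eq0.
  have Smn : S (r m + r n) by exact: subspaceD.
  rewrite sipZl ?sipZr//; last exact: subspaceZ.
  have -> : r m + r n = r m + 1 *: r n by rewrite scale1r.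
  rewrite sip_sqrB// sip_sqrD//.
  set A := b (r m) (r m); set B := b (r n) (r n); set C := b (r m) (r n).
  move: (m.+1%:R^-1) (n.+1%:R^-1) => u v; clear; lra.
exists l; split => //.
- move=> z Dz; have Sz := DS _ Dz; have Dzz a : D (a *: z) by exact: subspaceZ.
  suff lez w : D w -> b l w <= 0.
    apply/eqP; rewrite eq_le lez//=.
    by rewrite -oppr_le0 -(mulN1r (b l z)) -sipZr// lez.
  move=> Dw; have Sw := DS _ Dw; apply/ler_addgt0Pr => e e0; rewrite add0r.
  have q0 : 0 < b w w + 1 by rewrite ltr_pwDr// (sip_ge0 hb).
  have [N NP] := natSinv_small (divr_gt0 (exprn_gt0 2 e0) q0).
  apply: (@sip_cvg_ge (fun n => r (N + n)%N) l) => //.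
    move=> e1 e10; have [N1 N1P] := rl _ e10.
    by exists N1 => n Nn; apply: N1P; rewrite (leq_trans Nn)// leq_addl.
  move=> n; set k := (N + n)%N.
  have kn : k.+1%:R^-1 < e ^+ 2 / (b w w + 1) by apply: NP; rewrite leq_addr.
  (* nearly optimal multiple of [w], defined also if [w] is null *)
  pose s := b (r k) w / (b w w + 1).
  have := delP (d k + s *: w) ltac:(by apply: subspaceD => //; [exact: (dP _).1|exact: subspaceZ]).
  rewrite opprD addrA -/(r k) -scaleNr sip_sqrD//.
  have [_] := dP k; rewrite -/(r k).
  set A := b (r k) (r k); set B := b w w; move=> h1 h2.
  have Bq : 0 <= b w w by exact: (sip_ge0 hb).
  have h3 : 2 * s * b (r k) w - s ^+ 2 * B < e ^+ 2 / (B + 1).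
    apply: le_lt_trans kn; move: h1 h2; rewrite sqrrN.
    move: (k.+1%:R^-1) (s ^+ 2 * B) (b (r k) w) => u v t; clear; lra.
  have h4 : b (r k) w ^+ 2 / (B + 1) <= 2 * s * b (r k) w - s ^+ 2 * B.
    rewrite -subr_ge0 (_ : _ - _ = b (r k) w ^+ 2 / (B + 1) ^+ 2); last first.
      by rewrite /s -/B; field; rewrite gt_eqF.
    by rewrite divr_ge0 ?sqr_ge0.
  have := le_lt_trans h4 h3; rewrite ltr_pM2r ?invr_gt0// => h5.
  have [//|h6] := lerP (b (r k) w) e.
  have := ltr_pXn2r (n := 2) isT (ltW (lt_trans e0 h6) : _ \is Num.nneg) (ltW e0 : e \is Num.nneg).
  by rewrite h5 => /esym/(lt_trans h6); rewrite ltxx.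
- move=> e e0; have [N /(_ N (leqnn _)) NP] := rl _ e0.
  exists (d N); first exact: (dP _).1.
  by rewrite -addrAC -/(r N).
Qed.

(** The residual of a vector outside of the kernel of [phi] is orthogonal to
    that kernel, and a multiple of it represents [phi]. *)
Theorem riesz (phi : V -> R) C : sip_complete S b ->
  (forall a x y, S x -> S y -> phi (a *: x + y) = a * phi x + phi y) ->
  (forall x, S x -> `|phi x| <= C * Num.sqrt (b x x)) ->
  exists2 s, S s & forall x, S x -> b s x = phi x.
Proof.
move=> cS phiL phiB.
have phi0 : phi 0 = 0.
  have := phiL 1 0 0 S0 S0; rewrite scaler0 addr0 mul1r => /eqP.
  by rewrite -subr_eq0 opprD addrA subrr add0r oppr_eq0 => /eqP.
have [[x [Sx phix]]|all0] := pselect (exists x, S x /\ phi x != 0); last first.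
  exists 0 => // x Sx; rewrite sip0l//; apply/esym/eqP/negP => /negP h.
  by apply: all0; exists x.
pose D := [set v | S v /\ phi v = 0].
have hD : subspace D.
  split => [//|a u v [Su u0] [Sv v0]]; split; first exact: hS.2.
  by rewrite phiL// u0 v0 mulr0 addr0.
have [r [Sr rD rx]] := orthogonal_residual cS hD (fun v => @proj1 _ _) Sx.
have Sxr := subspaceB hS Sx Sr.
have phiB0 v : S v -> (forall e, 0 < e -> exists2 d, D d & b (v - d) (v - d) < e) -> phi v = 0.
  move=> Sv hv; apply/eqP; rewrite -normr_le0; apply/ler_addgt0Pr => e e0.
  rewrite add0r; pose K := `|C| + 1; have K0 : 0 < K by rewrite ltr_wpDl.
  have [d [Sd d0] dv] := hv _ (exprn_gt0 2 (divr_gt0 e0 K0)).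
  have Svd := subspaceB hS Sv Sd.
  have -> : phi v = phi (v - d).
    have := phiL (-1) d v Sd Sv; rewrite scaleN1r addrC => ->.
    by rewrite d0 mulr0 add0r.
  apply: le_trans (phiB _ Svd) _; apply: (@le_trans _ _ (K * (e / K))); last first.
    by rewrite mulrCA divff ?gt_eqF// mulr1.
  apply: (@le_trans _ _ (K * Num.sqrt (b (v - d) (v - d)))).
    by rewrite ler_wpM2r ?sqrtr_ge0// /K (le_trans (ler_norm _))// lerDl.
  have eK : 0 <= e / K by rewrite divr_ge0 ?(ltW e0) ?(ltW K0).
  by rewrite ler_pM2l// -(ger0_norm eK) -sqrtr_sqr ler_wsqrtr// ltW.
have phir : phi r = phi x.
  have h := phiB0 _ Sxr rx; have := phiL 1 (x - r) r Sxr Sr.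
  by rewrite scale1r subrK h mulr0 add0r.
have phir0 : phi r != 0 by rewrite phir.
have brr : b r r != 0.
  apply: contra phir0 => /eqP brr; have := phiB _ Sr.
  by rewrite brr sqrtr0 mulr0 normr_le0.
exists ((phi r / b r r) *: r); first exact: subspaceZ.
move=> v Sv; rewrite sipZl//.
have Dv : D ((- (phi v / phi r)) *: r + v).
  split; first exact: hS.2.
  by rewrite phiL// mulNr divfK// addNr.
have := rD _ Dv; have Sz := subspaceZ (- (phi v / phi r)) hS Sr.
rewrite sipDr// sipZr// => /eqP; rewrite mulNr addrC subr_eq0 => /eqP ->.
by field; rewrite phir0 brr.
Qed.

(** Gram-Schmidt: the next vector is replaced by its residual, whose
    multiple is added unless that residual is null. *)
Lemma finite_projection n (v : 'I_n -> V) x : (forall i, S (v i)) -> S x ->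
  exists a : 'I_n -> R, forall j, b (x - \sum_i a i *: v i) (v j) = 0.
Proof.
elim: n v x => [|n IH] v x Sv Sx; first by exists (fun=> 0) => -[].
pose w i := v (lift ord_max i); have Sw i : S (w i) by exact: Sv.
have [c cP] := IH w x Sw Sx; have [g gP] := IH w (v ord_max) Sw (Sv _).
set p := \sum_i _ in cP gP; set q := \sum_i _ in gP.
have Ssum (k : 'I_n -> R) : S (\sum_i k i *: w i).
  by apply: subspace_sum => // i; exact: subspaceZ.
have Sp : S p by exact: Ssum. have Sq : S q by exact: Ssum.
pose r := v ord_max - q; have Sr : S r by apply: subspaceB => //; exact: Sv.
pose s := if b r r == 0 then 0 else b (x - p) r / b r r.
pose a i := if unlift ord_max i is Some j then c j - s * g j else s.
exists a.
have -> : \sum_i a i *: v i = p + s *: r.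
  rewrite (bigD1 ord_max)//= {1}/a unlift_none.

  have -> : \sum_(i | i != ord_max) a i *: v i = \sum_j (c j - s * g j) *: w j.
    under eq_bigl do rewrite eq_sym; rewrite (big_mkcond (fun i => _ != i)).
    rewrite (bigD1_ord ord_max)//= eqxx add0r; apply: eq_bigr => j _.
    by rewrite neq_lift /a liftK.
  under eq_bigr do rewrite scalerBl -scalerA.
  by rewrite sumrB -scaler_sumr -/p -/q /r scalerBr addrCA.
have Sxp : S (x - p) by exact: subspaceB.
have Ssr : S (s *: r) by exact: subspaceZ.
have orth j : b (x - (p + s *: r)) (w j) = 0.
  by rewrite opprD addrA sipBl// sipZl// cP gP mulr0 subr0.
have orthr : b (x - (p + s *: r)) r = 0.
  rewrite opprD addrA sipBl// sipZl// /s; case: ifPn => [/eqP r0|r0].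
    by rewrite mul0r subr0 (sipC hb)// sip_null.
  by rewrite divfK// subrr.
have Se : S (x - (p + s *: r)) by apply: subspaceB => //; exact: subspaceD.
move=> j; case: (unliftP ord_max j) => [i ->|->]; first exact: orth.
rewrite -[v ord_max](subrK q) sipDr// orthr add0r (sipC hb)// sip_suml//; last first.
  by move=> i; exact: subspaceZ.
by apply: big1 => i _; rewrite sipZl// (sipC hb)// orth mulr0.
Qed.

Lemma sip_eq u v z : S u -> S v -> S z -> b (u - v) (u - v) = 0 -> b u z = b v z.
Proof.
move=> Su Sv Sz uv; have Suv := subspaceB hS Su Sv.
by apply/eqP; rewrite -subr_eq0 -sipBl// sip_null.
Qed.

Lemma sip_sqr_eq u v : S u -> S v -> b (u - v) (u - v) = 0 -> b u u = b v v.
Proof.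
by move=> Su Sv uv; rewrite (@sip_eq u v)// (sipC hb Sv Su) (@sip_eq u v).
Qed.

Lemma sip_cvgP (x : nat -> V) l :
  Num.sqrt (b (x n - l) (x n - l)) @[n --> \oo] --> (0 : R) <-> sip_cvg b x l.
Proof.
split => [/cvgrPdist_lt h e e0|h].
  have [N _ NP] := h (Num.sqrt e) ltac:(by rewrite sqrtr_gt0).
  exists N => n Nn; have := NP n Nn; rewrite /= sub0r normrN ger0_norm ?sqrtr_ge0//.
  by rewrite ltr_sqrt.
apply/cvgrPdist_lt => e e0; have [N NP] := h _ (exprn_gt0 2 e0).
exists N => // n /= Nn; rewrite sub0r normrN ger0_norm ?sqrtr_ge0//.
by rewrite -(gtr0_norm e0) -sqrtr_sqr ltr_sqrt ?NP// exprn_gt0.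
Qed.

End theory.
End semi_inner_product.

(** * Closed graphs *)

Section graph_closure.
Context {R : realType} {V1 V2 : lmodType R}.
Variables (S1 : set V1) (b1 : V1 -> V1 -> R) (S2 : set V2) (b2 : V2 -> V2 -> R).
Variables (D : set V1) (op : V1 -> V2).

(** The spaces [H2], [H20] and [Hdivdiv] are domains of such closures, with [op]
    the classical differential operator on a space [D] of smooth functions. *)
Definition graph_closure x y : Prop :=
  [/\ S1 x, S2 y & forall e : R, 0 < e -> exists2 u, D u &
    b1 (u - x) (u - x) < e /\ b2 (op u - y) (op u - y) < e].

Definition closure_dom : set V1 := [set x | exists y, graph_closure x y].

Definition closure_op x : V2 := xget 0 [set y | graph_closure x y].

Definition graph_ip x x' : R := b1 x x' + b2 (closure_op x) (closure_op x').

Hypotheses (h1 : semi_ip S1 b1) (h2 : semi_ip S2 b2) (hD : subspace D).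
Hypotheses (DS : D `<=` S1) (opS : forall u, D u -> S2 (op u)).
Hypothesis opL : forall (a : R) u v, D u -> D v ->
  op (a *: u + v) = a *: op u + op v.
Let hS1 := sip_sub h1.
Let hS2 := sip_sub h2.

Lemma graph_closure_seq x y : graph_closure x y <->
  [/\ S1 x, S2 y & exists phi : nat -> V1, [/\ forall n, D (phi n),
     Num.sqrt (b1 (phi n - x) (phi n - x)) @[n --> \oo] --> (0 : R)
   & Num.sqrt (b2 (op (phi n) - y) (op (phi n) - y)) @[n --> \oo] --> (0 : R)]].
Proof.
split=> -[Sx Sy].
  move=> h; split => //.
  have /choice[u uP] : forall n, exists u, [/\ D u, b1 (u - x) (u - x) < n.+1%:R^-1
      & b2 (op u - y) (op u - y) < n.+1%:R^-1].
    by move=> n; have [|u Du []] := h n.+1%:R^-1; [rewrite invr_gt0|exists u].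
  exists u; split; first by move=> n; have [] := uP n.
      apply/sip_cvgP => e e0.
    have [N NP] := natSinv_small e0; exists N => n Nn.
    by have [_ /lt_trans + _] := uP n; apply; exact: NP.
  apply/(sip_cvgP _ (op \o u)) => e e0.
  have [N NP] := natSinv_small e0; exists N => n Nn.
  by have [_ _ /lt_trans] := uP n; apply; exact: NP.
move=> [u [Du ux uy]]; split => // e e0.
have [N NP] := (sip_cvgP _ _ _).1 ux e e0.
have [M MP] := (sip_cvgP _ (op \o u) _).1 uy e e0.
by exists (u (N + M)%N) => //; split; [apply: NP; rewrite leq_addr|apply: MP; rewrite leq_addl].
Qed.

Lemma graph_closureD u : D u -> graph_closure u (op u).
Proof.
move=> Du; split; [exact: DS|exact: opS|move=> e e0; exists u => //].
by rewrite !subrr (sip0l h1) ?(sip0l h2) ?e0//; [exact: hS2.1|exact: hS1.1].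
Qed.

Lemma graph_closure_closed x y : S1 x -> S2 y ->
  (forall e : R, 0 < e -> exists x' y', [/\ graph_closure x' y',
     b1 (x' - x) (x' - x) < e & b2 (y' - y) (y' - y) < e]) ->
  graph_closure x y.
Proof.
move=> Sx Sy h; split => // e e0; have e4 : 0 < e / 4 by lra.
have [x' [y' [[Sx' Sy' /(_ _ e4)[u Du [ux uy]]] xx yy]]] := h _ e4.
have Su := DS Du; have So := opS Du.
exists u => //; split.
  rewrite -(subrK x' u) -addrA; apply: le_lt_trans (sip_sqr_triangle h1 _ _) _; last by lra.
    exact: subspaceB.
  exact: subspaceB.
rewrite -(subrK y' (op u)) -addrA; apply: le_lt_trans (sip_sqr_triangle h2 _ _) _; last by lra.
  exact: subspaceB.
exact: subspaceB.
Qed.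

Lemma graph_closure_ext x y x' y' : graph_closure x y -> S1 x' -> S2 y' ->
  b1 (x - x') (x - x') = 0 -> b2 (y - y') (y - y') = 0 -> graph_closure x' y'.
Proof.
move=> xy Sx' Sy' xx yy; apply: graph_closure_closed => // e e0.
by exists x, y; rewrite xx yy.
Qed.

Lemma graph_closureL (a : R) x y x' y' : graph_closure x y ->
  graph_closure x' y' -> graph_closure (a *: x + x') (a *: y + y').
Proof.
move=> [Sx Sy h] [Sx' Sy' h']; split; [exact: hS1.2|exact: hS2.2|move=> e e0].
have q0 : 0 < 2 * a ^+ 2 + 2 by have := sqr_ge0 a; lra.
have [u Du [ux uy]] := h _ (divr_gt0 e0 q0).
have [v Dv [vx vy]] := h' _ (divr_gt0 e0 q0).
have Su := DS Du; have So := opS Du; have Sv := DS Dv; have Sp := opS Dv.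
have a0 : 0 <= a ^+ 2 by exact: sqr_ge0.
have bnd s t : s < e / (2 * a ^+ 2 + 2) -> t < e / (2 * a ^+ 2 + 2) ->
    2 * (a * (a * s)) + 2 * t < e.
  set Q := _ / _ => hs ht; have eQ : e = (2 * a ^+ 2 + 2) * Q.
    by rewrite /Q mulrC divfK// gt_eqF.
  rewrite eQ [X in _ < X]mulrDl ler_ltD//; last by rewrite ltr_pM2l.
  by rewrite [a * (a * s)]mulrA -expr2 -mulrA !ler_wpM2l// ltW.
exists (a *: u + v); first exact: hD.2.
split.
  rewrite opprD addrACA -scalerBr.
  have S3 := subspaceB hS1 Su Sx; have S4 := subspaceB hS1 Sv Sx'.
  have S5 := subspaceZ a hS1 S3.
  apply: le_lt_trans (sip_sqr_triangle h1 _ _) _ => //.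
  by rewrite (sipZl h1)// (sipZr h1)//; exact: bnd.
rewrite opL// opprD addrACA -scalerBr.
have S3 := subspaceB hS2 So Sy; have S4 := subspaceB hS2 Sp Sy'.
have S5 := subspaceZ a hS2 S3.
apply: le_lt_trans (sip_sqr_triangle h2 _ _) _ => //.
by rewrite (sipZl h2)// (sipZr h2)//; exact: bnd.
Qed.

Lemma graph_closureB x y x' y' : graph_closure x y ->
  graph_closure x' y' -> graph_closure (x - x') (y - y').
Proof.
move=> xy xy'; have := graph_closureL (-1) xy' xy.
by rewrite !scaleN1r addrC [- y' + y]addrC.
Qed.

(** Both sides are continuous in the graph norm. Weak formulations on the
    closures are obtained from integration by parts for smooth functions in this
    way. *)
Lemma graph_closure_dual x y t g : graph_closure x y -> S2 t -> S1 g ->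
  (forall u, D u -> b2 (op u) t = b1 u g) -> b2 y t = b1 x g.
Proof.
move=> [Sx Sy h] St Sg dual; apply/eqP; rewrite -subr_eq0 -normr_le0.
apply/ler_addgt0Pr => e e0; rewrite add0r.
pose K := Num.sqrt (b2 t t) + Num.sqrt (b1 g g) + 1.
have K0 : 0 < K by rewrite ltr_wpDl// addr_ge0 ?sqrtr_ge0.
have eK0 : 0 < e / K by exact: divr_gt0.
have [u Du [ux uy]] := h _ (exprn_gt0 2 eK0).
have Su := DS Du; have So := opS Du.
have -> : b2 y t - b1 x g = b1 (u - x) g - b2 (op u - y) t.
  by rewrite (sipBl h1)// (sipBl h2)// dual//; ring.
have Sux := subspaceB hS1 Su Sx; have Suy := subspaceB hS2 So Sy.
have sq s : s < (e / K) ^+ 2 -> Num.sqrt s <= e / K.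
  move=> hs; rewrite -(ger0_norm (ltW eK0)) -sqrtr_sqr; exact/ler_wsqrtr/ltW.
apply: le_trans (ler_normB _ _) _.
apply: (@le_trans _ _ (e / K * Num.sqrt (b1 g g) + e / K * Num.sqrt (b2 t t))).
  apply: lerD.
    by apply: le_trans (sip_CS h1 Sux Sg) _; rewrite ler_wpM2r ?sqrtr_ge0// sq.
  by apply: le_trans (sip_CS h2 Suy St) _; rewrite ler_wpM2r ?sqrtr_ge0// sq.
rewrite -mulrDr mulrAC ler_pdivrMr// ler_pM2l// /K addrC lerDl//.
Qed.

(** The closure of the graph is again a graph, up to null vectors. *)
Hypothesis closable : forall y, graph_closure 0 y -> b2 y y = 0.

Lemma closure_opP x : closure_dom x -> graph_closure x (closure_op x).
Proof. by move=> [y xy]; exact: (@xgetPex _ 0 [set y | graph_closure x y]) (ex_intro _ y xy). Qed.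

Lemma closure_op_S x : closure_dom x -> S2 (closure_op x).
Proof. by move=> /closure_opP[]. Qed.

Lemma closure_dom_S x : closure_dom x -> S1 x.
Proof. by move=> /closure_opP[]. Qed.

Lemma graph_closure_uniq x y x' y' : graph_closure x y -> graph_closure x' y' ->
  b1 (x - x') (x - x') = 0 -> b2 (y - y') (y - y') = 0.
Proof.
move=> xy xy' xx; apply: closable; have h := graph_closureB xy xy'.
have [Sx Sy _] := h.
apply: (graph_closure_ext h) => //; first exact: hS1.1.
  by rewrite subr0.
by rewrite subrr (sip0l h2)//; exact: hS2.1.
Qed.

Lemma closure_op_uniq x y : graph_closure x y ->
  b2 (closure_op x - y) (closure_op x - y) = 0.
Proof.
move=> xy; have h : closure_dom x by exists y.
have [Sx _ _] := xy.
apply: (graph_closure_uniq (closure_opP h) xy).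
by rewrite subrr (sip0l h1)//; exact: hS1.1.
Qed.

Lemma closure_dom_sub : subspace closure_dom.
Proof.
split.
  exists (op 0); apply: graph_closureD; exact: hD.1.
by move=> a x x' [y xy] [y' xy']; exists (a *: y + y'); exact: graph_closureL.
Qed.

Lemma closure_opL (a : R) x x' z : closure_dom x -> closure_dom x' -> S2 z ->
  b2 (closure_op (a *: x + x')) z = a * b2 (closure_op x) z + b2 (closure_op x') z.
Proof.
move=> dx dx' Sz; rewrite -(sipL h2) ?closure_op_S//.
have h := graph_closureL a (closure_opP dx) (closure_opP dx').
have [_ Sh _] := h.
apply: (sip_eq h2) => //; last exact: closure_op_uniq.
- by apply: closure_op_S; exists (a *: closure_op x + closure_op x').
- exact: closure_op_S.
- exact: closure_op_S.
Qed.

Lemma graph_semi_ip : semi_ip closure_dom graph_ip.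
Proof.
split; first exact: closure_dom_sub.
- move=> x y dx dy; rewrite /graph_ip.
  rewrite (sipC h1 (closure_dom_S dx) (closure_dom_S dy)).
  by rewrite (sipC h2 (closure_op_S dx) (closure_op_S dy)).
- move=> a x y z dx dy dz; rewrite /graph_ip.
  rewrite (sipL h1 _ (closure_dom_S dx) (closure_dom_S dy) (closure_dom_S dz)).
  by rewrite (closure_opL _ dx dy (closure_op_S dz)) mulrDr addrACA.
- move=> x dx; apply: addr_ge0; first exact/(sip_ge0 h1)/closure_dom_S.
  exact/(sip_ge0 h2)/closure_op_S.
Qed.

(** Functions may be modified on null sets and outside of their domain without
    leaving the space. *)
Lemma closure_dom_ext x y : closure_dom y -> S1 x -> b1 (x - y) (x - y) = 0 ->
  closure_dom x /\ graph_ip (x - y) (x - y) = 0.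
Proof.
move=> dy Sx xy; have gy := closure_opP dy; have [Sy Soy _] := gy.
have gx : graph_closure x (closure_op y).
  apply: (graph_closure_ext gy Sx Soy); first by rewrite (sip_symB h1 Sy Sx).
  by rewrite subrr (sip0l h2)//; exact: hS2.1.
split; first by exists (closure_op y).
rewrite /graph_ip xy add0r.
have := closure_op_uniq (graph_closureB gx gy).
by rewrite subrr subr0.
Qed.

Lemma graph_complete : sip_complete S1 b1 -> sip_complete S2 b2 ->
  sip_complete closure_dom graph_ip.
Proof.
move=> c1 c2 x dx cx.
have Sx n : S1 (x n) by exact: closure_dom_S.
have So n : S2 (closure_op (x n)) by exact: closure_op_S.
have opB u v y : closure_dom u -> graph_closure v y ->
    b2 (closure_op (u - v)) (closure_op (u - v)) = b2 (closure_op u - y) (closure_op u - y).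
  move=> du vy; have dv : closure_dom v by exists y.
  have h := graph_closureB (closure_opP du) vy.
  have duv : closure_dom (u - v) by exists (closure_op u - y).
  apply: (sip_sqr_eq h2); [exact: closure_op_S|by have [] := h|].
  exact: closure_op_uniq.
have ge1 u : closure_dom u -> b1 u u <= graph_ip u u.
  by move=> du; rewrite lerDl; exact/(sip_ge0 h2)/closure_op_S.
have ge2 u : closure_dom u -> b2 (closure_op u) (closure_op u) <= graph_ip u u.
  by move=> du; rewrite lerDr; exact/(sip_ge0 h1)/closure_dom_S.
have [|l Sl xl] := c1 x Sx.
  move=> e e0; have [N NP] := cx e e0; exists N => m n Nm Nn.
  by apply: le_lt_trans (ge1 _ _) (NP m n Nm Nn); exact: subspaceB closure_dom_sub _ _.
have [|y Sy yl] := c2 (closure_op \o x) So.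
  move=> e e0; have [N NP] := cx e e0; exists N => m n Nm Nn /=.
  rewrite -(opB _ _ _ (dx m) (closure_opP (dx n))).
  by apply: le_lt_trans (ge2 _ _) (NP m n Nm Nn); exact: subspaceB closure_dom_sub _ _.
have ly : graph_closure l y.
  apply: graph_closure_closed => // e e0.
  have [N NP] := xl e e0; have [M MP] := yl e e0.
  exists (x (N + M)%N), (closure_op (x (N + M)%N)); split; first exact: closure_opP.
    by apply: NP; rewrite leq_addr.
  by apply: MP; rewrite leq_addl.
exists l; first by exists y.
move=> e e0; have e2 : 0 < e / 2 by lra.
have [N NP] := xl _ e2; have [M MP] := yl _ e2.
exists (N + M)%N => n Nn; rewrite /graph_ip (opB _ _ _ (dx n) ly).
have := NP n (leq_trans (leq_addr _ _) Nn).
have /= := MP n (leq_trans (leq_addl _ _) Nn); lra.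
Qed.

End graph_closure.

(** * Products and broken spaces *)

Section product.
Context {R : realType} {V1 V2 : lmodType R}.
Variables (S1 : set V1) (b1 : V1 -> V1 -> R) (S2 : set V2) (b2 : V2 -> V2 -> R).
Hypotheses (h1 : semi_ip S1 b1) (h2 : semi_ip S2 b2).

Definition prod_set : set (V1 * V2) := [set v | S1 v.1 /\ S2 v.2].
Definition prod_ip (v v' : V1 * V2) : R := b1 v.1 v'.1 + b2 v.2 v'.2.

Lemma prod_semi_ip : semi_ip prod_set prod_ip.
Proof.
split.
- split; first by split; [exact: (sip_sub h1).1|exact: (sip_sub h2).1].
  by move=> a x y [x1 x2] [y1 y2]; split; [exact: (sip_sub h1).2|exact: (sip_sub h2).2].
- by move=> x y [x1 x2] [y1 y2]; rewrite /prod_ip (sipC h1)// (sipC h2).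
- move=> a x y z [x1 x2] [y1 y2] [z1 z2]; rewrite /prod_ip /= (sipL h1)// (sipL h2)//.
  by rewrite mulrDr addrACA.
- by move=> x [x1 x2]; rewrite addr_ge0 ?(sip_ge0 h1) ?(sip_ge0 h2).
Qed.

Lemma prod_complete : sip_complete S1 b1 -> sip_complete S2 b2 ->
  sip_complete prod_set prod_ip.
Proof.
move=> c1 c2 x Sx cx.
have S1x n m : S1 ((x n).1 - (x m).1).
  by apply: subspaceB (sip_sub h1) _ _; have [] := Sx n; have [] := Sx m.
have S2x n m : S2 ((x n).2 - (x m).2).
  by apply: subspaceB (sip_sub h2) _ _; have [] := Sx n; have [] := Sx m.
have [n|e e0|l Sl xl] := c1 (fun n => (x n).1); first by have [] := Sx n.
  have [N NP] := cx e e0; exists N => m n Nm Nn.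
  by apply: le_lt_trans (NP m n Nm Nn); rewrite lerDl (sip_ge0 h2)//; exact: S2x.
have [n|e e0|k Sk xk] := c2 (fun n => (x n).2); first by have [] := Sx n.
  have [N NP] := cx e e0; exists N => m n Nm Nn.
  by apply: le_lt_trans (NP m n Nm Nn); rewrite lerDr (sip_ge0 h1)//; exact: S1x.
exists (l, k) => // e e0; have e2 : 0 < e / 2 by lra.
have [N NP] := xl _ e2; have [M MP] := xk _ e2.
exists (N + M)%N => n Nn; rewrite /prod_ip /=.
have := NP n (leq_trans (leq_addr _ _) Nn).
have := MP n (leq_trans (leq_addl _ _) Nn); lra.
Qed.
End product.

Section sum.
Context {R : realType} {V : lmodType R} {N : nat}.
Variables (S0 : set V) (b0 : V -> V -> R).
Variables (S W : 'I_N -> set V) (b w : 'I_N -> V -> V -> R).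
Hypotheses (h0 : semi_ip S0 b0) (hb : forall k, semi_ip (S k) (b k)).
Hypotheses (hw : forall k, semi_ip (W k) (w k)).
Hypotheses (S0W : forall k, S0 `<=` W k) (SW : forall k, S k `<=` W k).
Hypothesis wb : forall k x, S k x -> w k x x <= b k x x.
Hypothesis b0w : forall x, S0 x -> b0 x x = \sum_k w k x x.
Hypothesis ext : forall k x y, S0 x -> S k y -> w k (x - y) (x - y) = 0 ->
  S k x /\ b k (x - y) (x - y) = 0.

(** The pattern of the product spaces over a mesh: [S0] consists of square
    integrable functions on the whole domain, [S k] of functions with
    derivatives on the [k]-th element, and [w k] is the [L2] form on that
    element. *)
Definition broken_set : set V := [set x | S0 x /\ forall k, S k x].
Definition broken_ip x y : R := \sum_k b k x y.

Lemma broken_semi_ip : semi_ip broken_set broken_ip.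
Proof.
split.
- split; first by split => [|k]; [exact: (sip_sub h0).1|exact: (sip_sub (hb k)).1].
  move=> a x y [x0 xk] [y0 yk]; split => [|k]; first exact: (sip_sub h0).2.
  exact: (sip_sub (hb k)).2.
- by move=> x y [x0 xk] [y0 yk]; apply: eq_bigr => k _; exact: (sipC (hb k)).
- move=> a x y z [x0 xk] [y0 yk] [z0 zk]; rewrite /broken_ip mulr_sumr -big_split/=.
  by apply: eq_bigr => k _; exact: (sipL (hb k)).
- by move=> x [x0 xk]; apply: sumr_ge0 => k _; exact: (sip_ge0 (hb k)).
Qed.

(** The limits in the pieces and the limit in the whole space differ by null
    vectors of the weak forms [w k], hence can be identified. *)
Lemma broken_complete : sip_complete S0 b0 -> (forall k, sip_complete (S k) (b k)) ->
  sip_complete broken_set broken_ip.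
Proof.
move=> c0 ck x Sx cx.
have Sx0 n : S0 (x n) by have [] := Sx n.
have Sxk n k : S k (x n) by have [_] := Sx n; exact.
have Sd n m k : S k (x n - x m) by apply: subspaceB (sip_sub (hb k)) _ _.
have bk_le n m k : b k (x n - x m) (x n - x m) <= broken_ip (x n - x m) (x n - x m).
  rewrite /broken_ip (bigD1 k)//= lerDl; apply: sumr_ge0 => j _.
  exact: (sip_ge0 (hb j)).
have [|l Sl xl] := c0 x Sx0.
  move=> e e0; have [M MP] := cx e e0; exists M => m n Nm Nn.
  apply: le_lt_trans (MP m n Nm Nn); rewrite b0w; last exact: subspaceB (sip_sub h0) _ _.
  by apply: ler_sum => k _; exact: wb.
have /choice[y yP] k : exists y, S k y /\ sip_cvg (b k) x y.
  have [|y Sy xy] := ck k x (Sxk^~ k); last by exists y.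
  move=> e e0; have [M MP] := cx e e0; exists M => m n Nm Nn.
  exact: le_lt_trans (bk_le _ _ _) (MP m n Nm Nn).
have ly k : w k (l - y k) (l - y k) = 0.
  have [Sy xy] := yP k.
  have Wly : W k (l - y k).
    by apply: subspaceB (sip_sub (hw k)) _ _; [exact: S0W|exact: SW].
  apply/eqP; rewrite eq_le (sip_ge0 (hw k))// andbT.
  apply/ler_addgt0Pr => e e0; rewrite add0r; have e4 : 0 < e / 4 by lra.
  have [M MP] := xl _ e4; have [M' MP'] := xy _ e4.
  set n := (M + M')%N.
  have Wl : W k (l - x n) by apply: subspaceB (sip_sub (hw k)) _ _; exact: S0W.
  have Sy' : S k (x n - y k) by apply: subspaceB (sip_sub (hb k)) _ _.
  have S0l : S0 (l - x n) by apply: subspaceB (sip_sub h0) _ _.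
  rewrite -(subrK (x n) l) -addrA.
  apply: le_trans (sip_sqr_triangle (hw k) Wl (SW Sy')) _.
  have := wb Sy'; have := MP' n (leq_addl _ _).
  have := MP n (leq_addr _ _); rewrite (sip_symB h0)// b0w// (bigD1 k)//=.
  have : 0 <= \sum_(i < N | i != k) w i (l - x n) (l - x n).
    by apply: sumr_ge0 => i _; apply: (sip_ge0 (hw i)); exact: S0W.
  lra.
have Slk k : S k l by have [Sy _] := yP k; have [] := ext Sl Sy (ly k).
exists l; first by split.
have cvg_k k : sip_cvg (b k) x l.
  move=> e e0; have [Sy xy] := yP k; have [M MP] := xy e e0.
  exists M => n Mn; apply: le_lt_trans (MP n Mn); rewrite le_eqVlt; apply/orP; left.
  have [_ ly0] := ext Sl Sy (ly k).
  apply/eqP/(sip_sqr_eq (hb k)); try by apply: subspaceB (sip_sub (hb k)) _ _.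
  by rewrite opprB addrC addrA subrK (sip_symB (hb k)).
move=> e e0.
have N1 : 0 < N.+1%:R :> R by [].
have /choice[M MP] k := cvg_k k _ (divr_gt0 e0 N1).
exists (\max_k M k)%N => n Mn.
apply: (@le_lt_trans _ _ (\sum_(k < N) e / N.+1%:R)).
  by apply: ler_sum => k _; apply/ltW/MP/(leq_trans _ Mn)/leq_bigmax.
rewrite sumr_const card_ord -[_ *+ N]mulr_natr mulrAC ltr_pdivrMr// ltr_pM2l//.
by rewrite ltr_nat.
Qed.

End sum.

(** * Lebesgue measure on row vectors *)

Section boxes.
Context {R : realType} {d : nat}.
Local Notation pt := 'rV[R]_d.
Implicit Types (a b x : pt) (A B : set pt).

Definition box a b : set pt := [set x | forall i, a 0 i < x 0 i < b 0 i].

Lemma measurable_box a b : measurable (box a b).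
Proof.
rewrite (_ : box a b = \bigcap_(i in [set: 'I_d])
    ((fun x : pt => x 0 i) @^-1` `]a 0 i, b 0 i[%classic)).
  apply: fin_bigcap_measurable; first exact: finite_finset.
  by move=> i _; rewrite -[X in measurable X]setTI; exact: measurable_coord.
apply/seteqP; split => x /=; first by move=> h i _ /=; rewrite in_itv/=; exact: h.
by move=> h i; have := h i I; rewrite /= in_itv.
Qed.

Lemma nbhs_box x A : nbhs x A -> exists2 e : R, 0 < e & forall y : pt,
  (forall i, `|y 0 i - x 0 i| < e) -> A y.
Proof.
move=> /nbhs_ballP[e /= e0 xeA]; exists e => // y h; apply: xeA.
by split => // i j; rewrite !ord1 /ball/= distrC.
Qed.

Definition closed_box a b : set pt := [set x | forall i, a 0 i <= x 0 i <= b 0 i].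

Lemma sub_closed_box a b : box a b `<=` closed_box a b.
Proof. by move=> x h i; have /andP[/ltW -> /ltW ->] := h i. Qed.

Definition rational_corner (q : 'rV[rat]_d) : pt := map_mx ratr q.

Lemma rational_box_nbhs A x : open A -> A x -> exists qp : 'rV[rat]_d * 'rV[rat]_d,
  box (rational_corner qp.1) (rational_corner qp.2) x /\
  closed_box (rational_corner qp.1) (rational_corner qp.2) `<=` A.
Proof.
move=> oA Ax; have [e e0 eA] := nbhs_box (open_nbhs_nbhs (conj oA Ax)).
have ratP (u v : R) : u < v -> exists q : rat, u < ratr q < v.
  by move=> /rat_in_itvoo[q]; rewrite in_itv => h; exists q.
have /choice[q qP] i : exists q : rat, x 0 i - e < ratr q < x 0 i.
  by apply: ratP; rewrite ltrBlDr ltrDl.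
have /choice[p pP] i : exists p : rat, x 0 i < ratr p < x 0 i + e.
  by apply: ratP; rewrite ltrDl.
exists (\row_i q i, \row_i p i); split => /= [i|y yb].
  by rewrite !mxE; have /andP[_ ->] := qP i; have /andP[-> _] := pP i.
apply: eA => i; have := yb i; rewrite !mxE ltr_distl => /andP[h1 h2].
have /andP[h3 _] := qP i; have /andP[_ h4] := pP i.
by rewrite (lt_le_trans h3 h1) (le_lt_trans h2 h4).
Qed.

(** Open sets are countable unions of boxes with rational corners. *)
Lemma open_measurable_rV A : open A -> measurable A.
Proof.
move=> oA; pose B (qp : 'rV[rat]_d * 'rV[rat]_d) :=
  box (rational_corner qp.1) (rational_corner qp.2).
pose F n := if unpickle n is Some qp then
  if `[< B qp `<=` A >] then B qp else set0 else set0.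
rewrite (_ : A = \bigcup_n F n); last first.
  apply/seteqP; split => [x Ax|x [n _]]; last first.
    by rewrite /F; case: unpickle => // qp; case: asboolP => // h; exact: h.
  have [qp [Bx BA]] := rational_box_nbhs oA Ax.
  exists (pickle qp) => //; rewrite /F pickleK; case: asboolP => // -[].
  exact: subset_trans (@sub_closed_box _ _) BA.
apply: bigcupT_measurable => n; rewrite /F.
by case: unpickle => // qp; case: asboolP => // _; exact: measurable_box.
Qed.

Lemma continuous_measurable_rV (f : pt -> R) A : measurable A -> continuous f ->
  measurable_fun A f.
Proof.
move=> mA cf; apply: measurable_funS (subsetT A) _ => //.
apply: (@measurability _ _ _ _ _ _ (@measurable_realfun.RGenOInfty.G R)); first exact: measurable_realfun.RGenOInfty.measurableE.
move=> _ [_ [x ->] <-]; rewrite setTI; apply: open_measurable_rV.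
by move/continuousP : cf; apply; exact: interval_open.
Qed.

Definition boxes : set (set pt) := [set B | exists a b, B = box a b].

Lemma box_setI a b a' b' : exists a2 b2, box a b `&` box a' b' = box a2 b2 /\
  closed_box a2 b2 `<=` closed_box a' b'.
Proof.
exists (\row_i Num.max (a 0 i) (a' 0 i)), (\row_i Num.min (b 0 i) (b' 0 i)); split.
  apply/seteqP; split => x /=.
    move=> [h h'] i; rewrite !mxE gt_max lt_min.
    by have /andP[-> ->] := h i; have /andP[-> ->] := h' i.
  by move=> h; split=> i; have := h i; rewrite !mxE gt_max lt_min =>
    /andP[/andP[h1 h2] /andP[h3 h4]]; rewrite ?h1 ?h2 ?h3 ?h4.
move=> x h i; have := h i; rewrite !mxE ge_max le_min.
by move=> /andP[/andP[_ ->] /andP[_ ->]].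
Qed.

Lemma boxes_setI : setI_closed boxes.
Proof.
move=> _ _ [a [b ->]] [a' [b' ->]].
by have [a2 [b2 [-> _]]] := box_setI a b a' b'; exists a2, b2.
Qed.

Definition cube (n : R) : set pt := box (const_mx (- n)) (const_mx n).

Lemma cubeE n x : cube n x <-> forall i, `|x 0 i| < n.
Proof.
split => h i; have := h i; rewrite ?mxE ltr_norml//.
Qed.

Lemma rV_norm_ltP (x : pt) (e : R) : 0 < e -> (forall i, `|x 0 i| < e) <-> `|x| < e.
Proof.
move=> e0; have : ball (0 : pt) e x <-> `|x| < e.
  by rewrite -ball_normE /= sub0r normrN.
move=> <-; split=> [h|[_ h] i]; last by have := h 0 i; rewrite /ball/= mxE sub0r normrN.
by split => // i j; rewrite !ord1 /ball/= mxE sub0r normrN.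
Qed.

Lemma rV_norm_leP (x : pt) (e : R) : 0 <= e -> (forall i, `|x 0 i| <= e) <-> `|x| <= e.
Proof.
move=> e0; split => h.
  apply/ler_addgt0Pr => t t0; apply/ltW/rV_norm_ltP; first lra.
  by move=> i; have := h i; lra.
move=> i; apply/ler_addgt0Pr => t t0; apply/ltW; apply: (rV_norm_ltP _ _).2 i; first lra.
by apply: le_lt_trans h _; lra.
Qed.

Lemma cube_cover : \bigcup_n (cube n%:R) = setT.
Proof.
apply/seteqP; split => // x _; have [N xN] : exists N, `|x| < N%:R.
  by exists (Num.truncn `|x|).+1; rewrite truncnS_gt.
exists N => //; apply/cubeE/rV_norm_ltP => //.
exact: le_lt_trans xN.
Qed.

Lemma box_sigma_algebra : @measurable _ pt = <<s boxes >>.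
Proof.
apply/seteqP; split; last first.
  apply: smallest_sub; first exact: sigma_algebra_measurable.
  by move=> _ [a [b ->]]; exact: measurable_box.
apply: smallest_sub; first exact: smallest_sigma_algebra.
move=> _ [[i j] _ [B mB <-]]; rewrite setTI /= (ord1 i) {i}.
pose E := [set B : set R | <<s boxes >> ((fun x : pt => x 0 j) @^-1` B)].
have sE : sigma_algebra setT E.
  split.
  - by rewrite /E/= preimage_set0; exact: sigma_algebra0.
  - move=> C EC; rewrite /E/= setTD preimage_setC; exact: sigma_algebraC.
  - by move=> F EF; rewrite /E/= preimage_bigcup; exact: sigma_algebra_bigcup.
suff : measurable `<=` E by apply.
rewrite [measurable](measurable_realfun.RGenOInfty.measurableE R); apply: smallest_sub => // _ [y ->].
rewrite /E/= (_ : _ @^-1` _ = \bigcup_n box (\row_i (if i == j then y else - n%:R)) (const_mx n%:R)).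
  apply: sigma_algebra_bigcup => n; apply: sub_sigma_algebra.
  by exists (\row_i (if i == j then y else - n%:R)), (const_mx n%:R).
apply/seteqP; split => x /=; last first.
  by move=> [n _] /(_ j); rewrite !mxE eqxx in_itv/= => /andP[->].
rewrite in_itv/= andbT => yx; have : setT x by [].
rewrite -cube_cover => -[n _ /cubeE xn]; exists n => // i; rewrite !mxE.
by have := xn i; rewrite ltr_norml => /andP[h ->]; rewrite andbT; case: eqP => [->|].
Qed.

End boxes.

Section lebesgue_measure_rV.
Context {R : realType}.

Lemma cube_measure d (n : R) : 0 < n -> lebesgue_rV d (cube n) = ((2 * n) ^+ d)%:E.
Proof.
move=> n0; elim: d => [|d IH] /=.
  by rewrite diracE mem_set// => -[].
rewrite /lebesgue_step /pushforward.
transitivity ((@lebesgue_measure R \x lebesgue_rV d)%E (`]- n, n[%classic `*` cube n)).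
  congr ((_ \x _)%E _); apply/seteqP; split => -[x v] /=.
    move=> h; split => /=.
      by have := h (@lshift 1 d ord0); rewrite (rV_consl (x, v)) !mxE in_itv.
    by move=> i; have := h (@rshift 1 d i); rewrite (rV_consr (x, v)) !mxE.
  move=> [xn vn] i; case: (@split_ordP 1 d i) => k ->.
    by move: xn; rewrite (ord1 k) in_itv (rV_consl (x, v)) !mxE.
  by have := vn k; rewrite (rV_consr (x, v)) !mxE.
rewrite product_measure1E//; last exact: measurable_box.
rewrite IH /= -/lebesgue_measure lebesgue_measure_itv/= lte_fin gtrN// -EFinB -EFinM.
by rewrite exprS (_ : n - - n = 2 * n)//; ring.
Qed.

Lemma cube_finite d (n : R) : 0 < n -> (lebesgue_rV d (cube n) < +oo)%E.
Proof. by move=> n0; rewrite cube_measure// ltry. Qed.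

Lemma lebesgue_shift (c : R) (A : set R) : measurable A ->
  lebesgue_measure ((fun x => x + c) @^-1` A) = lebesgue_measure A.
Proof.
move=> mA.
have ms : measurable_fun setT (fun x : measurableTypeR R => x + c : measurableTypeR R).
  exact: measurable_funD.
pose fs : {mfun measurableTypeR R >-> measurableTypeR R} := HB.pack
  (fun x : measurableTypeR R => x + c : measurableTypeR R) (isMeasurableFun.Build _ _ _ _ _ ms).
apply/esym/(@lebesgue_measure_unique R (pushforward (@lebesgue_measure R) fs)) => // _ [[a b]] _ <-.
transitivity (@lebesgue_measure R `]a - c, b - c]%classic).
  by rewrite !lebesgue_measure_itv/= !lte_fin ltrD2r -!EFinB opprB addrA subrK.
congr (lebesgue_measure _).
by apply/seteqP; split => x /=; rewrite !in_itv/= ltrBlDr lerBrDr.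
Qed.

(** By induction on the dimension: both sides are product measures, and they
    agree on rectangles. *)
Lemma lebesgue_rV_shift d (c : 'rV[R]_d) (A : set 'rV[R]_d) : measurable A ->
  lebesgue_rV d ((fun x => x + c) @^-1` A) = lebesgue_rV d A.
Proof.
elim: d c A => [|d IH] c A mA /=.
  by rewrite (_ : _ @^-1` _ = A)//; apply/seteqP; split => x /=; rewrite [x + c]thinmx0 (thinmx0 x).
pose c0 := c 0 0; pose c1 : 'rV[R]_d := @rsubmx R 1 1 d c.
have ms0 : measurable_fun setT (fun x : measurableTypeR R => x + c0 : measurableTypeR R).
  exact: measurable_funD.
have ms1 : measurable_fun setT (fun v : 'rV[R]_d => v + c1).
  apply: measurable_fun_mx => i j; under eq_fun do rewrite mxE.
  by apply: measurable_funD => //; exact: measurable_coord.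
pose s (p : measurableTypeR R * 'rV[R]_d) : measurableTypeR R * 'rV[R]_d := (p.1 + c0, p.2 + c1).
have ms : measurable_fun setT s.
  by apply/measurable_fun_pairP; split; [exact: measurableT_comp ms0 measurable_fst|exact: measurableT_comp ms1 measurable_snd].
pose fs : {mfun (measurableTypeR R * 'rV[R]_d)%type >-> (measurableTypeR R * 'rV[R]_d)%type} :=
  HB.pack s (isMeasurableFun.Build _ _ _ _ _ ms).
have mA' : measurable (@rV_cons R d @^-1` A).
  by rewrite -[X in measurable X]setTI; exact: measurable_rV_cons.
have := product_measure_unique (m1 := @lebesgue_measure R) (m2 := lebesgue_rV d)
  (m' := pushforward (@lebesgue_measure R \x lebesgue_rV d)%E fs) _ mA'.
rewrite /lebesgue_step /pushforward => ->; last first.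
  move=> B C mB mC.
  transitivity ((@lebesgue_measure R \x lebesgue_rV d)%E
    (((fun x : measurableTypeR R => x + c0) @^-1` B) `*` ((fun v => v + c1) @^-1` C))) => //.
  rewrite product_measure1E; first by congr (_ * _)%E; [exact: lebesgue_shift|exact: IH].
    by rewrite -[X in measurable X]setTI; exact: ms0.
  by rewrite -[X in measurable X]setTI; exact: ms1.
congr ((_ \x _)%E _); apply/seteqP.
have E p : rV_cons (s p) = rV_cons p + c.
  apply/rowP => j; case: (@split_ordP 1 d j) => k ->; rewrite [RHS]mxE.
    by rewrite (ord1 k) !rV_consl /=; congr (_ + c _ _); apply: val_inj.
  by rewrite !rV_consr /= mxE /c1 mxE.
by split => p /=; rewrite E.
Qed.

Section shift.
Context {d : nat}.
Local Notation pt := 'rV[R]_d.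
Local Notation mu := (@lebesgue_rV R d).

Lemma bounded_finite (A : set pt) : bounded_set A -> measurable A -> (mu A < +oo)%E.
Proof.
move=> [M [_ hM]] mA; apply: le_lt_trans (cube_finite d (_ : 0 < `|M| + 2)); last by rewrite ltr_wpDl.
apply: le_measure; rewrite ?inE//; first exact: measurable_box.
move=> x Ax; apply/cubeE/rV_norm_ltP; first by rewrite ltr_wpDl.
apply: (@le_lt_trans _ _ (`|M| + 1)); last by rewrite ltrD2l ltr1n.
by apply: (hM _ _ x Ax); rewrite (le_lt_trans (ler_norm _))// ltrDl.
Qed.

Lemma measurable_shift (c : pt) : measurable_fun setT (fun x : pt => x + c).
Proof.
apply: measurable_fun_mx => i j; under eq_fun do rewrite mxE.
by apply: measurable_funD => //; exact: measurable_coord.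
Qed.

Lemma ge0_integral_shift (f : pt -> \bar R) (c : pt) : measurable_fun setT f ->
  (forall x, 0 <= f x)%E -> (\int[mu]_x f (x + c)%R = \int[mu]_x f x)%E.
Proof.
move=> mf f0.
have := @ge0_integral_pushforward _ _ _ _ R _ (measurable_shift c) mu setT f
  measurableT mf (fun x _ => f0 x).
rewrite preimage_setT /comp => <-.
apply: eq_measure_integral => [|mS A mA _]; first exact: measurable_shift.
exact: lebesgue_rV_shift.
Qed.

Lemma integrable_shift (f : pt -> \bar R) (c : pt) : mu.-integrable setT f ->
  mu.-integrable setT (fun x => f (x + c)).
Proof.
move=> /integrableP[mf foo]; apply/integrableP; split.
  exact: measurableT_comp mf (measurable_shift c).
rewrite (ge0_integral_shift (f := fun x => `|f x|%E))//.
exact: measurableT_comp.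
Qed.

Lemma Rintegral_shift (f : pt -> R) (c : pt) : mu.-integrable setT (EFin \o f) ->
  \int[mu]_x f (x + c) = \int[mu]_x f x.
Proof.
move=> fi; rewrite /Rintegral; congr fine.
have := @integral_pushforward _ _ _ _ R _ (measurable_shift c) mu setT (EFin \o f).
move=> /(_ (measurable_int _ fi)).
rewrite preimage_setT /comp => <-//; last exact: integrable_shift fi.
apply: eq_measure_integral => [|mS A mA _]; first exact: measurable_shift.
exact: lebesgue_rV_shift.
Qed.

End shift.

End lebesgue_measure_rV.

(** * Square integrable functions *)

Section geometric_cauchy.
Context {R : realType}.

Lemma geometric_cauchy_cvg (y : nat -> R) (c : R) :
  (forall k, `|y k.+1 - y k| <= c * 2^-1 ^+ k) -> cvgn y.
Proof.
move=> yc.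
have c0 : 0 <= c by have := yc 0%N; rewrite expr0 mulr1; exact: le_trans.
have bnd k m : `|y (k + m)%N - y k| <= 2 * c * 2^-1 ^+ k - 2 * c * 2^-1 ^+ (k + m).
  elim: m => [|m IH]; first by rewrite addn0 !subrr normr0.
  rewrite addnS -(subrK (y (k + m)%N) (y (k + m).+1)) -addrA.
  apply: le_trans (ler_normD _ _) _; have := yc (k + m)%N; move: IH.
  rewrite exprS; move: (2^-1 ^+ (k + m)) (2^-1 ^+ k) => u v; clear; lra.
apply/cauchy_cvgP/cauchyP => e e0.
have q0 : 0 < e / (2 * c + 1) by rewrite divr_gt0 ?ltr_wpDl ?mulr_ge0.
have [N _ NP] : \forall n \near \oo, `|2^-1 ^+ n : R| < e / (2 * c + 1).
  have /cvgr0Pnorm_lt := @cvg_expr R 2^-1 ltac:(by rewrite ger0_norm// invf_lt1// ltr1n).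
  exact.
exists (y N); exists N => // n /= Nn; rewrite /ball/= distrC -(subnKC Nn).
have := bnd N (n - N)%N; have := NP N (leqnn _); rewrite /= ger0_norm ?exprn_ge0//.
rewrite ltr_pdivlMr ?ltr_wpDl ?mulr_ge0//.
have : 0 <= 2 * c * 2^-1 ^+ (N + (n - N)) by rewrite !mulr_ge0 ?exprn_ge0.
have : 0 <= 2^-1 ^+ N :> R by rewrite exprn_ge0.
move: (2^-1 ^+ N) (_ * 2^-1 ^+ (N + _)) (`|_|) => u v w; nra.
Qed.

End geometric_cauchy.

Section L2_theory.
Context {R : realType} {d : nat}.
Local Notation pt := 'rV[R]_d.
Local Notation mu := (@lebesgue_rV R d).
Variables (A : set pt) (mA : measurable A).
Implicit Types (f g h : pt -> R).

Lemma integrable_mul f g : L2 A f -> L2 A g ->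
  mu.-integrable A (EFin \o (fun x => f x * g x)).
Proof.
move=> [mf fi] [mg gi].
apply: (le_integrable mA _ _ (integrableD mA fi gi)).
  by apply/measurable_EFinP; exact: measurable_funM.
move=> x Ax; rewrite /= lee_fin.
rewrite [leRHS]ger0_norm ?addr_ge0 ?sqr_ge0// ler_norml.
have := sqr_ge0 (f x - g x); have := sqr_ge0 (f x + g x).
have := sqr_ge0 (f x); have := sqr_ge0 (g x).
rewrite !expr2; set a := f x; set b := g x; nra.
Qed.

Lemma integrable_sqr f : measurable_fun A f ->
  (\int[mu]_(x in A) (f x ^+ 2)%:E < +oo)%E -> L2 A f.
Proof.
move=> mf foo; split => //; apply/integrableP; split.
  by apply/measurable_EFinP; exact: measurable_funX.
by under eq_integral do rewrite gee0_abs ?lee_fin ?sqr_ge0//.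
Qed.

Lemma L2_subspace : subspace (L2 A).
Proof.
split.
  split; first exact: measurable_cst.
  have := @integrable0 _ _ R mu A; apply: eq_integrable => // x _.
  by rewrite expr0n.
move=> a f g [mf fi] [mg gi]; split.
  by apply: measurable_funD => //; apply: measurable_funM => //; exact: measurable_cst.
have fi' := integrableZl mA (2 * a ^+ 2) fi; have gi' := integrableZl mA 2 gi.
apply: (le_integrable mA _ _ (integrableD mA fi' gi')).
  apply/measurable_EFinP; apply: measurable_funX.
  by apply: measurable_funD => //; apply: measurable_funM => //; exact: measurable_cst.
move=> x Ax; rewrite -!EFinM -EFinD !abse_EFin lee_fin.
rewrite !ger0_norm ?sqr_ge0//; last first.
  by rewrite -mulrA -exprMn addr_ge0// mulr_ge0// sqr_ge0.
rewrite (_ : (a *: f + g) x = a * f x + g x)//.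
have := sqr_ge0 (a * f x - g x); rewrite -mulrA -exprMn sqrrB sqrrD.
move: (a * f x) (g x) => b c; lra.
Qed.

Lemma ipC f g : ip A f g = ip A g f.
Proof. by apply: eq_Rintegral => x _; rewrite mulrC. Qed.

Lemma L2_semi_ip : semi_ip (L2 A) (ip A).
Proof.
split; first exact: L2_subspace.
- by move=> f g _ _; exact: ipC.
- move=> a f g h Lf Lg Lh; rewrite /ip.
  under eq_Rintegral do rewrite mulrDl -mulrA.
  have fh := integrable_mul Lf Lh; have gh := integrable_mul Lg Lh.
  rewrite RintegralD//; first by rewrite RintegralZl.
  by have := integrableZl mA a fh; apply: eq_integrable => // x _.
- by move=> f _; apply: Rintegral_ge0 => x _; rewrite -expr2 sqr_ge0.
Qed.

Lemma ip_sqrE f : L2 A f -> (\int[mu]_(x in A) (f x ^+ 2)%:E)%E = (ip A f f)%:E.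
Proof.
by move=> [mf fi]; rewrite /ip /Rintegral fineK// integrable_fin_num.
Qed.

Lemma ip_null f : L2 A f -> ip A f f = 0 -> ae_eq mu A f 0.
Proof.
move=> Lf f0; have [mf _] := Lf.
have := ip_sqrE Lf; rewrite f0 => h.
have /(ae_eq_integral_abs mu mA) : (\int[mu]_(x in A) `|(f x ^+ 2)%:E| = 0)%E.
  transitivity (\int[mu]_(x in A) (f x ^+ 2)%:E)%E => //.
  by apply: eq_integral => x _; rewrite gee0_abs ?lee_fin ?sqr_ge0.
move=> /(_ _)[]; first by apply/measurable_EFinP; exact: measurable_funX.
move=> N [mN N0 hN]; exists N; split => // x /= hx; apply: hN => /= hf; apply: hx => Ax.
by have := hf Ax => -[] /eqP; rewrite sqrf_eq0 => /eqP.
Qed.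

Lemma ip_ae_eq f f' g g' : L2 A f -> L2 A g -> L2 A f' -> L2 A g' ->
  ae_eq mu A f f' -> ae_eq mu A g g' -> ip A f g = ip A f' g'.
Proof.
move=> Lf Lg Lf' Lg' ff gg; congr fine; apply: ae_eq_integral => //.
- exact: measurable_int (integrable_mul Lf Lg).
- exact: measurable_int (integrable_mul Lf' Lg').
- by apply: filterS2 ff gg => x + + Ax => /(_ Ax) -> /(_ Ax) ->.
Qed.

Lemma L2_0 : L2 A 0. Proof. exact: L2_subspace.1. Qed.

Lemma ip_ae0 f : L2 A f -> ae_eq mu A f 0 -> ip A f f = 0.
Proof.
move=> Lf f0; rewrite (ip_ae_eq Lf Lf L2_0 L2_0 f0 f0).
exact: (sip0l L2_semi_ip L2_0).
Qed.

Lemma L2_eq_in f g : L2 A f -> {in A, f =1 g} -> L2 A g.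
Proof.
move=> [mf fi] fg; split.
  by apply: eq_measurable_fun mf => x xA; exact: fg.
by apply: eq_integrable fi => // x xA; rewrite fg.
Qed.

(** Riesz-Fischer: a fast Cauchy subsequence converges almost everywhere, since
    the integral of the weighted sum of its squared increments is finite, and
    Fatou's lemma gives the convergence of the whole sequence in norm. *)
Theorem L2_complete : sip_complete (L2 A) (ip A).
Proof.
move=> x Lx cx; have hL := L2_subspace.
have /choice[M MP] (k : nat) : exists M, forall m n, (M <= m)%N -> (M <= n)%N ->
    ip A (x m - x n) (x m - x n) < 2^-1 ^+ (3 * k).
  by apply: cx; rewrite exprn_gt0.
pose n_ := fix n_ k := if k is k'.+1 then maxn (M k) (n_ k').+1 else M 0%N.
have Mn k : (M k <= n_ k)%N by case: k => //= k; exact: leq_maxl.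
have n_S k : (n_ k < n_ k.+1)%N by rewrite /= leq_maxr.
have n_id k : (k <= n_ k)%N by elim: k => // k IH; exact: leq_ltn_trans IH (n_S k).
have n_mono k j : (n_ k <= n_ (k + j))%N.
  by elim: j => [|j IH]; rewrite ?addn0// addnS (leq_trans IH)// ltnW.
pose y k := x (n_ k).
have Ly k : L2 A (y k) by exact: Lx.
(* with this weight, a finite sum forces the increments to decay geometrically *)
pose w k t := (2 ^+ (2 * k) * (y k.+1 t - y k t) ^+ 2)%:E.
have Ld k : L2 A (y k.+1 - y k) by exact: subspaceB.
have mw k : measurable_fun A (w k).
  apply/measurable_EFinP; apply: measurable_funM; first exact: measurable_cst.
  by apply: measurable_funX; have [] := Ld k.
have w0 k t : (0 <= w k t)%E by rewrite lee_fin mulr_ge0 ?sqr_ge0// exprn_ge0.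
have wi k : (\int[mu]_(t in A) w k t <= (2^-1 ^+ k)%:E)%E.
  under eq_integral do rewrite /w EFinM.
  rewrite ge0_integralZl//; last 2 first.
  - by apply/measurable_EFinP; apply: measurable_funX; have [] := Ld k.
  - by move=> t _; rewrite lee_fin sqr_ge0.
  have := ip_sqrE (Ld k); rewrite !fctE => ->; rewrite -EFinM lee_fin.
  have := ltW (MP k (n_ k.+1) (n_ k) (leq_trans (Mn k) (ltnW (n_S k))) (Mn k)).
  move=> /(ler_wpM2l (exprn_ge0 (2 * k) (ler0n R 2))) /le_trans; apply.
  have -> : 2^-1 ^+ (3 * k) = 2^-1 ^+ (2 * k) * 2^-1 ^+ k :> R by rewrite -exprD -mulSnr.
  by rewrite mulrA -exprMn divff// expr1n mul1r.
have Goo : {ae mu, forall t, A t -> (\sum_(k <oo) w k t)%E \is a fin_num}.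
  apply: integrable_ae => //; apply/integrableP; split.
    exact: ge0_emeasurable_sum.
  under eq_integral do rewrite gee0_abs ?nneseries_ge0//.
  rewrite integral_nneseries//.
  apply: (@le_lt_trans _ _ (\sum_(k <oo) (2^-1 ^+ k)%:E)%E).
    by apply: lee_nneseries => [k _ _|k _]; [exact: integral_ge0|exact: wi].
  rewrite (_ : (\sum_(k <oo) _)%E = 2%:E) ?ltry//.
  apply/cvg_lim => //; rewrite (_ : (fun n => _) = EFin \o series (geometric 1 2^-1)).
    apply/cvg_EFin; first exact: nearW.
    rewrite (_ : fine \o _ = series (geometric 1 2^-1)); last by apply/funext.
    have := @cvg_geometric_series R 1 2^-1 ltac:(by rewrite ger0_norm// invf_lt1// ltr1n).
    by rewrite (_ : 1 / (1 - 2^-1) = 2)//; field.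
  apply/funext => n /=; rewrite /series/= sumEFin; congr EFin.
  by apply: eq_bigr => k _; rewrite mul1r.
(* measurable, and the limit wherever the sequence converges *)
pose l t := fine (limn_esup (fun k => (y k t)%:E)).
have ml : measurable_fun A l.
  apply: measurableT_comp => //; apply: measurable_fun_limn_esup => k.
  by apply/measurable_EFinP; have [] := Ly k.
have yl : {ae mu, forall t, A t -> y ^~ t @ \oo --> l t}.
  apply: filterS Goo => t + At => /(_ At) Gfin.
  pose c := fine (\sum_(k <oo) w k t)%E.
  have wc k : 2 ^+ (2 * k) * (y k.+1 t - y k t) ^+ 2 <= c.
    rewrite -lee_fin /c fineK// -/(w k t).
    have := @nneseries_lim_ge R (w ^~ t) xpredT 0 k.+1 (fun i _ _ => w0 i t).
    by apply: le_trans; rewrite big_nat_recr//= leeDr// sume_ge0.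
  have : cvgn (y ^~ t).
    apply: (@geometric_cauchy_cvg _ _ (c + 1)) => k.
    have c0 : 0 <= c by apply: le_trans (wc 0%N); rewrite mulr_ge0 ?sqr_ge0 ?exprn_ge0.
    rewrite -(@ler_pXn2r _ 2) ?nnegrE ?mulr_ge0 ?exprn_ge0 ?addr_ge0//.
    rewrite real_normK ?num_real// -(ler_pM2l (exprn_gt0 (2 * k) (ltr0n R 2))).
    apply: le_trans (wc k) _.
    rewrite exprMn -exprM mulnC mulrCA -exprMn divff// expr1n mulr1.
    by rewrite expr2; nra.
  move=> /[dup] ct /cvg_ex[a ya]; rewrite /l.
  have : (y k t)%:E @[k --> \oo] --> a%:E by apply: cvg_EFin => //; exact: nearW.
  by move=> /cvg_limn_einf_sup[_ ->].
have small e : 0 < e -> exists N, forall n, (N <= n)%N -> L2 A (l - x n) /\ ip A (l - x n) (l - x n) <= e.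
  move=> e0; have [N NP] := cx e e0.
  pose K := N; have NK : (N <= n_ K)%N by exact: n_id.
  exists N => n Nn.
  have mx k : measurable_fun A (fun t => ((y (K + k)%N t - x n t) ^+ 2)%:E).
    apply/measurable_EFinP; apply: measurable_funX.
    by have [] := subspaceB hL (Ly (K + k)%N) (Lx n).
  have mlx : measurable_fun A (l - x n) by apply: measurable_funB => //; have [] := Lx n.
  have fat : (\int[mu]_(t in A) ((l - x n) t ^+ 2)%:E <= e%:E)%E.
    apply: (@le_trans _ _ (limn_einf (fun k => \int[mu]_(t in A) ((y (K + k)%N t - x n t) ^+ 2)%:E)))%E.
      apply: le_trans (fatou mu mA mx _); last by move=> k t _; rewrite lee_fin sqr_ge0.
      rewrite le_eqVlt; apply/orP; left; apply/eqP.
      apply: ae_eq_integral => //.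
      - by apply/measurable_EFinP; exact: measurable_funX.
      - rewrite (_ : (fun t => _) = (fun t => - limn_esup (fun k =>
            - ((y (K + k)%N t - x n t) ^+ 2)%:E))%E); last first.
          apply/funext => t; rewrite -limn_einfN; congr limn_einf.
          by apply/funext => k; rewrite /comp oppeK.
        apply: measurableT_comp => //; apply: measurable_fun_limn_esup => k.
        exact: measurableT_comp.
      apply: filterS yl => t + At => /(_ At) yt.
      have : ((y (K + k)%N t - x n t) ^+ 2)%:E @[k --> \oo] --> ((l - x n) t ^+ 2)%:E.
        apply: cvg_EFin; first exact: nearW.
        under [X in X @ _]funext do rewrite /= expr2.
        have h : y (K + k)%N t - x n t @[k --> \oo] --> (l - x n) t.
          apply: cvgB; last exact: cvg_cst.
          move: yt; rewrite -(cvg_shiftn K); apply: cvg_trans; apply: near_eq_cvg.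
          by apply: nearW => k /=; rewrite addnC.
        by rewrite expr2; exact: cvgM.
      by move=> /cvg_limn_einf_sup[-> _].
    have hk k : (\int[mu]_(t in A) ((y (K + k)%N t - x n t) ^+ 2)%:E <= e%:E)%E.
      have := ip_sqrE (subspaceB hL (Ly (K + k)%N) (Lx n)); rewrite fctE => ->.
      by rewrite lee_fin ltW// NP// (leq_trans NK).
    rewrite limn_einf_lim; apply: lime_le; first exact: is_cvg_einfs.
    apply: nearW => k; apply: le_trans (hk k).
    by apply: ereal_inf_lbound; exists k => /=.
  have Llx : L2 A (l - x n) by apply: integrable_sqr => //; rewrite (le_lt_trans fat)// ltry.
  by split => //; rewrite -lee_fin -ip_sqrE.
have Ll : L2 A l.
  have [N NP] := small 1 ltr01; have [h _] := NP N (leqnn _).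
  by rewrite -(subrK (x N) l); exact: subspaceD.
exists l => // e e0; have e2 : 0 < e / 2 by lra.
have [N NP] := small _ e2; exists N => n Nn; have [_] := NP n Nn.
rewrite (sip_symB L2_semi_ip)// => /le_lt_trans; apply; lra.
Qed.

End L2_theory.

Section L2_set.
Context {R : realType} {d : nat}.
Local Notation pt := 'rV[R]_d.
Local Notation mu := (@lebesgue_rV R d).
Implicit Types (A B : set pt) (f g h : pt -> R).

Lemma L2S A B f : measurable A -> measurable B -> B `<=` A -> L2 A f -> L2 B f.
Proof.
move=> mA mB BA [mf fi]; split; first exact: measurable_funS BA mf.
exact: integrableS fi.
Qed.

Lemma L2_bounded A f (c : R) : measurable A -> bounded_set A -> measurable_fun A f ->
  (forall x, A x -> `|f x| <= c) -> L2 A f.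
Proof.
move=> mA bA mf fc; apply: integrable_sqr => //.
apply: (@le_lt_trans _ _ (\int[mu]_(x in A) (c ^+ 2)%:E)%E); last first.
  by rewrite integral_cst// lte_mul_pinfty ?lee_fin ?sqr_ge0// bounded_finite.
apply: ge0_le_integral => //.
- by move=> x _; rewrite lee_fin sqr_ge0.
- by apply/measurable_EFinP; exact: measurable_funX.
- move=> x Ax; rewrite lee_fin -real_normK ?num_real//.
  by rewrite ler_pXn2r ?nnegrE ?fc// (le_trans _ (fc x Ax)).
Qed.

Lemma bounded_closure A : bounded_set A -> bounded_set (closure A).
Proof.
move=> [M [Mr hM]]; exists M; split => // m Mm x cx.
have m2 : M < (M + m) / 2 by lra.
rewrite /=; apply/ler_addgt0Pr => e e0.
have [y [Ay]] := cx _ (nbhsx_ballx x e e0); rewrite -ball_normE/= => xy.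
rewrite -(subrK y x) addrC; apply: le_trans (ler_normD _ _) _.
rewrite lerD// ?(ltW xy)//; apply: (le_trans (hM _ m2 _ Ay)); lra.
Qed.

Lemma continuous_L2 A f : measurable A -> bounded_set A -> continuous f -> L2 A f.
Proof.
move=> mA bA cf.
have cA : compact (closure A).
  by apply: bounded_closed_compact; [exact: bounded_closure|exact: closed_closure].
have [M [_ hM]] := compact_bounded (continuous_compact (continuous_subspaceT cf) cA).
apply: (@L2_bounded _ _ (M + 1)) => //; first exact: continuous_measurable_rV.
move=> x Ax; apply: (hM (M + 1)); first by rewrite ltrDl.
by exists x => //; exact: subset_closure.
Qed.

End L2_set.

Section L2sym_theory.
Context {R : realType} {d : nat}.
Local Notation pt := 'rV[R]_d.
Local Notation mu := (@lebesgue_rV R d).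
Variables (A : set pt) (mA : measurable A).
Implicit Types (M : pt -> 'M[R]_d).

Lemma measurable_fun_mx_in M : (forall i j, measurable_fun A (fun x => M x i j)) ->
  measurable_fun A M.
Proof.
move=> mM; apply: (@measurability _ _ _ _ A M _ erefl).
by move=> _ [_ [p _ [B mB <-]] <-]; rewrite setTI; exact: mM.
Qed.

Lemma frob_sqr_ge0 (K : 'M[R]_d) : 0 <= frob K K.
Proof. by apply: sumr_ge0 => i _; apply: sumr_ge0 => j _; rewrite -expr2 sqr_ge0. Qed.

Lemma le_frob (K : 'M[R]_d) i j : K i j ^+ 2 <= frob K K.
Proof.
rewrite /frob (bigD1 i)//= (bigD1 j)//= -expr2 -addrA lerDl addr_ge0//.
  by apply: sumr_ge0 => k _; rewrite -expr2 sqr_ge0.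
by apply: sumr_ge0 => k _; apply: sumr_ge0 => l _; rewrite -expr2 sqr_ge0.
Qed.

Lemma L2symP M : L2sym A M <->
  (forall i j, L2 A (fun x => M x i j)) /\ (forall x, A x -> (M x)^T = M x).
Proof.
split=> [[mM sM iM]|[LM sM]].
  split => // i j; split; first exact: measurableT_comp (measurable_coord i j) mM.
  apply: le_integrable iM => //.
    apply/measurable_EFinP/measurable_funX.
    exact: measurableT_comp (measurable_coord i j) mM.
  by move=> x Ax; rewrite !gee0_abs ?lee_fin ?sqr_ge0 ?frob_sqr_ge0// le_frob.
split => //; first by apply: measurable_fun_mx_in => i j; have [] := LM i j.
rewrite (_ : (fun _ => _) = (fun x => \sum_i \sum_j (M x i j * M x i j)%:E)%E); last first.
  by apply/funext => x; rewrite /frob -sumEFin; apply: eq_bigr => i _; rewrite sumEFin.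
apply: integrable_sum => // i _; apply: integrable_sum => // j _.
exact: (integrable_mul mA (LM i j) (LM i j)).
Qed.

Lemma L2sym_coord M i j : L2sym A M -> L2 A (fun x => M x i j).
Proof. by move=> /L2symP[]. Qed.

Lemma Rintegral_sum (I : finType) (F : I -> pt -> R) :
  (forall i, mu.-integrable A (EFin \o F i)) ->
  mu.-integrable A (EFin \o (fun x => \sum_i F i x)) /\
  \int[mu]_(x in A) (\sum_i F i x) = \sum_i \int[mu]_(x in A) F i x.
Proof.
move=> Fi.
pose P (f : pt -> R) s := mu.-integrable A (EFin \o f) /\ \int[mu]_(x in A) f x = s.
suff : P (fun x => \sum_i F i x) (\sum_i \int[mu]_(x in A) F i x) by [].
rewrite (_ : (fun x => _) = \sum_i F i); last by apply/funext => x; rewrite fct_sumE.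
apply: (big_ind2 P).
- split; first by have := @integrable0 _ _ R mu A; apply: eq_integrable.
  by rewrite /Rintegral integral0_eq.
- move=> f s g t [fi <-] [gi <-]; split; last by rewrite -RintegralD.
  by have := integrableD mA fi gi; apply: eq_integrable.
- by move=> i _; split.
Qed.

Lemma ipM_sum M M' : L2sym A M -> L2sym A M' ->
  ipM A M M' = \sum_i \sum_j ip A (fun x => M x i j) (fun x => M' x i j).
Proof.
move=> LM LM'; rewrite /ipM /frob.
have h i j : mu.-integrable A (EFin \o (fun x => M x i j * M' x i j)).
  by apply: (@integrable_mul _ _ A) => //; exact: L2sym_coord.
rewrite (Rintegral_sum (F := fun i x => \sum_j M x i j * M' x i j) _).2; first last.
  by move=> i; exact: (Rintegral_sum (h i)).1.
by apply: eq_bigr => i _; rewrite (Rintegral_sum (h i)).2.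
Qed.

Lemma L2sym_subspace : subspace (L2sym A).
Proof.
split.
  apply/L2symP; split => [i j|x _]; last exact: trmx0.
  by rewrite (_ : (fun _ => _) = 0); [exact: L2_0|apply/funext => x; rewrite mxE].
move=> a M M' /L2symP[LM sM] /L2symP[LM' sM']; apply/L2symP; split => [i j|x Ax].
  rewrite (_ : (fun _ => _) = a *: (fun x => M x i j) + (fun x => M' x i j)).
    exact: (L2_subspace mA).2.
  by apply/funext => x; rewrite !mxE.
by rewrite linearD linearZ/= sM// sM'.
Qed.

Lemma ip_coordL (a : R) M M' (g : pt -> R) i j : L2sym A M -> L2sym A M' -> L2 A g ->
  ip A (fun x => (a *: M + M') x i j) g =
  a * ip A (fun x => M x i j) g + ip A (fun x => M' x i j) g.
Proof.
move=> /L2sym_coord LM /L2sym_coord LM' Lg; rewrite -(sipL (L2_semi_ip mA))//.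
by congr ip; apply/funext => x; rewrite !mxE.
Qed.

Lemma L2sym_semi_ip : semi_ip (L2sym A) (ipM A).
Proof.
split; first exact: L2sym_subspace.
- move=> M M' LM LM'; rewrite !ipM_sum//.
  by apply: eq_bigr => i _; apply: eq_bigr => j _; exact: ipC.
- move=> a M M' K LM LM' LK; rewrite !ipM_sum//; last exact: L2sym_subspace.2.
  rewrite mulr_sumr -big_split/=; apply: eq_bigr => i _.
  rewrite mulr_sumr -big_split/=; apply: eq_bigr => j _.
  by rewrite ip_coordL//; exact: L2sym_coord.
- by move=> M LM; apply: Rintegral_ge0 => x _; exact: frob_sqr_ge0.
Qed.

Lemma ipM_coord_le M i j : L2sym A M ->
  ip A (fun x => M x i j) (fun x => M x i j) <= ipM A M M.
Proof.
move=> LM; rewrite ipM_sum// (bigD1 i)//= (bigD1 j)//= -addrA lerDl.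
have h k l : 0 <= ip A (fun x => M x k l) (fun x => M x k l).
  by apply: (sip_ge0 (L2_semi_ip mA)); exact: L2sym_coord.
by rewrite addr_ge0// sumr_ge0// => k _; rewrite sumr_ge0.
Qed.

Lemma ipM_null M : L2sym A M -> ipM A M M = 0 -> ae_eq mu A M 0.
Proof.
move=> LM M0.
have h i j : ae_eq mu A (fun x => M x i j) 0.
  apply: (ip_null mA); first exact: L2sym_coord.
  apply/eqP; rewrite eq_le (sip_ge0 (L2_semi_ip mA)) ?andbT; last exact: L2sym_coord.
  by rewrite -M0 ipM_coord_le.
have : {ae mu, forall x, forall p : 'I_d * 'I_d, A x -> M x p.1 p.2 = 0}.
  have hn n : {ae mu, forall x, forall p, (unpickle n : option ('I_d * 'I_d)) = Some p -> A x -> M x p.1 p.2 = 0}.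
    case: (unpickle n) => [[i j]|]; last by apply: aeW.
    by apply: filterS (h i j) => x hx p [<-] Ax; exact: hx.
  by apply: filterS (ae_foralln hn) => x hx p; apply: (hx (pickle p)); rewrite pickleK.
by apply: filterS => x hx Ax; apply/matrixP => i j; rewrite (hx (i, j) Ax) mxE.
Qed.

Lemma ipM_ae_eq M K M' K' : L2sym A M -> L2sym A K -> L2sym A M' -> L2sym A K' ->
  ae_eq mu A M M' -> ae_eq mu A K K' -> ipM A M K = ipM A M' K'.
Proof.
move=> LM LK LM' LK' MM KK; rewrite !ipM_sum//.
apply: eq_bigr => i _; apply: eq_bigr => j _.
apply: ip_ae_eq; rewrite //; try exact: L2sym_coord.
  by apply: filterS MM => x h Ax; rewrite h.
by apply: filterS KK => x h Ax; rewrite h.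
Qed.

Lemma ipM_ae0 M : L2sym A M -> ae_eq mu A M 0 -> ipM A M M = 0.
Proof.
move=> LM M0; rewrite (ipM_ae_eq LM LM L2sym_subspace.1 L2sym_subspace.1 M0 M0).
exact: (sip0l L2sym_semi_ip L2sym_subspace.1).
Qed.

(** The limits of the entries need not form a symmetric matrix at every point
    of [A], only at almost every point: their symmetric part does. *)
Lemma L2sym_complete : sip_complete (L2sym A) (ipM A).
Proof.
move=> M LM cM.
have LB m n : L2sym A (M m - M n) by exact: subspaceB L2sym_subspace _ _.
have /choice[l lP] (p : 'I_d * 'I_d) : exists l, L2 A l /\
    sip_cvg (ip A) (fun n => (fun x => M n x p.1 p.2) : pt -> R) l.
  have [n|e e0|l Ll cl] := @L2_complete R d A mA (fun n x => M n x p.1 p.2).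
  - exact: L2sym_coord.
  - have [N NP] := cM e e0; exists N => m n Nm Nn.
    apply: le_lt_trans (NP m n Nm Nn).
    by apply: le_trans (ipM_coord_le p.1 p.2 (LB m n)); rewrite le_eqVlt; apply/orP; left; apply/eqP; congr ip; apply/funext => x; rewrite !mxE.
  - by exists l.
pose L x : 'M[R]_d := \matrix_(i, j) (2^-1 * (l (i, j) x + l (j, i) x)).
have LlL i j : L2 A (fun x => L x i j).
  rewrite (_ : (fun _ => _) = 2^-1 *: (l (i, j) + l (j, i))); last by apply/funext => x; rewrite mxE.
  apply: subspaceZ (L2_subspace mA) _; apply: subspaceD (L2_subspace mA) _ _.
    by have [] := lP (i, j).
  by have [] := lP (j, i).
have LL : L2sym A L.
  apply/L2symP; split => // x Ax.
  by apply/matrixP => i j; rewrite !mxE addrC.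
exists L => // e e0.
pose c := (d * d).+1%:R : R; have c0 : 0 < c by [].
have /choice[N NP] p : exists N, forall n, (N <= n)%N ->
    ip A ((fun x => M n x p.1 p.2) - l p) ((fun x => M n x p.1 p.2) - l p) < e / c.
  by have [_ cl] := lP p; apply: cl; rewrite divr_gt0.
exists (\max_p N p)%N => n Nn.
have hp p : ip A ((fun x => M n x p.1 p.2) - l p) ((fun x => M n x p.1 p.2) - l p) < e / c.
  by apply: NP; apply: leq_trans Nn; exact: leq_bigmax.
have LML : L2sym A (M n - L) by exact: subspaceB L2sym_subspace _ _.
have Lc p : L2 A ((fun x => M n x p.1 p.2) - l p).
  by apply: subspaceB (L2_subspace mA) _ _; [exact: L2sym_coord|have [] := lP p].
have sM x : A x -> (M n x)^T = M n x by have /L2symP[_] := LM n; exact.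
apply: (@le_lt_trans _ _ (\sum_(i < d) \sum_(j < d) e / c)); last first.
  rewrite !sumr_const !card_ord -mulrnA -[_ *+ (d * d)]mulr_natr mulrAC.
  by rewrite ltr_pdivrMr// ltr_pM2l// ltr_nat.
rewrite ipM_sum//; apply: ler_sum => i _; apply: ler_sum => j _.
set F := fun x => M n x i j - l (i, j) x; set G := fun x => M n x j i - l (j, i) x.
have LF : L2 A F by exact: (Lc (i, j)).
have LG : L2 A G by exact: (Lc (j, i)).
have Lh : L2 A (2^-1 *: (F + G)).
  by apply: subspaceZ (L2_subspace mA) _; exact: subspaceD (L2_subspace mA) _ _.
have LFG : L2 A (F + G) by exact: subspaceD (L2_subspace mA) _ _.
have eqA : ae_eq mu A (fun x => (M n - L) x i j) (2^-1 *: (F + G)).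
  apply: aeW => x Ax; have sji : M n x j i = M n x i j by rewrite -[in RHS](sM x Ax) mxE.
  transitivity (2^-1 * (F x + G x)) => //.
  by rewrite -[LHS]/((M n x - L x) i j) !mxE /F /G sji; field.
rewrite (ip_ae_eq mA (f' := 2^-1 *: (F + G)) (g' := 2^-1 *: (F + G)))//; try exact: L2sym_coord.
rewrite (sipZl (L2_semi_ip mA))// (sipZr (L2_semi_ip mA))//.
  have := sip_sqr_triangle (L2_semi_ip mA) LF LG.
  have := ltW (hp (i, j)); have := ltW (hp (j, i)); rewrite -!/F -!/G /= => h1 h2.
  have E1 : ip A F F <= e / c by exact: h2.
  have E2 : ip A G G <= e / c by exact: h1.
  move: E1 E2; move: (ip A F F) (ip A G G) (ip A (F + G) (F + G)) (e / c) => t1 t2 t3 t4; lra.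
Qed.

End L2sym_theory.

(** * Smooth functions *)

Section directional.
Context {R : realType} {d : nat}.
Local Notation pt := 'rV[R]_d.

Lemma line_quotient (f : pt -> R) x v t :
  (fun h : R => h^-1 *: (((fun s : R => f (x + s *: v)) \o shift t) (h *: (1 : R)) - f (x + t *: v))) =
  (fun h : R => h^-1 *: ((f \o shift (x + t *: v)) (h *: v) - f (x + t *: v))).
Proof.
apply/funext => h /=; congr (_ *: (f _ - _)).
by rewrite -[h *: 1]/(h * 1) mulr1 scalerDl addrCA.
Qed.

Lemma line_is_derive (f : pt -> R) x v t : derivable f (x + t *: v) v ->
  is_derive t (1 : R) (fun s : R => f (x + s *: v)) ('D_v f (x + t *: v)).
Proof.
move=> df; apply: DeriveDef; first by rewrite /derivable line_quotient.
by rewrite /derive line_quotient.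
Qed.

Lemma is_derive_line (f : pt -> R) x v l :
  is_derive (0 : R) (1 : R) (fun s : R => f (x + s *: v)) l -> is_derive x v f l.
Proof.
move=> [df dl]; rewrite (_ : x = x + 0 *: v); last by rewrite scale0r addr0.
by apply: DeriveDef; [rewrite /derivable -line_quotient|rewrite /derive -line_quotient].
Qed.

Lemma is_derive_comp (f : pt -> R) (h : R -> R) x v l : derivable f x v ->
  is_derive (f x) 1 h l -> is_derive x v (h \o f) (l * 'D_v f x).
Proof.
move=> df dh; apply: is_derive_line.
have df0 : derivable f (x + 0 *: v) v by rewrite scale0r addr0.
have := line_is_derive df0; rewrite scale0r addr0 => hf.
by apply: (@is_derive1_comp _ h (fun s => f (x + s *: v))); rewrite scale0r addr0.
Qed.

End directional.

Section smoothness.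
Context {R : realType} {d : nat}.
Local Notation pt := 'rV[R]_d.
Local Notation e_ i := (delta_mx (ord0 : 'I_1) i : pt).
Implicit Types (f g : pt -> R).

Fixpoint smoothn n f : Prop :=
  if n is n'.+1 then [/\ continuous f, forall i x, derivable f x (e_ i)
    & forall i, smoothn n' (partial i f)] else continuous f.

Lemma smooth_partial f i : smooth f -> smooth (partial i f).
Proof. by move=> sf s; have := sf (rcons s i); rewrite foldr_rcons. Qed.

Lemma smooth_continuous f : smooth f -> continuous f.
Proof. by move=> /(_ [::])[]. Qed.

Lemma smooth_derivable f i x : smooth f -> derivable f x (e_ i).
Proof. by move=> /(_ [::])[_]. Qed.

Lemma smoothP f : smooth f <-> forall n, smoothn n f.
Proof.
split=> [sf n|sf s].
  elim: n f sf => [|n IH] f sf /=; first exact: smooth_continuous.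
  split; [exact: smooth_continuous|move=> i x; exact: smooth_derivable|].
  by move=> i; apply: IH; exact: smooth_partial.
elim/last_ind: s f sf => [|s i IH] f sf.
  by have [cf df _] := sf 1%N; split.
by rewrite foldr_rcons; apply: IH => n; have [_ _] := sf n.+1; exact.
Qed.

Lemma smoothnW n f : smoothn n.+1 f -> smoothn n f.
Proof.
elim: n f => [|n IH] f; first by case.
by move=> [cf df sf]; split => // i; apply: IH; exact: sf.
Qed.

Lemma partialD f g i x : derivable f x (e_ i) -> derivable g x (e_ i) ->
  partial i (f + g) x = partial i f x + partial i g x.
Proof. by move=> df dg; rewrite /partial deriveD. Qed.

Lemma partialZ f (a : R) i x : derivable f x (e_ i) ->
  partial i (a *: f) x = a * partial i f x.
Proof. by move=> df; rewrite /partial deriveZ. Qed.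

Lemma partialM f g i x : derivable f x (e_ i) -> derivable g x (e_ i) ->
  partial i (fun y => f y * g y) x = partial i f x * g x + f x * partial i g x.
Proof.
move=> df dg; rewrite /partial (deriveM df dg).
by rewrite addrC -[_ *: _]/(_ * _) mulrC.
Qed.

Lemma smoothnD n f g : smoothn n f -> smoothn n g -> smoothn n (f + g).
Proof.
elim: n f g => [|n IH] f g /=; first by move=> cf cg x; exact: cvgD (cf x) (cg x).
move=> [cf df sf] [cg dg sg]; split.
- by move=> x; exact: cvgD (cf x) (cg x).
- by move=> i x; exact: derivableD.
- move=> i; rewrite (_ : partial i (f + g) = partial i f + partial i g); first exact: IH.
  by apply/funext => x; exact: partialD.
Qed.

Lemma smoothnM n f g : smoothn n f -> smoothn n g -> smoothn n (fun x => f x * g x).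
Proof.
elim: n f g => [|n IH] f g; first by move=> cf cg x; exact: cvgM (cf x) (cg x).
move=> sf' sg'; have [cf df sf] := sf'; have [cg dg sg] := sg'; split.
- by move=> x; exact: cvgM (cf x) (cg x).
- by move=> i x; exact: derivableM.
- move=> i; rewrite (_ : partial i _ = (fun x => partial i f x * g x) +
    (fun x => f x * partial i g x)).
    by apply: smoothnD; [exact: IH (sf i) (smoothnW sg')|exact: IH (smoothnW sf') (sg i)].
  by apply/funext => x; exact: partialM.
Qed.

Lemma partial_cst (a : R) i : partial i (cst a : pt -> R) = cst 0.
Proof. by apply/funext => x; rewrite /partial derive_cst. Qed.

Lemma smoothn_cst n (a : R) : smoothn n (cst a : pt -> R).
Proof.
elim: n a => [|n IH] a; first exact: cst_continuous.
split; [exact: cst_continuous|by move=> i x; exact: derivable_cst|].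
by move=> i; rewrite partial_cst.
Qed.

Lemma is_derive_coord (k i : 'I_d) (x : pt) :
  is_derive x (e_ i) (fun y : pt => y 0 k) ((k == i)%:R).
Proof.
apply: is_derive_line.
rewrite (_ : (fun s => _) = (fun s : R => x 0 k + s * (k == i)%:R)); last first.
  by apply/funext => s; rewrite !mxE eqxx andTb.
apply: is_derive_eq; rewrite add0r -[_ *: 1]/(_ * 1) mulr1 -[_ *: _]/(_ * _) mulr0 add0r.
by rewrite mul1r.
Qed.

Lemma smoothn_coord n (k : 'I_d) : smoothn n (fun y : pt => y 0 k).
Proof.
have c : continuous (fun y : pt => y 0 k) by exact: coord_continuous.
case: n => [//|n]; split => //.
  by move=> i x; have [] := is_derive_coord k i x.
move=> i; rewrite (_ : partial i _ = cst (k == i)%:R); first exact: smoothn_cst.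
by apply/funext => x; have [] := is_derive_coord k i x.
Qed.

(** A smooth function of one variable, given with all its derivatives. *)
Definition derivative_tower (h : nat -> R -> R) : Prop :=
  forall k (x : R), is_derive x (1 : R) (h k) (h k.+1 x).

Lemma smoothn_comp n h k f : derivative_tower h -> smoothn n f ->
  smoothn n (h k \o f).
Proof.
move=> hh.
have ch j : continuous (h j).
  move=> x; apply: differentiable_continuous; apply/derivable1_diffP.
  by have [] := hh j x.
elim: n k f => [|n IH] k f sf.
  by move=> x; apply: continuous_comp; [exact: sf|exact: ch].
have [cf df psf] := sf; split.
- by move=> x; apply: continuous_comp; [exact: cf|exact: ch].
- by move=> i x; have [] := is_derive_comp (df i x) (hh k (f x)).
- move=> i; rewrite (_ : partial i _ = (fun x => (h k.+1 \o f) x * partial i f x)).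
    by exact: (smoothnM (IH _ _ (smoothnW sf)) (psf i)).
  apply/funext => x; rewrite /partial.
  by have [_ ->] := is_derive_comp (df i x) (hh k (f x)).
Qed.

Lemma smoothD f g : smooth f -> smooth g -> smooth (f + g).
Proof. by move=> /smoothP sf /smoothP sg; apply/smoothP => n; exact: smoothnD. Qed.

Lemma smoothM f g : smooth f -> smooth g -> smooth (fun x => f x * g x).
Proof. by move=> /smoothP sf /smoothP sg; apply/smoothP => n; exact: smoothnM. Qed.

Lemma smooth_cst (a : R) : smooth (cst a : pt -> R).
Proof. by apply/smoothP => n; exact: smoothn_cst. Qed.

Lemma smoothZ (a : R) f : smooth f -> smooth (a *: f).
Proof.
by move=> sf; exact: (smoothM (smooth_cst a) sf).
Qed.

Lemma smooth_subspace : subspace (smooth : set (pt -> R)).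
Proof.
split; first exact: smooth_cst.
by move=> a f g sf sg; exact: (smoothD (smoothZ a sf) sg).
Qed.

Lemma smooth_coord (k : 'I_d) : smooth (fun y : pt => y 0 k).
Proof. by apply/smoothP => n; exact: smoothn_coord. Qed.

Lemma smooth_comp h f : derivative_tower h -> smooth f -> smooth (h 0%N \o f).
Proof. by move=> hh /smoothP sf; apply/smoothP => n; exact: smoothn_comp. Qed.

Lemma smooth_prod (I : Type) (s : seq I) (F : I -> pt -> R) :
  (forall i, smooth (F i)) -> smooth (fun x => \prod_(i <- s) F i x).
Proof.
move=> sF; elim: s => [|i s IH].
  by under eq_fun do rewrite big_nil; exact: smooth_cst.
by under eq_fun do rewrite big_cons; exact: smoothM.
Qed.

End smoothness.

Section flat.
Context {R : realType}.

(** [exp (- 1 / x)] extended by zero; its derivatives are of the form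
    [P (1 / x) * exp (- 1 / x)] with [P] a polynomial. *)
Definition flat_poly (P : {poly R}) (x : R) : R :=
  if 0 < x then P.[x^-1] * expR (- x^-1) else 0.

Fixpoint flat_coef n : {poly R} :=
  if n is n'.+1 then 'X^2 * (flat_coef n' - (flat_coef n')^`()) else 1.

Definition flat (n : nat) : R -> R := flat_poly (flat_coef n).

(** A single term of the exponential series dominates a given power of
    [x^-1]. *)
Lemma flat_bound (P : {poly R}) : exists c, 0 <= c /\
  forall x, 0 < x -> `|P.[x^-1] * expR (- x^-1)| <= c * x.
Proof.
exists (\sum_(i < size P) `|P`_i| * i.+1`!%:R); split.
  by apply: sumr_ge0 => i _; rewrite mulr_ge0.
move=> x x0; rewrite horner_coef mulr_suml mulr_suml.
apply: le_trans (ler_norm_sum _ _ _) _; apply: ler_sum => i _.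
rewrite !normrM -!mulrA ler_wpM2l// normrX !gtr0_norm ?invr_gt0 ?expR_gt0//.
set y := x^-1; have y0 : 0 < y by rewrite invr_gt0.
have -> : x = y^-1 by rewrite invrK.
rewrite expRN ler_pdivrMr ?expR_gt0//.
have := expR_ge1Dxn i (ltW y0) => h.
have f0 : 0 < i.+1`!%:R :> R by rewrite ltr0n fact_gt0.
rewrite mulrAC ler_pdivlMr// -exprSr mulrC -ler_pdivrMr//.
by apply: le_trans h; rewrite lerDr.
Qed.

Lemma flat_tower : derivative_tower flat.
Proof.
move=> k x; rewrite /flat /=; set P := flat_coef k.
have [x0|x0|->] := ltgtP x 0.
- rewrite /flat_poly (ltNge 0 x) (ltW x0)/=.
  apply: (@near_eq_is_derive _ _ _ (cst 0)) => //.
  by near=> y; rewrite /flat_poly (lt_gtF (_ : y < 0))//; near: y; exact: lt_nbhsl.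
- have -> : flat_poly ('X^2 * (P - P^`())) x = P.[x^-1] * (expR (- x^-1) * x ^- 2) + expR (- x^-1) * (- x ^- 2 * P^`().[x^-1]).
    rewrite /flat_poly x0 hornerM hornerXn hornerD hornerN exprVn.
    move: (horner P x^-1) (horner P^`() x^-1) (expR (- x^-1)) (x ^- 2) => a b c u.
    by ring.
  apply: (@near_eq_is_derive _ _ _ (fun y : R => horner P y^-1 * expR (- y^-1) : R)).
    by near=> y; rewrite /flat_poly (_ : 0 < y)//; near: y; exact: lt_nbhsr.
  have xn : x != 0 by rewrite gt_eqF.
  have dV : is_derive x 1 (fun y : R => y^-1) (- x ^- 2).
    apply: (is_derive_eq (is_deriveV xn (is_derive_id _ _))).
    by rewrite -[_ *: _]/(_ * _) mulr1.
  have dN : is_derive x 1 (fun y : R => - y^-1) (x ^- 2).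
    by have := is_deriveN dV; rewrite opprK.
  have dE := @is_derive1_comp _ expR (fun y : R => - y^-1) x _ _ (is_derive_expR _) dN.
  have dP := @is_derive1_comp _ (horner P) (fun y : R => y^-1) x _ _ (is_derive_poly _ _) dV.
  have := is_deriveM dP dE.
  rewrite -!/(_ * _) /GRing.scale/= => h; apply: (is_derive_eq h).
  by rewrite /=; ring.
- rewrite [flat_poly _ 0]/flat_poly ltxx.
  have [c [c0 cP]] := flat_bound ('X * P).
  have lim : h^-1 *: ((flat_poly P \o shift 0) (h *: (1 : R)) - flat_poly P 0) @[h --> (0 : R)^'] --> (0 : R).
    apply/cvgrPdist_le => e e0; near=> h.
    rewrite sub0r normrN /= addr0 -[h *: 1]/(h * 1) mulr1 {2}/flat_poly ltxx subr0.
    rewrite -[_ *: _]/(_ * _) /flat_poly; case: ifPn => h0; last by rewrite mulr0 normr0 ltW.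
    have := cP h h0; rewrite hornerM hornerX -mulrA => /le_trans; apply.
    have hs : `|h| < e / (c + 1) by near: h; apply: dnbhs0_lt; rewrite divr_gt0// ltr_wpDl.
    move: hs; rewrite gtr0_norm// ltr_pdivlMr ?ltr_wpDl//; nra.
  by apply: DeriveDef; [apply/cvg_ex; exists 0|exact: cvg_lim].
Unshelve. all: by end_near. Qed.

Lemma flat_gt0 x : 0 < x -> 0 < flat 0 x.
Proof. by move=> x0; rewrite /flat /flat_poly x0 hornerC mul1r expR_gt0. Qed.

Lemma flat_le0 x : x <= 0 -> flat 0 x = 0.
Proof. by move=> x0; rewrite /flat /flat_poly ltNge x0. Qed.

Lemma flat_ge0 x : 0 <= flat 0 x.
Proof. by have [/flat_gt0/ltW//|/flat_le0->] := ltP 0 x. Qed.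

Lemma flat_le1 x : flat 0 x <= 1.
Proof.
rewrite /flat /flat_poly; case: ifPn => [x0|//].
by rewrite hornerC mul1r -expR0 ler_expR oppr_le0 invr_ge0 ltW.
Qed.

End flat.

Section support.
#[local] Opaque smooth.
Context {R : realType} {d : nat}.
Local Notation pt := 'rV[R]_d.
Local Notation mu := (@lebesgue_rV R d).
Local Notation e_ i := (delta_mx (ord0 : 'I_1) i : pt).
Implicit Types (A B K : set pt) (f g : pt -> R).

Lemma test_functionI A K f : smooth f -> compact K -> K `<=` A ->
  (forall x, ~ K x -> f x = 0) -> test_function A f.
Proof.
move=> sf cK KA f0.
have clK : closed K by apply: compact_closed => //; exact: norm_hausdorff.
have sK : closure [set x | f x != 0] `<=` K.
  rewrite [X in _ `<=` X](closure_id K).1//; apply: closure_subset => x /= /eqP fx.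
  by apply: contra_notP fx; exact: f0.
split => //; last exact: subset_trans KA.
by apply: subclosed_compact cK sK; exact: closed_closure.
Qed.

Lemma test_out A f x : test_function A f -> ~ closure [set y | f y != 0] x -> f x = 0.
Proof.
move=> _ h; apply/eqP; apply: contra_notT h => fx; exact: subset_closure.
Qed.

Lemma test_smooth A f : test_function A f -> smooth f.
Proof. by case. Qed.

Lemma test_functionS A B f : A `<=` B -> test_function A f -> test_function B f.
Proof. by move=> AB [sf cf fA]; split => //; exact: subset_trans AB. Qed.

Lemma test_subspace A : subspace (test_function A : set (pt -> R)).
Proof.
split.
  apply: (@test_functionI _ set0) => //; [exact: smooth_subspace.1|exact: compact0].
move=> a f g tf tg; have [sf cf fA] := tf; have [sg cg gA] := tg.
apply: (@test_functionI _ (closure [set x | f x != 0] `|` closure [set x | g x != 0])).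
- exact: smooth_subspace.2.
- exact: compactU.
- by move=> x [/fA|/gA].
- move=> x /not_orP[hf hg].
  rewrite (_ : (a *: f + g) x = a * f x + g x)//.
  by rewrite (test_out tf hf) (test_out tg hg) mulr0 addr0.
Qed.

Lemma test_mul A f g : smooth f -> test_function A g ->
  test_function A (fun x => f x * g x).
Proof.
move=> sf tg; have [sg cg gA] := tg.
apply: (test_functionI (smoothM sf sg) cg gA) => x hx.
by rewrite (test_out tg hx) mulr0.
Qed.

Lemma near_partial0 f i x : (\forall y \near x, f y = 0) -> partial i f x = 0.
Proof.
move=> h; rewrite /partial.
rewrite (@near_eq_derive _ _ _ _ (cst 0))//; first by rewrite derive_cst.
Qed.

Lemma test_partial A f i : test_function A f -> test_function A (partial i f).
Proof.
move=> tf; have [sf cf fA] := tf.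
apply: (test_functionI (smooth_partial i sf) cf fA) => x hx.
apply: near_partial0.
have : nbhs x (~` closure [set x | f x != 0]).
  by apply: open_nbhs_nbhs; split => //; apply: closed_openC; exact: closed_closure.
by apply: filterS => y hy; exact: test_out tf hy.
Qed.

Lemma compact_bounded_by K : compact K -> exists M : R, 0 < M /\ forall x, K x -> `|x| < M.
Proof.
move=> /compact_bounded [M [_ hM]]; exists (`|M| + 2); split; first by rewrite ltr_wpDl.
move=> x Kx; apply: (@le_lt_trans _ _ (`|M| + 1)); last by rewrite ltrD2l ltr1n.
by apply: (hM _ _ x Kx); rewrite (le_lt_trans (ler_norm _))// ltrDl.
Qed.

Lemma bounded_cube (M : R) : bounded_set (cube M : set pt).
Proof.
exists `|M|; split; first exact: num_real.
move=> m Mm x /cubeE xM; rewrite /=.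
apply/rV_norm_leP; first by rewrite ltW// (le_lt_trans _ Mm).
by move=> i; rewrite ltW// (lt_trans (xM i))// (le_lt_trans (ler_norm _)).
Qed.

Lemma test_cube A f : test_function A f ->
  exists M : R, 0 < M /\ forall x, f x != 0 -> `|x| < M.
Proof.
move=> [_ /compact_bounded_by[M [M0 h]] _]; exists M; split => // x fx.
by apply: h; exact: subset_closure.
Qed.

(** Heine's theorem for compactly supported functions. *)
Lemma test_uniform_continuous A f : test_function A f -> forall e : R, 0 < e ->
  exists2 del : R, 0 < del & forall x y, `|x - y| < del -> `|f x - f y| < e.
Proof.
move=> tf e e0; have [sf cf _] := tf; set K := closure _ in cf.
have cnt := smooth_continuous sf.
have /compact_near_coveringP/near_covering_withinP := cf.
move=> /(_ R (at_right 0) (fun del x => forall y, `|x - y| < del -> `|f x - f y| < e)).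
case.
  move=> x Kx; have e2 : 0 < e / 2 by lra.
  have /cvgrPdist_lt/(_ _ e2) := cnt x.
  move=> /nbhs_ballP[r /= r0 hr].
  have r2 : 0 < r / 2 by lra.
  exists (ball x (r / 2), [set del | del < r / 2]).
    split; first exact: nbhsx_ballx.
    by exact: nbhs_right_lt.
  move=> [x' del] [/= xx' dr] Kx' y xy.
  have h1 : ball x r x' by apply: le_ball xx'; lra.
  have h2 : ball x r y.
    rewrite (_ : r = r / 2 + r / 2); last by lra.
    apply: (ball_triangle xx'); rewrite -ball_normE/=.
    exact: lt_trans xy _.
  have := hr _ h1; have := hr _ h2 => /= H2 H1.
  rewrite -(subrK (f x) (f x')) -addrA; apply: le_lt_trans (ler_normD _ _) _.
  by rewrite distrC in H1; lra.
move=> r /= r0 hr; have r2 : 0 < r / 2 by lra.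
have hK x y : K x -> `|x - y| < r / 2 -> `|f x - f y| < e.
  move=> Kx; apply: (hr (r / 2)) => //=.
  by rewrite sub0r normrN gtr0_norm//; lra.
exists (r / 2) => // x y xy.
have [Kx|Kx] := pselect (K x); first exact: hK.
have [Ky|Ky] := pselect (K y); first by rewrite distrC; apply: hK => //; rewrite distrC.
by rewrite (test_out tf Kx) (test_out tf Ky) subrr normr0.
Qed.

Lemma MVT_direction f x v t : (forall y, derivable f y v) -> t != 0 ->
  exists2 c : R, `|c| < `|t| & t^-1 * (f (x + t *: v) - f x) = 'D_v f (x + c *: v).
Proof.
move=> df t0; pose g s := f (x + s *: v).
have dg s : is_derive s (1 : R) g ('D_v f (x + s *: v)) by exact: line_is_derive.
have cg (I : set R) : {within I, continuous g}.
  apply: continuous_subspaceT => s; apply: differentiable_continuous.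
  by apply/derivable1_diffP; have [] := dg s.
have g0 : g 0 = f x by rewrite /g scale0r addr0.
have [tn|tp|] := ltgtP t 0; last by move=> h; rewrite h eqxx in t0.
- have [c] := @MVT _ g (fun s => 'D_v f (x + s *: v)) t 0 tn (fun s _ => dg s) (cg _).
  rewrite in_itv/= => /andP[tc c0] h; exists c; first by rewrite !ltr0_norm// ltrN2.
  apply: (mulfI t0); rewrite mulrA divff// mul1r -/(g t) -g0.
  by move: h; move: ('D_v f _) => D h; lra.
- have [c] := @MVT _ g (fun s => 'D_v f (x + s *: v)) 0 t tp (fun s _ => dg s) (cg _).
  rewrite in_itv/= => /andP[c0 ct] h; exists c; first by rewrite !gtr0_norm.
  apply: (mulfI t0); rewrite mulrA divff// mul1r -/(g t) -g0 h.
  by move: ('D_v f _) => D; lra.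
Qed.

(** By the mean value theorem the quotient is the partial derivative at a nearby
    point. *)
Lemma test_uniform_quotient A f i : test_function A f -> forall e : R, 0 < e ->
  exists2 del : R, 0 < del & forall x (t : R), t != 0 -> `|t| < del ->
    `|t^-1 * (f (x + t *: e_ i) - f x) - partial i f x| < e.
Proof.
move=> tf e e0.
have [del del0 hdel] := test_uniform_continuous (test_partial i tf) e0.
exists del => // x t t0 td.
have df y : derivable f y (e_ i) by exact: (smooth_derivable (test_smooth tf)).
have [c ct ->] := MVT_direction x df t0.
rewrite -/(partial i f _); apply: hdel.
rewrite addrC addKr normrZ (_ : `|e_ i| = 1) ?mulr1; first exact: lt_trans td.
apply/le_anti/andP; split.
  apply/rV_norm_leP => // k; rewrite mxE eqxx /=; case: eqP => _; by rewrite ?normr1 ?normr0.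
have := (rV_norm_leP (e_ i) (normr_ge0 (e_ i))).2 (lexx _) i.
by rewrite mxE !eqxx normr1.
Qed.

Lemma L2_support A f (c : R) : measurable A -> bounded_set A -> measurable_fun setT f ->
  (forall x, `|f x| <= c) -> (forall x, ~ A x -> f x = 0) ->
  L2 setT f /\ ip setT f f <= c ^+ 2 * fine (mu A).
Proof.
move=> mA bA mf fc f0.
have mfA : measurable_fun A f by exact: measurable_funS mf.
have E : (\int[mu]_x (f x ^+ 2)%:E = \int[mu]_(x in A) (f x ^+ 2)%:E)%E.
  rewrite [RHS]integral_mkcond; apply: eq_integral => x _.
  by rewrite patchE; case: ifPn => // /negP; rewrite inE => /f0 ->; rewrite expr0n.
have LA : L2 A f by apply: (@L2_bounded _ _ A f c).
have LT : L2 setT f by apply: integrable_sqr => //; rewrite E (ip_sqrE mA LA) ltry.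
split => //; rewrite -lee_fin -(ip_sqrE measurableT LT) E.
have muA : mu A \is a fin_num by rewrite ge0_fin_numE// bounded_finite.
rewrite EFinM fineK// -integral_cst//.
apply: ge0_le_integral => //.
- by move=> x _; rewrite lee_fin sqr_ge0.
- by apply/measurable_EFinP; exact: measurable_funX.
- move=> x Ax; rewrite lee_fin -real_normK ?num_real//.
  by rewrite ler_pXn2r ?nnegrE ?fc// (le_trans _ (fc x)).
Qed.

Lemma Rintegral_small A f (c : R) : measurable A -> bounded_set A -> measurable_fun setT f ->
  (forall x, `|f x| <= c) -> (forall x, ~ A x -> f x = 0) ->
  mu.-integrable setT (EFin \o f) /\ `|\int[mu]_x f x| <= c * fine (mu A).
Proof.
move=> mA bA mf fc f0.
have cA : mu.-integrable A (EFin \o cst c).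
  apply/integrableP; split; first exact/measurable_EFinP/measurable_cst.
  rewrite (eq_integral (cst `|c|%:E))// integral_cst//.
  by rewrite lte_mul_pinfty// bounded_finite.
have c0 : 0 <= c by apply: le_trans (fc 0).
have fA : mu.-integrable A (EFin \o f).
  apply: le_integrable cA => //; first by apply/measurable_EFinP; exact: measurable_funS mf.
  by move=> x _; rewrite /= lee_fin [leRHS]ger0_norm.
have fE : f = f \_ A.
  by apply/funext => x; rewrite patchE; case: ifPn => // /negP; rewrite inE => /f0.
have fT : mu.-integrable setT (EFin \o f).
  by rewrite fE -restrict_EFin; exact/(integrable_mkcond _ mA).
split => //; rewrite [in leLHS]fE -Rintegral_mkcond.
apply: le_trans (le_normr_Rintegral mA fA) _.
rewrite -Rintegral_cst//; apply: le_Rintegral => //.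
by have := integrable_abse fA; apply: eq_integrable.
Qed.

Lemma test_L2 A B f : measurable B -> test_function A f -> L2 B f.
Proof.
move=> mB tf; have [M [M0 hM]] := test_cube tf.
have cf := smooth_continuous (test_smooth tf).
have [_ /continuous_compact - /(_ _ f (continuous_subspaceT cf)) /compact_bounded[c [_ hc]] _] := tf.
apply: L2S (measurableT) mB _ _ => //.
have [] // := @L2_support (cube M) f (`|c| + 1).
- exact: measurable_box.
- exact: bounded_cube.
- exact: continuous_measurable_rV.
- move=> x; have [->|fx] := eqVneq (f x) 0; first by rewrite normr0 addr_ge0.
  apply: (hc (`|c| + 1)); first by rewrite (le_lt_trans (ler_norm _))// ltrDl.
  by exists x => //; exact: subset_closure.
- move=> x; apply: contra_notP => /eqP fx; apply/cubeE/rV_norm_ltP => //; exact: hM.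
Qed.

Lemma test_integrable A f : test_function A f -> mu.-integrable setT (EFin \o f).
Proof.
move=> tf; have [M [M0 hM]] := test_cube tf.
have cf := smooth_continuous (test_smooth tf).
have [_ /continuous_compact - /(_ _ f (continuous_subspaceT cf)) /compact_bounded[c [_ hc]] _] := tf.
have [] // := @Rintegral_small (cube M) f (`|c| + 1).
- exact: measurable_box.
- exact: bounded_cube.
- exact: continuous_measurable_rV.
- move=> x; have [->|fx] := eqVneq (f x) 0; first by rewrite normr0 addr_ge0.
  apply: (hc (`|c| + 1)); first by rewrite (le_lt_trans (ler_norm _))// ltrDl.
  by exists x => //; exact: subset_closure.
- move=> x; apply: contra_notP => /eqP fx; apply/cubeE/rV_norm_ltP => //; exact: hM.
Qed.

(** The difference quotients have vanishing integral by translation invariance,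
    and converge uniformly with supports in a fixed cube. *)
Lemma Rintegral_partial A f i : test_function A f -> \int[mu]_x partial i f x = 0.
Proof.
move=> tf; have tp := test_partial i tf.
have [M1 [M10 hM1]] := test_cube tf.
have [M2 [M20 hM2]] := test_cube tp.
pose M := M1 + M2; have M0 : 0 < M by exact: addr_gt0.
have hM x : f x != 0 -> `|x| < M by move=> /hM1 h; rewrite /M; lra.
have mc : measurable (cube (M + 1) : set pt) by exact: measurable_box.
have bc : bounded_set (cube (M + 1) : set pt) by exact: bounded_cube.
apply/eqP; rewrite -normr_le0; apply/ler_addgt0Pr => e e0; rewrite add0r.
pose K := fine (mu (cube (M + 1))) + 1.
have K0 : 0 < K by rewrite ltr_wpDl// fine_ge0.
have [del del0 hdel] := test_uniform_quotient i tf (divr_gt0 e0 K0).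
pose t := Num.min (del / 2) 2^-1.
have t0 : 0 < t by rewrite lt_min invr_gt0 ltr0n andbT; lra.
have td : `|t| < del by rewrite gtr0_norm// gt_min; apply/orP; left; lra.
have t1 : `|t| < 1 by rewrite gtr0_norm// gt_min; apply/orP; right; rewrite invf_lt1// ltr1n.
have fi := test_integrable tf; have pi := test_integrable tp.
have fsi : mu.-integrable setT (EFin \o (fun x => f (x + t *: e_ i))) by exact: (integrable_shift _ fi).
pose q x := t^-1 * (f (x + t *: e_ i) - f x).
have dqi : mu.-integrable setT (EFin \o (fun x => f (x + t *: e_ i) - f x)).
  by have := integrableB measurableT fsi fi; apply: eq_integrable.
have qi : mu.-integrable setT (EFin \o q).
  by have := integrableZl measurableT t^-1 dqi; apply: eq_integrable.
have q0 : \int[mu]_x q x = 0.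
  rewrite /q RintegralZl// RintegralB//.
  by rewrite (Rintegral_shift (f := f) _ fi) subrr mulr0.
have out x : ~ cube (M + 1) x -> [/\ f x = 0, f (x + t *: e_ i) = 0 & partial i f x = 0].
  move=> hx; split; apply: contra_notP hx => /eqP.
  - by move=> /hM fx; apply/cubeE => k; have := (rV_norm_ltP x M0).2 fx k; lra.
  - move=> /hM fx; apply/cubeE => k.
    have := (rV_norm_ltP _ M0).2 fx k; rewrite !mxE eqxx/= => h.
    rewrite -(addrK (t * (k == i)%:R) (x 0 k)); apply: le_lt_trans (ler_normB _ _) _.
    apply: ltr_leD => //; rewrite normrM.
    by case: eqP => _; rewrite ?normr1 ?normr0 ?mulr1 ?mulr0// ltW.
  - move=> /hM2 px; apply/cubeE/rV_norm_ltP; first lra.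
    by rewrite /M; lra.
have cont_q : measurable_fun setT (fun x => partial i f x - q x).
  apply: measurable_funB; first by have [/measurable_EFinP] := integrableP _ _ _ pi.
  by have [/measurable_EFinP] := integrableP _ _ _ qi.
have [|x hx|_] := @Rintegral_small (cube (M + 1)) (fun x => partial i f x - q x) (e / K) mc bc cont_q.
- by move=> x; rewrite distrC ltW// hdel// gt_eqF.
- by have [h1 h2 h3] := out x hx; rewrite /q h1 h2 h3 subrr mulr0 subrr.
rewrite RintegralB// q0 subr0 => /le_trans; apply.
rewrite mulrAC ler_pdivrMr// ler_pM2l// /K lerDl//.
Qed.

End support.

(** * Bump functions *)

Section bumps.
Context {R : realType} {d : nat}.
Local Notation pt := 'rV[R]_d.
Local Notation mu := (@lebesgue_rV R d).
Implicit Types (A B : set pt) (f g : pt -> R).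
#[local] Opaque smooth.

Lemma smooth_affine (a b : R) (k : 'I_d) : smooth (fun x : pt => a * x 0 k + b).
Proof. exact: (smoothD (smoothZ a (smooth_coord k)) (smooth_cst b)). Qed.

Lemma smooth_flat f : smooth f -> smooth (fun x => flat 0 (f x)).
Proof. by move=> sf; exact: (smooth_comp flat_tower sf). Qed.

(** Positive exactly inside the box, and tending to its indicator function as
    the slope [n] grows. *)
Definition box_bump (n : R) (a b : pt) (x : pt) : R :=
  \prod_i (flat 0 (n * (x 0 i - a 0 i)) * flat 0 (n * (b 0 i - x 0 i))).

Lemma smooth_box_bump n a b : smooth (box_bump n a b).
Proof.
apply: smooth_prod => i; apply: smoothM; apply: smooth_flat.
  rewrite (_ : (fun _ => _) = (fun x : pt => n * x 0 i + (- (n * a 0 i)))).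
    exact: smooth_affine.
  by apply/funext => x; rewrite mulrBr.
rewrite (_ : (fun _ => _) = (fun x : pt => - n * x 0 i + n * b 0 i)).
  exact: smooth_affine.
by apply/funext => x; rewrite mulrBr mulNr addrC.
Qed.

Lemma box_bump_ge0 n a b x : 0 <= box_bump n a b x.
Proof. by apply: prodr_ge0 => i _; rewrite mulr_ge0 ?flat_ge0. Qed.

Lemma box_bump_le1 n a b x : box_bump n a b x <= 1.
Proof.
suff /andP[] : 0 <= box_bump n a b x <= 1 by [].
apply: (big_ind (fun z => 0 <= z <= 1)) => [|u v /andP[u0 u1] /andP[v0 v1]|i _].
- by rewrite ler01 lexx.
- by rewrite mulr_ge0//= mulr_ile1.
- by rewrite mulr_ge0 ?flat_ge0//= mulr_ile1 ?flat_ge0 ?flat_le1.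
Qed.

Lemma box_bump_gt0 n a b x : 0 < n -> box a b x -> 0 < box_bump n a b x.
Proof.
move=> n0 bx; apply: prodr_gt0 => i _; have /andP[h1 h2] := bx i.
by rewrite mulr_gt0// flat_gt0// mulr_gt0// subr_gt0.
Qed.

Lemma box_bump_out n a b x : 0 < n -> ~ box a b x -> box_bump n a b x = 0.
Proof.
move=> n0 /existsNP[i /negP]; rewrite negb_and -!leNgt => h.
rewrite /box_bump (bigD1 i)//=; case/orP: h => h.
  by rewrite flat_le0 ?mul0r// pmulr_rle0// subr_le0.
by rewrite [X in _ * X * _]flat_le0 ?mulr0 ?mul0r// pmulr_rle0// subr_le0.
Qed.

Lemma closed_boxE a b : closed_box a b =
  [set x : pt | forall i, x 0 i \in `[a 0 i, b 0 i]].
Proof. by apply/seteqP; split => x h i; have := h i; rewrite in_itv. Qed.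

Lemma compact_closed_box a b : compact (closed_box a b : set pt).
Proof.
rewrite closed_boxE; apply: (@rV_compact R d (fun i => [set` `[a 0 i, b 0 i]])) => i.
exact: segment_compact.
Qed.

Lemma test_box_bump n a b A : 0 < n -> closed_box a b `<=` A ->
  test_function A (box_bump n a b).
Proof.
move=> n0 bA.
apply: (test_functionI (smooth_box_bump n a b) (@compact_closed_box a b) bA) => x hx.
by apply: box_bump_out => // /sub_closed_box.
Qed.

(** A normalized box bump. *)
Lemma mollifier (e : R) : 0 < e -> exists rho : pt -> R,
  [/\ test_function setT rho, forall x, 0 <= rho x,
      forall x, rho x != 0 -> `|x| < e & \int[mu]_x rho x = 1].
Proof.
move=> e0; pose h := box_bump 1 (const_mx (- e)) (const_mx e).
have th : test_function setT h by apply: test_box_bump.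
have hi := test_integrable th.
have h0 x : 0 <= h x by exact: box_bump_ge0.
pose c := \int[mu]_x h x.
have c0 : 0 < c.
  rewrite lt_neqAle Rintegral_ge0 ?andbT; last by move=> *; exact: h0.
  apply/eqP => hc.
  have h00 : (\int[mu]_x `|(h x)%:E| = 0)%E.
    transitivity (\int[mu]_x (h x)%:E)%E.
      by apply: eq_integral => x _; rewrite gee0_abs ?lee_fin.
    have := integrable_fin_num measurableT hi; move=> /fineK <-.
    by rewrite -[fine _]/c -hc.
  have mh : measurable_fun setT (EFin \o h) by exact: measurable_int hi.
  have /(ae_eq_integral_abs mu measurableT mh) [N [mN N0 hN]] := h00.
  have : (mu (cube e) <= mu N)%E.
    apply: le_measure; rewrite ?inE//; first exact: measurable_box.
    move=> x xe; apply: hN => /= /(_ I) => -[hx].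
    by have := box_bump_gt0 ltr01 xe; rewrite -/(h x) hx ltxx.
  by rewrite N0 cube_measure// lee_fin leNgt exprn_gt0// mulr_gt0.
exists (c^-1 *: h); split.
- exact: (subspaceZ _ (test_subspace setT) th).
- by move=> x; rewrite mulr_ge0// invr_ge0 ltW.
- move=> x; rewrite mulf_eq0 negb_or => /andP[_ hx].
  apply/rV_norm_ltP => //; apply/cubeE; apply: contra_notP (elimN eqP hx) => hx'.
  by apply: box_bump_out.
- by rewrite RintegralZl// mulVf// gt_eqF.
Qed.

Lemma flat_mono (s t : R) : 0 < s -> s <= t -> flat 0 s <= flat 0 t.
Proof.
move=> s0 st; have t0 := lt_le_trans s0 st.
rewrite /flat /flat_poly s0 t0 !hornerC !mul1r ler_expR lerN2.
by rewrite lef_pV2.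
Qed.

(** Composing [flat] with itself gives a function that is exactly constant on
    both sides of the unit interval. *)
Definition smooth_step (t : R) : R :=
  1 - flat 0 (flat 0 1 - flat 0 t) / flat 0 (flat 0 1).

Lemma smooth_step1 (t : R) : 1 <= t -> smooth_step t = 1.
Proof.
by move=> t1; rewrite /smooth_step flat_le0 ?mul0r ?subr0// subr_le0 flat_mono.
Qed.

Lemma smooth_step0 (t : R) : t <= 0 -> smooth_step t = 0.
Proof.
move=> t0; rewrite /smooth_step (flat_le0 t0) subr0 divff ?subrr//.
by rewrite gt_eqF// !flat_gt0.
Qed.

Lemma smooth_smooth_step f : smooth f -> smooth (fun x => smooth_step (f x)).
Proof.
move=> sf; rewrite (_ : (fun _ => _) = cst 1 +
    (- (flat 0 (flat 0 1))^-1) *: (fun x => flat 0 (cst (flat 0 1) x + ((-1) *: (fun x => flat 0 (f x))) x))).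
  apply: smoothD; first exact: smooth_cst.
  apply: smoothZ; apply: smooth_flat; apply: smoothD; first exact: smooth_cst.
  by apply: smoothZ; exact: smooth_flat.
apply/funext => x; rewrite /smooth_step [RHS]/=.
rewrite -[RHS]/(1 + (- (flat 0 (flat 0 1))^-1 * flat 0 (flat 0 1 + (-1) * flat 0 (f x)))).
by rewrite mulN1r mulNr mulrC.
Qed.

(** A product of smooth steps, two in each coordinate. *)
Lemma plateau (p : pt) (r : R) : 0 < r -> exists chi : pt -> R,
  [/\ test_function setT chi, forall x, `|x - p| < r -> chi x = 1
    & forall x, chi x != 0 -> `|x - p| < 2 * r].
Proof.
move=> r0; have r2 : 0 < 2 * r by rewrite mulr_gt0.
pose F (i : 'I_d) (x : pt) := smooth_step (- r^-1 * x 0 i + (2 + p 0 i / r)) *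
  smooth_step (r^-1 * x 0 i + (2 - p 0 i / r)) : R.
pose chi x : R := \prod_i F i x.
have argl i (x : pt) : - r^-1 * x 0 i + (2 + p 0 i / r) = (2 * r - (x - p) 0 i) / r.
  by rewrite !mxE; field; rewrite gt_eqF.
have argr i (x : pt) : r^-1 * x 0 i + (2 - p 0 i / r) = (2 * r + (x - p) 0 i) / r.
  by rewrite !mxE; field; rewrite gt_eqF.
have schi : smooth chi.
  by apply: smooth_prod => i; apply: smoothM; apply: smooth_smooth_step; exact: smooth_affine.
have chi0 x : chi x != 0 -> forall i, `|(x - p) 0 i| < 2 * r.
  move=> cx i; rewrite ltr_norml; apply: contra_notT (elimN eqP cx).
  rewrite negb_and -!leNgt /chi (bigD1 i)//= /F argl argr => /orP[h|h].
    have s0 : smooth_step ((2 * r + (x - p) 0 i) / r) = 0.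
      by apply: smooth_step0; rewrite pmulr_lle0 ?invr_gt0//; lra.
    by rewrite s0 mulr0 mul0r.
  by rewrite smooth_step0 ?mul0r// pmulr_lle0 ?invr_gt0//; lra.
exists chi; split.
- apply: (test_functionI schi (@compact_closed_box (p - const_mx (2 * r)) (p + const_mx (2 * r)))) => // x.
  apply: contra_notP => /eqP cx i; have := chi0 _ cx i.
  by rewrite !mxE ltr_norml => /andP[h1 h2]; apply/andP; split; lra.
- move=> x /rV_norm_ltP - /(_ r0) h; apply: big1 => i _; rewrite /F argl argr.
  have := h i; rewrite ltr_norml => /andP[h1 h2].
  by rewrite !smooth_step1 ?mulr1// ler_pdivlMr//; lra.
- by move=> x /chi0 h; apply/rV_norm_ltP.
Qed.

End bumps.

(** * The fundamental lemma of the calculus of variations *)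

Section bump_limit.
Context {R : realType} {d : nat}.
Local Notation pt := 'rV[R]_d.

Lemma flat_cvg1 (s : R) : 0 < s -> flat 0 (n.+1%:R * s) @[n --> \oo] --> (1 : R).
Proof.
move=> s0; rewrite (_ : (fun n => _) = (fun n => expR (- (n.+1%:R^-1 * s^-1)))); last first.
  apply/funext => n; rewrite /flat /flat_poly mulr_gt0//= hornerC mul1r invfM//.
have h : - (n.+1%:R^-1 * s^-1) @[n --> \oo] --> (0 : R).
  apply/cvgrPdist_lt => e e0; have [N NP] := natSinv_small (mulr_gt0 e0 s0).
  exists N => // n /= Nn; rewrite sub0r opprK gtr0_norm ?mulr_gt0 ?invr_gt0//.
  by rewrite ltr_pdivrMr// NP.
have := @continuous_cvg _ _ _ _ _ _ expR _ (@continuous_expR R 0) h.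
by rewrite expR0; apply.
Qed.

Lemma box_bump_cvg (a b x : pt) :
  box_bump n.+1%:R a b x @[n --> \oo] --> (\1_(box a b) x : R).
Proof.
have [bx|bx] := pselect (box a b x); last first.
  rewrite indicE memNset//; apply: cvg_near_cst; apply: nearW => n.
  by apply: box_bump_out.
rewrite indicE mem_set//= /box_bump.
have h i : flat 0 (n.+1%:R * (x 0 i - a 0 i)) * flat 0 (n.+1%:R * (b 0 i - x 0 i)) @[n --> \oo] --> (1 : R).
  have /andP[h1 h2] := bx i; rewrite -subr_gt0 in h1; rewrite -subr_gt0 in h2.
  by have := cvgM (flat_cvg1 h1) (flat_cvg1 h2); rewrite mulr1; apply.
elim: (index_enum _) => [|i s IH].
  by under eq_fun do rewrite big_nil; exact: cvg_cst.
under eq_fun do rewrite big_cons.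
by have := cvgM (h i) IH; rewrite mulr1; apply.
Qed.

End bump_limit.

Section null_on_boxes.
Context {R : realType} {d : nat}.
Local Notation pt := 'rV[R]_d.
Local Notation mu := (@lebesgue_rV R d).
Local Open Scope ereal_scope.

Section density.
Variables (f : pt -> \bar R) (mf : measurable_fun setT f) (f0 : forall x, 0 <= f x).

Definition density_measure (A : set pt) : \bar R := \int[mu]_(x in A) f x.

Let density0 : density_measure set0 = 0.
Proof. by rewrite /density_measure integral_set0. Qed.

Let density_ge0 A : 0 <= density_measure A.
Proof. exact: integral_ge0. Qed.

Let density_sigma_additive : semi_sigma_additive density_measure.
Proof. exact: semi_sigma_additive_nng_induced. Qed.

HB.instance Definition _ := isMeasure.Build _ _ _ density_measure
  density0 density_ge0 density_sigma_additive.

Definition density : {measure set pt -> \bar R} := density_measure.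

End density.

(** The densities [f^\+] and [f^\-] define finite measures that agree on the
    boxes, which generate the Borel sets. *)
Lemma null_on_boxes (f : pt -> \bar R) : mu.-integrable setT f ->
  (forall a b, \int[mu]_(x in box a b) f x = 0) -> ae_eq mu setT f (cst 0).
Proof.
move=> fi f0; have mf := measurable_int _ fi.
have mp : measurable_fun setT f^\+ by exact: measurable_funepos.
have mn : measurable_fun setT f^\- by exact: measurable_funeneg.
have p0 x : 0 <= f^\+ x by exact: funepos_ge0.
have n0 x : 0 <= f^\- x by exact: funeneg_ge0.
have pi : mu.-integrable setT f^\+ by exact: integrable_funepos.
have ni : mu.-integrable setT f^\- by exact: integrable_funeneg.
have fin g (A : set pt) : measurable A -> mu.-integrable setT g -> \int[mu]_(x in A) g x \is a fin_num.
  by move=> mA gi; apply: integrable_fin_num => //; exact: integrableS gi.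
have mboxes : boxes `<=` @measurable _ pt by move=> _ [a [b ->]]; exact: measurable_box.
have eqm (A : set pt) : measurable A -> density mp p0 A = density mn n0 A.
  rewrite box_sigma_algebra.
  apply: (@g_sigma_algebra_measure_unique _ _ _ boxes mboxes (fun n => cube n%:R)).
  - by move=> n; exists (const_mx (- n%:R)%R), (const_mx n%:R).
  - exact: cube_cover.
  - exact: boxes_setI.
  - move=> _ [a [b ->]]; have mb : measurable (box a b) by exact: measurable_box.
    have := f0 a b; rewrite integralE /density /= /density_measure.
    move: (fin _ _ mb pi) (fin _ _ mb ni).
    move: (\int[mu]_(x in box a b) f^\+ x) (\int[mu]_(x in box a b) f^\- x).
    by move=> [u| |] [v| |] // _ _ [/eqP]; rewrite subr_eq0 => /eqP ->.
  - by move=> k; rewrite -ge0_fin_numE//; apply: fin => //; exact: measurable_box.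
apply: integral_ae_eq => // A _ mA.
rewrite integral_cst// mul0e integralE.
have := eqm A mA; rewrite /density /= /density_measure => ->.
by rewrite subee// fin.
Qed.

End null_on_boxes.

Section fundamental_lemma.
Context {R : realType} {d : nat}.
Local Notation pt := 'rV[R]_d.
Local Notation mu := (@lebesgue_rV R d).
Implicit Types (A : set pt) (f g : pt -> R).

Lemma bounded_closed_box (a b : pt) : bounded_set (closed_box a b).
Proof. by apply: compact_bounded; exact: compact_closed_box. Qed.

Lemma bounded_box (a b : pt) : bounded_set (box a b).
Proof.
have [M [Mr h]] := bounded_closed_box a b; exists M; split=> // m Mm x.
by move=> /sub_closed_box; exact: h.
Qed.

(** The bumps of the box are test functions that converge to its indicator
    function, boundedly. *)
Lemma integral_box_test A f (a b : pt) : measurable A -> L2 A f ->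
  closed_box a b `<=` A ->
  (forall psi, test_function A psi -> ip A f psi = 0) ->
  (\int[mu]_(x in box a b) (f x)%:E = 0)%E.
Proof.
move=> mA Lf bA f0.
have mb : measurable (box a b) by exact: measurable_box.
have bbA : box a b `<=` A by move=> x /sub_closed_box/bA.
have Lb : L2 (box a b) f by exact: L2S Lf.
have L1 : L2 (box a b) (cst 1 : pt -> R).
  apply: (@L2_bounded _ _ _ _ 1) => //.
    exact: bounded_box.
  by move=> x _; rewrite normr1.
have fi : mu.-integrable (box a b) (EFin \o f).
  by have := integrable_mul mb Lb L1; apply: eq_integrable => // x _; rewrite /= mulr1.
have mf : measurable_fun (box a b) f by have [] := Lb.
pose h n x := box_bump n.+1%:R a b x.
have mh n : measurable_fun setT (h n).
  by apply: continuous_measurable_rV => //; apply: smooth_continuous; exact: smooth_box_bump.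
have hf n : (\int[mu]_(x in box a b) (f x * h n x)%:E = 0)%E.
  have th : test_function A (h n) by apply: test_box_bump.
  have fhi := integrable_mul mA Lf (test_L2 mA th).
  have := f0 _ th; rewrite /ip /Rintegral.
  have -> : (\int[mu]_(x in box a b) (f x * h n x)%:E = \int[mu]_(x in A) (f x * h n x)%:E)%E.
    rewrite integral_mkcond [RHS]integral_mkcond; apply: eq_integral => x _.
    rewrite !patchE; have [xb|xb] := boolP (x \in box a b).
      by rewrite mem_set//; apply: bbA; rewrite inE in xb.
    case: ifP => // _; rewrite /h box_bump_out ?mulr0//.
    by move=> xb'; move: xb; rewrite mem_set.
  by have /fineK <- := integrable_fin_num mA fhi => /= ->.
have [|||||_ _ h0] := @dominated_convergence _ _ R mu (box a b) mb
  (fun n x => (f x * h n x)%:E) (EFin \o f) (fun x => `|(f x)%:E|%E).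
- move=> n; apply/measurable_EFinP; apply: measurable_funM => //.
  exact: measurable_funS (mh n).
- exact/measurable_EFinP.
- apply: aeW => x bx; apply: cvg_EFin; first exact: nearW.
  rewrite -[X in _ --> X](mulr1 (f x)).
  apply: cvgM; first exact: cvg_cst.
  by have := @box_bump_cvg R d a b x; rewrite indicE mem_set.
- exact: integrable_abse.
- apply: aeW => x n bx; rewrite /= lee_fin normrM ler_piMr//.
  by rewrite ger0_norm ?box_bump_ge0 ?box_bump_le1.
have : (fun n => \int[mu]_(x in box a b) (f x * h n x)%:E)%E @ \oo --> 0%E.
  by under eq_fun do rewrite hf; exact: cvg_cst.
by move=> /(cvg_unique _ h0) ->.
Qed.

(** The integrals over all boxes inside [A] vanish, hence [f] is null on each
    box with rational corners whose closure is contained in [A]. Countably many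
    such boxes cover [A]. *)
Theorem fundamental_lemma A f : open A -> L2 A f ->
  (forall psi, test_function A psi -> ip A f psi = 0) -> ae_eq mu A f 0.
Proof.
move=> oA Lf f0; have mA : measurable A by exact: open_measurable_rV.
have onbox (a b : pt) : closed_box a b `<=` A -> {ae mu, forall x, box a b x -> f x = 0}.
  move=> bA; have mb : measurable (box a b) by exact: measurable_box.
  pose g := ((EFin \o f) \_ (box a b)).
  have Lb : L2 (box a b) f by apply: L2S Lf => // x /sub_closed_box/bA.
  have L1 : L2 (box a b) (cst 1 : pt -> R).
    apply: (@L2_bounded _ _ _ _ 1) => //.
      exact: bounded_box.
    by move=> x _; rewrite normr1.
  have fi : mu.-integrable (box a b) (EFin \o f).
    by have := integrable_mul mb Lb L1; apply: eq_integrable => // x _; rewrite /= mulr1.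
  have gi : mu.-integrable setT g by exact/(integrable_mkcond _ mb).
  have g0 a' b' : (\int[mu]_(x in box a' b') g x = 0)%E.
    rewrite -integral_mkcondr.
    have [a2 [b2 [-> ab]]] := box_setI a' b' a b.
    by apply: (integral_box_test mA Lf) => //; exact: subset_trans ab bA.
  have := null_on_boxes gi g0; apply: filterS => x /(_ I) + bx.
  by rewrite /g patchE mem_set// => -[].
have hn n : {ae mu, forall x, forall qp : 'rV[rat]_d * 'rV[rat]_d, unpickle n = Some qp ->
    closed_box (rational_corner qp.1) (rational_corner qp.2) `<=` A ->
    box (rational_corner qp.1) (rational_corner qp.2) x -> f x = 0}.
  case: (unpickle n) => [qp|]; last by apply: aeW.
  have [qA|qA] := pselect (closed_box (rational_corner qp.1) (rational_corner qp.2 : pt) `<=` A).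
    by apply: filterS (onbox _ _ qA) => x hx _ [<-] _; exact: hx.
  by apply: aeW => x _ [<-] /qA.
apply: filterS (ae_foralln hn) => x hx Ax.
have [qp [bx qA]] := rational_box_nbhs oA Ax.
by apply: (hx (pickle qp) qp); rewrite ?pickleK.
Qed.

End fundamental_lemma.

(** * Hessian and double divergence *)

Section operators.
Context {R : realType} {d : nat}.
Local Notation pt := 'rV[R]_d.
Implicit Types (A B : set pt) (f g : pt -> R) (Th : pt -> 'M[R]_d).
#[local] Opaque smooth.

Lemma ip_supp A f g : (forall x, ~ A x -> f x * g x = 0) -> ip A f g = ip setT f g.
Proof.
move=> h; rewrite /ip [LHS]Rintegral_mkcond; apply: eq_Rintegral => x _.
by rewrite patchE; case: ifPn => // /negP; rewrite inE => /h ->.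
Qed.

(** One of the two functions is compactly supported in [A], so that no boundary
    term appears. *)
Definition ibp_pair A f g : Prop :=
  (test_function A f /\ smooth g) \/ (smooth f /\ test_function A g).

Lemma ibp_pair_sym A f g : ibp_pair A f g -> ibp_pair A g f.
Proof. by move=> [[]|[]] *; [right|left]. Qed.

Lemma ibp_pair_partial A f g i : ibp_pair A f g -> ibp_pair A (partial i f) g.
Proof.
by move=> [[tf sg]|[sf tg]]; [left; exact: (conj (test_partial i tf) sg)|
  right; exact: (conj (smooth_partial i sf) tg)].
Qed.

Lemma ibp_pair_test A f g : ibp_pair A f g -> test_function A (fun x => f x * g x).
Proof.
move=> [[tf sg]|[sf tg]]; last exact: test_mul.
by rewrite (_ : (fun _ => _) = (fun x => g x * f x)); [exact: test_mul|apply/funext => x; rewrite mulrC].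
Qed.

Lemma ibp_pair_smooth A f g : ibp_pair A f g -> smooth f /\ smooth g.
Proof. by move=> [[/test_smooth]|[? /test_smooth]]. Qed.

Lemma test_sub A f x : test_function A f -> ~ A x -> f x = 0.
Proof. by move=> tf hx; apply: (test_out tf); have [_ _ fA] := tf; move/fA. Qed.

Lemma ip_ibp_pair A f g : ibp_pair A f g -> ip A f g = ip setT f g.
Proof. by move=> h; apply: ip_supp => x; exact: (test_sub (ibp_pair_test h)). Qed.

(** The integral of a derivative of the compactly supported product vanishes. *)
Lemma ibp A f g i : ibp_pair A f g -> ip A (partial i f) g = - ip A f (partial i g).
Proof.
move=> h; have [sf sg] := ibp_pair_smooth h.
have h1 := ibp_pair_partial i h.
have h2 := ibp_pair_sym (ibp_pair_partial i (ibp_pair_sym h)).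
rewrite (ip_ibp_pair h1) (ip_ibp_pair h2).
have := Rintegral_partial i (ibp_pair_test h).
have -> : partial i (fun x => f x * g x) = (fun x => partial i f x * g x + f x * partial i g x).
  apply/funext => x; apply: partialM; first exact: (smooth_derivable sf).
  exact: (smooth_derivable sg).
rewrite RintegralD//; last 2 first.
- exact: test_integrable (ibp_pair_test h1).
- exact: test_integrable (ibp_pair_test h2).
by move/eqP; rewrite addr_eq0 => /eqP.
Qed.

Lemma ibp2 A f g i j : ibp_pair A f g ->
  ip A (partial j (partial i f)) g = ip A f (partial i (partial j g)).
Proof.
move=> h; rewrite ibp; last exact: ibp_pair_partial.
rewrite ibp ?opprK//.
exact/ibp_pair_sym/ibp_pair_partial/ibp_pair_sym.
Qed.

Lemma hess_coord f x i j : eps (grad f) x i j =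
  2^-1 * (partial j (partial i f) x + partial i (partial j f) x).
Proof.
have E k : (fun y => grad f y ord0 k) = partial k f by apply/funext => y; rewrite mxE.
by rewrite !mxE !E.
Qed.

Lemma smooth_sum n (F : 'I_n -> pt -> R) : (forall i, smooth (F i)) ->
  smooth (\sum_i F i).
Proof. exact: subspace_sum smooth_subspace. Qed.

Lemma partial_sum n (F : 'I_n -> pt -> R) k x : (forall i, smooth (F i)) ->
  partial k (fun y => \sum_i F i y) x = \sum_i partial k (F i) x.
Proof.
move=> sF; rewrite (_ : (fun y => _) = \sum_i F i); last by apply/funext => y; rewrite fct_sumE.
rewrite /partial derive_sum// => i; exact: (smooth_derivable (sF i)).
Qed.

Lemma divdiv_coord Th x : (forall i j, smooth (fun x => Th x i j)) ->
  div (rowdiv Th) x = \sum_i \sum_j partial i (partial j (fun y => Th y i j)) x.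
Proof.
move=> sT; apply: eq_bigr => i _.
rewrite (_ : (fun y => _) = (fun y => \sum_j partial j (fun z => Th z i j) y)); last first.
  apply/funext => y; rewrite mxE; apply: eq_bigr => j _.
  by congr (partial j _ y); apply/funext => z; rewrite mxE.
by rewrite partial_sum// => j; exact: smooth_partial.
Qed.

#[local] Opaque partial eps grad div rowdiv.

Lemma hess_linear (a : R) f g : smooth f -> smooth g ->
  eps (grad (a *: f + g)) = a *: eps (grad f) + eps (grad g).
Proof.
move=> sf sg.
have pL (k : 'I_d) (h h' : pt -> R) : smooth h -> smooth h' ->
    partial k (a *: h + h') = a *: partial k h + partial k h'.
  move=> sh sh'; apply/funext => x; rewrite partialD; last 2 first.
  - exact: smooth_derivable (smoothZ a sh).
  - exact: smooth_derivable sh'.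
  by rewrite partialZ; last exact: smooth_derivable sh.
have E k l : partial k (partial l (a *: f + g)) =
    a *: partial k (partial l f) + partial k (partial l g).
  by rewrite (pL l _ _ sf sg) (pL k _ _ (smooth_partial l sf) (smooth_partial l sg)).
apply/funext => x; apply/matrixP => i j.
transitivity (a * eps (grad f) x i j + eps (grad g) x i j); last first.
  by rewrite [RHS]mxE [X in _ = X + _]mxE.
apply: etrans (hess_coord _ x i j) _.
apply: etrans (esym (f_equal2 (fun p q => a * p + q) (hess_coord f x i j) (hess_coord g x i j))).
rewrite (E i j) (E j i).
rewrite -[LHS]/(2^-1 * (a * partial j (partial i f) x + partial j (partial i g) x +
  (a * partial i (partial j f) x + partial i (partial j g) x))).
by move: (partial j _ x) (partial i _ x) (partial j _ x) (partial i _ x) => u v w z; ring.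
Qed.

Lemma smooth_sym_subspace : subspace (smooth_sym : set (pt -> 'M[R]_d)).
Proof.
split.
  split => [i j|x]; last by rewrite trmx0.
  rewrite (_ : (fun _ => _) = cst 0); first exact: smooth_cst.
  by apply/funext => x; rewrite mxE.
move=> a Th Th' [sT tT] [sT' tT']; split => [i j|x].
  rewrite (_ : (fun _ => _) = a *: (fun x => Th x i j) + (fun x => Th' x i j)).
    exact: smooth_subspace.2.
  by apply/funext => x; rewrite !mxE.
by rewrite linearD linearZ/= tT tT'.
Qed.

Lemma divdiv_linear (a : R) Th Th' : smooth_sym Th -> smooth_sym Th' ->
  div (rowdiv (a *: Th + Th')) = a *: div (rowdiv Th) + div (rowdiv Th').
Proof.
move=> sT sT'; apply/funext => x.
have [s1 _] := smooth_sym_subspace.2 a _ _ sT sT'.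
have [s2 _] := sT; have [s3 _] := sT'.
apply: etrans (divdiv_coord x s1) _.
apply: etrans (esym (f_equal2 (fun p q => a * p + q) (divdiv_coord x s2) (divdiv_coord x s3))).
rewrite mulr_sumr -big_split/=; apply: eq_bigr => i _.
rewrite mulr_sumr -big_split/=; apply: eq_bigr => j _.
rewrite (_ : (fun y => _) = a *: (fun x => Th x i j) + (fun x => Th' x i j)); last first.
  by apply/funext => y; rewrite !mxE.
have -> : partial j (a *: (fun x => Th x i j) + (fun x => Th' x i j)) =
    a *: partial j (fun x => Th x i j) + partial j (fun x => Th' x i j).
  apply/funext => y; rewrite partialD; last 2 first.
  - exact: smooth_derivable (smoothZ a (s2 i j)).
  - exact: smooth_derivable (s3 i j).
  by rewrite partialZ//; exact: smooth_derivable (s2 i j).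
have s4 := smooth_partial j (s2 i j); have s5 := smooth_partial j (s3 i j).
rewrite partialD; last 2 first.
- exact: smooth_derivable (smoothZ a s4).
- exact: smooth_derivable s5.
by rewrite partialZ//; exact: smooth_derivable s4.
Qed.

(** The matrix [sym_unit i j] represents, in the Frobenius inner product, the
    entry [i j] of a symmetric matrix. *)
Definition sym_unit (i j : 'I_d) : 'M[R]_d := 2^-1 *: (delta_mx i j + delta_mx j i).

Lemma frob_delta (K : 'M[R]_d) i j : frob K (delta_mx i j) = K i j.
Proof.
rewrite /frob (bigD1 i)//= [X in _ + X]big1 => [|k ki]; last first.
  by apply: big1 => l _; rewrite mxE (negbTE ki) mulr0.
rewrite (bigD1 j)//= [X in _ + X + _]big1 => [|l lj].
  by rewrite mxE !eqxx mulr1 !addr0.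
by rewrite mxE (negbTE lj) andbF mulr0.
Qed.

Lemma frobZr (a : R) (K L : 'M[R]_d) : frob K (a *: L) = a * frob K L.
Proof.
rewrite /frob mulr_sumr; apply: eq_bigr => i _; rewrite mulr_sumr.
by apply: eq_bigr => j _; rewrite mxE mulrCA.
Qed.

Lemma frobDr (K L L' : 'M[R]_d) : frob K (L + L') = frob K L + frob K L'.
Proof.
rewrite /frob -big_split; apply: eq_bigr => i _; rewrite -big_split.
by apply: eq_bigr => j _; rewrite mxE mulrDr.
Qed.

Lemma frobC (K L : 'M[R]_d) : frob K L = frob L K.
Proof. by apply: eq_bigr => i _; apply: eq_bigr => j _; rewrite mulrC. Qed.

Lemma frob_sym_unit (K : 'M[R]_d) i j : frob K (sym_unit i j) = 2^-1 * (K i j + K j i).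
Proof. by rewrite /sym_unit frobZr frobDr !frob_delta. Qed.

Lemma sym_unit_sym i j : (sym_unit i j)^T = sym_unit i j.
Proof. by rewrite /sym_unit linearZ linearD /= !trmx_delta addrC. Qed.

Lemma smooth_sym_unit f i j : smooth f -> smooth_sym (fun x => f x *: sym_unit i j).
Proof.
move=> sf; split => [k l|x]; last by rewrite linearZ/= sym_unit_sym.
rewrite (_ : (fun _ => _) = sym_unit i j k l *: f); first exact: smoothZ.
by apply/funext => x; rewrite mxE mulrC.
Qed.

(** Weak formulations tested with tensors can thereby be read entry by entry. *)
Lemma divdiv_sym_unit f i j x : smooth f ->
  div (rowdiv (fun x => f x *: sym_unit i j)) x = eps (grad f) x i j.
Proof.
move=> sf; have [s1 _] := smooth_sym_unit i j sf.
rewrite divdiv_coord// hess_coord addrC.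
pose K : 'M[R]_d := \matrix_(k, l) partial k (partial l f) x.
transitivity (frob K (sym_unit i j)); last by rewrite frob_sym_unit !mxE.
apply: eq_bigr => k _; apply: eq_bigr => l _.
rewrite (_ : (fun y => _) = sym_unit i j k l *: f); last first.
  by apply/funext => y; rewrite mxE mulrC.
have -> : partial l (sym_unit i j k l *: f) = sym_unit i j k l *: partial l f.
  by apply/funext => y; rewrite partialZ//; exact: smooth_derivable.
rewrite partialZ; last exact/smooth_derivable/smooth_partial.
by rewrite [K k l]mxE mulrC.
Qed.

Lemma L2sym_smooth A Th : measurable A -> bounded_set A -> smooth_sym Th -> L2sym A Th.
Proof.
move=> mA bA [sT tT]; apply/(L2symP mA); split => // i j.
by apply: continuous_L2 => //; exact: smooth_continuous (sT i j).
Qed.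

Lemma smooth_L2 A f : measurable A -> bounded_set A -> smooth f -> L2 A f.
Proof. by move=> mA bA sf; apply: continuous_L2 => //; exact: smooth_continuous sf. Qed.

Lemma smooth_hess f i j : smooth f -> smooth (fun x => eps (grad f) x i j).
Proof.
move=> sf; rewrite (_ : (fun _ => _) = 2^-1 *: (partial j (partial i f) + partial i (partial j f))).
  by apply: smoothZ; apply: smoothD; do 2 apply: smooth_partial.
by apply/funext => x; rewrite hess_coord.
Qed.

Lemma smooth_sym_hess f : smooth f -> smooth_sym (eps (grad f)).
Proof.
move=> sf; split => [i j|x]; first exact: smooth_hess.
apply/matrixP => i j; apply: etrans (mxE _ _ _ _) _.
apply: etrans (hess_coord f x j i) _; apply: etrans (esym (hess_coord f x i j)).
exact: (congr1 _ (addrC (partial i (partial j f) x) _)).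
Qed.

Lemma smooth_divdiv Th : smooth_sym Th -> smooth (div (rowdiv Th)).
Proof.
move=> [sT _].
rewrite (_ : div _ = \sum_i \sum_j partial i (partial j (fun y => Th y i j))).
  by do 2 (apply: smooth_sum => ?); do 2 apply: smooth_partial.
apply/funext => x; rewrite divdiv_coord// fct_sumE; apply: eq_bigr => i _.
by rewrite fct_sumE.
Qed.

(** Integrate by parts twice in each entry. *)
Theorem hess_divdiv_duality A f Th : measurable A -> bounded_set A -> smooth f ->
  smooth_sym Th -> (forall i j, ibp_pair A f (fun x => Th x i j)) ->
  ipM A (eps (grad f)) Th = ip A f (div (rowdiv Th)).
Proof.
move=> mA bA sf sT h; have [s1 tT] := sT.
have hf := L2_semi_ip mA (d := d).
have Lp i j : L2 A (partial i (partial j f)).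
  exact: (smooth_L2 mA bA (smooth_partial i (smooth_partial j sf))).
have LT i j : L2 A (fun x => Th x i j) by exact: (smooth_L2 mA bA (s1 i j)).
have Lf : L2 A f by exact: smooth_L2.
have Ld i j : L2 A (partial i (partial j (fun y => Th y i j))).
  exact: (smooth_L2 mA bA (smooth_partial i (smooth_partial j (s1 i j)))).
rewrite (ipM_sum mA); last 2 first.
- exact/L2sym_smooth/smooth_sym_hess.
- exact: L2sym_smooth.
have -> : div (rowdiv Th) = \sum_i \sum_j partial i (partial j (fun y => Th y i j)).
  apply/funext => x; rewrite divdiv_coord// fct_sumE; apply: eq_bigr => i _.
  by rewrite fct_sumE.
rewrite ipC (sip_suml hf)//; last first.
  by move=> i; apply: subspace_sum => //; exact: L2_subspace.
under [RHS]eq_bigr do rewrite (sip_suml hf)//.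
have E i j : ip A (fun x => eps (grad f) x i j) (fun x => Th x i j) =
    2^-1 * (ip A f (partial i (partial j (fun y => Th y i j))) +
            ip A f (partial j (partial i (fun y => Th y j i)))).
  rewrite (_ : (fun x => eps _ x i j) = 2^-1 *: (partial j (partial i f) + partial i (partial j f))); last first.
    by apply/funext => x; rewrite hess_coord.
  rewrite (sipZl hf)//; last exact: subspaceD (L2_subspace mA) _ _.
  congr (_ * _); apply: etrans (sipDl hf (Lp j i) (Lp i j) (LT i j)) _.
  congr (_ + _); first exact: (ibp2 i j (h i j)).
  apply: etrans (ibp2 j i (h i j)) _; congr (ip A f (partial j (partial i _))).
  by apply/funext => x; rewrite -[in LHS]tT mxE.
rewrite (eq_bigr _ (fun i _ => eq_bigr _ (fun j _ => E i j))).
under eq_bigr do under eq_bigr do rewrite mulrDr.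
under eq_bigr do rewrite big_split.
rewrite big_split /= [X in _ + X]exchange_big /= -big_split /=.
apply: eq_bigr => i _; rewrite -big_split; apply: eq_bigr => j _ /=.
by rewrite -mulrDl -[2^-1 + 2^-1]mulr2n -[_ *+ 2]mulr_natl divff// mul1r ipC.
Qed.

End operators.

Section dense.
Context {R : realType} {d : nat}.
Local Notation pt := 'rV[R]_d.
Local Notation mu := (@lebesgue_rV R d).
Implicit Types (A B : set pt) (f g : pt -> R) (Th : pt -> 'M[R]_d).
#[local] Opaque smooth partial eps grad div rowdiv.

(** The residual with respect to the test functions is orthogonal to all of
    them, hence null by the fundamental lemma. *)
Lemma test_dense A f (e : R) : open A -> L2 A f -> 0 < e ->
  exists2 psi, test_function A psi & ip A (f - psi) (f - psi) < e.
Proof.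
move=> oA Lf e0; have mA : measurable A by exact: open_measurable_rV.
have hf := L2_semi_ip mA (d := d).
have TL : test_function A `<=` L2 A by move=> psi; exact: test_L2.
have [r [Lr r0 hr]] := orthogonal_residual hf (L2_complete mA) (test_subspace A) TL Lf.
have rr : ip A r r = 0 by apply: ip_ae0 => //; exact: fundamental_lemma.
have e2 : 0 < e / 2 by lra.
have [psi tpsi hpsi] := hr _ e2; exists psi => //.
have Lpsi := TL _ tpsi.
have L1 := subspaceB (L2_subspace mA) (subspaceB (L2_subspace mA) Lf Lr) Lpsi.
rewrite (_ : f - psi = (f - r - psi) + r); last by rewrite addrAC -[f - r + r]/_ subrK.
apply: le_lt_trans (sip_sqr_triangle hf L1 Lr) _; rewrite rr; lra.
Qed.

Section element.
Variables (A : set pt) (oA : open A) (bA : bounded_set A).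
Let mA : measurable A := open_measurable_rV oA.
Let hL := L2_semi_ip mA.
Let hM := L2sym_semi_ip mA.

Definition hess_graph (D : set (pt -> R)) :=
  graph_closure (L2 A) (ip A) (L2sym A) (ipM A) D (fun f => eps (grad f)).

Definition divdiv_graph :=
  graph_closure (L2sym A) (ipM A) (L2 A) (ip A) smooth_sym (fun Th => div (rowdiv Th)).

Lemma smooth_in_L2 (D : set (pt -> R)) : D `<=` smooth -> D `<=` L2 A.
Proof. by move=> Ds f /Ds; exact: smooth_L2. Qed.

Lemma hess_in_L2 (D : set (pt -> R)) : D `<=` smooth ->
  forall u, D u -> L2sym A (eps (grad u)).
Proof. by move=> Ds f /Ds sf; apply: L2sym_smooth => //; exact: smooth_sym_hess. Qed.

Lemma divdiv_in_L2 Th : smooth_sym Th -> L2 A (div (rowdiv Th)).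
Proof. by move=> sT; apply: smooth_L2 => //; exact: smooth_divdiv. Qed.

Lemma hess_closureE (D : set (pt -> R)) z H : D `<=` smooth ->
  hess_closure D A z H <-> hess_graph D z H.
Proof.
move=> Ds; apply: iff_sym.
exact: graph_closure_seq.
Qed.

Lemma ddiv_closureE Th g : ddiv_closure A Th g <-> divdiv_graph Th g.
Proof.
apply: iff_sym.
exact: graph_closure_seq.
Qed.

(** Integration by parts against compactly supported tensors shows that each
    entry of [H] is orthogonal to all test functions. *)
Lemma hess_closable H : hess_graph smooth 0 H -> ipM A H H = 0.
Proof.
move=> h; have [_ LH _] := h; have [_ sH] := (L2symP mA _).1 LH.
apply: (ipM_ae0 mA LH).
have h0 i j : ae_eq mu A (fun x => H x i j) 0.
  apply: fundamental_lemma => //; first exact: L2sym_coord LH.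
  move=> psi tpsi; have spsi := test_smooth tpsi.
  pose Th x := psi x *: sym_unit i j : 'M[R]_d.
  have sTh : smooth_sym Th by exact: smooth_sym_unit.
  transitivity (ipM A H Th).
    apply: eq_Rintegral => x; rewrite inE => Ax.
    by rewrite /Th frobZr frob_sym_unit -{3}(sH x Ax) mxE; field.
  have LTh := L2sym_smooth mA bA sTh; have Ldd := divdiv_in_L2 sTh.
  rewrite (graph_closure_dual hL hM (smooth_in_L2 (@subset_refl _ _)) (hess_in_L2 (@subset_refl _ _)) h LTh Ldd).
    by rewrite (sip0l hL).
  move=> u su; apply: (hess_divdiv_duality mA bA su sTh) => k l; right; split; first exact: su.
  rewrite (_ : (fun _ => _) = sym_unit i j k l *: psi); last first.
    by apply/funext => x; rewrite /Th mxE mulrC.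
  exact: subspaceZ (test_subspace A) tpsi.
have : {ae mu, forall x, forall p : 'I_d * 'I_d, A x -> H x p.1 p.2 = 0}.
  have hn n : {ae mu, forall x, forall p, (unpickle n : option ('I_d * 'I_d)) = Some p -> A x -> H x p.1 p.2 = 0}.
    case: (unpickle n) => [[i j]|]; last by apply: aeW.
    by apply: filterS (h0 i j) => x hx p [<-] Ax; exact: hx.
  by apply: filterS (ae_foralln hn) => x hx p; apply: (hx (pickle p)); rewrite pickleK.
by apply: filterS => x hx Ax; apply/matrixP => i j; rewrite (hx (i, j) Ax) mxE.
Qed.

Lemma divdiv_closable g : divdiv_graph 0 g -> ip A g g = 0.
Proof.
move=> h; have [_ Lg _] := h; apply: (ip_ae0 mA Lg).
apply: fundamental_lemma => // psi tpsi; have spsi := test_smooth tpsi.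
have Lpsi := smooth_L2 mA bA spsi.
have LH := L2sym_smooth mA bA (smooth_sym_hess spsi).
rewrite (graph_closure_dual hM hL (fun Th sT => L2sym_smooth mA bA sT) divdiv_in_L2 h Lpsi LH).
  by rewrite (sip0l hM).
move=> Th sTh; rewrite ipC -hess_divdiv_duality//; last first.
  by move=> i j; left; exact: (conj tpsi (sTh.1 i j)).
by rewrite (sipC hM)//; exact: L2sym_smooth.
Qed.

End element.
End dense.

(** * Translation and convolution *)

Section translation.
Context {R : realType} {d : nat}.
Local Notation pt := 'rV[R]_d.
Local Notation mu := (@lebesgue_rV R d).
Local Notation e_ i := (delta_mx (ord0 : 'I_1) i : pt).
Implicit Types (A B : set pt) (f g : pt -> R) (a : pt).
#[local] Opaque smooth.

Definition translate a f : pt -> R := fun x => f (x + a).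

Lemma partial_translate a f i : partial i (translate a f) = translate a (partial i f).
Proof.
apply/funext => x; rewrite /translate /partial /derive /=.
by under eq_fun do rewrite -addrA.
Qed.

Lemma derivable_translate a f i x : derivable f (x + a) (e_ i) ->
  derivable (translate a f) x (e_ i).
Proof.
rewrite /derivable (_ : (fun h => _) = (fun h : R => h^-1 *: ((translate a f \o shift x) (h *: e_ i) - translate a f x)))//.
by apply/funext => h; rewrite /translate /= addrA.
Qed.

Lemma continuous_translate a f : continuous f -> continuous (translate a f).
Proof.
move=> cf x; apply: (@continuous_comp _ _ _ (fun y : pt => y + a) f); last exact: cf.
by apply: (@cvgD _ _ _ (nbhs x)); [exact: cvg_id|exact: cvg_cst].
Qed.

Lemma smooth_translate a f : smooth f -> smooth (translate a f).
Proof.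
move=> /smoothP sf; apply/smoothP => n; elim: n f {sf}(sf n) => [|n IH] f /=.
  exact: continuous_translate.
move=> [cf df pf]; split; first exact: continuous_translate.
  by move=> i x; apply: derivable_translate; exact: df.
by move=> i; rewrite partial_translate; apply: IH; exact: pf.
Qed.

Lemma L2_translate a f : L2 setT f -> L2 setT (translate a f).
Proof.
move=> [mf intf]; split; first exact: measurableT_comp mf (measurable_shift a).
exact: (integrable_shift a intf).
Qed.

Lemma ip_translate a f : L2 setT f ->
  ip setT (translate a f) (translate a f) = ip setT f f.
Proof.
move=> Lf; rewrite /ip.
exact: (Rintegral_shift (f := fun x => f x * f x) a (integrable_mul measurableT Lf Lf)).
Qed.

Let hL := L2_semi_ip (d := d) (@measurableT _ pt : measurable [set: pt]) : semi_ip (L2 [set: pt]) (ip [set: pt] (R := R)).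

Lemma translateB a f g : translate a (f - g) = translate a f - translate a g.
Proof. by []. Qed.

(** True for test functions by uniform continuity, hence for all square
    integrable functions by density. *)
Lemma translate_continuous f : L2 setT f -> forall e : R, 0 < e ->
  exists2 del : R, 0 < del & forall a, `|a| < del ->
    ip setT (translate a f - f) (translate a f - f) < e.
Proof.
move=> Lf e e0; have e6 : 0 < e / 16 by lra.
have e8 : 0 < e / 8 by lra.
have [psi tpsi hpsi] := test_dense openT Lf e6.
have Lpsi := test_L2 (@measurableT _ pt) tpsi.
have [M [M0 hM]] := test_cube tpsi.
pose B : set pt := cube (M + 1).
have mB : measurable B by exact: measurable_box.
have bB : bounded_set B by exact: bounded_cube.
have [c c0 hc] : exists2 c : R, 0 < c & c ^+ 2 * fine (mu B) < e / 8.
  have m0 : 0 <= fine (mu B) by rewrite fine_ge0.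
  exists (Num.min 1 (e / 8 / (fine (mu B) + 1))).
    by rewrite lt_min ltr01/= divr_gt0// ltr_wpDl.
  set q := e / 8 / _; have qm : q * (fine (mu B) + 1) = e / 8 by rewrite divfK// gt_eqF// ltr_wpDl.
  have q0 : 0 < q by rewrite divr_gt0// ltr_wpDl.
  have [h|h] := leP 1 q.
    by rewrite expr1n mul1r; nra.
  by rewrite expr2 -mulrA; nra.
have [del del0 hdel] := test_uniform_continuous tpsi c0.
exists (Num.min del 1); first by rewrite lt_min del0 ltr01.
move=> a; rewrite lt_min => /andP[adel a1].
have spsi := test_smooth tpsi.
have [Lw hw] : L2 setT (translate a psi - psi) /\
    ip setT (translate a psi - psi) (translate a psi - psi) <= c ^+ 2 * fine (mu B).
  apply: L2_support => //.
  - apply: continuous_measurable_rV => //; apply: smooth_continuous.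
    exact: (subspaceB smooth_subspace (smooth_translate a spsi) spsi).
  - move=> x; apply/ltW; apply: hdel; rewrite addrAC subrr add0r//.
  - move=> x /cubeE hx.
    have hMx : M + 1 <= `|x|.
      rewrite leNgt; apply/negP => xM; apply: hx; exact/rV_norm_ltP/xM/ltr_wpDl/ltr01/ltW.
    have p0 y : M <= `|y| -> psi y = 0.
      by move=> h; apply/eqP; apply: contraT => /hM; rewrite ltNge h.
    rewrite (_ : (_ - _) x = psi (x + a) - psi x)// !p0 ?subrr//; first by lra.
    have := ler_normB (x + a) a; rewrite addrK; lra.
have Ld := subspaceB (L2_subspace (@measurableT _ pt)) Lf Lpsi.
have Lt := L2_translate a Ld.
have -> : translate a f - f = translate a (f - psi) + ((translate a psi - psi) - (f - psi)).
  by rewrite translateB opprB [X in _ = _ + X]addrA subrK addrA subrK.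
apply: le_lt_trans (sip_sqr_triangle hL Lt _) _.
  exact: subspaceB (L2_subspace measurableT) _ _.
rewrite ip_translate//.
have := sip_sqr_triangle hL Lw (subspaceN (L2_subspace measurableT) Ld).
have -> : ip setT (- (f - psi)) (- (f - psi)) = ip setT (f - psi) (f - psi).
  by apply: eq_Rintegral => x _; exact: mulrNN.
lra.
Qed.

End translation.

Section convolution.
Context {R : realType} {d : nat}.
Local Notation pt := 'rV[R]_d.
Local Notation mu := (@lebesgue_rV R d).
Local Notation e_ i := (delta_mx (ord0 : 'I_1) i : pt).
Implicit Types (A B : set pt) (f g u rho : pt -> R) (a x y : pt).
#[local] Opaque smooth.

Let hS : subspace (L2 [set: pt] (R := R)) := L2_subspace measurableT.
Let hL : semi_ip (L2 [set: pt] (R := R)) (ip [set: pt]) := L2_semi_ip measurableT.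

(** The convolution of [u] with the reflection of [rho]. *)
Definition mollify rho u : pt -> R := fun x => ip setT u (translate (- x) rho).

Lemma ip_uniform_small u B : L2 setT u -> measurable B -> bounded_set B ->
  exists2 C : R, 0 < C & forall g (c : R), measurable_fun setT g -> 0 <= c ->
    (forall y, `|g y| <= c) -> (forall y, ~ B y -> g y = 0) ->
    `|ip setT u g| <= c * C.
Proof.
move=> Lu mB bB.
exists (Num.sqrt (ip setT u u) * Num.sqrt (fine (mu B)) + 1).
  by rewrite ltr_wpDl// mulr_ge0 ?sqrtr_ge0.
move=> g c mg c0 gc gB; have [Lg hg] := L2_support mB bB mg gc gB.
apply: le_trans (sip_CS hL Lu Lg) _; rewrite mulrDr mulr1 ler_wpDr// mulrCA.
rewrite ler_wpM2l ?sqrtr_ge0//.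
rewrite -(ger0_norm c0) -sqrtr_sqr -sqrtrM ?sqr_ge0// ler_wsqrtr//.
Qed.

Lemma translate_out rho (M : R) x h y : (forall z, rho z != 0 -> `|z| < M) ->
  `|h| < 1 -> 0 < M -> ~ cube (`|x| + M + 1) y -> rho (y - x + h) = 0.
Proof.
move=> hM h1 M0 hy; apply/eqP; apply: contraT => /hM hyx; exfalso; apply: hy.
apply/cubeE/rV_norm_ltP; first by have := normr_ge0 x; lra.
have := ler_normD (y - x + h) x; have := ler_normB (y - x + h + x) h.
rewrite (_ : y - x + h + x - h = y); first by lra.
by rewrite addrAC addrK subrK.
Qed.

Lemma mollify_continuous rho u : test_function setT rho -> L2 setT u ->
  continuous (mollify rho u).
Proof.
move=> tr Lu x; have [M [M0 hM]] := test_cube tr.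
have mB : measurable (cube (`|x| + M + 1) : set pt) by exact: measurable_box.
have [C C0 hC] := ip_uniform_small Lu mB (bounded_cube _).
have sr := test_smooth tr.
apply/(@cvgrPdist_lt _ _ _ (nbhs x)) => e e0.
have e1 : 0 < e / C / 2 by rewrite !divr_gt0.
have [del del0 hdel] := test_uniform_continuous tr e1.
have m0 : 0 < Num.min del 1 by rewrite lt_min del0 ltr01.
near=> y.
have : `|x - y| < Num.min del 1 by near: y; exact: cvgr_dist_lt.
rewrite lt_min => /andP[xy xy1].
have Lt z : L2 setT (translate z rho) by exact/L2_translate/(test_L2 measurableT tr).
rewrite /mollify -(sipBr hL (Lt _) (Lt _) Lu).
apply: (@le_lt_trans _ _ (e / C / 2 * C)); last first.
  by rewrite mulrAC divfK ?gt_eqF//; lra.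
apply: hC; [|exact: ltW| |].
- apply: continuous_measurable_rV => //; apply: smooth_continuous.
  by apply: (subspaceB smooth_subspace); exact: smooth_translate.
- move=> z; apply/ltW/hdel; rewrite opprB addrC addrA subrK.
  by rewrite distrC.
- move=> z hz; rewrite -[LHS]/(rho (z - x) - rho (z - y)).
  rewrite -[z - x]addr0 (translate_out hM _ M0 hz) ?normr0//.
  rewrite (_ : z - y = z - x + (x - y)); last by rewrite addrA subrK.
  by rewrite (translate_out hM _ M0 hz) ?subrr.
Unshelve. all: by end_near. Qed.

(** The difference quotients of [rho] converge uniformly, with supports in a
    fixed bounded set. *)
Lemma mollify_derive rho u i x : test_function setT rho -> L2 setT u ->
  is_derive x (e_ i) (mollify rho u) (- mollify (partial i rho) u x).
Proof.
move=> tr Lu; have tp := test_partial i tr.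
have [M1 [M10 hM1]] := test_cube tr; have [M2 [M20 hM2]] := test_cube tp.
pose M := M1 + M2; have M0 : 0 < M by rewrite addr_gt0.
have hM y : rho y != 0 -> `|y| < M by move=> /hM1; rewrite /M; lra.
have hM' y : partial i rho y != 0 -> `|y| < M by move=> /hM2; rewrite /M; lra.
have mB : measurable (cube (`|x| + M + 1) : set pt) by exact: measurable_box.
have [C C0 hC] := ip_uniform_small Lu mB (bounded_cube _).
have sr := test_smooth tr; have sp := test_smooth tp.
have Lt z : L2 setT (translate z rho) by exact/L2_translate/(test_L2 measurableT tr).
have Lp z : L2 setT (translate z (partial i rho)) by exact/L2_translate/(test_L2 measurableT tp).
have lim : h^-1 *: ((mollify rho u \o shift x) (h *: e_ i) - mollify rho u x) @[h --> (0 : R)^'] -->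
    (- mollify (partial i rho) u x : R).
  apply/cvgrPdist_lt => e e0.
  have e1 : 0 < e / C / 2 by rewrite !divr_gt0.
  have [del del0 hdel] := test_uniform_quotient i tr e1.
  have m0 : 0 < Num.min del 1 by rewrite lt_min del0 ltr01.
  near=> h.
  have : `|h| < Num.min del 1 by near: h; exact: dnbhs0_lt.
  have h0 : h != 0 by near: h; exact: nbhs_dnbhs_neq.
  rewrite lt_min => /andP[hd h1].
  have he : `|h *: e_ i| < 1.
    apply/rV_norm_ltP => // k; rewrite !mxE/= eq_sym.
    by case: (_ == _); rewrite ?mulr1// mulr0 normr0.
  pose g : pt -> R := (- h)^-1 *: (translate (- (h *: e_ i + x)) rho - translate (- x) rho) -
    translate (- x) (partial i rho).
  have -> : - mollify (partial i rho) u x -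
      h^-1 *: ((mollify rho u \o shift x) (h *: e_ i) - mollify rho u x) = ip setT u g.
    rewrite /g (sipBr hL _ (Lp _) Lu); last exact/(subspaceZ _ hS)/(subspaceB hS).
    rewrite (sipZr hL _ (subspaceB hS (Lt _) (Lt _)) Lu) (sipBr hL (Lt _) (Lt _) Lu).
    by rewrite invrN mulNr addrC -[_ *: _]/(_ * _).
  apply: (@le_lt_trans _ _ (e / C / 2 * C)); last first.
    by rewrite mulrAC divfK ?gt_eqF//; lra.
  have gE z : g z = (- h)^-1 * (rho (z - x + (- h) *: e_ i) - rho (z - x)) - partial i rho (z - x).
    rewrite /g -[LHS]/((- h)^-1 * (rho (z - (h *: e_ i + x)) - rho (z - x)) - partial i rho (z - x)).
    by rewrite opprD scaleNr addrA addrAC.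
  apply: hC; [|exact: ltW| |].
  - apply: continuous_measurable_rV => //; apply: smooth_continuous.
    apply: (subspaceB smooth_subspace); last exact: smooth_translate.
    by apply: smoothZ; apply: (subspaceB smooth_subspace); exact: smooth_translate.
  - move=> z; rewrite gE; apply/ltW/hdel; rewrite ?oppr_eq0// normrN//.
  - move=> z hz; rewrite gE.
    rewrite (translate_out hM _ M0 hz); last by rewrite scaleNr normrN.
    rewrite -[z - x]addr0 (translate_out hM _ M0 hz) ?normr0//.
    by rewrite (translate_out hM' _ M0 hz) ?normr0// !subr0 mulr0.
by apply: DeriveDef; [apply/cvg_ex; exists (- mollify (partial i rho) u x)|exact: cvg_lim].
Unshelve. all: by end_near. Qed.

Lemma mollify_partial rho u i : test_function setT rho -> L2 setT u ->
  partial i (mollify rho u) = mollify (- partial i rho) u.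
Proof.
move=> tr Lu; apply/funext => x; have h := mollify_derive i x tr Lu.
rewrite /partial derive_val /mollify.
have Lp : L2 setT (translate (- x) (partial i rho)).
  exact/L2_translate/(test_L2 measurableT (test_partial i tr)).
apply: etrans (esym (mulN1r _)) _; rewrite -(sipZr hL (-1) Lp Lu).
by congr ip; exact: scaleN1r.
Qed.

Lemma smooth_mollify rho u : test_function setT rho -> L2 setT u -> smooth (mollify rho u).
Proof.
move=> tr Lu; apply/smoothP => n; elim: n rho tr => [|n IH] rho tr /=.
  exact: mollify_continuous.
split; first exact: mollify_continuous.
  by move=> i x; have h := mollify_derive i x tr Lu; exact: ex_derive.
move=> i; rewrite mollify_partial//; apply: IH.
exact: subspaceN (test_subspace _) (test_partial i tr).
Qed.

Lemma mollify_partial2 rho u i j : test_function setT rho -> L2 setT u ->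
  partial j (partial i (mollify rho u)) = mollify (partial j (partial i rho)) u.
Proof.
move=> tr Lu; rewrite mollify_partial// mollify_partial//; last first.
  exact: subspaceN (test_subspace _) (test_partial i tr).
congr mollify; apply/funext => x.
have sp := smooth_partial i (test_smooth tr).
rewrite -[partial i rho in LHS]scale1r -scaleNr -[LHS]/(- partial j ((-1) *: partial i rho) x).
by rewrite partialZ ?mulN1r ?opprK//; exact: smooth_derivable sp.
Qed.

Lemma mollify_out rho u A (e : R) x : (forall z, rho z != 0 -> `|z| < e) ->
  (forall y, ~ A y -> u y = 0) -> mollify rho u x != 0 -> exists2 y, A y & `|y - x| < e.
Proof.
move=> hr hu; apply: contra_neqP => h.
rewrite /mollify /ip (_ : (fun y => _) = cst 0) ?Rintegral_cst ?mul0r//.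
apply/funext => y; have [Ay|/hu->] := pselect (A y); last by rewrite mul0r.
rewrite /translate (_ : rho _ = 0) ?mulr0//; apply/eqP; apply: contraT => /hr yx.
by exfalso; apply: h; exists y.
Qed.

Lemma test_mollify rho u A : test_function setT rho -> L2 setT u -> bounded_set A ->
  (forall y, ~ A y -> u y = 0) -> test_function setT (mollify rho u).
Proof.
move=> tr Lu [M [Mr bA]] hu; have [M' [M'0 hM]] := test_cube tr.
pose m := `|M| + 1 + M'.
apply: (@test_functionI _ _ _ (closed_box (const_mx (- m)) (const_mx m))) => //.
- exact: smooth_mollify.
- exact: compact_closed_box.
move=> x hx; apply/eqP; apply: contra_notT hx => hx.
have [y Ay yx] := mollify_out hM hu hx.
apply/sub_closed_box/cubeE/rV_norm_ltP.
  by rewrite /m; have := normr_ge0 M; lra.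
have yM : `|y| <= `|M| + 1 by apply: bA Ay; rewrite (le_lt_trans (ler_norm M))// ltrDl.
by have := ler_normB y (y - x); rewrite opprB addrC subrK /m; lra.
Qed.

Lemma L2_mul_bounded A f g (c : R) : measurable A -> L2 A f -> measurable_fun A g ->
  (forall x, `|g x| <= c) ->
  L2 A (fun x => f x * g x) /\ ip A (fun x => f x * g x) (fun x => f x * g x) <= c ^+ 2 * ip A f f.
Proof.
move=> mA Lf mg gc; have [mf intf] := Lf.
have mfg : measurable_fun A (fun x => f x * g x) by exact: measurable_funM.
have h : (\int[mu]_(x in A) ((f x * g x) ^+ 2)%:E <= (c ^+ 2 * ip A f f)%:E)%E.
  rewrite EFinM -(ip_sqrE mA Lf) -ge0_integralZl//; last 3 first.
  - by apply/measurable_EFinP; exact: measurable_funX.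
  - by move=> x _; rewrite lee_fin sqr_ge0.
  - by rewrite lee_fin sqr_ge0.
  apply: ge0_le_integral => //.
  - by move=> x _; rewrite lee_fin sqr_ge0.
  - by apply/measurable_EFinP; exact: measurable_funX.
  - by apply/measurable_EFinP; apply: measurable_funM => //; exact: measurable_funX.
  - move=> x _; rewrite lee_fin exprMn mulrC ler_wpM2r ?sqr_ge0//.
    by rewrite -[g x ^+ 2]real_normK ?num_real// ler_sqr ?nnegrE ?(le_trans _ (gc x)).
have L : L2 A (fun x => f x * g x).
  by apply: integrable_sqr => //; apply: le_lt_trans h _; exact: ltry.
by split => //; rewrite -lee_fin -ip_sqrE.
Qed.

Lemma test_bounded A f : test_function A f -> exists c : R, forall x, `|f x| <= c.
Proof.
move=> tf; have [sf cf _] := tf; set K := closure _ in cf.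
have : compact (f @` K).
  apply: continuous_compact => //; apply: continuous_subspaceT.
  exact: smooth_continuous sf.
move=> /compact_bounded[c [cr hc]]; exists (`|c| + 1) => x.
have [Kx|hx] := pselect (K x); last by rewrite (test_out tf hx) normr0 addr_ge0.
apply: hc; last by exists x.
by rewrite (le_lt_trans (ler_norm c))// ltrDl.
Qed.

(** Jensen's inequality for the probability density [rho]. *)
Lemma mollify_jensen rho f x : test_function setT rho -> (forall y, 0 <= rho y) ->
  \int[mu]_y rho y = 1 -> L2 setT f ->
  (((mollify rho f x - f x) ^+ 2)%:E <=
    \int[mu]_y (((f (x + y) - f x) ^+ 2 * rho y)%:E))%E.
Proof.
move=> tr r0 r1 Lf; have cr := smooth_continuous (test_smooth tr).
have mr : measurable_fun setT rho by exact: continuous_measurable_rV.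
have Ltf := L2_translate x Lf; have Lr := test_L2 measurableT tr.
(* the Cauchy-Schwarz inequality will be applied to the factors of [s * s] *)
pose s y := Num.sqrt (rho y).
have sE y : s y * s y = rho y by rewrite -expr2 sqr_sqrtr.
have ms : measurable_fun setT s.
  apply: continuous_measurable_rV => // y.
  by apply: (@continuous_comp _ _ _ rho Num.sqrt); [exact: cr|exact: sqrt_continuous].
have [M [M0 hM]] := test_cube tr.
have [c hc] : exists c, forall y, `|s y| <= c.
  have [c hc] := test_bounded tr; exists (Num.sqrt c) => y.
  rewrite ger0_norm ?sqrtr_ge0// ler_wsqrtr//.
  exact: le_trans (ler_norm _) (hc y).
have [Ls _] : L2 setT s /\ ip setT s s <= c ^+ 2 * fine (mu (cube M)).
  apply: L2_support => //.
  - exact: measurable_box.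
  - exact: bounded_cube.
  - move=> y /cubeE hy; rewrite /s (_ : rho y = 0) ?sqrtr0//.
    apply/eqP; apply: contraT => /hM yM; exfalso; apply: hy; exact/rV_norm_ltP.
have ss1 : ip setT s s = 1 by rewrite -r1; apply: eq_Rintegral => y _; exact: sE.
have [Lfs _] := L2_mul_bounded measurableT Ltf ms hc.
pose G := (fun y => translate x f y * s y) - f x *: s.
have LG : L2 setT G by exact/(subspaceB hS)/(subspaceZ _ hS).
have GE y : G y = (f (x + y) - f x) * s y.
  by rewrite /G -[LHS]/(f (y + x) * s y - f x * s y) mulrBl [y + x]addrC.
have h : mollify rho f x - f x = ip setT G s.
  rewrite /G (sipBl hL)// ?(sipZl hL)// ?ss1 ?mulr1; last exact: subspaceZ.
  congr (_ - _); rewrite /mollify /ip.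
  transitivity (\int[mu]_y (f (y + x) * rho y)).
    rewrite -[RHS](Rintegral_shift (f := fun y => f (y + x) * rho y) (- x)).
      by apply: eq_Rintegral => y _; rewrite subrK.
    exact: (integrable_mul measurableT Ltf Lr).
  by apply: eq_Rintegral => y _; rewrite -sE mulrA.
have := sip_CS2 hL LG Ls; rewrite -h ss1 mulr1 -lee_fin => /le_trans; apply.
rewrite -ip_sqrE// le_eqVlt; apply/orP; left; apply/eqP; apply: eq_integral => y _.
by rewrite GE exprMn [s y ^+ 2]sE.
Qed.

(** By the inequality of Jensen and the theorem of Fubini, the error is at most
    an average of the translation errors over the support of [rho]. *)
Theorem mollify_close rho f (del e : R) : test_function setT rho -> (forall y, 0 <= rho y) ->
  (forall y, rho y != 0 -> `|y| < del) -> \int[mu]_y rho y = 1 -> L2 setT f ->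
  (forall a, `|a| < del -> ip setT (translate a f - f) (translate a f - f) <= e) ->
  L2 setT (mollify rho f) /\ ip setT (mollify rho f - f) (mollify rho f - f) <= e.
Proof.
move=> tr r0 rd r1 Lf he; have cr := smooth_continuous (test_smooth tr).
have mr : measurable_fun setT rho by exact: continuous_measurable_rV.
have [mf _] := Lf.
have mm : measurable_fun setT (mollify rho f).
  by apply: continuous_measurable_rV => //; exact: mollify_continuous.
have mF : measurable_fun setT (fun p : pt * pt => ((f (p.1 + p.2) - f p.1) ^+ 2 * rho p.2)%:E).
  have mD : measurable_fun setT (fun p : pt * pt => p.1 + p.2).
    apply: measurable_fun_mx => i j.
    rewrite (_ : (fun p => _) = (fun p : pt * pt => p.1 i j + p.2 i j)); last first.
      by apply/funext => p; rewrite mxE.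
    apply: measurable_funD.
      exact: measurableT_comp (measurable_coord i j) measurable_fst.
    exact: measurableT_comp (measurable_coord i j) measurable_snd.
  apply: measurableT_comp => //; apply: measurable_funM.
    apply: measurable_funX; apply: measurable_funB; first exact: measurableT_comp.
    exact: measurableT_comp.
  exact: measurableT_comp.
have h : (\int[mu]_x ((mollify rho f x - f x) ^+ 2)%:E <= e%:E)%E.
  apply: (@le_trans _ _ (\int[mu]_x \int[mu]_y (((f (x + y) - f x) ^+ 2 * rho y)%:E))%E).
    apply: ge0_le_integral => //.
    - by move=> x _; rewrite lee_fin sqr_ge0.
    - by apply: measurableT_comp => //; apply: measurable_funX; exact: measurable_funB.
    - apply: (measurable_fun_fubini_tonelli_F (m2 := mu) (fun p : pt * pt => ((f (p.1 + p.2) - f p.1) ^+ 2 * rho p.2)%:E)) => //.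
      by move=> p; rewrite lee_fin mulr_ge0 ?sqr_ge0.
    - by move=> x _; exact: mollify_jensen.
  rewrite (fubini_tonelli (fun p : pt * pt => ((f (p.1 + p.2) - f p.1) ^+ 2 * rho p.2)%:E))//; last first.
    by move=> p; rewrite lee_fin mulr_ge0 ?sqr_ge0.
  apply: (@le_trans _ _ (\int[mu]_y (e * rho y)%:E)%E).
    apply: ge0_le_integral => //.
    - by move=> y _; apply: integral_ge0 => x _; rewrite lee_fin mulr_ge0 ?sqr_ge0.
    - apply: (measurable_fun_fubini_tonelli_G (m1 := mu) (fun p : pt * pt => ((f (p.1 + p.2) - f p.1) ^+ 2 * rho p.2)%:E)) => //.
      by move=> p; rewrite lee_fin mulr_ge0 ?sqr_ge0.
    - by apply: measurableT_comp => //; exact: measurable_funM.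
    - move=> y _.
      under eq_integral do rewrite mulrC EFinM /=.
      have mg : measurable_fun setT (fun x => ((f (x + y) - f x) ^+ 2)%:E).
        apply: measurableT_comp => //; apply: measurable_funX; apply: measurable_funB => //.
        exact: measurableT_comp mf (measurable_shift y).
      rewrite (ge0_integralZl mu measurableT mg); last 2 first.
      - by move=> x _; rewrite lee_fin sqr_ge0.
      - by rewrite lee_fin.
      have [->|ry] := eqVneq (rho y) 0; first by rewrite mul0e mulr0.
      rewrite mulrC EFinM lee_wpmul2l// ?lee_fin//.
      have Lt := subspaceB hS (L2_translate y Lf) Lf.
      by rewrite (ip_sqrE measurableT Lt) lee_fin; exact: he (rd _ ry).
  have ir := test_integrable tr.
  under eq_integral do rewrite EFinM.
  rewrite integralZl//.
  have -> : (\int[mu]_y (rho y)%:E)%E = 1%E.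
    by rewrite -r1 /Rintegral fineK//; exact: integrable_fin_num.
  by rewrite mule1.
have Ld : L2 setT (mollify rho f - f).
  by apply: integrable_sqr; [exact: measurable_funB|exact: le_lt_trans h (ltry _)].
split; last by rewrite -lee_fin -ip_sqrE.
by rewrite -[mollify _ _](subrK f); exact: subspaceD.
Qed.

End convolution.

(** * Lipschitz boundaries *)

Section lipschitz_domains.
Context {R : realType} {d : nat}.
Local Notation pt := 'rV[R]_d.
Local Notation mu := (@lebesgue_rV R d).
Implicit Types (A K : set pt) (p a x y : pt).

Lemma closure_near A x (e : R) : 0 < e -> closure A x -> exists2 y, A y & `|y - x| < e.
Proof.
move=> e0 /(_ _ (nbhsx_ballx x _ e0))[y [Ay]].
by rewrite -ball_normE /= distrC => xy; exists y.
Qed.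

Lemma compact_finite_balls K (r : pt -> R) x0 : compact K -> K x0 ->
  (forall p, K p -> 0 < r p) ->
  exists m (p : nat -> pt), (forall k, K (p k)) /\
    forall x, K x -> exists2 k, (k < m)%N & `|x - p k| < r (p k).
Proof.
rewrite compact_cover => cK Kx0 r0.
have [|x Kx|D DK KD] := cK pt K (fun p => ball p (r p)).
- by move=> p _; exact: ball_open.
- by exists x => //; apply: ballxx; exact: r0.
exists (size (finmap.enum_fset D)), (nth x0 (finmap.enum_fset D)); split.
  move=> k; have [h|h] := ltnP k (size (finmap.enum_fset D)).
    by have := DK _ (mem_nth x0 h); rewrite inE.
  by rewrite nth_default.
move=> x /KD[p /= pD]; rewrite -ball_normE /= => xp.
exists (index p (finmap.enum_fset D)); first by rewrite index_mem.
by rewrite nth_index// distrC.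
Qed.

(** The direction [a] points into [A] near [p], up to the boundary and
    uniformly: the room left for perturbations is proportional to the
    displacement, and can hold the width of a mollifier. *)
Definition inward A p a (r c : R) : Prop :=
  [/\ 0 < r, 0 < c &
    forall (t : R) x y, 0 < t -> t < r -> closure A x -> `|x - p| < r ->
      `|y - x| < c * t -> A (y + t *: a)].

Lemma open_inward A p : open A -> A p -> exists r, inward A p 0 r 1.
Proof.
move=> oA Ap; have /nbhs_ballP[e /= e0 eA] : nbhs p A by exact: open_nbhs_nbhs.
exists (e / 3); split => //; first by rewrite divr_gt0.
move=> t x y t0 tr _ xp; rewrite mul1r scaler0 addr0 => yx.
apply: eA; rewrite -ball_normE /= distrC -(subrK x y) -addrA.
apply: le_lt_trans (ler_normD _ _) _; lra.
Qed.

Lemma norm_mulmx_le (Q : 'M[R]_d) : exists2 C : R, 0 < C & forall v : pt, `|v *m Q| <= C * `|v|.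
Proof.
exists (\sum_i \sum_j `|Q i j| + 1).
  by rewrite ltr_wpDl// sumr_ge0// => i _; apply: sumr_ge0.
move=> v; apply/rV_norm_leP.
  by rewrite mulr_ge0// addr_ge0// sumr_ge0// => i _; apply: sumr_ge0.
move=> j; rewrite mxE; apply: le_trans (ler_norm_sum _ _ _) _.
rewrite mulrDl mul1r ler_wpDr// mulr_suml; apply: ler_sum => i _.
rewrite normrM mulrC ler_pM//; last by apply: (rV_norm_leP _ (normr_ge0 v)).2.
by rewrite (bigD1 j)//= lerDl sumr_ge0.
Qed.

(** In the graph coordinates of [p], the direction [a] is vertical, and the
    admissible width depends on the slope of the graph. *)
Lemma lipschitz_inward A p : open A -> lipschitz_boundary A -> closure A p ->
  exists a r c, inward A p a r c.
Proof.
move=> oA lA clp; have [Ap|nAp] := pselect (A p).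
  by have [r h] := open_inward oA Ap; exists 0, r, 1.
have [Q [i [gam [QQ lip nearA]]]] := lA p (conj clp nAp).
have QQ' := mulmx1C QQ.
have [L L0 hL] : exists2 L : R, 0 < L & forall u v, `|gam u - gam v| <= L * `|u - v|.
  case: lip => L [_ hL]; exists (`|L| + 1); first by rewrite ltr_wpDl.
  move=> u v; apply: (hL (`|L| + 1) _ (u, v)) => //.
  by rewrite (le_lt_trans (ler_norm L))// ltrDl.
have [C C0 hC] := norm_mulmx_le Q.
have /nbhs_ballP[e /= e0 eA] := nearA.
pose a : pt := delta_mx 0 i *m Q^T.
have aQ : a *m Q = delta_mx 0 i by rewrite -mulmxA QQ' mulmx1.
pose c := ((L + 1) * C)^-1.
have c0 : 0 < c by rewrite invr_gt0 mulr_gt0// addr_gt0.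
pose r := e / (c + 3 + `|a|).
have den0 : 0 < c + 3 + `|a| by have := normr_ge0 a; lra.
have r0 : 0 < r by rewrite divr_gt0.
have re : r * (c + 3 + `|a|) = e by rewrite divfK// gt_eqF.
exists a, r, c; split => // t x y t0 tr clx xp yx.
have [x' Ax' x'x] : exists2 x', A x' & `|x' - x| < Num.min r (c * t - `|y - x|).
  by apply: closure_near clx; rewrite lt_min r0/= subr_gt0.
move: x'x; rewrite lt_min => /andP[x'r x'c].
have yx' : `|y - x'| < c * t.
  by rewrite -(subrK x y) -addrA (le_lt_trans (ler_normD _ _))// [`|x - x'|]distrC; lra.
have ctr : c * t < c * r by rewrite ltr_pM2l.
have ta : `|t *: a| <= r * `|a|.
  by rewrite normrZ gtr0_norm// ler_wpM2r// ltW.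
have x'p : `|x' - p| < 2 * r.
  by rewrite -(subrK x x') -addrA (le_lt_trans (ler_normD _ _))//; lra.
have rc : 0 < c * r by exact: mulr_gt0.
have ra : 0 <= r * `|a| by rewrite mulr_ge0// ltW.
have bx' : ball p e x'.
  rewrite -ball_normE /= distrC; nra.
have by' : ball p e (y + t *: a).
  rewrite -ball_normE /= distrC.
  have -> : y + t *: a - p = (y - x') + (t *: a + (x' - p)).
    by rewrite [t *: a + _]addrC addrA [y - x' + _]addrA subrK addrAC.
  apply: le_lt_trans (ler_normD _ _) _.
  have := ler_normD (t *: a) (x' - p); nra.
have [/(_ Ax') hx' _] := eA _ bx'.
apply: (eA _ by').2.
have -> : (y + t *: a) *m Q = y *m Q + t *: delta_mx 0 i by rewrite mulmxDl -scalemxAl aQ.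
have -> : col' i (y *m Q + t *: delta_mx 0 i) = col' i (y *m Q).
  apply/rowP => j; rewrite !mxE /= [lift i j == i]eq_sym (negbTE (neq_lift i j)).
  by rewrite mulr0 addr0.
have -> : (y *m Q + t *: delta_mx 0 i : pt) 0 i = (y *m Q) 0 i + t.
  by rewrite mxE; congr (_ + _); rewrite mxE mxE !eqxx mulr1.
(* moving by [t] raises the graph coordinate by [t], more than the slope loses *)
have := hL (col' i (y *m Q)) (col' i (x' *m Q)).
have -> : col' i (y *m Q) - col' i (x' *m Q) = col' i ((y - x') *m Q).
  by rewrite mulmxBl; apply/rowP => j; rewrite !mxE.
have h1 : `|(y *m Q) 0 i - (x' *m Q) 0 i| <= C * `|y - x'|.
  rewrite (_ : _ - _ = ((y - x') *m Q) 0 i); last by rewrite mulmxBl !mxE.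
  apply: le_trans (hC (y - x')); exact: (rV_norm_leP _ (normr_ge0 _)).2.
have h2 : `|col' i ((y - x') *m Q)| <= C * `|y - x'|.
  apply: le_trans (hC (y - x')); apply/rV_norm_leP => // j.
  by rewrite mxE; exact: (rV_norm_leP _ (normr_ge0 _)).2.
have h3 : (L + 1) * C * `|y - x'| < t.
  rewrite mulrC -ltr_pdivlMr; last by rewrite mulr_gt0// addr_gt0.
  by rewrite [t / _]mulrC.
move=> h4; move: h1; rewrite ler_norml => /andP[h1 _].
have h5 : L * `|col' i ((y - x') *m Q)| <= L * (C * `|y - x'|) by rewrite ler_pM2l.
have := le_trans (ler_norm _) (le_trans h4 h5).
move: hx' h1 h3; rewrite mulrDl mul1r mulrDl -mulrA.
move: (C * _) (gam _) (gam _) (_ 0 i) (_ 0 i) => k g1 g2 u v.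
move: (L * k) => Lk; lra.
Qed.

(** Infinitely many disjoint translates of the boundary near [p] fit into [A],
    which has finite measure. *)
Lemma inward_local_null A p a (r c : R) : open A -> bounded_set A -> inward A p a r c ->
  mu ((closure A `\` A) `&` ball p r) = 0%E.
Proof.
move=> oA bA [r0 c0 hin]; set E := _ `&` _.
have mA : measurable A by exact: open_measurable_rV.
have mE : measurable E.
  apply: measurableI; last by apply: open_measurable_rV; exact: ball_open.
  apply: measurableD => //; rewrite -[closure A]setCK; apply: measurableC.
  by apply: open_measurable_rV; apply: closed_openC; exact: closed_closure.
pose t k : R := r / k.+2%:R.
have t0 k : 0 < t k by rewrite divr_gt0.
have tr k : t k < r by rewrite ltr_pdivrMr// ltr_pMr// ltr1n.
have tmono k l : (k < l)%N -> t l < t k.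
  by move=> kl; rewrite ltr_pM2l// ltf_pV2 ?posrE// ltr_nat !ltnS.
have push x s : E x -> 0 < s -> s < r -> A (x + s *: a).
  move=> [[clx _] xp] s0 sr; apply: (hin s x x) => //.
    by move: xp; rewrite -ball_normE /= distrC.
  by rewrite subrr normr0 mulr_gt0.
pose F k := (fun x : pt => x + - (t k *: a)) @^-1` E.
have mF k : measurable (F k).
  by rewrite -[F k]setTI; exact: measurable_shift.
have FA k : F k `<=` A.
  by move=> x Fx; have := push _ _ Fx (t0 k) (tr k); rewrite subrK.
have disj k l : (k < l)%N -> F k `&` F l = set0.
  move=> kl; rewrite -subset0 => x [Fk Fl].
  have tkl := tmono _ _ kl; have tk := tr k; have tl := t0 l.
  have := push _ (t k - t l) Fk; rewrite subr_gt0 => /(_ tkl).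
  have -> : x + - (t k *: a) + (t k - t l) *: a = x - t l *: a.
    by rewrite scalerBl addrA subrK.
  have h : t k - t l < r by lra.
  by move=> /(_ h) Ax; case: Fl => -[].
have tF : trivIset [set: nat] F.
  apply/trivIsetP => k l _ _; rewrite neq_ltn => /orP[/disj//|/disj].
  by rewrite setIC.
have muF k : mu (F k) = mu E by exact: lebesgue_rV_shift.
have finA := bounded_finite bA mA.
have finE : mu E \is a fin_num.
  rewrite ge0_fin_numE// -(muF 0%N); apply: le_lt_trans finA.
  by apply: le_measure; rewrite ?inE.
(* [n] of the translates *)
have EF n : ((fine (mu E) *+ n)%:E <= mu A)%E.
  apply: (@le_trans _ _ (mu (\bigcup_k F k))); last first.
    apply: le_measure; rewrite ?inE//; first exact: bigcup_measurable.
    by apply: bigcup_sub => k _; exact: FA.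
  rewrite measure_semi_bigcup//; last exact: bigcup_measurable.
  apply: le_trans (nneseries_lim_ge (m := 0) n _) => //.
  rewrite big_mkord (eq_bigr (fun=> mu E)) ?sumr_const; last by move=> k _; exact: muF.
  by rewrite card_ord EFin_natmul fineK.
rewrite -(fineK finE); congr EFin; apply/eqP; rewrite eq_le fine_ge0 ?andbT//.
rewrite leNgt; apply/negP => E0.
have m0 : 0 < fine (mu A) + 1 by rewrite ltr_wpDl// fine_ge0.
have [N /(_ _ (leqnn N))] := natSinv_small (divr_gt0 E0 m0).
rewrite ltr_pdivlMr// mulrC ltr_pdivrMr// => hN.
have := EF N.+1; rewrite -(fineK (_ : mu A \is a fin_num)) ?ge0_fin_numE//.
by rewrite lee_fin -mulr_natr; lra.
Qed.

(** The factor eight leaves room for a mollification and for the supports of a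
    partition of unity. *)
Lemma inward_cover A : A !=set0 -> bounded_set A ->
  (forall p, closure A p -> exists a r c, inward A p a r c) ->
  exists m (p a : nat -> pt) (r c : nat -> R),
    (forall k, inward A (p k) (a k) (r k) (c k)) /\
    forall x, closure A x -> exists2 k, (k < m)%N & `|x - p k| < r k / 8.
Proof.
move=> [x0 Ax0] bA hin.
have cK : compact (closure A).
  by apply: bounded_closed_compact; [exact: bounded_closure|exact: closed_closure].
have [q hq] : {q : pt -> pt * R * R | forall p, closure A p -> inward A p (q p).1.1 (q p).1.2 (q p).2}.
  apply/cid; have [|q hq] := @choice _ (pt * R * R)%type (fun p q => closure A p -> inward A p q.1.1 q.1.2 q.2).
    move=> p; have [/hin[a [r [c h]]]|h] := pselect (closure A p); last by exists (0, 0, 0).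
    by exists (a, r, c).
  by exists q.
have [|m [p [pA cov]]] := @compact_finite_balls _ (fun x => (q x).1.2 / 8) x0 cK (subset_closure Ax0).
  by move=> x /hq[r0 _ _]; rewrite divr_gt0.
exists m, p, (fun k => (q (p k)).1.1), (fun k => (q (p k)).1.2), (fun k => (q (p k)).2).
by split => [k|//]; exact/hq/pA.
Qed.

(** By compactness, finitely many of the neighbourhoods of [inward_local_null]
    cover the boundary. *)
Theorem inward_boundary_null A : open A -> bounded_set A ->
  (forall p, closure A p -> exists a r c, inward A p a r c) ->
  mu.-negligible (closure A `\` A).
Proof.
move=> oA bA hin; have [->|/set0P nA] := eqVneq A set0.
  by rewrite closure0 set0D; exact: negligible_set0.
have [m [p [a [r [c [hk cov]]]]]] := inward_cover nA bA hin.
suff : mu.-negligible (\bigcup_k ((closure A `\` A) `&` ball (p k) (r k))).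
  apply: negligibleS => x [clx nx]; have [k _ xp] := cov x clx.
  exists k => //; split => //; rewrite -ball_normE /= distrC; have [r0 _ _] := hk k; lra.
apply: negligible_bigcup => k.
exists ((closure A `\` A) `&` ball (p k) (r k)); split => //; last exact: inward_local_null (hk k).
apply: measurableI; last by apply: open_measurable_rV; exact: ball_open.
apply: measurableD; last exact: open_measurable_rV.
rewrite -[closure A]setCK; apply: measurableC.
by apply: open_measurable_rV; apply: closed_openC; exact: closed_closure.
Qed.

End lipschitz_domains.

(** * Partitions of unity and convergence in the mean *)

Section partition.
Context {R : realType} {d : nat}.
Local Notation pt := 'rV[R]_d.
#[local] Opaque smooth.

(** The telescoping products [b k * \prod_(j < k) (1 - b j)] of plateau
    functions add up to one wherever one of the [b k] is one. *)
Lemma partition_of_unity m (p : nat -> pt) (r : nat -> R) : (forall k, 0 < r k) ->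
  exists chi : nat -> pt -> R,
    [/\ forall k, test_function setT (chi k),
        forall k x, chi k x != 0 -> `|x - p k| < 2 * r k
      & forall x, (exists2 k, (k < m)%N & `|x - p k| < r k) -> \sum_(k < m) chi k x = 1].
Proof.
move=> r0.
have [b hb] := choice (fun k => plateau (p k) (r0 k)).
pose P k (x : pt) := \prod_(j <- iota 0 k) (1 - b j x).
have sP k : smooth (P k).
  apply: smooth_prod => j; have [tb _ _] := hb j.
  rewrite (_ : (fun x => _) = cst 1 - b j)//.
  exact: subspaceB smooth_subspace (smooth_cst 1) (test_smooth tb).
exists (fun k x => P k x * b k x); split.
- by move=> k; have [tb _ _] := hb k; exact: test_mul.
- by move=> k x; rewrite mulf_eq0 negb_or => /andP[_]; have [_ _] := hb k; exact.
move=> x [k km xk].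
have tele n : \sum_(k < n) P k x * b k x = 1 - P n x.
  elim: n => [|n IH]; first by rewrite big_ord0 /P big_nil subrr.
  rewrite big_ord_recr IH /= /P -[in iota 0 n.+1]addn1 iotaD big_cat big_seq1 add0n /=.
  by rewrite mulrBr mulr1 opprB addrA addrAC.
rewrite tele /P (bigD1_seq k) ?iota_uniq ?mem_iota//=.
by have [_ /(_ _ xk)-> _] := hb k; rewrite subrr mul0r subr0.
Qed.

End partition.

Section L2_convergence.
Context {R : realType} {d : nat}.
Local Notation pt := 'rV[R]_d.
Local Notation all := [set: pt].
Implicit Types (f g : pt -> R) (F G : nat -> pt -> R).
#[local] Opaque smooth.

Let mT : measurable all := measurableT.
Let hS : subspace (L2 all (R := R)) := L2_subspace mT.
Let hL : semi_ip (L2 all (R := R)) (ip all) := L2_semi_ip mT.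

Definition L2cvg F f : Prop :=
  [/\ forall n, L2 all (F n), L2 all f & sip_cvg (ip all) F f].

Lemma L2cvgD F G f g : L2cvg F f -> L2cvg G g -> L2cvg (fun n => F n + G n) (f + g).
Proof.
move=> [LF Lf hF] [LG Lg hG]; split; [by move=> n; exact: subspaceD|exact: subspaceD|].
move=> e e0; have e4 : 0 < e / 4 by lra.
have [N1 h1] := hF _ e4; have [N2 h2] := hG _ e4.
exists (maxn N1 N2) => n; rewrite geq_max => /andP[/h1 H1 /h2 H2].
rewrite opprD addrACA; apply: le_lt_trans (sip_sqr_triangle hL _ _) _.
- exact: subspaceB.
- exact: subspaceB.
lra.
Qed.

Lemma L2cvgM F f chi : test_function all chi -> L2cvg F f ->
  L2cvg (fun n x => F n x * chi x) (fun x => f x * chi x).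
Proof.
move=> tc [LF Lf hF]; have [c hc] := test_bounded tc.
have mc : measurable_fun all chi.
  by apply: continuous_measurable_rV => //; exact: smooth_continuous (test_smooth tc).
split; [by move=> n; exact: (L2_mul_bounded mT (LF n) mc hc).1|exact: (L2_mul_bounded mT Lf mc hc).1|].
move=> e e0; have e4 : 0 < e / (c ^+ 2 + 1) by rewrite divr_gt0// ltr_wpDl ?sqr_ge0.
have [N h] := hF _ e4; exists N => n Nn.
have Ld := subspaceB hS (LF n) Lf.
rewrite (_ : _ - _ = (fun x => (F n - f) x * chi x)); last first.
  by apply/funext => x; rewrite -[RHS]/((F n x - f x) * chi x) mulrBl.
apply: le_lt_trans (L2_mul_bounded mT Ld mc hc).2 _.
have := h _ Nn; rewrite ltr_pdivlMr ?ltr_wpDl ?sqr_ge0// => h1.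
have := sip_ge0 hL Ld; nra.
Qed.

(** The order of the quantifiers matters: the displacement [t] serves all large
    [n], so that [n] can be chosen after [t]. *)
Lemma L2cvg_translate F f a : L2cvg F f -> forall e : R, 0 < e ->
  \forall t \near 0^'+, \forall n \near \oo,
    ip all (translate (- (t *: a)) (F n) - F n) (translate (- (t *: a)) (F n) - F n) < e.
Proof.
move=> [LF Lf hF] e e0; have e16 : 0 < e / 16 by lra.
have [del del0 hdel] := translate_continuous Lf e16.
have [N hN] := hF _ e16.
have q0 : 0 < del / (`|a| + 1) by rewrite divr_gt0// ltr_wpDl.
near=> t; exists N => //= n /= /hN {}hN.
have ta : `|- (t *: a)| < del.
  have t0 : 0 < t by near: t; exact: nbhs_right_gt.
  have : t < del / (`|a| + 1) by near: t; exact: nbhs_right_lt.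
  rewrite normrN normrZ gtr0_norm// ltr_pdivlMr ?ltr_wpDl//; nra.
set b := - (t *: a) in ta *.
have Ld := subspaceB hS (LF n) Lf.
have Lt := L2_translate b Ld.
have -> : translate b (F n) - F n = translate b (F n - f) + ((translate b f - f) - (F n - f)).
  by rewrite translateB opprB [X in _ = _ + X]addrA subrK addrA subrK.
have Lw := subspaceB hS (L2_translate b Lf) Lf.
apply: le_lt_trans (sip_sqr_triangle hL Lt (subspaceB hS Lw Ld)) _.
rewrite ip_translate//.
have := sip_sqr_triangle hL Lw (subspaceN hS Ld).
have -> : ip all (- (F n - f)) (- (F n - f)) = ip all (F n - f) (F n - f).
  by apply: eq_Rintegral => x _; exact: mulrNN.
have := hdel _ ta; lra.
Unshelve. all: by end_near. Qed.

Lemma sip_sum_le m (v : 'I_m -> pt -> R) (e : R) : (forall k, L2 all (v k)) ->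
  (forall k, ip all (v k) (v k) <= e) -> 0 <= e ->
  ip all (\sum_k v k) (\sum_k v k) <= 4 ^+ m * e.
Proof.
move=> Lv hv e0; elim: m v Lv hv => [|m IH] v Lv hv.
  by rewrite big_ord0 (sip0l hL) ?mulr_ge0//; exact: hS.1.
rewrite big_ord_recr /=; apply: le_trans (sip_sqr_triangle hL _ (Lv _)) _.
  exact: subspace_sum.
have := IH (fun k => v (widen_ord (leqnSn m) k)) (fun k => Lv _) (fun k => hv _).
have q1 : 1 <= (4 : R) ^+ m by apply: exprn_ege1; rewrite ler1n.
have := hv ord_max; rewrite exprS; move: (4 ^+ m) q1 => q; nra.
Qed.

End L2_convergence.

(** * Test functions are dense among the functions with a weak Hessian *)

Section hessian_coordinates.
Context {R : realType} {d : nat}.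
Local Notation pt := 'rV[R]_d.
Local Notation all := [set: pt].
Implicit Types (f g chi : pt -> R) (i j : 'I_d).
#[local] Opaque smooth partial eps grad div rowdiv.

Let mT : measurable all := measurableT.
Let hL : semi_ip (L2 all (R := R)) (ip all) := L2_semi_ip mT.

(** The identity and the entries of the Hessian, treated uniformly. *)
Definition hess_entry (o : option ('I_d * 'I_d)) f : pt -> R :=
  if o is Some ij then 2^-1 *: (partial ij.2 (partial ij.1 f) + partial ij.1 (partial ij.2 f))
  else f.

Lemma hess_entryE i j f : (fun x => eps (grad f) x i j) = hess_entry (Some (i, j)) f.
Proof. by apply/funext => x; exact: hess_coord. Qed.

Lemma test_hess_entry o A f : test_function A f -> test_function A (hess_entry o f).
Proof.
case: o => [[i j]|//] tf; apply: (subspaceZ _ (test_subspace A)).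
exact: (subspaceD (test_subspace A) (test_partial j (test_partial i tf)) (test_partial i (test_partial j tf))).
Qed.

Lemma hess_entry_translate o a f : hess_entry o (translate a f) = translate a (hess_entry o f).
Proof. by case: o => [[i j]|//] /=; rewrite !partial_translate. Qed.

Lemma hess_entryL o (a : R) f g : smooth f -> smooth g ->
  hess_entry o (a *: f + g) = a *: hess_entry o f + hess_entry o g.
Proof.
case: o => [[i j]|//] sf sg; rewrite -!hess_entryE hess_linear//.
apply/funext => x; apply: etrans (mxE _ _ _ _) _; congr (_ + _); exact: mxE.
Qed.

Lemma hess_entry_sum o m (F : 'I_m -> pt -> R) : (forall k, smooth (F k)) ->
  hess_entry o (\sum_k F k) = \sum_k hess_entry o (F k).
Proof.
have D f g : smooth f -> smooth g -> hess_entry o (f + g) = hess_entry o f + hess_entry o g.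
  by move=> sf sg; have := hess_entryL o 1 sf sg; rewrite !scale1r.
have s0 : smooth (0 : pt -> R) by exact: smooth_subspace.1.
have h0 : hess_entry o 0 = 0.
  by apply: (addrI (hess_entry o 0)); rewrite -D// !addr0.
elim: m F => [|m IH] F sF; first by rewrite !big_ord0.
rewrite !big_ord_recr /= D; [|exact: smooth_sum|exact: sF].
by congr (_ + _); apply: IH => k; exact: sF.
Qed.

Lemma hess_entryB o f g : smooth f -> smooth g ->
  hess_entry o (f - g) = hess_entry o f - hess_entry o g.
Proof.
by move=> sf sg; rewrite addrC -scaleN1r (hess_entryL o (-1) sg sf) scaleN1r addrC.
Qed.

Lemma hess_entryM i j f chi : smooth f -> smooth chi ->
  hess_entry (Some (i, j)) (fun x => f x * chi x) =
  (fun x => hess_entry (Some (i, j)) f x * chi x) + (fun x => f x * hess_entry (Some (i, j)) chi x)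
  + (fun x => partial i f x * partial j chi x) + (fun x => partial j f x * partial i chi x).
Proof.
move=> sf sc.
have P k g h : smooth g -> smooth h -> partial k (fun x => g x * h x) =
    (fun x => partial k g x * h x) + (fun x => g x * partial k h x).
  by move=> sg sh; apply/funext => x; apply: partialM; exact: smooth_derivable.
have PP k l x : partial k (partial l (fun x => f x * chi x)) x =
   partial k (partial l f) x * chi x + partial l f x * partial k chi x
   + (partial k f x * partial l chi x + f x * partial k (partial l chi) x).
  have s1 := smooth_partial l sf; have s2 := smooth_partial l sc.
  rewrite (P l _ _ sf sc).
  rewrite partialD; [|exact: smooth_derivable (smoothM s1 sc)|exact: smooth_derivable (smoothM sf s2)].
  by rewrite (P k _ _ s1 sc) (P k _ _ sf s2).
apply/funext => x.
apply: etrans (congr2 (fun a b => 2^-1 * (a + b)) (PP j i x) (PP i j x)) _.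
rewrite -[RHS]/(2^-1 * (partial j (partial i f) x + partial i (partial j f) x) * chi x +
  f x * (2^-1 * (partial j (partial i chi) x + partial i (partial j chi) x)) +
  partial i f x * partial j chi x + partial j f x * partial i chi x).
move: (partial j (partial i f) x) (partial i (partial j f) x) (partial j (partial i chi) x)
  (partial i (partial j chi) x) (partial i f x) (partial j f x) (partial i chi x) (partial j chi x)
  (f x) (chi x) => a b c e p q r s u v.
by field.
Qed.

(** Integration by parts and the Cauchy-Schwarz inequality. This controls the
    first derivatives, which do not occur in the norm of [H2]. *)
Lemma gradient_interpolation f i : test_function all f ->
  ip all (partial i f) (partial i f) ^+ 2 <=
  ip all f f * ip all (hess_entry (Some (i, i)) f) (hess_entry (Some (i, i)) f).
Proof.
move=> tf; have tp := test_partial i tf; have tpp := test_partial i tp.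
have -> : hess_entry (Some (i, i)) f = partial i (partial i f).
  apply/funext => x.
  rewrite -[LHS]/(2^-1 * (partial i (partial i f) x + partial i (partial i f) x)).
  by move: (partial i _ x) => y; field.
have -> : ip all (partial i f) (partial i f) = - ip all f (partial i (partial i f)).
  by apply: ibp; left; exact: (conj tf (test_smooth tp)).
rewrite sqrrN; apply: (sip_CS2 hL); [exact: (test_L2 mT tf)|exact: (test_L2 mT tpp)].
Qed.

End hessian_coordinates.

Section weak_hessian.
Context {R : realType} {d : nat}.
Local Notation pt := 'rV[R]_d.
Local Notation all := [set: pt].
Local Notation mu := (@lebesgue_rV R d).
Implicit Types (A : set pt) (f g chi rho u : pt -> R) (i j : 'I_d).
#[local] Opaque smooth partial eps grad div rowdiv.

Let mT : measurable all := measurableT.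
Let hS : subspace (L2 all (R := R)) := L2_subspace mT.
Let hL : semi_ip (L2 all (R := R)) (ip all) := L2_semi_ip mT.

(** The translates of [rho] are themselves test functions. *)
Lemma hess_entry_mollify o rho u v : test_function all rho -> L2 all u ->
  (forall psi, test_function all psi -> ip all u (hess_entry o psi) = ip all v psi) ->
  hess_entry o (mollify rho u) = mollify rho v.
Proof.
move=> tr Lu huv.
have tt x : test_function all (translate x rho).
  have [M [M0 hM]] := test_cube tr.
  apply: (@test_functionI _ _ _ (closed_box (const_mx (- (M + `|x|))) (const_mx (M + `|x|)))) => //.
  - exact: smooth_translate (test_smooth tr).
  - exact: compact_closed_box.
  move=> y hy; apply/eqP; apply: contra_notT hy => /hM hy.
  apply/sub_closed_box/cubeE/rV_norm_ltP; first by have := normr_ge0 x; lra.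
  by have := ler_normB (y + x) x; rewrite addrK; lra.
apply/funext => x; rewrite [RHS]/mollify -huv// hess_entry_translate.
case: o huv => [[i j]|//] huv.
transitivity (2^-1 * (mollify (partial j (partial i rho)) u x + mollify (partial i (partial j rho)) u x)).
  exact: (congr2 (fun f g : pt -> R => 2^-1 * (f x + g x)) (mollify_partial2 i j tr Lu) (mollify_partial2 j i tr Lu)).
have Lij k l : L2 all (translate (- x) (partial k (partial l rho))).
  exact: (L2_translate _ (test_L2 mT (test_partial k (test_partial l tr)))).
apply: etrans (esym (sipZr hL _ (subspaceD hS (Lij j i) (Lij i j)) Lu)).
exact: (congr1 _ (esym (sipDr hL (Lij j i) (Lij i j) Lu))).
Qed.

Variable (rho : nat -> pt -> R).
Hypothesis rhoP : forall n, [/\ test_function all (rho n), forall x, 0 <= rho n x,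
  forall x, rho n x != 0 -> `|x| < n.+1%:R^-1 & \int[mu]_x rho n x = 1].

Lemma L2cvg_mollify f : L2 all f -> L2cvg (fun n => mollify (rho n) f) f.
Proof.
move=> Lf; split=> // [n|e e0].
  have [tr r0 rd r1] := rhoP n.
  apply: (mollify_close (e := 4 * ip all f f) tr r0 rd r1 Lf _).1 => a _.
  apply: le_trans (sip_sqr_triangle hL (L2_translate a Lf) (subspaceN hS Lf)) _.
  have -> : ip all (- f) (- f) = ip all f f by apply: eq_Rintegral => x _; exact: mulrNN.
  rewrite ip_translate//; lra.
have e2 : 0 < e / 2 by lra.
have [del del0 hdel] := translate_continuous Lf e2.
have [N hN] := natSinv_small del0; exists N => n /hN Nn.
have [tr r0 rd r1] := rhoP n.
have hr y : rho n y != 0 -> `|y| < del by move=> /rd /lt_trans; apply.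
have he a : `|a| < del -> ip all (translate a f - f) (translate a f - f) <= e / 2.
  by move=> /hdel/ltW.
have := (mollify_close tr r0 hr r1 Lf he).2; lra.
Qed.

Variables (A : set pt) (v : option ('I_d * 'I_d) -> pt -> R).
Hypotheses (bA : bounded_set A) (Lv : forall o, L2 all (v o)).
Hypothesis vA : forall x, ~ A x -> v None x = 0.
Hypothesis weak : forall o psi, test_function all psi ->
  ip all (v None) (hess_entry o psi) = ip all (v o) psi.

Let w n := mollify (rho n) (v None).

Let tw n : test_function all (w n).
Proof. by have [tr _ _ _] := rhoP n; exact: test_mollify tr (Lv _) bA vA. Qed.

Lemma L2cvg_hess_mollify o : L2cvg (fun n => hess_entry o (w n)) (v o).
Proof.
rewrite (_ : (fun n => _) = (fun n => mollify (rho n) (v o))); first exact: L2cvg_mollify.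
apply/funext => n; have [tr _ _ _] := rhoP n.
by apply: hess_entry_mollify => // psi; exact: weak.
Qed.

(** A Cauchy sequence, by interpolation between the functions and their second
    derivatives. *)
Lemma L2cvg_grad_mollify i : exists g, L2cvg (fun n => partial i (w n)) g.
Proof.
have Lp n : L2 all (partial i (w n)) by exact: (test_L2 mT (test_partial i (tw n))).
suff /(L2_complete mT Lp)[g Lg hg] : sip_cauchy (ip all) (fun n => partial i (w n)) by exists g.
move=> e e0.
have cauchy o : sip_cauchy (ip all) (fun n => hess_entry o (w n)).
  by have [LF Lf hF] := L2cvg_hess_mollify o; exact: (sip_cvg_cauchy hL LF Lf hF).
have [N1 h1] := cauchy None e e0; have [N2 h2] := cauchy (Some (i, i)) e e0.
exists (maxn N1 N2) => m n; rewrite !geq_max => /andP[m1 m2] /andP[n1 n2].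
have := h1 _ _ m1 n1; have := h2 _ _ m2 n2.
have sm := test_smooth (tw m); have sn := test_smooth (tw n).
rewrite -hess_entryB// => H2 H1.
have -> : partial i (w m) - partial i (w n) = partial i (w m - w n).
  apply/funext => x; rewrite -[LHS]/(partial i (w m) x - partial i (w n) x).
  have -> : w m - w n = w m + (-1) *: w n by rewrite scaleN1r.
  rewrite (partialD (smooth_derivable sm) (smooth_derivable (smoothZ _ sn))).
  by rewrite (partialZ _ (smooth_derivable sn)) mulN1r.
have twd := subspaceB (test_subspace all) (tw m) (tw n).
have := gradient_interpolation i twd.
have p0 := sip_ge0 hL (test_L2 mT (test_partial i twd)).
have q0 := sip_ge0 hL (test_L2 mT twd).
have r0 := sip_ge0 hL (test_L2 mT (test_hess_entry (Some (i, i)) twd)).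
rewrite /= in H1.
move: (ip _ (partial i _) _) (ip _ (w m - w n) _) (ip _ (hess_entry _ _) _) H1 H2 p0 q0 r0 => p q r H1 H2 p0 q0 r0 H3.
by rewrite ltNge; apply/negP => ep; nra.
Qed.

(** By the product rule, where first derivatives come in. *)
Lemma L2cvg_localized o chi : test_function all chi ->
  exists g, L2cvg (fun n => hess_entry o (fun x => w n x * chi x)) g.
Proof.
move=> tc; case: o => [[i j]|]; last first.
  by exists (fun x => v None x * chi x); exact: L2cvgM tc (L2cvg_hess_mollify None).
have sc := test_smooth tc.
have [gi hi] := L2cvg_grad_mollify i; have [gj hj] := L2cvg_grad_mollify j.
have H := L2cvgD (L2cvgD (L2cvgD (L2cvgM tc (L2cvg_hess_mollify (Some (i, j))))
  (L2cvgM (test_hess_entry (Some (i, j)) tc) (L2cvg_hess_mollify None)))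
  (L2cvgM (test_partial j tc) hi)) (L2cvgM (test_partial i tc) hj).
suff -> : (fun n => hess_entry (Some (i, j)) (fun x => w n x * chi x)) =
    (fun n => (fun x => hess_entry (Some (i, j)) (w n) x * chi x) +
      (fun x => hess_entry None (w n) x * hess_entry (Some (i, j)) chi x) +
      (fun x => partial i (w n) x * partial j chi x) + (fun x => partial j (w n) x * partial i chi x)).
  by eexists; exact: H.
by apply/funext => n; apply: hess_entryM sc; exact: test_smooth (tw n).
Qed.

Lemma w_near n x : w n x != 0 -> exists2 y, A y & `|y - x| < n.+1%:R^-1.
Proof. by have [_ _ hr _] := rhoP n; exact: mollify_out hr vA. Qed.

(** The displacement dominates the width of the mollifier, so that the support
    ends up well inside [A]. *)
Lemma test_pushed chi p a (r c t : R) n : test_function all chi -> inward A p a r c ->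
  (forall x, chi x != 0 -> `|x - p| < r / 2) -> 0 < t -> t < r ->
  2 * n.+1%:R^-1 < c * t -> n.+1%:R^-1 < r / 8 ->
  test_function A (translate (- (t *: a)) (fun x => w n x * chi x)).
Proof.
move=> tc [r0 c0 hin] hc t0 tr; set eta := n.+1%:R^-1 => hct hr8.
have eta0 : 0 < eta by rewrite invr_gt0.
set f := translate _ _.
have fA : closure [set x | f x != 0] `<=` A.
  move=> x /(closure_near eta0)[x' fx' x'x].
  move: fx'; rewrite /= /f /translate mulf_eq0 negb_or => /andP[/w_near[y Ay yx'] /hc hx'].
  have -> : x = x - t *: a + t *: a by rewrite subrK.
  apply: (hin t y) => //; first exact: subset_closure.
    rewrite -(subrK (x' - t *: a) y) -addrA; apply: le_lt_trans (ler_normD _ _) _.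
    by rewrite -/eta in yx'; lra.
  rewrite (_ : x - t *: a - y = (x - x') + ((x' - t *: a) - y)); last first.
    by rewrite !addrA subrK.
  apply: le_lt_trans (ler_normD _ _) _; rewrite [`|x - x'|]distrC [X in _ + X]distrC.
  by rewrite -/eta in yx'; lra.
split => //.
  apply: smooth_translate; apply: smoothM; first exact: test_smooth (tw n).
  exact: test_smooth tc.
apply: bounded_closed_compact; last exact: closed_closure.
by have [M [Mr hM]] := bA; exists M; split => // s Ms x /fA; exact: hM.
Qed.

Hypothesis A0 : A !=set0.
Hypothesis hin : forall p, closure A p -> exists a r c, inward A p a r c.

(** The mollified function is cut into pieces near the points of a finite cover,
    and each piece is pushed inside [A] in its own direction. The displacement
    [t] is fixed first, and then the mollification is chosen finer than [t]. *)
Theorem test_approximation (e : R) : 0 < e ->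
  exists2 phi, test_function A phi &
    forall o, ip all (hess_entry o phi - v o) (hess_entry o phi - v o) < e.
Proof.
move=> e0.
have [m [p [a [r [c [hk cov]]]]]] := inward_cover A0 bA hin.
have r4 k : 0 < r k / 4 by have [r0 _ _] := hk k; rewrite divr_gt0.
have [chi [tchi supp sum1]] := partition_of_unity m p r4.
pose F k n x := w n x * chi k x.
have sF k n : smooth (F k n).
  by apply: smoothM; [exact: test_smooth (tw n)|exact: test_smooth (tchi k)].
have tF k n o : test_function all (hess_entry o (F k n)).
  by apply: test_hess_entry; apply: test_mul; [exact: test_smooth (tw n)|exact: tchi].
(* [4 ^+ m] is the loss in adding up the [m] errors, see [sip_sum_le] *)
have e1 : 0 < e / 8 / 4 ^+ m by rewrite !divr_gt0// exprn_gt0.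
have [t [t0 ht]] : exists t : R, 0 < t /\ forall k : 'I_m, t < r k /\ forall o,
    \forall n \near \oo, ip all (translate (- (t *: a k)) (hess_entry o (F k n)) - hess_entry o (F k n))
      (translate (- (t *: a k)) (hess_entry o (F k n)) - hess_entry o (F k n)) < e / 8 / 4 ^+ m.
  apply: (@filter_ex _ (0 : R)^'+).
  near=> t; split; first by near: t; exact: nbhs_right_gt.
  near: t; apply: filter_forall => k; near=> t; split.
    by near: t; apply: nbhs_right_lt; have [] := hk k.
  near: t; apply: filter_forall => o.
  have [g hg] := L2cvg_localized o (tchi k).
  exact: (L2cvg_translate (a k) hg e1).
have [n [hn1 hn2]] : exists n, (forall k : 'I_m, [/\ forall o,
    ip all (translate (- (t *: a k)) (hess_entry o (F k n)) - hess_entry o (F k n))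
      (translate (- (t *: a k)) (hess_entry o (F k n)) - hess_entry o (F k n)) < e / 8 / 4 ^+ m,
    2 * n.+1%:R^-1 < c k * t & n.+1%:R^-1 < r k / 8]) /\
    forall o, ip all (hess_entry o (w n) - v o) (hess_entry o (w n) - v o) < e / 4.
  have small (s : R) : 0 < s -> \forall n \near \oo, n.+1%:R^-1 < s.
    by move=> s0; exact: (near_infty_natSinv_lt (PosNum s0)).
  apply: (@filter_ex _ \oo).
  near=> n; split.
    near: n; apply: filter_forall => k; near=> n; split.
    - by near: n; apply: filter_forall => o; have [_] := ht k; exact.
    - rewrite mulrC -ltr_pdivlMr//; near: n; apply: small.
      by have [_ c0 _] := hk k; rewrite divr_gt0// mulr_gt0.
    - by near: n; apply: small; have [r0 _ _] := hk k; rewrite divr_gt0.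
  near: n; apply: filter_forall => o; have [_ _ hcv] := L2cvg_hess_mollify o.
  have e4 : 0 < e / 4 by lra.
  by have [N hN] := hcv _ e4; exists N.
pose phi := \sum_(k < m) translate (- (t *: a k)) (F k n).
exists phi.
  apply: (subspace_sum (test_subspace A)) => k; have [tr _] := ht k; have [_ h2 h3] := hn1 k.
  apply: (test_pushed (tchi k) (hk k)) => // x /supp; lra.
move=> o.
have wF : w n = \sum_(k < m) F k n.
  apply/funext => x; rewrite fct_sumE -mulr_sumr.
  have [->|wx] := eqVneq (w n x) 0; first by rewrite mul0r.
  rewrite sum1 ?mulr1//; have [y Ay yx] := w_near wx.
  have [k km yk] := cov _ (subset_closure Ay); exists k => //.
  have [_ _ /=] := hn1 (Ordinal km) => hr.
  rewrite -(subrK y x) -addrA; apply: le_lt_trans (ler_normD _ _) _.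
  by rewrite [`|x - y|]distrC; move: yx hr; move: n.+1%:R^-1 => s; lra.
pose D k := translate (- (t *: a k)) (hess_entry o (F k n)) - hess_entry o (F k n).
have LF k : L2 all (hess_entry o (F k n)) by exact: test_L2 mT (tF k n o).
have LD k : L2 all (D k) by exact: subspaceB hS (L2_translate _ (LF k)) (LF k).
have phiE : hess_entry o phi - v o = \sum_(k < m) D k + (hess_entry o (w n) - v o).
  rewrite /phi hess_entry_sum; last by move=> k; exact: smooth_translate.
  rewrite wF hess_entry_sum// addrA; congr (_ - _).
  rewrite -big_split /=; apply: eq_bigr => k _; rewrite /D subrK.
  exact: hess_entry_translate.
have Lw : L2 all (hess_entry o (w n)) by exact: test_L2 mT (test_hess_entry o (tw n)).
rewrite phiE; apply: le_lt_trans (sip_sqr_triangle hL (subspace_sum hS LD) (subspaceB hS Lw (Lv o))) _.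
have := @sip_sum_le _ _ m D (e / 8 / 4 ^+ m) LD (fun k => ltW (let: And3 h _ _ := hn1 k in h o)) (ltW e1).
rewrite mulrC divfK ?gt_eqF ?exprn_gt0//; have := hn2 o; lra.
Unshelve. all: by end_near. Qed.

End weak_hessian.

(** * The spaces on one element *)

Section element_spaces.
Context {R : realType} {d : nat}.
Local Notation pt := 'rV[R]_d.
Variables (A : set pt) (oA : open A) (bA : bounded_set A).
Implicit Types (f g z : pt -> R) (Th H : pt -> 'M[R]_d).
#[local] Opaque smooth partial eps grad div rowdiv.

Let mA : measurable A := open_measurable_rV oA.
Let hL : semi_ip (L2 A) (ip A) := L2_semi_ip mA.
Let hM : semi_ip (L2sym A) (ipM A) := L2sym_semi_ip mA.

Let smL : smooth `<=` L2 A := smooth_in_L2 oA bA (@subset_refl _ smooth).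
Let hsL := hess_in_L2 oA bA (@subset_refl _ smooth).
Let ssL : smooth_sym `<=` L2sym A := fun Th sT => L2sym_smooth mA bA sT.
Let ddL : forall Th, smooth_sym Th -> L2 A (div (rowdiv Th)) := divdiv_in_L2 oA bA.
Let hcl := hess_closable oA bA.
Let dcl := divdiv_closable oA bA.

Lemma H2_dom : H2 A = closure_dom (L2 A) (ip A) (L2sym A) (ipM A) smooth (fun f => eps (grad f)).
Proof.
apply/seteqP; split => z [H hH]; exists H; apply/(hess_closureE A z H (@subset_refl _ smooth)); exact: hH.
Qed.

Lemma Hdivdiv_dom :
  Hdivdiv A = closure_dom (L2sym A) (ipM A) (L2 A) (ip A) smooth_sym (fun Th => div (rowdiv Th)).
Proof. by apply/seteqP; split => Th [g hg]; exists g; apply/ddiv_closureE; exact: hg. Qed.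

Lemma hess_op : hess A = closure_op (L2 A) (ip A) (L2sym A) (ipM A) smooth (fun f => eps (grad f)).
Proof.
apply/funext => z; congr xget; apply/seteqP.
by split => H h; apply/(hess_closureE A z H (@subset_refl _ smooth)).
Qed.

Lemma divdiv_op :
  divdiv A = closure_op (L2sym A) (ipM A) (L2 A) (ip A) smooth_sym (fun Th => div (rowdiv Th)).
Proof.
by apply/funext => Th; congr xget; apply/seteqP; split => g h; apply/ddiv_closureE.
Qed.

Lemma ip2_graph : ip2 A = graph_ip (L2 A) (ip A) (L2sym A) (ipM A) smooth (fun f => eps (grad f)).
Proof. by apply/funext => z; apply/funext => z'; rewrite /ip2 hess_op. Qed.

Lemma ipdd_graph :
  ipdd A = graph_ip (L2sym A) (ipM A) (L2 A) (ip A) smooth_sym (fun Th => div (rowdiv Th)).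
Proof. by apply/funext => z; apply/funext => z'; rewrite /ipdd divdiv_op. Qed.

Lemma H2_semi_ip : semi_ip (H2 A) (ip2 A).
Proof.
rewrite H2_dom ip2_graph.
exact: (graph_semi_ip hL hM smooth_subspace smL hsL (@hess_linear R d) hcl).
Qed.

Lemma H2_complete : sip_complete (H2 A) (ip2 A).
Proof.
rewrite H2_dom ip2_graph.
exact: (graph_complete hL hM smooth_subspace smL hsL (@hess_linear R d) hcl (L2_complete mA) (L2sym_complete mA)).
Qed.

Lemma Hdivdiv_semi_ip : semi_ip (Hdivdiv A) (ipdd A).
Proof.
rewrite Hdivdiv_dom ipdd_graph.
exact: (graph_semi_ip hM hL (smooth_sym_subspace) ssL ddL (@divdiv_linear R d) dcl).
Qed.

Lemma Hdivdiv_complete : sip_complete (Hdivdiv A) (ipdd A).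
Proof.
rewrite Hdivdiv_dom ipdd_graph.
exact: (graph_complete hM hL (smooth_sym_subspace) ssL ddL (@divdiv_linear R d) dcl (L2sym_complete mA) (L2_complete mA)).
Qed.

Lemma H2_ext z z' : H2 A z' -> L2 A z -> ip A (z - z') (z - z') = 0 ->
  H2 A z /\ ip2 A (z - z') (z - z') = 0.
Proof.
rewrite H2_dom ip2_graph.
exact: (closure_dom_ext hL hM smooth_subspace smL hsL (@hess_linear R d) hcl).
Qed.

Lemma Hdivdiv_ext Th Th' : Hdivdiv A Th' -> L2sym A Th -> ipM A (Th - Th') (Th - Th') = 0 ->
  Hdivdiv A Th /\ ipdd A (Th - Th') (Th - Th') = 0.
Proof.
rewrite Hdivdiv_dom ipdd_graph.
exact: (closure_dom_ext hM hL smooth_sym_subspace ssL ddL (@divdiv_linear R d) dcl).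
Qed.

Lemma H2_graph z : H2 A z -> hess_graph A smooth z (hess A z).
Proof. by rewrite H2_dom hess_op; exact: closure_opP. Qed.

Lemma Hdivdiv_graph Th : Hdivdiv A Th -> divdiv_graph A Th (divdiv A Th).
Proof. by rewrite Hdivdiv_dom divdiv_op; exact: closure_opP. Qed.

Lemma H2_L2 z : H2 A z -> L2 A z.
Proof. by move=> [H []]. Qed.

Lemma hess_L2 z : H2 A z -> L2sym A (hess A z).
Proof. by move=> /H2_graph[]. Qed.

Lemma Hdivdiv_L2 Th : Hdivdiv A Th -> L2sym A Th.
Proof. by move=> [H []]. Qed.

Lemma divdiv_L2 Th : Hdivdiv A Th -> L2 A (divdiv A Th).
Proof. by move=> /Hdivdiv_graph[]. Qed.

Lemma hess_graph_H2 z H : hess_graph A smooth z H -> H2 A z.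
Proof. by move=> h; rewrite H2_dom; exists H. Qed.

Lemma divdiv_graph_H Th g : divdiv_graph A Th g -> Hdivdiv A Th.
Proof. by move=> h; rewrite Hdivdiv_dom; exists g. Qed.

Lemma hess_uniq z z' H H' : hess_graph A smooth z H -> hess_graph A smooth z' H' ->
  ip A (z - z') (z - z') = 0 -> ipM A (H - H') (H - H') = 0.
Proof. exact: (graph_closure_uniq hL hM smooth_subspace smL hsL (@hess_linear R d) hcl). Qed.

Lemma divdiv_uniq Th Th' g g' : divdiv_graph A Th g -> divdiv_graph A Th' g' ->
  ipM A (Th - Th') (Th - Th') = 0 -> ip A (g - g') (g - g') = 0.
Proof. exact: (graph_closure_uniq hM hL smooth_sym_subspace ssL ddL (@divdiv_linear R d) dcl). Qed.

Lemma hess_ipL (a : R) z z' H : H2 A z -> H2 A z' -> L2sym A H ->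
  ipM A (hess A (a *: z + z')) H = a * ipM A (hess A z) H + ipM A (hess A z') H.
Proof.
rewrite H2_dom hess_op => hz hz' LH.
exact: (closure_opL hL hM smooth_subspace smL hsL (@hess_linear R d) hcl).
Qed.

Lemma divdiv_ipL (a : R) Th Th' g : Hdivdiv A Th -> Hdivdiv A Th' -> L2 A g ->
  ip A (divdiv A (a *: Th + Th')) g = a * ip A (divdiv A Th) g + ip A (divdiv A Th') g.
Proof.
rewrite Hdivdiv_dom divdiv_op => hz hz' LH.
exact: (closure_opL hM hL smooth_sym_subspace ssL ddL (@divdiv_linear R d) dcl).
Qed.

Lemma smooth_sym_divdiv Th : smooth_sym Th -> divdiv_graph A Th (div (rowdiv Th)).
Proof. exact: (graph_closureD hM hL ssL ddL). Qed.

(** Integration by parts; the boundary terms vanish since [z] is a limit of test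
    functions. The two limits are taken one after the other. *)
Lemma closure_duality z H Th g : hess_graph A (test_function A) z H -> divdiv_graph A Th g ->
  ip A g z = ipM A Th H.
Proof.
move=> hz hT.
have ts : test_function A `<=` smooth by move=> f; exact: test_smooth.
have tL := smooth_in_L2 oA bA ts; have hsL' := hess_in_L2 oA bA ts.
have [LT Lg _] := hT; have [Lz LH _] := hz.
rewrite ipC (sipC hM LT LH); apply/esym.
apply: (graph_closure_dual hL hM tL hsL' hz LT Lg) => phi tphi.
rewrite (sipC hM (hsL' _ tphi) LT) ipC; apply/esym.
apply: (graph_closure_dual hM hL ssL ddL hT (tL _ tphi) (hsL' _ tphi)) => Th' sTh'.
rewrite ipC -(hess_divdiv_duality mA bA (test_smooth tphi) sTh').
  exact: (sipC hM (hsL' _ tphi) (ssL sTh')).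
by move=> i j; left; exact: (conj tphi (sTh'.1 i j)).
Qed.

End element_spaces.

Section restriction.
Context {R : realType} {d : nat}.
Local Notation pt := 'rV[R]_d.
Local Notation mu := (@lebesgue_rV R d).
Implicit Types (A B : set pt) (f g z : pt -> R) (Th H M : pt -> 'M[R]_d).
#[local] Opaque smooth partial eps grad div rowdiv.

Lemma ip_le_sub A B f : measurable A -> measurable B -> A `<=` B -> L2 B f -> ip A f f <= ip B f f.
Proof.
move=> mA mB AB Lf; rewrite -lee_fin -!ip_sqrE//; last exact: L2S Lf.
apply: ge0_subset_integral => //.
  by have [mf _] := Lf; apply/measurable_EFinP; exact: measurable_funX.
by move=> x _; rewrite lee_fin sqr_ge0.
Qed.

Lemma L2symS A B M : measurable A -> measurable B -> A `<=` B -> L2sym B M -> L2sym A M.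
Proof.
move=> mA mB AB /(L2symP mB)[LM sM]; apply/(L2symP mA); split.
  by move=> i j; exact: L2S (LM i j).
by move=> x /AB; exact: sM.
Qed.

Lemma ipM_le_sub A B M : measurable A -> measurable B -> A `<=` B -> L2sym B M ->
  ipM A M M <= ipM B M M.
Proof.
move=> mA mB AB LM; have LA := L2symS mA mB AB LM.
rewrite (ipM_sum mA LA LA) (ipM_sum mB LM LM).
by do 2 (apply: ler_sum => ? _); apply: ip_le_sub => //; exact: L2sym_coord.
Qed.

Lemma hess_graphS D A B z H : open A -> open B -> bounded_set B -> A `<=` B -> D `<=` smooth ->
  hess_graph B D z H -> hess_graph A D z H.
Proof.
move=> oA oB bB AB Ds [Lz LH h].
have mA := open_measurable_rV oA; have mB := open_measurable_rV oB.
split; [exact: L2S Lz|exact: L2symS LH|] => e /h[u Du [h1 h2]]; exists u => //.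
split; [apply: le_lt_trans h1; apply: ip_le_sub|apply: le_lt_trans h2; apply: ipM_le_sub] => //.
  by apply: subspaceB (L2_subspace mB) _ Lz; exact: (smooth_in_L2 oB bB Ds).
by apply: subspaceB (L2sym_subspace mB) _ LH; exact: (hess_in_L2 oB bB Ds).
Qed.

Lemma divdiv_graphS A B Th g : open A -> open B -> bounded_set B -> A `<=` B ->
  divdiv_graph B Th g -> divdiv_graph A Th g.
Proof.
move=> oA oB bB AB [LT Lg h].
have mA := open_measurable_rV oA; have mB := open_measurable_rV oB.
split; [exact: L2symS LT|exact: L2S Lg|] => e /h[u Du [h1 h2]]; exists u => //.
split; [apply: le_lt_trans h1; apply: ipM_le_sub|apply: le_lt_trans h2; apply: ip_le_sub] => //.
  by apply: subspaceB (L2sym_subspace mB) _ LT; exact: L2sym_smooth.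
by apply: subspaceB (L2_subspace mB) _ Lg; exact: divdiv_in_L2.
Qed.

Lemma hess_graph_sub D D' A z H : D `<=` D' -> hess_graph A D z H -> hess_graph A D' z H.
Proof. by move=> DD [Lz LH h]; split => // e /h[u /DD Du hu]; exists u. Qed.

Lemma L2_restrict A f : measurable A -> L2 A f -> L2 [set: pt] (f \_ A).
Proof.
move=> mA [mf intf]; split; first by apply/(measurable_restrictT _ mA).
rewrite (_ : (fun x => _) = (fun x => (f x ^+ 2)%:E) \_ A).
  by apply/(integrable_mkcond _ mA).
apply/funext => x; rewrite !patchE; case: ifP => // _.
by rewrite expr0n.
Qed.

Lemma ip_restrict A f g : ip [set: pt] (f \_ A) g = ip A f g.
Proof.
rewrite -(@ip_supp _ _ A); last by move=> x nAx; rewrite patchE memNset// mul0r.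
by apply: eq_Rintegral => x; rewrite patchE => ->.
Qed.

(** Extended by zero, [u] has the weak Hessian [h] on the whole space: the
    tensors [Th] need not vanish on the boundary, and this is how the boundary
    conditions are encoded. *)
Theorem weak_hess_H20 A u h : open A -> A !=set0 -> bounded_set A -> lipschitz_boundary A ->
  L2 A u -> L2sym A h ->
  (forall Th, smooth_sym Th -> ip A u (div (rowdiv Th)) = ipM A h Th) ->
  hess_graph A (test_function A) u h.
Proof.
move=> oA A0 bA lA Lu Lh weak; have mA := open_measurable_rV oA.
pose v (o : option ('I_d * 'I_d)) : pt -> R :=
  (if o is Some ij then fun x => h x ij.1 ij.2 else u) \_ A.
have Lv o : L2 setT (v o).
  by apply: L2_restrict => //; case: o => [[i j]|//]; exact: L2sym_coord.
have vA x : ~ A x -> v None x = 0.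
  by move=> nAx; rewrite /v patchE memNset.
have [_ sh] := (L2symP mA h).1 Lh.
have weak' o psi : test_function setT psi -> ip setT (v None) (hess_entry o psi) = ip setT (v o) psi.
  move=> tpsi; rewrite !ip_restrict; case: o => [[i j]|//]; have spsi := test_smooth tpsi.
  transitivity (ip A u (div (rowdiv (fun x => psi x *: sym_unit i j)))).
    apply: eq_Rintegral => x _; congr (_ * _); apply/esym; apply: etrans (divdiv_sym_unit i j x spsi) _.
    exact: hess_coord.
  rewrite weak; last exact: smooth_sym_unit.
  apply: eq_Rintegral => x; rewrite inE => Ax.
  by rewrite frobZr frob_sym_unit -{2}(sh x Ax) mxE /=; field.
have [rho rhoP] : exists rho : nat -> pt -> R, forall n, [/\ test_function setT (rho n),
    forall x, 0 <= rho n x, forall x, rho n x != 0 -> `|x| < n.+1%:R^-1 & \int[mu]_x rho n x = 1].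
  have [|rho hr] := @choice _ _ (fun n (r : pt -> R) => [/\ test_function setT r,
    forall x, 0 <= r x, forall x, r x != 0 -> `|x| < n.+1%:R^-1 & \int[mu]_x r x = 1]).
    by move=> n; apply: mollifier; rewrite invr_gt0.
  by exists rho.
split => // e e0.
(* small enough for the sum over all entries of the Hessian *)
pose e' := e / (d * d).+2%:R.
have e'0 : 0 < e' by rewrite divr_gt0.
have [phi tphi hphi] := test_approximation rhoP bA Lv vA weak' A0
  (fun p => @lipschitz_inward _ _ A p oA lA) e'0.
have Lo o : L2 setT (hess_entry o phi - v o).
  exact: subspaceB (L2_subspace measurableT) (test_L2 measurableT (test_hess_entry o tphi)) (Lv o).
have le_o o f : (forall x, A x -> f x = (hess_entry o phi - v o) x) -> ip A f f <= e'.
  move=> hf; apply/ltW; apply: le_lt_trans (hphi o).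
  rewrite (_ : ip A f f = ip A (hess_entry o phi - v o) (hess_entry o phi - v o)).
    exact: ip_le_sub.
  by apply: eq_Rintegral => x; rewrite inE => Ax; rewrite hf.
exists phi => //; split.
  apply: (@le_lt_trans _ _ e').
    apply: (le_o None) => x Ax; rewrite -[LHS]/(phi x - u x) -[RHS]/(phi x - v None x).
    by rewrite /v patchE mem_set.
  by rewrite /e' ltr_pdivrMr// ltr_pMr// ltr1n.
have LH := L2sym_smooth mA bA (smooth_sym_hess (test_smooth tphi)).
have LD := subspaceB (L2sym_subspace mA) LH Lh.
rewrite (ipM_sum mA LD LD).
apply: (@le_lt_trans _ _ (\sum_(i < d) \sum_(j < d) e')).
  apply: ler_sum => i _; apply: ler_sum => j _.
  apply: (le_o (Some (i, j))) => x Ax.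
  transitivity (eps (grad phi) x i j - h x i j).
    by rewrite [LHS]mxE [X in _ + X]mxE.
  apply: etrans (congr1 (fun a => a - h x i j) (hess_coord phi x i j)) _.
  rewrite -[RHS]/(hess_entry (Some (i, j)) phi x - v (Some (i, j)) x).
  by rewrite /v patchE mem_set.
rewrite !sumr_const !card_ord -mulrnA -mulr_natr /e' mulrAC ltr_pdivrMr//.
by rewrite ltr_pM2l// ltr_nat ltnW.
Qed.

End restriction.

(** * Poincare inequality *)

Section poincare.
Context {R : realType} {d : nat}.
Local Notation pt := 'rV[R]_d.
Local Notation all := [set: pt].
Implicit Types (A : set pt) (f z : pt -> R) (H : pt -> 'M[R]_d).

Lemma partial_coord i : partial i (fun x : pt => x 0 i) = cst (1 : R).
Proof.
apply/funext => x; have hd := is_derive_coord i i x.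
by rewrite /partial (@derive_val _ _ _ _ _ _ _ hd) eqxx.
Qed.

#[local] Opaque smooth partial eps grad div rowdiv.

Let mT : measurable all := measurableT.
Let hL : semi_ip (L2 all (R := R)) (ip all) := L2_semi_ip mT.

(** Integrate the derivative of [x 0 i * f x ^+ 2], and apply the Cauchy-Schwarz
    inequality. *)
Lemma poincare_partial A (m : R) f i : open A -> (forall x : pt, A x -> `|x| <= m) ->
  test_function A f -> ip all f f <= 4 * m ^+ 2 * ip all (partial i f) (partial i f).
Proof.
move=> oA hm tf; have tf' := test_functionS (@subsetT _ A) tf; have sf := test_smooth tf.
have Lf := test_L2 mT tf'; have Lp := test_L2 mT (test_partial i tf').
(* the coordinate, cut off where [f] vanishes in order to be bounded *)
pose g : pt -> R := (fun x : pt => x 0 i) \_ A.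
have mg : measurable_fun all g.
  by apply/(measurable_restrictT _ (open_measurable_rV oA)); apply: measurable_funS (measurable_coord 0 i).
have gm x : `|g x| <= `|m|.
  rewrite /g patchE; case: ifPn => [|_]; last by rewrite normr0.
  rewrite inE => Ax; apply: le_trans (ler_norm m); apply: le_trans (hm x Ax).
  exact: (rV_norm_leP _ (normr_ge0 x)).2.
have [Lfg hfg] := L2_mul_bounded mT Lf mg gm.
have parts : ip all f f = - 2 * ip all (fun x => f x * g x) (partial i f).
  have h : ibp_pair all (fun x : pt => x 0 i) (fun x => f x * f x).
    by right; exact: (conj (smooth_coord i) (test_mul sf tf')).
  transitivity (ip all (partial i (fun x : pt => x 0 i)) (fun x => f x * f x)).
    by rewrite partial_coord; apply: eq_Rintegral => x _; rewrite mul1r.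
  apply: etrans (ibp i h) _; rewrite mulNr.
  suff -> : ip all (fun x : pt => x 0 i) (partial i (fun x => f x * f x)) =
      2 * ip all (fun x => f x * g x) (partial i f) by [].
  rewrite -(sipZl hL 2 Lfg Lp).
  apply: eq_Rintegral => x _; rewrite (partialM (smooth_derivable sf) (smooth_derivable sf)).
  rewrite -[RHS]/(2 * (f x * g x) * partial i f x) /g patchE.
  case: ifPn => [_|/negP nA]; first by ring.
  by rewrite (test_sub tf) ?inE//; first ring; move=> Ax; apply: nA; rewrite inE.
have := sip_CS2 hL Lfg Lp; rewrite real_normK ?num_real// in hfg.
have p0 := sip_ge0 hL Lf; have q0 := sip_ge0 hL Lp.
move: parts hfg p0 q0; move: (ip all f f) (ip all (partial i f) (partial i f)) (ip _ (fun _ => _) (partial i f)) (ip all (fun _ => _) _).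
move=> p q s r -> hr p0 q0 hs.
have h1 : s ^+ 2 <= m ^+ 2 * (- 2 * s) * q by apply: le_trans hs _; rewrite ler_wpM2r.
have [->|s0] := eqVneq s 0; first by rewrite mulr0 mulr_ge0// mulr_ge0// sqr_ge0.
have s1 : s < 0 by rewrite lt_neqAle s0/=; lra.
rewrite -(ler_pM2r (_ : 0 < - s)); last lra.
have := sqr_ge0 m; move: (m ^+ 2) h1 => m2 h1 m20.
nra.
Qed.

(** The function is bounded by a first derivative, and this one, by
    interpolation, by the function and a second derivative. *)
Lemma poincare A (i : 'I_d) : open A -> bounded_set A ->
  exists2 C : R, 0 <= C & forall z H, hess_graph A (test_function A) z H ->
    ip A z z <= C * ipM A H H.
Proof.
move=> oA bA; have mA := open_measurable_rV oA.
have [m [mr hm]] := bA; pose m1 := `|m| + 1.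
have hm1 x : A x -> `|x| <= m1.
  by apply: hm; rewrite /m1 (le_lt_trans (ler_norm m))// ltrDl.
have bound f : test_function A f -> ip A f f <= 16 * m1 ^+ 4 * ipM A (eps (grad f)) (eps (grad f)).
  move=> tf; have tf' := test_functionS (@subsetT _ A) tf; have sf := test_smooth tf.
  have LH := L2sym_smooth mA bA (smooth_sym_hess sf).
  have h1 := poincare_partial i oA hm1 tf.
  have h2 := gradient_interpolation i tf'.
  have h3 := ipM_coord_le mA i i LH; rewrite hess_entryE in h3.
  have te := test_hess_entry (Some (i, i)) tf.
  have E g : test_function A g -> ip A g g = ip all g g.
    by move=> tg; apply: ip_supp => x nAx; rewrite (test_sub tg nAx) mul0r.
  rewrite (E _ te) in h3; rewrite (E _ tf).
  have p0 := sip_ge0 hL (test_L2 mT tf').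
  have q0 := sip_ge0 hL (test_L2 mT (test_partial i tf')).
  have s0 := sip_ge0 hL (test_L2 mT (test_functionS (@subsetT _ A) te)).
  have m0 := sqr_ge0 m1.
  apply: (@le_trans _ _ (16 * m1 ^+ 4 * ip all (hess_entry (Some (i, i)) f) (hess_entry (Some (i, i)) f))).
    rewrite (exprM m1 2 2).
    move: (ip all f f) (ip _ (partial i f) _) (ip _ (hess_entry _ _) _) (m1 ^+ 2) h1 h2 p0 q0 s0 m0 => p q s u h1 h2 p0 q0 s0 u0.
    have [qz|qn] := eqVneq q 0; first by rewrite qz mulr0 in h1; apply: le_trans h1 _; rewrite !mulr_ge0// sqr_ge0.
    have q1 : 0 < q by rewrite lt_neqAle eq_sym qn.
    have h4 : q * q <= q * (4 * u * s).
      by rewrite -expr2; apply: le_trans h2 _; apply: le_trans (ler_wpM2r s0 h1) _; rewrite -!mulrA [q * _]mulrC -!mulrA [s * q]mulrC; lra.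
    rewrite ler_pM2l// in h4.
    apply: le_trans h1 _; apply: le_trans (ler_wpM2l _ h4) _; first by rewrite mulr_ge0.
    by rewrite expr2; lra.
  by rewrite ler_wpM2l// mulr_ge0// exprn_even_ge0.
set C := 16 * m1 ^+ 4 in bound.
have C0 : 0 <= C by rewrite mulr_ge0// exprn_even_ge0.
exists (4 * C); first by rewrite mulr_ge0.
move=> z H [Lz LH happ].
have hA := L2_semi_ip mA (d := d); have hM := L2sym_semi_ip mA (d := d).
apply/ler_addgt0Pr => e e0.
have e'0 : 0 < e / (4 * C + 2) by rewrite divr_gt0// ltr_wpDl// mulr_ge0.
have [u tu [h1 h2]] := happ _ e'0.
have Lu := test_L2 mA tu; have LHu := L2sym_smooth mA bA (smooth_sym_hess (test_smooth tu)).
have h3 := sip_sqr_triangle hA (subspaceB (sip_sub hA) Lz Lu) Lu; rewrite subrK in h3.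
have h4 := sip_sqr_triangle hM (subspaceB (sip_sub hM) LHu LH) LH; rewrite subrK in h4.
rewrite (sip_symB hA Lz Lu) in h3.
have h5 := bound _ tu.
have he : e / (4 * C + 2) * (4 * C + 2) = e by rewrite divfK// gt_eqF// ltr_wpDl// mulr_ge0.
have := ler_wpM2l C0 h4; have := ler_wpM2l C0 (ltW h2).
move: he h1 h3 h5; move: (e / _) => r; nra.
Qed.

End poincare.

(** * The constitutive tensor *)

Section compliance.
Context {R : realType} {d : nat}.
Local Notation pt := 'rV[R]_d.
Implicit Types (K L : 'M[R]_d) (M : pt -> 'M[R]_d) (A : set pt).

Lemma frob_scalar (c : R) L : frob c%:M L = c * \tr L.
Proof.
rewrite /frob /mxtrace mulr_sumr; apply: eq_bigr => i _.
rewrite (bigD1 i)//= big1 ?addr0 => [|j ji]; first by rewrite mxE eqxx mulr1n.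
by rewrite mxE eq_sym (negbTE ji) mulr0n mul0r.
Qed.

(** The constitutive tensor and its inverse are both of this form. The
    eigenvalues are [a], on traceless matrices, and [a + b * d%:R], on multiples
    of the identity. *)
Definition isotropic (a b : R) K : 'M[R]_d := a *: K + b *: (\tr K)%:M.

Definition isotropic_field a b M : pt -> 'M[R]_d := fun x => isotropic a b (M x).

Lemma isotropicL a b (k : R) K L : isotropic a b (k *: K + L) = k *: isotropic a b K + isotropic a b L.
Proof.
rewrite /isotropic (_ : \tr (k *: K + L) = k * \tr K + \tr L); last by rewrite linearP.
apply/matrixP => i j; rewrite !mxE.
by case: (i == j); rewrite ?mulr1n ?mulr0n; ring.
Qed.

Lemma isotropic_sym a b K : K^T = K -> (isotropic a b K)^T = isotropic a b K.
Proof. by move=> sK; rewrite linearD !linearZ /= tr_scalar_mx sK. Qed.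

(** The quantity [s] is positive, by positive definiteness at the identity
    matrix, so that the trace part can be inverted. *)
Lemma Cinv_isotropic E t nu : (0 < d)%N -> 0 < E -> 0 < t -> -1 < nu -> nu <= 2^-1 ->
  @Ctens_posdef R d E t nu -> exists a b, [/\ 0 < a, 0 < a + b * d%:R &
    forall K, K^T = K -> Cinv E t nu K = isotropic a b K].
Proof.
move=> d0 E0 t0 nu1 nu2 pos.
have n1 : 0 < 1 - nu by have := @invr_gt0 R 2; lra.
set D := E * t ^+ 3 / (12 * (1 - nu ^+ 2)).
have D0 : 0 < D.
  rewrite divr_gt0// ?mulr_gt0 ?exprn_gt0//.
  by rewrite (_ : 1 - nu ^+ 2 = (1 - nu) * (1 + nu)) ?mulr_gt0//; [lra|ring].
have dR : 0 < d%:R :> R by rewrite ltr0n.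
have trI c : \tr (c%:M : 'M[R]_d) = c * d%:R by rewrite mxtrace_scalar mulr_natr.
pose s := nu * d%:R + (1 - nu).
have s0 : 0 < s.
  have I0 : (1%:M : 'M[R]_d) != 0.
    apply/negP => /eqP/matrixP/(_ (Ordinal d0) (Ordinal d0)); rewrite !mxE eqxx /=.
    by move/eqP; rewrite oner_eq0.
  have := pos 1%:M (tr_scalar_mx _ _) I0.
  rewrite /Ctens -/D frobC frob_scalar mul1r linearZ linearD linearZ /= !trI.
  rewrite mul1r pmulr_rgt0// -mulrDl mulrC pmulr_rgt0//.
exists (D * (1 - nu))^-1, (- (D * (1 - nu))^-1 * nu / s).
have Dn0 : 0 < D * (1 - nu) by rewrite mulr_gt0.
have Dn : D != 0 by rewrite gt_eqF.
have nn : 1 - nu != 0 by rewrite gt_eqF.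
have sn : s != 0 by rewrite gt_eqF.
have ab : (D * (1 - nu))^-1 + - (D * (1 - nu))^-1 * nu / s * d%:R = (D * s)^-1.
  have sE : nu * d%:R = s - (1 - nu) by rewrite /s; ring.
  rewrite -[_ / s * _]mulrA [s^-1 * _]mulrC mulrA -[_ * nu * _]mulrA sE.
  by clearbody s; field; rewrite Dn nn sn.
split; [by rewrite invr_gt0|by rewrite ab invr_gt0 mulr_gt0|].
move=> K sK; set b := - _ * nu / s; set a := _^-1.
have CK : Ctens E t nu (isotropic a b K) = K.
  have trF : \tr (isotropic a b K) = (D * s)^-1 * \tr K.
    by rewrite /isotropic mxtraceD !mxtraceZ trI -ab -/a -/b; ring.
  rewrite /Ctens -/D trF /isotropic.
  apply/matrixP => i j; rewrite !mxE.
  rewrite /a /b -/s; case: (i == j); rewrite ?mulr1n ?mulr0n; field; rewrite ?Dn ?nn ?sn//.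
rewrite /Cinv; case: xgetP => [L _ [sL CL]|]; last first.
  by move=> /(_ (isotropic a b K))[]; split => //; exact: isotropic_sym.
apply/eqP; rewrite -subr_eq0; apply: contraT => h.
have := pos (L - isotropic a b K) _ h.
rewrite linearB /= sL isotropic_sym// => /(_ erefl).
have CB (X Y : 'M[R]_d) : Ctens E t nu (X - Y) = Ctens E t nu X - Ctens E t nu Y.
  rewrite /Ctens (_ : \tr (X - Y) = \tr X - \tr Y); last exact: raddfB.
  apply/matrixP => i j; rewrite !mxE.
  by case: (i == j); rewrite ?mulr1n ?mulr0n; ring.
rewrite CB CL CK subrr (_ : frob 0 _ = 0) ?ltxx//.
by rewrite /frob big1// => i _; rewrite big1// => j _; rewrite mxE mul0r.
Qed.

Variables (A : set pt) (mA : measurable A) (a b : R).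
Hypotheses (a0 : 0 < a) (ab0 : 0 < a + b * d%:R).
Let hM : semi_ip (L2sym A) (ipM A) := L2sym_semi_ip mA (d := d).
Let hS : subspace (L2sym A) := L2sym_subspace mA (d := d).

Let Tr M x : 'M[R]_d := (\tr (M x))%:M.

Let L2sym_Tr M : L2sym A M -> L2sym A (Tr M).
Proof.
move=> LM; apply/(L2symP mA); split; last by move=> x _; rewrite tr_scalar_mx.
have Ltr : L2 A (fun x => \tr (M x)).
  rewrite (_ : (fun x => _) = \sum_i (fun x => M x i i)); last by apply/funext => x; rewrite fct_sumE.
  by apply: (subspace_sum (L2_subspace mA)) => i; exact: L2sym_coord LM.
move=> i j; rewrite (_ : (fun x => _) = ((i == j)%:R : R) *: (fun x => \tr (M x))).
  exact: subspaceZ (L2_subspace mA) Ltr.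
by apply/funext => x; rewrite -[RHS]/(_%:R * \tr (M x)) mulr_natl [LHS]mxE.
Qed.

Let Tr_sym M M' : ipM A (Tr M) M' = ipM A M (Tr M').
Proof. by apply: eq_Rintegral => x _; rewrite [RHS]frobC !frob_scalar mulrC. Qed.

Let Tr_sqr M : L2sym A M -> ipM A (Tr M) (Tr M) = d%:R * ipM A M (Tr M).
Proof.
move=> LM; have LT := L2sym_Tr LM; rewrite -(sipZr hM _ LT LM); apply: eq_Rintegral => x _.
rewrite frobZr [frob (M x) _]frobC !frob_scalar mxtrace_scalar -mulr_natr; ring.
Qed.

(** The square of the norm of [d%:R *: M - Tr M] is nonnegative. *)
Let Tr_bounds M : L2sym A M -> 0 <= ipM A M (Tr M) /\ ipM A M (Tr M) <= d%:R * ipM A M M.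
Proof.
move=> LM; have LT := L2sym_Tr LM.
have m0 := sip_ge0 hM LM; have t0 := sip_ge0 hM LT; rewrite Tr_sqr// in t0.
have [d0|d0] := posnP d; last first.
  have dR : 0 < d%:R :> R by rewrite ltr0n.
  rewrite pmulr_rge0// in t0; split => //.
  have := sip_ge0 hM (subspaceB hS (subspaceZ d%:R hS LM) LT).
  rewrite (sip_sqrB hM (subspaceZ _ hS LM) LT) Tr_sqr// (sipZl hM _ LM (subspaceZ _ hS LM)).
  rewrite (sipZl hM _ LM LT) (sipZr hM _ LM LM).
  move: (ipM A M M) (ipM A M _) => m p; nra.
have Z Q : ipM A M Q = 0.
  rewrite /ipM (_ : (fun x => _) = cst 0) ?Rintegral_cst ?mul0r//.
  by apply/funext => x; rewrite /frob big1// => i; move: (ltn_ord i); rewrite {2}d0.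
by rewrite !Z mulr0.
Qed.

Local Notation iso := (isotropic_field a b).

Let isoE M : iso M = a *: M + b *: Tr M.
Proof. by []. Qed.

Lemma L2sym_isotropic M : L2sym A M -> L2sym A (iso M).
Proof.
move=> LM; rewrite isoE; apply: hS.2 => //.
exact: subspaceZ (L2sym_Tr LM).
Qed.

Lemma isotropic_self_adjoint M M' : L2sym A M -> L2sym A M' ->
  ipM A M (iso M') = ipM A (iso M) M'.
Proof.
move=> LM LK; rewrite !isoE.
rewrite (sipDr hM (subspaceZ _ hS LK) (subspaceZ _ hS (L2sym_Tr LK)) LM).
rewrite (sipZr hM _ LK LM) (sipZr hM _ (L2sym_Tr LK) LM).
by rewrite (sipL hM _ LM (subspaceZ _ hS (L2sym_Tr LM)) LK) (sipZl hM _ (L2sym_Tr LM) LK) Tr_sym.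
Qed.

Lemma isotropic_coercive : exists2 c : R, 0 < c & forall M, L2sym A M ->
  c * ipM A M M <= ipM A M (iso M).
Proof.
exists (Num.min a (a + b * d%:R)); first by rewrite lt_min a0.
move=> M LM; have [t0 t1] := Tr_bounds LM; have m0 := sip_ge0 hM LM.
rewrite isoE (sipDr hM (subspaceZ _ hS LM) (subspaceZ _ hS (L2sym_Tr LM)) LM).
rewrite (sipZr hM _ LM LM) (sipZr hM _ (L2sym_Tr LM) LM).
have c1 : Num.min a (a + b * d%:R) <= a by rewrite ge_min lexx.
have c2 : Num.min a (a + b * d%:R) <= a + b * d%:R by rewrite ge_min lexx orbT.
move: (Num.min _ _) c1 c2 t0 t1 m0 => c; move: (ipM A M M) (ipM A M (Tr M)) (d%:R : R) => m p D c1 c2 t0 t1 m0.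
have [b0|b0] := leP 0 b.
  have := mulr_ge0 b0 t0; have := ler_wpM2r m0 c1; lra.
have := ler_wpM2r m0 c2; have : b * p >= b * (D * m) by rewrite ler_nM2l.
lra.
Qed.

Lemma isotropic_bounded : exists2 c : R, 0 <= c & forall M, L2sym A M ->
  ipM A (iso M) (iso M) <= c ^+ 2 * ipM A M M.
Proof.
pose c := 1 + a ^+ 2 + (2 * `|a * b| + b ^+ 2 * d%:R) * d%:R.
have c1 : 1 <= c.
  have h : 0 <= (2 * `|a * b| + b ^+ 2 * d%:R) * d%:R.
    by rewrite mulr_ge0// addr_ge0// mulr_ge0// sqr_ge0.
  by have := sqr_ge0 a; rewrite /c; lra.
exists c; first by apply: le_trans c1.
move=> M LM; have [t0 t1] := Tr_bounds LM; have m0 := sip_ge0 hM LM.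
have LT := L2sym_Tr LM.
rewrite isoE (sip_sqrD hM b (subspaceZ a hS LM) LT) (sipZl hM _ LM (subspaceZ a hS LM)).
rewrite (sipZr hM _ LM LM) (sipZl hM _ LM LT) Tr_sqr//.
apply: (@le_trans _ _ (c * ipM A M M)); last first.
  rewrite ler_wpM2r// expr2 ler_peMl//; exact: le_trans c1.
have D0 : 0 <= d%:R :> R by [].
rewrite /c; have := ler_norm (a * b); have := sqr_ge0 b; have := normr_ge0 (a * b).
move: (b ^+ 2) (`|a * b|) (d%:R : R) D0 t1 => b2 k D D0 t1 k0 b20 abk.
move: (ipM A M M) (ipM A M (Tr M)) t0 t1 m0 => m p t0 t1 m0.
have h1 : a * b * p <= k * p by rewrite ler_wpM2r.
have h2 : k * p <= k * (D * m) by rewrite ler_wpM2l.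
have h3 : b2 * D * p <= b2 * D * (D * m) by rewrite ler_wpM2l// mulr_ge0.
have -> : a * (a * m) = a ^+ 2 * m by ring.
nra.
Qed.

End compliance.

(** * Meshes *)

Section mesh.
Context {R : realType} {d : nat}.
Local Notation pt := 'rV[R]_d.
Local Notation mu := (@lebesgue_rV R d).
Context (Omega : set pt) (hOmega : plate_domain Omega).
Context {N : nat} (T : 'I_N -> set pt) (hT : is_mesh Omega T).
Implicit Types (f g z : pt -> R) (Th H M : pt -> 'M[R]_d).
#[local] Opaque smooth partial eps grad div rowdiv.

Lemma domain_open : open Omega. Proof. by case: hOmega. Qed.
Lemma domain_bounded : bounded_set Omega. Proof. by case: hOmega. Qed.
Lemma domain_measurable : measurable Omega.
Proof. exact: open_measurable_rV domain_open. Qed.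
Lemma element_open k : open (T k). Proof. by case: hT => /(_ k)[]. Qed.
Arguments element_open : clear implicits.
Lemma element_sub k : T k `<=` Omega. Proof. by case: hT. Qed.
Lemma element_measurable k : measurable (T k).
Proof. exact: open_measurable_rV (element_open k). Qed.
Lemma element_bounded k : bounded_set (T k).
Proof.
by have [m [mr hm]] := domain_bounded; exists m; split => // s ms x /element_sub; exact: hm.
Qed.

Let oO := domain_open.
Let bO := domain_bounded.
Let mO := domain_measurable.
Let oT := element_open.
Arguments oT : clear implicits.
Let bT := element_bounded.
Let mT := element_measurable.
Let TO := element_sub.
Let hLO : semi_ip (L2 Omega) (ip Omega) := L2_semi_ip mO.
Let hMO : semi_ip (L2sym Omega) (ipM Omega) := L2sym_semi_ip mO.
Let hL k : semi_ip (L2 (T k)) (ip (T k)) := L2_semi_ip (mT k).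
Let hM k : semi_ip (L2sym (T k)) (ipM (T k)) := L2sym_semi_ip (mT k).

Lemma L2_element k f : L2 Omega f -> L2 (T k) f.
Proof. exact: L2S. Qed.

Lemma L2sym_element k M : L2sym Omega M -> L2sym (T k) M.
Proof. exact: L2symS. Qed.

Lemma element_disjoint k l x : T k x -> l != k -> \1_(T l) x = 0 :> R.
Proof.
move=> Tx lk; rewrite indicE memNset// => Tlx.
have [_ _ /(_ _ _ lk) h _] := hT.
by have : (T l `&` T k) x by []; rewrite h.
Qed.

(** Lipschitz elements have null boundaries. *)
Lemma mesh_ae : {ae mu, forall x, Omega x -> exists k, T k x}.
Proof.
have h : {ae mu, forall x, forall k : 'I_N, closure (T k) x -> T k x}.
  apply: filter_forall => k.
  have [/(_ k)[oTk _ lTk] _ _ _] := hT.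
  have := inward_boundary_null oTk (bT k) (fun p => @lipschitz_inward _ _ (T k) p oTk lTk).
  apply: negligibleS => x /= nx; split; first by apply: contrapT => h; apply: nx => /h.
  by move=> Tx; apply: nx.
apply: filterS h => x h Ox; have [_ _ _ cov] := hT.
have : closure Omega x by exact: subset_closure.
by rewrite -cov => -[k _ /h]; exists k.
Qed.

Lemma L2_restrict_element k f : L2 (T k) f -> L2 Omega (f \_ (T k)).
Proof. by move=> Lf; apply: (L2S measurableT mO _ (L2_restrict (mT k) Lf)). Qed.

Lemma ip_restrict_element k f g : ip Omega (f \_ (T k)) g = ip (T k) f g.
Proof.
rewrite -[RHS]ip_restrict -[LHS]ip_restrict; congr ip; apply/funext => x.
rewrite [LHS]patchE; case: ifPn => // /negP; rewrite inE => nOx.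
by rewrite patchE memNset// => /TO.
Qed.

Lemma glueE (F : 'I_N -> pt -> R) k x : T k x -> \sum_l \1_(T l) x * F l x = F k x.
Proof.
move=> Tx; rewrite (bigD1 k)//= big1 ?addr0 => [|l lk].
  by rewrite indicE mem_set// mul1r.
by rewrite (element_disjoint Tx lk) mul0r.
Qed.

Lemma L2_glue (F : 'I_N -> pt -> R) : (forall k, L2 (T k) (F k)) ->
  L2 Omega (fun x => \sum_l \1_(T l) x * F l x).
Proof.
move=> LF; rewrite (_ : (fun x => _) = \sum_l (F l \_ (T l))).
  by apply: (subspace_sum (L2_subspace mO)) => l; exact: L2_restrict_element.
apply/funext => x; rewrite fct_sumE; apply: eq_bigr => l _.
by rewrite patchE indicE; case: (x \in T l); rewrite ?mul1r ?mul0r.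
Qed.

Lemma ip_mesh f g : L2 Omega f -> L2 Omega g -> ip Omega f g = \sum_k ip (T k) f g.
Proof.
move=> Lf Lg; have Lr k := L2_restrict_element (L2_element k Lf).
rewrite (ip_ae_eq mO (f' := \sum_k (f \_ (T k))) (g' := g))//.
- rewrite (sip_suml hLO)//; apply: eq_bigr => k _; exact: ip_restrict_element.
- exact: subspace_sum (L2_subspace mO) _.
- apply: filterS mesh_ae => x h Ox; have [k Tx] := h Ox.
  rewrite fct_sumE -[LHS](glueE (fun=> f) Tx); apply: eq_bigr => l _.
  by rewrite patchE indicE; case: (x \in T l); rewrite ?mul1r ?mul0r.
- exact: ae_eq_refl.
Qed.

Lemma ipM_mesh M M' : L2sym Omega M -> L2sym Omega M' ->
  ipM Omega M M' = \sum_k ipM (T k) M M'.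
Proof.
move=> LM LM'; rewrite (ipM_sum mO LM LM').
under eq_bigr => i _ do under eq_bigr => j _ do
  rewrite (ip_mesh (L2sym_coord mO i j LM) (L2sym_coord mO i j LM')).
under eq_bigr => i _ do rewrite exchange_big.
rewrite exchange_big; apply: eq_bigr => k _.
by rewrite (ipM_sum (mT k) (L2sym_element k LM) (L2sym_element k LM')).
Qed.

Lemma hessbE k z x : T k x -> hessb T z x = hess (T k) z x.
Proof.
move=> Tx; apply/matrixP => i j; rewrite /hessb summxE.
under eq_bigr do rewrite mxE.
exact: (glueE (fun l x => hess (T l) z x i j) Tx).
Qed.

Lemma divdivbE k Th x : T k x -> divdivb T Th x = divdiv (T k) Th x.
Proof. exact: (glueE (fun l => divdiv (T l) Th)). Qed.

Lemma hessb_L2 z : (forall k, H2 (T k) z) -> L2sym Omega (hessb T z).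
Proof.
move=> hz; apply/(L2symP mO); split.
  move=> i j; rewrite (_ : (fun x => _) = (fun x => \sum_l \1_(T l) x * hess (T l) z x i j)).
    by apply: L2_glue => k; apply: L2sym_coord => //; exact: hess_L2.
  by apply/funext => x; rewrite /hessb summxE; apply: eq_bigr => l _; rewrite mxE.
move=> x _; apply/matrixP => i j; rewrite mxE /hessb !summxE; apply: eq_bigr => k _.
rewrite !mxE indicE; have [|_] := boolP (x \in T k); last by rewrite !mul0r.
rewrite inE => Tx; have [_ s] := (L2symP (mT k) _).1 (hess_L2 (hz k)).
by rewrite -{1}(s x Tx) mxE.
Qed.

Lemma divdivb_L2 Th : (forall k, Hdivdiv (T k) Th) -> L2 Omega (divdivb T Th).
Proof. by move=> hT'; apply: L2_glue => k; exact: divdiv_L2. Qed.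

Lemma ip_divdivb u Th : L2 Omega u -> (forall k, Hdivdiv (T k) Th) ->
  ip Omega u (divdivb T Th) = \sum_k ip (T k) u (divdiv (T k) Th).
Proof.
move=> Lu hTh; rewrite ip_mesh//; last exact: divdivb_L2.
apply: eq_bigr => k _; apply: eq_Rintegral => x; rewrite inE => Tx.
by rewrite (divdivbE _ Tx).
Qed.

Lemma ipM_hessb M z : L2sym Omega M -> (forall k, H2 (T k) z) ->
  ipM Omega M (hessb T z) = \sum_k ipM (T k) M (hess (T k) z).
Proof.
move=> LM hz; rewrite ipM_mesh//; last exact: hessb_L2.
apply: eq_bigr => k _; apply: eq_Rintegral => x; rewrite inE => Tx.
by rewrite (hessbE _ Tx).
Qed.

(** ** The broken spaces *)

Lemma H2b_semi_ip : semi_ip (H2b Omega T) (ip2b T).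
Proof. exact: (broken_semi_ip hLO (fun k => H2_semi_ip (oT k) (bT k))). Qed.

Lemma Hdivdivb_semi_ip : semi_ip (Hdivdivb Omega T) (ipddb T).
Proof. exact: (broken_semi_ip hMO (fun k => Hdivdiv_semi_ip (oT k) (bT k))). Qed.

Lemma ip_le_ip2 k z : H2 (T k) z -> ip (T k) z z <= ip2 (T k) z z.
Proof.
by move=> hz; rewrite /ip2 lerDl; apply: (sip_ge0 (hM k)); exact: hess_L2.
Qed.

Lemma ipM_le_ipdd k Th : Hdivdiv (T k) Th -> ipM (T k) Th Th <= ipdd (T k) Th Th.
Proof.
by move=> hz; rewrite /ipdd lerDl; apply: (sip_ge0 (hL k)); exact: divdiv_L2.
Qed.

Lemma H2b_complete : sip_complete (H2b Omega T) (ip2b T).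
Proof.
apply: (broken_complete hLO (fun k => H2_semi_ip (oT k) (bT k)) hL).
- by move=> k; exact: L2_element.
- by move=> k; exact: H2_L2.
- exact: ip_le_ip2.
- by move=> z Lz; exact: ip_mesh.
- by move=> k z z' Lz hz'; apply: H2_ext => //; exact: L2_element.
- exact: L2_complete.
- by move=> k; exact: H2_complete.
Qed.

Lemma Hdivdivb_complete : sip_complete (Hdivdivb Omega T) (ipddb T).
Proof.
apply: (broken_complete hMO (fun k => Hdivdiv_semi_ip (oT k) (bT k)) hM).
- by move=> k; exact: L2sym_element.
- by move=> k; exact: Hdivdiv_L2.
- exact: ipM_le_ipdd.
- by move=> z Lz; exact: ipM_mesh.
- by move=> k z z' Lz hz'; apply: Hdivdiv_ext => //; exact: L2sym_element.
- exact: L2sym_complete.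
- by move=> k; exact: Hdivdiv_complete.
Qed.

Lemma V_semi_ip : semi_ip (Vspace Omega T) (ipV T).
Proof. exact: (prod_semi_ip H2b_semi_ip Hdivdivb_semi_ip). Qed.

Lemma V_complete : sip_complete (Vspace Omega T) (ipV T).
Proof. exact: (prod_complete H2b_semi_ip Hdivdivb_semi_ip H2b_complete Hdivdivb_complete). Qed.

Lemma ip_le_ip2b z : H2b Omega T z -> ip Omega z z <= ip2b T z z.
Proof.
by move=> [Lz hz]; rewrite ip_mesh//; apply: ler_sum => k _; exact: ip_le_ip2.
Qed.

Lemma hessb_le_ip2b z : H2b Omega T z -> ipM Omega (hessb T z) (hessb T z) <= ip2b T z z.
Proof.
move=> [Lz hz]; have Lh := hessb_L2 hz; rewrite ipM_mesh//; apply: ler_sum => k _.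
rewrite (_ : ipM _ _ _ = ipM (T k) (hess (T k) z) (hess (T k) z)).
  by rewrite /ip2 lerDr; apply: (sip_ge0 (hL k)); exact: L2_element.
by apply: eq_Rintegral => x; rewrite inE => Tx; rewrite (hessbE _ Tx).
Qed.

Lemma ipM_le_ipddb Th : Hdivdivb Omega T Th -> ipM Omega Th Th <= ipddb T Th Th.
Proof.
by move=> [LT hTh]; rewrite ipM_mesh//; apply: ler_sum => k _; exact: ipM_le_ipdd.
Qed.

Lemma divdivb_le_ipddb Th : Hdivdivb Omega T Th ->
  ip Omega (divdivb T Th) (divdivb T Th) <= ipddb T Th Th.
Proof.
move=> [LT hTh]; have Ld := divdivb_L2 hTh; rewrite ip_mesh//; apply: ler_sum => k _.
rewrite (_ : ip _ _ _ = ip (T k) (divdiv (T k) Th) (divdiv (T k) Th)).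
  by rewrite /ipdd lerDr; apply: (sip_ge0 (hM k)); exact: L2sym_element.
by apply: eq_Rintegral => x; rewrite inE => Tx; rewrite (divdivbE _ Tx).
Qed.

Lemma H2b_null z : H2b Omega T z -> ae_eq mu Omega z 0 <-> ip2b T z z = 0.
Proof.
move=> hz; have [Lz hzk] := hz; split => [z0|z0]; last first.
  apply: (ip_null mO Lz); apply/eqP; rewrite eq_le (sip_ge0 hLO)// andbT -z0.
  exact: ip_le_ip2b.
have := ip_ae0 mO Lz z0; rewrite ip_mesh// => s0.
apply: big1 => k _.
have k0 : ip (T k) z z = 0.
  apply/eqP; rewrite eq_le (sip_ge0 (hL k)) ?andbT; last exact: L2_element.
  rewrite -s0 (bigD1 k)//= lerDl; apply: sumr_ge0 => l _.
  by apply: (sip_ge0 (hL l)); exact: L2_element.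
have := @H2_ext _ _ _ (oT k) (bT k) z 0 (sip_sub (H2_semi_ip (oT k) (bT k))).1 (L2_element k Lz).
by rewrite subr0 => /(_ k0)[].
Qed.

Lemma Hdivdivb_null Th : Hdivdivb Omega T Th -> ae_eq mu Omega Th 0 <-> ipddb T Th Th = 0.
Proof.
move=> hz; have [Lz hzk] := hz; split => [z0|z0]; last first.
  apply: (ipM_null mO Lz); apply/eqP; rewrite eq_le (sip_ge0 hMO)// andbT -z0.
  exact: ipM_le_ipddb.
have := ipM_ae0 mO Lz z0; rewrite ipM_mesh// => s0.
apply: big1 => k _.
have k0 : ipM (T k) Th Th = 0.
  apply/eqP; rewrite eq_le (sip_ge0 (hM k)) ?andbT; last exact: L2sym_element.
  rewrite -s0 (bigD1 k)//= lerDl; apply: sumr_ge0 => l _.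
  by apply: (sip_ge0 (hM l)); exact: L2sym_element.
have := @Hdivdiv_ext _ _ _ (oT k) (bT k) Th 0 (sip_sub (Hdivdiv_semi_ip (oT k) (bT k))).1 (L2sym_element k Lz).
by rewrite subr0 => /(_ k0)[].
Qed.

(** ** Conforming functions *)

Section conforming.
Variables (z : pt -> R) (H : pt -> 'M[R]_d) (Th : pt -> 'M[R]_d) (g : pt -> R).
Hypotheses (hz : hess_graph Omega (test_function Omega) z H) (hg : divdiv_graph Omega Th g).

Let ts : test_function Omega `<=` smooth. Proof. by move=> f; exact: test_smooth. Qed.

Let hzk k : hess_graph (T k) smooth z H.
Proof.
apply: (hess_graphS (oT k) oO bO (@TO k) (@subset_refl _ smooth)).
exact: hess_graph_sub ts hz.
Qed.

Let hgk k : divdiv_graph (T k) Th g.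
Proof. exact: (divdiv_graphS (oT k) oO bO (@TO k) hg). Qed.

Lemma conforming_H2b : H2b Omega T z.
Proof. by have [Lz _ _] := hz; split => // k; exact: hess_graph_H2 (hzk k). Qed.

Lemma conforming_Hdivdivb : Hdivdivb Omega T Th.
Proof. by have [Lz _ _] := hg; split => // k; exact: divdiv_graph_H (hgk k). Qed.

Let hessk k : ipM (T k) (hess (T k) z - H) (hess (T k) z - H) = 0.
Proof.
have [_ /(_ k) h] := conforming_H2b.
apply: (hess_uniq (oT k) (bT k) (H2_graph h) (hzk k)).
rewrite subrr (sip0l (hL k))//; exact: (sip_sub (hL k)).1.
Qed.

Let divdivk k : ip (T k) (divdiv (T k) Th - g) (divdiv (T k) Th - g) = 0.
Proof.
have [_ /(_ k) h] := conforming_Hdivdivb.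
apply: (divdiv_uniq (oT k) (bT k) (Hdivdiv_graph h) (hgk k)).
rewrite subrr (sip0l (hM k))//; exact: (sip_sub (hM k)).1.
Qed.

Let LHk k : L2sym (T k) H. Proof. by have [_ LH _] := hz; exact: L2sym_element. Qed.
Let Lgk k : L2 (T k) g. Proof. by have [_ Lg _] := hg; exact: L2_element. Qed.
Let Lhk k : L2sym (T k) (hess (T k) z).
Proof. by have [_ h] := conforming_H2b; exact: hess_L2. Qed.
Let Ldk k : L2 (T k) (divdiv (T k) Th).
Proof. by have [_ h] := conforming_Hdivdivb; exact: divdiv_L2. Qed.

Lemma conforming_hess k M : L2sym (T k) M -> ipM (T k) M (hess (T k) z) = ipM (T k) M H.
Proof.
move=> LM; rewrite (sipC (hM k) LM (Lhk k)) (sipC (hM k) LM (LHk k)).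
exact: (sip_eq (hM k) (Lhk k) (LHk k) LM (hessk k)).
Qed.

Lemma conforming_divdiv k f : L2 (T k) f -> ip (T k) f (divdiv (T k) Th) = ip (T k) f g.
Proof.
move=> Lf; rewrite ipC [RHS]ipC.
exact: (sip_eq (hL k) (Ldk k) (Lgk k) Lf (divdivk k)).
Qed.

Lemma conforming_ip2b : ip2b T z z = ip Omega z z + ipM Omega H H.
Proof.
have [Lz LH _] := hz.
rewrite (ip_mesh Lz Lz) (ipM_mesh LH LH) -big_split; apply: eq_bigr => k _ /=.
by rewrite /ip2 (sip_sqr_eq (hM k) (Lhk k) (LHk k) (hessk k)).
Qed.

Lemma conforming_ipddb : ipddb T Th Th = ipM Omega Th Th + ip Omega g g.
Proof.
have [LTh Lg _] := hg.
rewrite (ipM_mesh LTh LTh) (ip_mesh Lg Lg) -big_split; apply: eq_bigr => k _ /=.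
by rewrite /ipdd (sip_sqr_eq (hL k) (Ldk k) (Lgk k) (divdivk k)).
Qed.

(** The jumps across the skeleton cancel: the sum over the elements is the
    integral over [Omega] to which [closure_duality] applies. *)
Lemma conforming_trace : \sum_k trace_form (T k) Th z = 0.
Proof.
have [Lz LH _] := hz; have [LTh Lg _] := hg.
transitivity (\sum_k (ip (T k) g z - ipM (T k) Th H)).
  apply: eq_bigr => k _; rewrite /trace_form (conforming_hess (L2sym_element k LTh)).
  by rewrite ipC (conforming_divdiv (L2_element k Lz)) ipC.
rewrite sumrB -(ip_mesh Lg Lz) -(ipM_mesh LTh LH).
by rewrite (closure_duality oO bO hz hg) subrr.
Qed.

End conforming.

End mesh.
Arguments element_open {R d Omega N T} hT k.

(** * Dual norms *)

Section dual_norm.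
Context {R : realType} {V : lmodType R}.
Variables (S : set V) (b : V -> V -> R) (null : V -> Prop).
Hypotheses (hb : semi_ip S b) (nullP : forall x, S x -> null x <-> b x x = 0).
Variables (L : V -> R) (C : R).
Hypotheses (LN : forall x, S x -> L (- x) = - L x).
Hypotheses (LC : forall x, S x -> `|L x| <= C * Num.sqrt (b x x)).

(** The norms of both kinds of traces are of this form. *)
Definition dual_norm : R :=
  sup [set r | exists x, [/\ S x, ~ null x & r = L x / Num.sqrt (b x x)]].

Let nonnull x : S x -> ~ null x -> 0 < Num.sqrt (b x x).
Proof.
move=> Sx nx; rewrite sqrtr_gt0 lt_neqAle (sip_ge0 hb Sx) andbT eq_sym.
by apply/eqP => /(nullP Sx).
Qed.

Let quotient_le x : S x -> ~ null x -> L x / Num.sqrt (b x x) <= dual_norm.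
Proof.
move=> Sx nx; apply: ub_le_sup; last by exists x.
exists C => _ [y [Sy ny ->]]; rewrite ler_pdivrMr ?nonnull//.
exact: le_trans (ler_norm _) (LC Sy).
Qed.

Let sqr_opp x : S x -> b (- x) (- x) = b x x.
Proof.
move=> Sx; have SN := subspaceN (sip_sub hb) Sx.
by rewrite (sipNl hb Sx SN) (sipC hb Sx SN) (sipNl hb Sx Sx) opprK.
Qed.

Let nonnull_opp x : S x -> ~ null x -> S (- x) /\ ~ null (- x).
Proof.
move=> Sx nx; have SN := subspaceN (sip_sub hb) Sx; split => //.
by move/(nullP SN); rewrite sqr_opp// => /(nullP Sx).
Qed.

Lemma dual_norm_ge0 : 0 <= dual_norm.
Proof.
have [[x [Sx nx]]|h] := pselect (exists x, S x /\ ~ null x).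
  have [SN nN] := nonnull_opp Sx nx.
  have := quotient_le Sx nx; have := quotient_le SN nN.
  rewrite sqr_opp// LN// mulNr; lra.
rewrite /dual_norm (_ : [set r | _] = set0) ?sup0//.
by rewrite -subset0 => r [x [Sx nx _]]; apply: h; exists x.
Qed.

Lemma dual_norm_bound x : S x -> `|L x| <= dual_norm * Num.sqrt (b x x).
Proof.
move=> Sx; have [nx|nx] := pselect (null x).
  have b0 := (nullP Sx).1 nx.
  by have := LC Sx; rewrite b0 sqrtr0 !mulr0.
have p := nonnull Sx nx; have [SN nN] := nonnull_opp Sx nx.
have := quotient_le Sx nx; have := quotient_le SN nN.
rewrite sqr_opp// LN// !ler_pdivrMr// => h1 h2.
by rewrite ler_norml; apply/andP; split; lra.
Qed.

Lemma dual_norm_le K : 0 <= K -> (forall x, S x -> L x <= K * Num.sqrt (b x x)) ->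
  dual_norm <= K.
Proof.
move=> K0 hK; have [[x [Sx nx]]|h] := pselect (exists x, S x /\ ~ null x).
  apply: ge_sup; first by exists (L x / Num.sqrt (b x x)), x.
  by move=> _ [y [Sy ny ->]]; rewrite ler_pdivrMr ?nonnull//; exact: hK.
rewrite /dual_norm (_ : [set r | _] = set0) ?sup0//.
by rewrite -subset0 => r [x [Sx nx _]]; apply: h; exists x.
Qed.

End dual_norm.

Section compliance_field.
Context {R : realType} {d : nat}.
Local Notation pt := 'rV[R]_d.
Implicit Types (A : set pt) (M : pt -> 'M[R]_d).

Definition Cinv_field E t nu M : pt -> 'M[R]_d := fun x => Cinv E t nu (M x).

(** What the estimates use of the compliance tensor. *)
Record compliance E t nu A (c0 c2 : R) : Prop := Compliance {
  cmp_pos : 0 < c0;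
  cmp_bound_ge0 : 0 <= c2;
  cmp_L2 : forall M, L2sym A M -> L2sym A (Cinv_field E t nu M);
  cmp_coercive : forall M, L2sym A M -> c0 * ipM A M M <= ipM A M (Cinv_field E t nu M);
  cmp_bounded : forall M, L2sym A M ->
    ipM A (Cinv_field E t nu M) (Cinv_field E t nu M) <= c2 ^+ 2 * ipM A M M;
  cmp_adjoint : forall M M', L2sym A M -> L2sym A M' ->
    ipM A M (Cinv_field E t nu M') = ipM A (Cinv_field E t nu M) M';
  cmp_linear : forall (k : R) M M' M'', L2sym A M -> L2sym A M' -> L2sym A M'' ->
    ipM A M'' (Cinv_field E t nu (k *: M + M')) =
    k * ipM A M'' (Cinv_field E t nu M) + ipM A M'' (Cinv_field E t nu M') }.

Theorem compliance_exists E t nu A : (0 < d)%N -> 0 < E -> 0 < t -> -1 < nu -> nu <= 2^-1 ->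
  @Ctens_posdef R d E t nu -> measurable A -> exists c0 c2, compliance E t nu A c0 c2.
Proof.
move=> d0 E0 t0 nu1 nu2 pos mA.
have [a [b [a0 ab0 HC]]] := Cinv_isotropic d0 E0 t0 nu1 nu2 pos.
have [c0 c00 h0] := isotropic_coercive mA a0 ab0.
have [c2 c20 h2] := isotropic_bounded mA a b.
have CE M : L2sym A M -> forall x, A x -> Cinv_field E t nu M x = isotropic_field a b M x.
  by move=> /(L2symP mA)[_ s] x Ax; apply: HC; exact: s.
have hM := L2sym_semi_ip mA (d := d).
have eqr M M' : L2sym A M' -> ipM A M (Cinv_field E t nu M') = ipM A M (isotropic_field a b M').
  by move=> LM'; apply: eq_Rintegral => x; rewrite inE => Ax; rewrite CE.
have eql M M' : L2sym A M -> ipM A (Cinv_field E t nu M) M' = ipM A (isotropic_field a b M) M'.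
  by move=> LM'; apply: eq_Rintegral => x; rewrite inE => Ax; rewrite CE.
have Li M : L2sym A M -> L2sym A (isotropic_field a b M) by exact: L2sym_isotropic.
have LC M : L2sym A M -> L2sym A (Cinv_field E t nu M).
  move=> LM; have /(L2symP mA)[LI sI] := Li _ LM; apply/(L2symP mA); split.
    move=> i j; apply: (L2_eq_in mA (LI i j)) => x; rewrite inE => Ax.
    by rewrite (CE M LM x Ax).
  by move=> x Ax; rewrite (CE M LM x Ax); exact: sI.
exists c0, c2; split => //.
- by move=> M LM; rewrite eqr//; exact: h0.
- by move=> M LM; rewrite eqr// eql//; exact: h2.
- by move=> M M' LM LM'; rewrite eqr// eql//; exact: isotropic_self_adjoint.
- move=> k M M' M'' LM LM' LM''; have LS := (L2sym_subspace mA).2 k _ _ LM LM'.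
  rewrite !eqr// -(sipZr hM k (Li _ LM) LM'') -(sipDr hM (subspaceZ _ (sip_sub hM) (Li _ LM)) (Li _ LM') LM'').
  by congr ipM; apply/funext => x; exact: isotropicL.
Qed.

End compliance_field.

(** * Traces *)

Section trace_form.
Context {R : realType} {d : nat}.
Local Notation pt := 'rV[R]_d.
Variables (A : set pt) (oA : open A) (bA : bounded_set A).
Implicit Types (z : pt -> R) (Th : pt -> 'M[R]_d).

Let mA : measurable A := open_measurable_rV oA.
Let hL : semi_ip (L2 A) (ip A) := L2_semi_ip mA.
Let hM : semi_ip (L2sym A) (ipM A) := L2sym_semi_ip mA.

Let combine (a p p' r r' : R) : (a * p + p') - (a * r + r') = a * (p - r) + (p' - r').
Proof. by ring. Qed.

Lemma trace_formLz (a : R) Th z z' : Hdivdiv A Th -> H2 A z -> H2 A z' ->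
  trace_form A Th (a *: z + z') = a * trace_form A Th z + trace_form A Th z'.
Proof.
move=> hT hz hz'; have LT := Hdivdiv_L2 hT; have Ld := divdiv_L2 hT.
have hzz := (sip_sub (H2_semi_ip oA bA)).2 a _ _ hz hz'.
have E1 : ip A (divdiv A Th) (a *: z + z') = a * ip A (divdiv A Th) z + ip A (divdiv A Th) z'.
  apply: etrans (sipDr hL (subspaceZ a (sip_sub hL) (H2_L2 hz)) (H2_L2 hz') Ld) _.
  by congr (_ + _); exact: (sipZr hL a (H2_L2 hz) Ld).
have E2 : ipM A Th (hess A (a *: z + z')) = a * ipM A Th (hess A z) + ipM A Th (hess A z').
  apply: etrans (sipC hM LT (hess_L2 hzz)) (etrans (hess_ipL oA bA a hz hz' LT) _).
  have C z0 (h : H2 A z0) : ipM A (hess A z0) Th = ipM A Th (hess A z0).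
    exact: (sipC hM (hess_L2 h) LT).
  have X := @f_equal2 R R R (fun p r => a * p + r) _ _ _ _ (C z hz) (C z' hz').
  exact: X.
exact: etrans (congr2 (fun p r => p - r) E1 E2) (combine _ _ _ _ _).
Qed.

Lemma trace_formLT (a : R) Th Th' z : Hdivdiv A Th -> Hdivdiv A Th' -> H2 A z ->
  trace_form A (a *: Th + Th') z = a * trace_form A Th z + trace_form A Th' z.
Proof.
move=> hT hT' hz; have E1 := divdiv_ipL oA bA a hT hT' (H2_L2 hz).
have E2 := sipL hM a (Hdivdiv_L2 hT) (Hdivdiv_L2 hT') (hess_L2 hz).
exact: etrans (congr2 (fun p r => p - r) E1 E2) (combine _ _ _ _ _).
Qed.

Lemma trace_form_bound Th z : Hdivdiv A Th -> H2 A z ->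
  `|trace_form A Th z| <= 2 * Num.sqrt (ipdd A Th Th) * Num.sqrt (ip2 A z z).
Proof.
move=> hT hz; have LT := Hdivdiv_L2 hT; have Ld := divdiv_L2 hT.
have Lz := H2_L2 hz; have Lh := hess_L2 hz.
have T0 := sip_ge0 hM LT; have d0 := sip_ge0 hL Ld; have z0 := sip_ge0 hL Lz; have h0 := sip_ge0 hM Lh.
apply: le_trans (ler_normB _ _) _.
have h1 : `|ip A (divdiv A Th) z| <= Num.sqrt (ipdd A Th Th) * Num.sqrt (ip2 A z z).
  apply: le_trans (sip_CS hL Ld Lz) _; apply: ler_pM; rewrite ?sqrtr_ge0// ler_wsqrtr//.
    by rewrite /ipdd lerDr.
  by rewrite /ip2 lerDl.
have h2 : `|ipM A Th (hess A z)| <= Num.sqrt (ipdd A Th Th) * Num.sqrt (ip2 A z z).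
  apply: le_trans (sip_CS hM LT Lh) _; apply: ler_pM; rewrite ?sqrtr_ge0// ler_wsqrtr//.
    by rewrite /ipdd lerDl.
  by rewrite /ip2 lerDr.
lra.
Qed.

Lemma trace_form_eqz Th z z' : Hdivdiv A Th -> H2 A z -> H2 A z' ->
  ip2 A (z - z') (z - z') = 0 -> trace_form A Th z = trace_form A Th z'.
Proof.
move=> hT hz hz' h0; have hB := subspaceB (sip_sub (H2_semi_ip oA bA)) hz hz'.
have := trace_form_bound hT hB; rewrite h0 sqrtr0 mulr0 normr_le0 => /eqP t0.
by rewrite -[z](subrK z') -[z - z']scale1r (trace_formLz 1 hT hB hz') t0 mulr0 add0r.
Qed.

Lemma trace_form_eqT Th Th' z : Hdivdiv A Th -> Hdivdiv A Th' -> H2 A z ->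
  ipdd A (Th - Th') (Th - Th') = 0 -> trace_form A Th z = trace_form A Th' z.
Proof.
move=> hT hT' hz h0; have hB := subspaceB (sip_sub (Hdivdiv_semi_ip oA bA)) hT hT'.
have := trace_form_bound hB hz; rewrite h0 sqrtr0 mulr0 mul0r normr_le0 => /eqP t0.
by rewrite -[Th](subrK Th') -[Th - Th']scale1r (trace_formLT 1 hB hT' hz) t0 mulr0 add0r.
Qed.

End trace_form.

Section traces.
Context {R : realType} {d : nat}.
Local Notation pt := 'rV[R]_d.
Local Notation mu := (@lebesgue_rV R d).
Context (Omega : set pt) (hOmega : plate_domain Omega).
Context {N : nat} (T : 'I_N -> set pt) (hT : is_mesh Omega T).
Implicit Types (z : pt -> R) (Th : pt -> 'M[R]_d).
Implicit Types (q : 'I_N -> (pt -> R) -> R) (v : 'I_N -> (pt -> 'M[R]_d) -> R).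

Let oO := domain_open hOmega.
Let bO := domain_bounded hOmega.
Let oT k : open (T k) := element_open hT k.
Arguments oT : clear implicits.
Let bT := element_bounded hOmega hT.
Let TO := element_sub hT.

Lemma Hdivdiv_element k Th : Hdivdiv Omega Th -> Hdivdiv (T k) Th.
Proof.
by move=> /Hdivdiv_graph h; exact: divdiv_graph_H (divdiv_graphS (oT k) oO bO (@TO k) h).
Qed.

Lemma H20_graph z : H20 Omega z -> exists H, hess_graph Omega (test_function Omega) z H.
Proof.
move=> [H h]; exists H; apply/hess_closureE; last exact: h.
by move=> f; exact: test_smooth.
Qed.

Lemma H20_element k z : H20 Omega z -> H2 (T k) z.
Proof. by move=> /H20_graph[H h]; have [_] := conforming_H2b hOmega hT h; exact. Qed.

Lemma tr_dDivE k Th z : H2 (T k) z -> tr_dDiv (T k) Th z = trace_form (T k) Th z.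
Proof. by move=> hz; rewrite /tr_dDiv asboolT. Qed.

Lemma tr_GgradE k z Th : Hdivdiv (T k) Th -> tr_Ggrad (T k) z Th = trace_form (T k) Th z.
Proof. by move=> hz; rewrite /tr_Ggrad asboolT. Qed.

Lemma Hm32_subspace : subspace (Hm32 Omega T).
Proof.
have [S0 SL] := sip_sub (Hdivdiv_semi_ip oO bO).
split.
  exists 0 => //; apply/funext => k; apply/funext => z; rewrite /tr_dDiv.
  case: asboolP => // hz; have [h0 _] := sip_sub (Hdivdiv_semi_ip (oT k) (bT k)).
  have := trace_formLT (oT k) (bT k) 1 h0 h0 hz.
  rewrite scale1r addr0 mul1r => /eqP; rewrite -subr_eq0 opprD addrA subrr add0r oppr_eq0.
  by move=> /eqP.
move=> a _ _ [Th hTh ->] [Th' hTh' ->]; exists (a *: Th + Th'); first exact: SL.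
apply/funext => k; apply/funext => z.
rewrite -[LHS]/(a * tr_dDiv (T k) Th z + tr_dDiv (T k) Th' z) /tr_dDiv.
case: asboolP => hz; last by rewrite mulr0 addr0.
by rewrite (trace_formLT (oT k) (bT k) a (Hdivdiv_element k hTh) (Hdivdiv_element k hTh') hz).
Qed.

Lemma H20_subspace : subspace (H20 Omega).
Proof.
have mO := domain_measurable hOmega.
have ts : test_function Omega `<=` smooth by move=> f; exact: test_smooth.
have hL := L2_semi_ip mO (d := d); have hM := L2sym_semi_ip mO (d := d).
have SL (a : R) z z' : H20 Omega z -> H20 Omega z' -> H20 Omega (a *: z + z').
  move=> /H20_graph[H h] /H20_graph[H' h']; exists (a *: H + H').
  apply/(hess_closureE Omega _ _ ts).
  apply: (graph_closureL hL hM (test_subspace Omega) (smooth_in_L2 oO bO ts) (hess_in_L2 oO bO ts) _ a h h').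
  by move=> k f g tf tg; exact: (hess_linear k (ts _ tf) (ts _ tg)).
split => //; exists 0; apply/(hess_closureE Omega _ _ ts).
have t0 := (test_subspace Omega).1.
have := graph_closureD hL hM (smooth_in_L2 oO bO ts) (hess_in_L2 oO bO ts) t0.
have -> : eps (grad (0 : pt -> R)) = 0.
  have s0 : smooth (0 : pt -> R) by exact: smooth_subspace.1.
  have := hess_linear 1 s0 s0; rewrite !scale1r addr0 => h.
  by apply: (addrI (eps (grad (0 : pt -> R)))); rewrite addr0 -h.
exact.
Qed.

Lemma H32_subspace : subspace (H32 Omega T).
Proof.
have [S0 SL] := H20_subspace.
split.
  exists 0 => //; apply/funext => k; apply/funext => Th; rewrite /tr_Ggrad.
  case: asboolP => // hTh; have [h0 _] := sip_sub (H2_semi_ip (oT k) (bT k)).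
  have := trace_formLz (oT k) (bT k) 1 hTh h0 h0.
  rewrite scale1r addr0 mul1r => /eqP; rewrite -subr_eq0 opprD addrA subrr add0r oppr_eq0.
  by move=> /eqP.
move=> a _ _ [z hz ->] [z' hz' ->]; exists (a *: z + z'); first exact: SL.
apply/funext => k; apply/funext => Th.
rewrite -[LHS]/(a * tr_Ggrad (T k) z Th + tr_Ggrad (T k) z' Th) /tr_Ggrad.
case: asboolP => hTh; last by rewrite mulr0 addr0.
by rewrite (trace_formLz (oT k) (bT k) a hTh (H20_element k hz) (H20_element k hz')).
Qed.

Lemma pairing_qL q (a : R) z z' : Hm32 Omega T q -> H2b Omega T z -> H2b Omega T z' ->
  pairing q (a *: z + z') = a * pairing q z + pairing q z'.
Proof.
move=> [Th hTh ->] hz hz'; have [_ hzz] := (sip_sub (H2b_semi_ip hOmega hT)).2 a _ _ hz hz'.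
have [_ hzk] := hz; have [_ hzk'] := hz'.
rewrite /pairing mulr_sumr -big_split; apply: eq_bigr => k _ /=.
rewrite !tr_dDivE//; exact: (trace_formLz (oT k) (bT k) a (Hdivdiv_element k hTh) (hzk k) (hzk' k)).
Qed.

Lemma pairing_vL v (a : R) Th Th' : H32 Omega T v -> Hdivdivb Omega T Th -> Hdivdivb Omega T Th' ->
  pairing v (a *: Th + Th') = a * pairing v Th + pairing v Th'.
Proof.
move=> [z hz ->] hTh hTh'; have [_ hTT] := (sip_sub (Hdivdivb_semi_ip hOmega hT)).2 a _ _ hTh hTh'.
have [_ hk] := hTh; have [_ hk'] := hTh'.
rewrite /pairing mulr_sumr -big_split; apply: eq_bigr => k _ /=.
rewrite !tr_GgradE//; exact: (trace_formLT (oT k) (bT k) a (hk k) (hk' k) (H20_element k hz)).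
Qed.

Lemma sum_bound (c s t : 'I_N -> R) (B : R) : (forall k, 0 <= c k) -> (forall k, 0 <= s k) ->
  (forall k, `|t k| <= c k * Num.sqrt (s k)) -> \sum_k s k = B ->
  `|\sum_k t k| <= (\sum_k c k) * Num.sqrt B.
Proof.
move=> c0 s0 ht <-; apply: le_trans (ler_norm_sum _ _ _) _; rewrite mulr_suml.
apply: ler_sum => k _; apply: le_trans (ht k) _; rewrite ler_wpM2l// ler_wsqrtr//.
by rewrite (bigD1 k)//= lerDl sumr_ge0.
Qed.

Lemma pairing_q_bounded q : Hm32 Omega T q -> exists C, forall z, H2b Omega T z ->
  `|pairing q z| <= C * Num.sqrt (ip2b T z z).
Proof.
move=> [Th hTh ->]; eexists => z [_ hz].
apply: (sum_bound (c := fun k => 2 * Num.sqrt (ipdd (T k) Th Th)) (s := fun k => ip2 (T k) z z)) => //.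
- by move=> k; apply: (sip_ge0 (H2_semi_ip (oT k) (bT k))).
- by move=> k; rewrite tr_dDivE//; apply: trace_form_bound => //; exact: Hdivdiv_element.
Qed.

Lemma pairing_v_bounded v : H32 Omega T v -> exists C, forall Th, Hdivdivb Omega T Th ->
  `|pairing v Th| <= C * Num.sqrt (ipddb T Th Th).
Proof.
move=> [z hz ->]; eexists => Th [_ hTh].
apply: (sum_bound (c := fun k => 2 * Num.sqrt (ip2 (T k) z z)) (s := fun k => ipdd (T k) Th Th)) => //.
- by move=> k; apply: (sip_ge0 (Hdivdiv_semi_ip (oT k) (bT k))).
- move=> k; rewrite tr_GgradE// mulrAC; apply: trace_form_bound => //; exact: H20_element.
Qed.

Let qN q : Hm32 Omega T q -> forall z, H2b Omega T z -> pairing q (- z) = - pairing q z.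
Proof.
move=> hq z hz; have [S0 _] := sip_sub (H2b_semi_ip hOmega hT).
have p0 : pairing q 0 = 0.
  have := pairing_qL 1 hq S0 S0; rewrite scale1r addr0 mul1r; lra.
by have := pairing_qL (-1) hq hz S0; rewrite addr0 p0 addr0 scaleN1r mulN1r.
Qed.

Let vN v : H32 Omega T v -> forall Th, Hdivdivb Omega T Th -> pairing v (- Th) = - pairing v Th.
Proof.
move=> hq z hz; have [S0 _] := sip_sub (Hdivdivb_semi_ip hOmega hT).
have p0 : pairing v 0 = 0.
  have := pairing_vL 1 hq S0 S0; rewrite scale1r addr0 mul1r; lra.
by have := pairing_vL (-1) hq hz S0; rewrite addr0 p0 addr0 scaleN1r mulN1r.
Qed.

Lemma nrm_m32_ge0 q : Hm32 Omega T q -> 0 <= nrm_m32 Omega T q.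
Proof.
move=> hq; have [C hC] := pairing_q_bounded hq.
exact: (dual_norm_ge0 (H2b_semi_ip hOmega hT) (H2b_null hOmega hT) (qN hq) hC).
Qed.

Lemma nrm_m32_bound q z : Hm32 Omega T q -> H2b Omega T z ->
  `|pairing q z| <= nrm_m32 Omega T q * Num.sqrt (ip2b T z z).
Proof.
move=> hq; have [C hC] := pairing_q_bounded hq.
exact: (dual_norm_bound (H2b_semi_ip hOmega hT) (H2b_null hOmega hT) (qN hq) hC).
Qed.

Lemma nrm_m32_le q K : 0 <= K -> (forall z, H2b Omega T z -> pairing q z <= K * Num.sqrt (ip2b T z z)) ->
  nrm_m32 Omega T q <= K.
Proof. exact: (dual_norm_le (H2b_semi_ip hOmega hT) (H2b_null hOmega hT)). Qed.

Lemma nrm_32_ge0 v : H32 Omega T v -> 0 <= nrm_32 Omega T v.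
Proof.
move=> hq; have [C hC] := pairing_v_bounded hq.
exact: (dual_norm_ge0 (Hdivdivb_semi_ip hOmega hT) (Hdivdivb_null hOmega hT) (vN hq) hC).
Qed.

Lemma nrm_32_bound v Th : H32 Omega T v -> Hdivdivb Omega T Th ->
  `|pairing v Th| <= nrm_32 Omega T v * Num.sqrt (ipddb T Th Th).
Proof.
move=> hq; have [C hC] := pairing_v_bounded hq.
exact: (dual_norm_bound (Hdivdivb_semi_ip hOmega hT) (Hdivdivb_null hOmega hT) (vN hq) hC).
Qed.

Lemma nrm_32_le v K : 0 <= K ->
  (forall Th, Hdivdivb Omega T Th -> pairing v Th <= K * Num.sqrt (ipddb T Th Th)) ->
  nrm_32 Omega T v <= K.
Proof. exact: (dual_norm_le (Hdivdivb_semi_ip hOmega hT) (Hdivdivb_null hOmega hT)). Qed.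

Let ip_zero (A : set pt) (f : pt -> R) : measurable A -> (forall x, A x -> f x = 0) ->
  ip A f f = 0.
Proof.
move=> mA h; transitivity (\int[mu]_(x in A) (0 : R)); last by rewrite Rintegral_cst// mul0r.
by apply: eq_Rintegral => x; rewrite inE => Ax; rewrite h// mulr0.
Qed.

Let ipM_zero (A : set pt) (M : pt -> 'M[R]_d) : measurable A -> (forall x, A x -> M x = 0) ->
  ipM A M M = 0.
Proof.
move=> mA h; transitivity (\int[mu]_(x in A) (0 : R)); last by rewrite Rintegral_cst// mul0r.
apply: eq_Rintegral => x; rewrite inE => Ax; rewrite h// /frob big1// => i _.
by rewrite big1// => j _; rewrite mxE mul0r.
Qed.

Let mT k : measurable (T k) := element_measurable hT k.
Let mO : measurable Omega := domain_measurable hOmega.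

(** Functions supported in one element separate the components of a trace. *)
Lemma restrict_H2b k z : H2 (T k) z -> exists z', [/\ H2b Omega T z',
  ip2 (T k) (z' - z) (z' - z) = 0 & forall l, l != k -> ip2 (T l) (z' - 0) (z' - 0) = 0].
Proof.
move=> hz; pose z' := z \_ (T k); exists z'.
have Lz' : L2 Omega z' by exact: (L2_restrict_element hOmega hT (H2_L2 hz)).
have hk : H2 (T k) z' /\ ip2 (T k) (z' - z) (z' - z) = 0.
  apply: (H2_ext (oT k) (bT k) hz (L2_element hOmega hT k Lz')).
  apply: (ip_zero (mT _)) => x Tx; rewrite -[LHS]/(z' x - z x) /z' patchE mem_set// subrr//.
have hl l : l != k -> H2 (T l) z' /\ ip2 (T l) (z' - 0) (z' - 0) = 0.
  move=> lk; have [h0 _] := sip_sub (H2_semi_ip (oT l) (bT l)).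
  apply: (H2_ext (oT l) (bT l) h0 (L2_element hOmega hT l Lz')).
  apply: (ip_zero (mT _)) => x Tx; rewrite subr0 /z' patchE; case: ifPn => //; rewrite inE => Tkx.
  have /eqP := element_disjoint hT Tkx lk.
  by rewrite indicE mem_set// oner_eq0.
split; [split => // l|exact: hk.2|by move=> l /hl[]].
by have [->|/hl[]//] := eqVneq l k; exact: hk.1.
Qed.

Lemma nrm_m32_null q : Hm32 Omega T q -> nrm_m32 Omega T q = 0 -> q = 0.
Proof.
move=> hq q0; have [Th hTh qE] := hq.
apply/funext => k; apply/funext => z; rewrite qE -[RHS]/0.
have [hz|hz] := pselect (H2 (T k) z); last by rewrite /tr_dDiv asboolF.
rewrite tr_dDivE//; have [z' [hz' zk zl]] := restrict_H2b hz; have [_ hk'] := hz'.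
have ql l : q l z' = trace_form (T l) Th z' by rewrite qE; exact: (tr_dDivE Th (hk' l)).
have qk : trace_form (T k) Th z = q k z'.
  rewrite ql; exact: esym (trace_form_eqz (oT k) (bT k) (Hdivdiv_element k hTh) (hk' k) hz zk).
have := nrm_m32_bound hq hz'; rewrite q0 mul0r normr_le0 => /eqP.
rewrite qk /pairing (bigD1 k)//= big1 ?addr0// => l lk.
have [h0 _] := sip_sub (H2_semi_ip (oT l) (bT l)); have hl := Hdivdiv_element l hTh.
rewrite ql; apply: etrans (trace_form_eqz (oT l) (bT l) hl (hk' l) h0 (zl l lk)) _.
have := trace_formLz (oT l) (bT l) 1 hl h0 h0.
rewrite scale1r addr0 mul1r; move: (trace_form _ _ _) => r; lra.
Qed.

Lemma restrict_Hdivdivb k Th : Hdivdiv (T k) Th -> exists Th', [/\ Hdivdivb Omega T Th',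
  ipdd (T k) (Th' - Th) (Th' - Th) = 0 & forall l, l != k -> ipdd (T l) (Th' - 0) (Th' - 0) = 0].
Proof.
move=> hz; pose Th' x := \1_(T k) x *: Th x; exists Th'.
have [Lc sc] := (L2symP (mT k) _).1 (Hdivdiv_L2 hz).
have LT' : L2sym Omega Th'.
  apply/(L2symP mO); split => [i j|x _].
    rewrite (_ : (fun x => _) = (fun x => Th x i j) \_ (T k)).
      exact: (L2_restrict_element hOmega hT (Lc i j)).
    apply/funext => x; rewrite mxE indicE patchE.
    by case: (x \in T k); rewrite ?mul1r ?mul0r.
  rewrite /Th' indicE; have [|_] := boolP (x \in T k); last by rewrite !scale0r trmx0.
  by rewrite inE => Tx; rewrite !scale1r sc.
have hk : Hdivdiv (T k) Th' /\ ipdd (T k) (Th' - Th) (Th' - Th) = 0.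
  apply: (Hdivdiv_ext (oT k) (bT k) hz (L2sym_element hOmega hT k LT')).
  apply: (ipM_zero (mT _)) => x Tx; rewrite -[LHS]/(Th' x - Th x) /Th' indicE mem_set// scale1r subrr//.
have hl l : l != k -> Hdivdiv (T l) Th' /\ ipdd (T l) (Th' - 0) (Th' - 0) = 0.
  move=> lk; have [h0 _] := sip_sub (Hdivdiv_semi_ip (oT l) (bT l)).
  apply: (Hdivdiv_ext (oT l) (bT l) h0 (L2sym_element hOmega hT l LT')).
  apply: (ipM_zero (mT _)) => x Tx; rewrite subr0 /Th' (element_disjoint hT Tx) ?scale0r//.
  by rewrite eq_sym.
split; [split => // l|exact: hk.2|by move=> l /hl[]].
by have [->|/hl[]//] := eqVneq l k; exact: hk.1.
Qed.

Lemma nrm_32_null v : H32 Omega T v -> nrm_32 Omega T v = 0 -> v = 0.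
Proof.
move=> hv v0; have [z hz vE] := hv.
apply/funext => k; apply/funext => Th; rewrite vE -[RHS]/0.
have [hTh|hTh] := pselect (Hdivdiv (T k) Th); last by rewrite /tr_Ggrad asboolF.
rewrite tr_GgradE//; have [Th' [hTh' Tk Tl]] := restrict_Hdivdivb hTh; have [_ hk'] := hTh'.
have vl l : v l Th' = trace_form (T l) Th' z by rewrite vE; exact: (tr_GgradE z (hk' l)).
have vk : trace_form (T k) Th z = v k Th'.
  rewrite vl; exact: esym (trace_form_eqT (oT k) (bT k) (hk' k) hTh (H20_element k hz) Tk).
have := nrm_32_bound hv hTh'; rewrite v0 mul0r normr_le0 => /eqP.
rewrite vk /pairing (bigD1 k)//= big1 ?addr0// => l lk.
have [h0 _] := sip_sub (Hdivdiv_semi_ip (oT l) (bT l)); have hl := H20_element l hz.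
rewrite vl; apply: etrans (trace_form_eqT (oT l) (bT l) (hk' l) h0 hl (Tl l lk)) _.
have := trace_formLT (oT l) (bT l) 1 h0 h0 hl.
rewrite scale1r addr0 mul1r; move: (trace_form _ _ _) => r; lra.
Qed.

End traces.

(** * The bilinear form *)

Section bilinear_form.
Context {R : realType} {d : nat}.
Local Notation pt := 'rV[R]_d.
Context (Omega : set pt) (hOmega : plate_domain Omega).
Context {N : nat} (T : 'I_N -> set pt) (hT : is_mesh Omega T).
Context (E t nu c0 c2 : R) (cmp : @compliance R d E t nu Omega c0 c2).
Implicit Types (z u f g : pt -> R) (Th M H : pt -> 'M[R]_d) (w : trial R d N) (v : test R d).
#[local] Opaque smooth partial eps grad div rowdiv hess divdiv.

Let mO := domain_measurable hOmega.
Let oT : forall k, open (T k) := fun k => element_open hT k.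
Arguments oT : clear implicits.
Let bT := element_bounded hOmega hT.
Let mT := element_measurable hT.
Let hL : semi_ip (L2 Omega) (ip Omega) := L2_semi_ip mO.
Let hM : semi_ip (L2sym Omega) (ipM Omega) := L2sym_semi_ip mO.
Let h2b := H2b_semi_ip hOmega hT.
Let hdd := Hdivdivb_semi_ip hOmega hT.
Let hV := V_semi_ip hOmega hT.

Local Notation B := (bform Omega T E t nu).
Local Notation C := (Cinv_field E t nu).
Local Notation Uspace := (Uspace Omega T).
Local Notation Vspace := (Vspace Omega T).
Local Notation H2b := (H2b Omega T).
Local Notation Hdivdivb := (Hdivdivb Omega T).

Lemma bformE w v : Uspace w -> Vspace v -> B w v =
  ipM Omega (tr_M w) (hessb T v.1) + ipM Omega (tr_M w) (C v.2) +
  ip Omega (tr_u w) (divdivb T v.2) + pairing (tr_qhat w) v.1 - pairing (tr_uhat w) v.2.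
Proof.
move=> [Lu LM hu hq] [[Lz hz] [LT hTh]].
have Lh := hessb_L2 hOmega hT hz; have LC := cmp_L2 cmp LT.
have X := sipDr hM Lh LC LM.
exact: (congr1 (fun r => r + _ + _ - _) X).
Qed.

Lemma ipM_hessbL (a : R) M z z' : L2sym Omega M -> H2b z -> H2b z' ->
  ipM Omega M (hessb T (a *: z + z')) = a * ipM Omega M (hessb T z) + ipM Omega M (hessb T z').
Proof.
move=> LM hz hz'; have [_ hzz] := (sip_sub h2b).2 a _ _ hz hz'.
have [_ hk] := hz; have [_ hk'] := hz'.
have S z0 (h : forall k, H2 (T k) z0) := ipM_hessb hOmega hT LM h.
have Z := @f_equal2 R R R (fun p r => a * p + r) _ _ _ _ (S z hk) (S z' hk').
apply: etrans (S _ hzz) _; apply: etrans _ (esym Z); cbv beta.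
rewrite mulr_sumr -big_split; apply: eq_bigr => k _ /=.
have LMk := L2sym_element hOmega hT k LM; have hMk := L2sym_semi_ip (mT k) (d := d).
have X := hess_ipL (oT k) (bT k) a (hk k) (hk' k) LMk.
have C0 z0 (h : H2 (T k) z0) : ipM (T k) M (hess (T k) z0) = ipM (T k) (hess (T k) z0) M.
  exact: (sipC hMk LMk (hess_L2 h)).
apply: etrans (C0 _ (hzz k)) _; apply: etrans X _.
have Y := @f_equal2 R R R (fun p r => a * p + r) _ _ _ _ (C0 z (hk k)) (C0 z' (hk' k)).
exact: esym Y.
Qed.

Lemma ip_divdivbL (a : R) u Th Th' : L2 Omega u -> Hdivdivb Th -> Hdivdivb Th' ->
  ip Omega u (divdivb T (a *: Th + Th')) = a * ip Omega u (divdivb T Th) + ip Omega u (divdivb T Th').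
Proof.
move=> Lu hz hz'; have [_ hzz] := (sip_sub hdd).2 a _ _ hz hz'.
have [_ hk] := hz; have [_ hk'] := hz'.
have S Th0 (h : forall k, Hdivdiv (T k) Th0) := ip_divdivb hOmega hT Lu h.
have Z := @f_equal2 R R R (fun p r => a * p + r) _ _ _ _ (S Th hk) (S Th' hk').
apply: etrans (S _ hzz) _; apply: etrans _ (esym Z); cbv beta.
rewrite mulr_sumr -big_split; apply: eq_bigr => k _ /=.
have Luk := L2_element hOmega hT k Lu.
have X := divdiv_ipL (oT k) (bT k) a (hk k) (hk' k) Luk.
have C0 Th0 : ip (T k) u (divdiv (T k) Th0) = ip (T k) (divdiv (T k) Th0) u by exact: ipC.
apply: etrans (C0 _) _; apply: etrans X _.
have Y := @f_equal2 R R R (fun p r => a * p + r) _ _ _ _ (C0 Th) (C0 Th').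
exact: esym Y.
Qed.

Let combine (a p1 q1 p2 q2 p3 q3 p4 q4 p5 q5 : R) :
  a * p1 + q1 + (a * p2 + q2) + (a * p3 + q3) + (a * p4 + q4) - (a * p5 + q5) =
  a * (p1 + p2 + p3 + p4 - p5) + (q1 + q2 + q3 + q4 - q5).
Proof. by ring. Qed.

Lemma bformLv (a : R) w v v' : Uspace w -> Vspace v -> Vspace v' ->
  B w (a *: v + v') = a * B w v + B w v'.
Proof.
move=> hw hv hv'; have hvv := (sip_sub hV).2 a _ _ hv hv'.
rewrite (bformE hw hv) (bformE hw hv') (bformE hw hvv).
have [Lu LM hu hq] := hw; have [hz hTh] := hv; have [hz' hTh'] := hv'.
have E1 := ipM_hessbL a LM hz hz'.
have E2 := cmp_linear cmp a hTh.1 hTh'.1 LM.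
have E3 := ip_divdivbL a Lu hTh hTh'.
have E4 := pairing_qL hOmega hT a hq hz hz'.
have E5 := pairing_vL hOmega hT a hu hTh hTh'.
have X := f_equal2 (fun p q => p - q) (f_equal2 +%R (f_equal2 +%R (f_equal2 +%R E1 E2) E3) E4) E5.
exact: etrans X (combine _ _ _ _ _ _ _ _ _ _ _).
Qed.

Lemma bformLw (a : R) w w' v : Uspace w -> Uspace w' -> Vspace v ->
  B (a *: w + w') v = a * B w v + B w' v.
Proof.
move=> hw hw' hv; have [Lu LM hu hq] := hw; have [Lu' LM' hu' hq'] := hw'.
have [hz hTh] := hv.
have Lh := hessb_L2 hOmega hT hz.2; have LC := cmp_L2 cmp hTh.1.
have Ld := divdivb_L2 hOmega hT hTh.2.
have E1 := sipL hM a LM LM' (subspaceD (sip_sub hM) Lh LC).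
have E2 := sipL hL a Lu Lu' Ld.
have P (X : Type) (q q' : 'I_N -> X -> R) x :
    pairing (a *: q + q') x = a * pairing q x + pairing q' x.
  by rewrite /pairing mulr_sumr -big_split.
have E3 := P _ (tr_qhat w) (tr_qhat w') v.1.
have E4 := P _ (tr_uhat w) (tr_uhat w') v.2.
have X := f_equal2 (fun p q => p - q) (f_equal2 +%R (f_equal2 +%R E1 E2) E3) E4.
apply: etrans X _; rewrite /bform; ring.
Qed.

Lemma Uspace_subspace : subspace Uspace.
Proof.
have [q0 qL] := Hm32_subspace hOmega hT; have [v0 vL] := H32_subspace hOmega hT.
have [u0 uL] := sip_sub hL; have [M0 ML] := sip_sub hM.
split; first by split.
move=> a w w' [Lu LM hu hq] [Lu' LM' hu' hq']; split.
- exact: (uL a (tr_u w) (tr_u w') Lu Lu').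
- exact: (ML a (tr_M w) (tr_M w') LM LM').
- exact: (vL a (tr_uhat w) (tr_uhat w') hu hu').
- exact: (qL a (tr_qhat w) (tr_qhat w') hq hq').
Qed.

Lemma nrmU_ge w : Uspace w -> [/\ Num.sqrt (ip Omega (tr_u w) (tr_u w)) <= nrmU Omega T w,
  Num.sqrt (ipM Omega (tr_M w) (tr_M w)) <= nrmU Omega T w,
  nrm_32 Omega T (tr_uhat w) <= nrmU Omega T w & nrm_m32 Omega T (tr_qhat w) <= nrmU Omega T w].
Proof.
move=> [Lu LM hu hq]; rewrite /nrmU /nrm /nrmM.
have a0 := sqrtr_ge0 (ip Omega (tr_u w) (tr_u w)).
have b0 := sqrtr_ge0 (ipM Omega (tr_M w) (tr_M w)).
have v0 := nrm_32_ge0 hOmega hT hu; have q0 := nrm_m32_ge0 hOmega hT hq.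
move: a0 b0 v0 q0; set a := Num.sqrt (ip _ _ _); set b := Num.sqrt (ipM _ _ _).
set v := nrm_32 _ _ _; set q := nrm_m32 _ _ _ => a0 b0 v0 q0.
have le x : 0 <= x -> x ^+ 2 <= a ^+ 2 + b ^+ 2 + v ^+ 2 + q ^+ 2 ->
    x <= Num.sqrt (a ^+ 2 + b ^+ 2 + v ^+ 2 + q ^+ 2).
  by move=> x0 h; rewrite -[x]ger0_norm// -sqrtr_sqr ler_wsqrtr.
have := sqr_ge0 a; have := sqr_ge0 b; have := sqr_ge0 v; have := sqr_ge0 q.
by move=> *; split; apply: le => //; lra.
Qed.

Lemma nrmU_le w : Uspace w -> nrmU Omega T w <=
  Num.sqrt (ip Omega (tr_u w) (tr_u w)) + Num.sqrt (ipM Omega (tr_M w) (tr_M w)) +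
  nrm_32 Omega T (tr_uhat w) + nrm_m32 Omega T (tr_qhat w).
Proof.
move=> [Lu LM hu hq]; rewrite /nrmU /nrm /nrmM.
have a0 := sqrtr_ge0 (ip Omega (tr_u w) (tr_u w)).
have b0 := sqrtr_ge0 (ipM Omega (tr_M w) (tr_M w)).
have v0 := nrm_32_ge0 hOmega hT hu; have q0 := nrm_m32_ge0 hOmega hT hq.
move: a0 b0 v0 q0; set a := Num.sqrt (ip _ _ _); set b := Num.sqrt (ipM _ _ _).
set v := nrm_32 _ _ _; set q := nrm_m32 _ _ _ => a0 b0 v0 q0.
rewrite -[leRHS]ger0_norm ?addr_ge0// -sqrtr_sqr ler_wsqrtr//; nra.
Qed.

Lemma ipV_parts v : Vspace v -> ip2b T v.1 v.1 <= ipV T v v /\ ipddb T v.2 v.2 <= ipV T v v.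
Proof.
move=> [hz hTh]; have := sip_ge0 h2b hz; have := sip_ge0 hdd hTh.
by rewrite /ipV => h1 h2; split; lra.
Qed.

Lemma bform_bound w v : Uspace w -> Vspace v ->
  `|B w v| <= (c2 + 4) * nrmU Omega T w * Num.sqrt (ipV T v v).
Proof.
move=> hw hv; rewrite (bformE hw hv).
have [Lu LM hu hq] := hw; have [hz hTh] := hv.
have [p1 p2] := ipV_parts hv.
have [n1 n2 n3 n4] := nrmU_ge hw.
have c20 := cmp_bound_ge0 cmp.
set n := nrmU _ _ _ in n1 n2 n3 n4 *; set s := Num.sqrt (ipV T v v).
have s0 : 0 <= s by exact: sqrtr_ge0.
have n0 : 0 <= n by exact: le_trans (sqrtr_ge0 _) n1.
have le1 : Num.sqrt (ip2b T v.1 v.1) <= s by exact: ler_wsqrtr.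
have le2 : Num.sqrt (ipddb T v.2 v.2) <= s by exact: ler_wsqrtr.
have Lh := hessb_L2 hOmega hT hz.2; have LC := cmp_L2 cmp hTh.1.
have Ld := divdivb_L2 hOmega hT hTh.2.
have b1 : `|ipM Omega (tr_M w) (hessb T v.1)| <= n * s.
  apply: le_trans (sip_CS hM LM Lh) _; apply: ler_pM => //.
  exact: ler_wsqrtr (le_trans (hessb_le_ip2b hOmega hT hz) p1).
have b2 : `|ipM Omega (tr_M w) (C v.2)| <= n * (c2 * s).
  apply: le_trans (sip_CS hM LM LC) _; apply: ler_pM => //.
  rewrite -[c2]ger0_norm// -sqrtr_sqr -sqrtrM ?sqr_ge0// ler_wsqrtr//.
  apply: le_trans (cmp_bounded cmp hTh.1) _; rewrite ler_wpM2l ?sqr_ge0//.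
  exact: le_trans (ipM_le_ipddb hOmega hT hTh) p2.
have b3 : `|ip Omega (tr_u w) (divdivb T v.2)| <= n * s.
  apply: le_trans (sip_CS hL Lu Ld) _; apply: ler_pM => //.
  exact: ler_wsqrtr (le_trans (divdivb_le_ipddb hOmega hT hTh) p2).
have b4 : `|pairing (tr_qhat w) v.1| <= n * s.
  apply: le_trans (nrm_m32_bound hOmega hT hq hz) _; apply: ler_pM => //.
  exact: (nrm_m32_ge0 hOmega hT hq).
have b5 : `|pairing (tr_uhat w) v.2| <= n * s.
  apply: le_trans (nrm_32_bound hOmega hT hu hTh) _; apply: ler_pM => //.
  exact: (nrm_32_ge0 hOmega hT hu).
have tri (a1 a2 a3 a4 a5 : R) : `|a1 + a2 + a3 + a4 - a5| <= `|a1| + `|a2| + `|a3| + `|a4| + `|a5|.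
  apply: le_trans (ler_normB _ _) _; rewrite lerD2r.
  by do 3 (apply: le_trans (ler_normD _ _) _; rewrite lerD2r).
apply: le_trans (tri _ _ _ _ _) _.
rewrite (_ : (c2 + 4) * n * s = n * s + n * (c2 * s) + n * s + n * s + n * s); last by ring.
by rewrite !lerD.
Qed.

Lemma trial_to_testP w : Uspace w -> Vspace (trial_to_test Omega T E t nu w) /\
  forall v, Vspace v -> ipV T (trial_to_test Omega T E t nu w) v = B w v.
Proof.
move=> hw; rewrite /trial_to_test; case: xgetP => [s _ h //|].
have [s Ss hs] := riesz hV (V_complete hOmega hT) (fun a v v' => @bformLv a w v v' hw)
  (fun v => @bform_bound w v hw).
by move=> /(_ s)[]; split.
Qed.

End bilinear_form.

(** * The inf-sup condition *)

Lemma sqrt_le_of (R : realType) (K x : R) : 0 <= K -> 0 <= x -> x <= K * Num.sqrt x -> Num.sqrt x <= K.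
Proof.
move=> K0 x0 h; have s0 := sqrtr_ge0 x; have sE := sqr_sqrtr x0.
have [->//|sn] := eqVneq (Num.sqrt x) 0.
have sp : 0 < Num.sqrt x by rewrite lt_neqAle eq_sym sn.
by rewrite -(ler_pM2r sp) -expr2 sE.
Qed.

Section infsup.
Context {R : realType} {d : nat}.
Local Notation pt := 'rV[R]_d.
Context (Omega : set pt) (hOmega : plate_domain Omega).
Context (E t nu c0 c2 : R) (cmp : @compliance R d E t nu Omega c0 c2).
Variables (Cp : R) (Cp0 : 0 <= Cp).
Hypothesis poincareP : forall z H, hess_graph Omega (test_function Omega) z H ->
  ip Omega z z <= Cp * ipM Omega H H.
Implicit Types (z u f g : pt -> R) (Th M H : pt -> 'M[R]_d).
#[local] Opaque smooth partial eps grad div rowdiv hess divdiv.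

Let oO := domain_open hOmega.
Let bO := domain_bounded hOmega.
Let mO := domain_measurable hOmega.
Let hL : semi_ip (L2 Omega) (ip Omega) := L2_semi_ip mO.
Let hM : semi_ip (L2sym Omega) (ipM Omega) := L2sym_semi_ip mO.
Let hdd := Hdivdiv_semi_ip oO bO.
Local Notation C := (Cinv_field E t nu).

(** If [K < x], the inequality may be divided by [x]. *)
Lemma coercive_arith (P K x : R) : 0 <= P -> 0 <= K -> 0 <= x ->
  c0 * x ^+ 2 <= x * K + K * (P * (K + c2 * x)) ->
  x <= ((1 + P * c2 + P) / c0 + 1) * K.
Proof.
move=> P0 K0 x0 h; have c00 := cmp_pos cmp; have c20 := cmp_bound_ge0 cmp.
have Pc : 0 <= P * c2 by exact: mulr_ge0.
set r := _ / c0; have r0 : 0 <= r by apply: divr_ge0; [lra|exact: ltW].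
have rE : r * c0 = 1 + P * c2 + P by rewrite divfK// gt_eqF.
rewrite leNgt; apply/negP => hx.
have rK : 0 <= r * K by exact: mulr_ge0.
have Kx : K < x by lra.
have xp : 0 < x by lra.
have h1 : c0 * ((r + 1) * K) * x < c0 * x * x by rewrite ltr_pM2r// ltr_pM2l.
have h2 : P * K * K <= P * K * x by rewrite ler_wpM2l ?mulr_ge0// ltW.
have h3 : 0 <= c0 * K * x by rewrite !mulr_ge0// ltW.
have h4 : c0 * ((r + 1) * K) * x = (r * c0) * K * x + c0 * K * x by ring.
rewrite h4 rE in h1; rewrite expr2 in h; nra.
Qed.

Section fields.
Variables (u : pt -> R) (M : pt -> 'M[R]_d) (K : R).
Hypotheses (Lu : L2 Omega u) (LM : L2sym Omega M) (K0 : 0 <= K).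
(** The bound on the bilinear form for conforming test functions, on which the
    trace terms vanish. *)
Hypothesis conf : forall z H Th g, hess_graph Omega (test_function Omega) z H ->
  divdiv_graph Omega Th g ->
  `|ipM Omega M H + ipM Omega M (C Th) + ip Omega u g| <=
  K * Num.sqrt (ip Omega z z + ipM Omega H H + (ipM Omega Th Th + ip Omega g g)).

Let x := Num.sqrt (ipM Omega M M).
(** The factor between the norm of the Hessian and the full norm on [H20]. *)
Let P := Num.sqrt (Cp + 1).

Let hess0 : hess_graph Omega (test_function Omega) 0 0.
Proof.
have [L0 _] := sip_sub hL; have [M0 _] := sip_sub hM.
have ts : test_function Omega `<=` smooth by move=> f; exact: test_smooth.
have := graph_closureD hL hM (smooth_in_L2 oO bO ts) (hess_in_L2 oO bO ts) (test_subspace Omega).1.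
have -> : eps (grad (0 : pt -> R)) = 0.
  have s0 : smooth (0 : pt -> R) by exact: smooth_subspace.1.
  have := hess_linear 1 s0 s0; rewrite !scale1r addr0 => h.
  by apply: (addrI (eps (grad (0 : pt -> R)))); rewrite addr0 -h.
exact.
Qed.

Let divdiv0 : divdiv_graph Omega 0 0.
Proof.
have := smooth_sym_divdiv oO bO (smooth_sym_subspace (R := R) (d := d)).1.
have -> : div (rowdiv (0 : pt -> 'M[R]_d)) = 0.
  have s0 := (smooth_sym_subspace (R := R) (d := d)).1.
  have := divdiv_linear 1 s0 s0; rewrite !scale1r addr0 => h.
  by apply: (addrI (div (rowdiv (0 : pt -> 'M[R]_d)))); rewrite addr0 -h.
exact.
Qed.

Let phi Th := ipM Omega M (C Th) + ip Omega u (divdiv Omega Th).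

Let combine (a p1 p2 p3 p4 : R) : a * p1 + p2 + (a * p3 + p4) = a * (p1 + p3) + (p2 + p4).
Proof. by ring. Qed.

Let phiL (a : R) Th Th' : Hdivdiv Omega Th -> Hdivdiv Omega Th' ->
  phi (a *: Th + Th') = a * phi Th + phi Th'.
Proof.
move=> hT hT'; have E1 := cmp_linear cmp a (Hdivdiv_L2 hT) (Hdivdiv_L2 hT') LM.
have E2 := divdiv_ipL oO bO a hT hT' Lu.
have C0 Th0 : ip Omega u (divdiv Omega Th0) = ip Omega (divdiv Omega Th0) u by exact: ipC.
have Y := f_equal2 +%R E1 (etrans (C0 _) E2).
have Z := @f_equal2 R R R (fun p r => a * p + r) _ _ _ _ (C0 Th) (C0 Th').
apply: etrans Y _; apply: etrans (f_equal2 +%R erefl (esym Z)) _.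
exact: combine.
Qed.

Let CZ : ipM Omega M (C 0) = 0.
Proof.
have [M0 _] := sip_sub hM.
have := cmp_linear cmp 1 M0 M0 LM; rewrite scale1r addr0 mul1r; lra.
Qed.

Let ip0 f : L2 Omega f -> ip Omega f 0 = 0.
Proof. by move=> Lf; rewrite ipC (sip0l hL Lf). Qed.

Let ipM0 Q : L2sym Omega Q -> ipM Omega Q 0 = 0.
Proof. by move=> LQ; have [M0 _] := sip_sub hM; rewrite (sipC hM LQ M0) (sip0l hM LQ). Qed.

Let phi_bound Th : Hdivdiv Omega Th -> `|phi Th| <= K * Num.sqrt (ipdd Omega Th Th).
Proof.
move=> hT; have := conf hess0 (Hdivdiv_graph hT).
have [L0 _] := sip_sub hL; have [M0 _] := sip_sub hM.
by rewrite (ipM0 LM) (ip0 L0) (ipM0 M0) !add0r.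
Qed.

(** Take the Riesz representative [S] of the part of the form that acts on the
    tensor variable: [u - div div S] then vanishes on the boundary together with
    its gradient, so that it may be used as the scalar test function. The
    coercivity of the compliance tensor closes the estimate. *)
Lemma field_bounds : x <= ((1 + P * c2 + P) / c0 + 1) * K /\
  Num.sqrt (ip Omega u u) <= P * (K + c2 * x) + K.
Proof.
have x0 : 0 <= x by exact: sqrtr_ge0.
have P0 : 0 <= P by exact: sqrtr_ge0.
have c20 := cmp_bound_ge0 cmp.
have [S hS SE] := riesz hdd (Hdivdiv_complete oO bO) phiL phi_bound.
have LS := Hdivdiv_L2 hS; have Lg := divdiv_L2 hS; set g := divdiv Omega S in Lg.
have LC := cmp_L2 cmp LM.
have S0 := sip_ge0 hdd hS.
have SK : Num.sqrt (ipdd Omega S S) <= K.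
  apply: sqrt_le_of => //; apply: le_trans (phi_bound hS); rewrite -SE//.
  exact: ler_norm.
have sM : Num.sqrt (ipM Omega S S) <= K.
  apply: le_trans SK; rewrite ler_wsqrtr// /ipdd lerDl; exact: sip_ge0 hL _ Lg.
have sg : Num.sqrt (ip Omega g g) <= K.
  apply: le_trans SK; rewrite ler_wsqrtr// /ipdd lerDr; exact: sip_ge0 hM _ LS.
pose u1 := u - g; pose h := S - C M.
have Lu1 : L2 Omega u1 := subspaceB (sip_sub hL) Lu Lg.
have Lh : L2sym Omega h := subspaceB (sip_sub hM) LS LC.
have G : hess_graph Omega (test_function Omega) u1 h.
  have [_ O0 _ lO _] := hOmega.
  apply: weak_hess_H20 => // Th sTh.
  have gTh := smooth_sym_divdiv oO bO sTh; have hTh := divdiv_graph_H gTh.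
  have [LTh LD _] := gTh; set D := div (rowdiv Th) in gTh LD *.
  have DD f : L2 Omega f -> ip Omega f (divdiv Omega Th) = ip Omega f D.
    move=> Lf; apply: etrans (ipC _ _ _) _; apply: etrans _ (ipC _ _ _).
    apply: (sip_eq hL (divdiv_L2 hTh) LD Lf).
    apply: (divdiv_uniq oO bO (Hdivdiv_graph hTh) gTh).
    by rewrite subrr (sip0l hM)//; exact: (sip_sub hM).1.
  (* the defining property of [S], with the classical double divergence *)
  have E1 : ipM Omega S Th + ip Omega g D = ipM Omega M (C Th) + ip Omega u D.
    apply: etrans (f_equal2 +%R erefl (esym (DD g Lg))) _.
    by apply: etrans (SE Th hTh) _; congr (_ + _); exact: DD.
  have E2 := cmp_adjoint cmp LM LTh.
  have E3 := sipBl hL Lu Lg LD; have E4 := sipBl hM LS LC LTh.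
  apply: etrans E3 _; apply: etrans _ (esym E4); lra.
have h0 := sip_ge0 hM Lh.
have hN : Num.sqrt (ipM Omega h h) <= K + c2 * x.
  have := sip_triangle hM LS (subspaceN (sip_sub hM) LC) => /le_trans; apply.
  apply: lerD => //.
  rewrite (_ : ipM Omega (- C M) (- C M) = ipM Omega (C M) (C M)); last first.
    rewrite (sipNl hM LC (subspaceN (sip_sub hM) LC)) (sipC hM LC (subspaceN (sip_sub hM) LC)).
    by rewrite (sipNl hM LC LC) opprK.
  rewrite -[c2]ger0_norm// -sqrtr_sqr /x -sqrtrM ?sqr_ge0// ler_wsqrtr//.
  exact: (cmp_bounded cmp LM).
have pu := poincareP G.
have uN : Num.sqrt (ip Omega u1 u1 + ipM Omega h h) <= P * Num.sqrt (ipM Omega h h).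
  by rewrite /P -sqrtrM ?addr_ge0// ler_wsqrtr//; lra.
have conf1 : `|ipM Omega M h| <= K * (P * (K + c2 * x)).
  have := conf G divdiv0; have [L0 _] := sip_sub hL; have [M0 _] := sip_sub hM.
  rewrite CZ (ip0 Lu) (ip0 L0) (ipM0 M0) !addr0 => /le_trans; apply.
  rewrite ler_wpM2l//; apply: le_trans uN _; exact: ler_wpM2l.
have coer : c0 * x ^+ 2 <= x * K + K * (P * (K + c2 * x)).
  rewrite /x sqr_sqrtr; last exact: sip_ge0 hM _ LM.
  apply: le_trans (cmp_coercive cmp LM) _.
  have -> : ipM Omega M (C M) = ipM Omega M S - ipM Omega M h.
    have := sipBr hM LS LC LM; rewrite -/h; lra.
  apply: le_trans (ler_norm _) (le_trans (ler_normB _ _) (lerD _ conf1)).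
  apply: le_trans (sip_CS hM LM LS) _; rewrite ler_wpM2l//.
split; first exact: coercive_arith.
have -> : u = u1 + g by rewrite /u1 subrK.
apply: le_trans (sip_triangle hL Lu1 Lg) _; apply: lerD => //.
apply: le_trans (ler_wpM2l P0 hN); rewrite /P -sqrtrM ?addr_ge0// ler_wsqrtr//; lra.
Qed.

End fields.

Section mesh.
Context {N : nat} (T : 'I_N -> set pt) (hT : is_mesh Omega T).
Implicit Types (w : trial R d N) (v : test R d).
Local Notation B := (bform Omega T E t nu).

(** Conforming test functions do not see the traces of conforming functions. *)
Lemma bform_conforming w z H Th g : Uspace Omega T w ->
  hess_graph Omega (test_function Omega) z H -> divdiv_graph Omega Th g ->
  B w (z, Th) = ipM Omega (tr_M w) H + ipM Omega (tr_M w) (C Th) + ip Omega (tr_u w) g.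
Proof.
move=> hw hz hg; have [Lu LM [z0 hz0 vE] [Th0 hTh0 qE]] := hw.
have hz2 := conforming_H2b hOmega hT hz; have hT2 := conforming_Hdivdivb hOmega hT hg.
have [_ LH _] := hz; have [LTh Lg _] := hg.
have E0 := bformE hOmega hT cmp hw (conj hz2 hT2 : Vspace Omega T (z, Th)).
have E1 : ipM Omega (tr_M w) (hessb T z) = ipM Omega (tr_M w) H.
  apply: etrans (ipM_hessb hOmega hT LM hz2.2) _; apply: etrans _ (esym (ipM_mesh hOmega hT LM LH)).
  by apply: eq_bigr => k _; exact: (conforming_hess hOmega hT hz (L2sym_element hOmega hT k LM)).
have E2 : ip Omega (tr_u w) (divdivb T Th) = ip Omega (tr_u w) g.
  apply: etrans (ip_divdivb hOmega hT Lu hT2.2) _; apply: etrans _ (esym (ip_mesh hOmega hT Lu Lg)).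
  by apply: eq_bigr => k _; exact: (conforming_divdiv hOmega hT hg (L2_element hOmega hT k Lu)).
have E3 : pairing (tr_qhat w) z = 0.
  rewrite qE; apply: etrans (conforming_trace hOmega hT hz (Hdivdiv_graph hTh0)).
  by apply: eq_bigr => k _; exact: tr_dDivE (hz2.2 k).
have E4 : pairing (tr_uhat w) Th = 0.
  have [H0 hH0] := H20_graph hz0.
  rewrite vE; apply: etrans (conforming_trace hOmega hT hH0 hg).
  by apply: eq_bigr => k _; exact: tr_GgradE (hT2.2 k).
have X := f_equal2 (fun p q => p - q) (f_equal2 +%R (f_equal2 +%R (f_equal2 +%R E1 erefl) E2) E3) E4.
by apply: etrans E0 _; apply: etrans (X _) _; rewrite subr0 addr0.
Qed.

Let V0 : Vspace Omega T (0 : test R d) := (sip_sub (V_semi_ip hOmega hT)).1.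

(** A vanishing tensor component isolates the trace [tr_qhat w]; likewise,
    [bform_tensor] isolates [tr_uhat w]. *)
Lemma bform_scalar w z : Uspace Omega T w -> H2b Omega T z ->
  B w (z, 0) = ipM Omega (tr_M w) (hessb T z) + pairing (tr_qhat w) z.
Proof.
move=> hw hz; have [Lu LM hu hq] := hw.
have [_ hT0] := V0; have [M0 _] := sip_sub hM.
have E0 := bformE hOmega hT cmp hw (conj hz hT0 : Vspace Omega T (z, 0)).
have E1 : ipM Omega (tr_M w) (C 0) = 0.
  have := cmp_linear cmp 1 M0 M0 LM; rewrite scale1r addr0 mul1r; lra.
have E2 : ip Omega (tr_u w) (divdivb T 0) = 0.
  have := ip_divdivbL hOmega hT 1 Lu hT0 hT0; rewrite scale1r addr0 mul1r; lra.
have E4 : pairing (tr_uhat w) 0 = 0.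
  have := pairing_vL hOmega hT 1 hu hT0 hT0; rewrite scale1r addr0 mul1r; lra.
have X := f_equal2 (fun p q => p - q) (f_equal2 +%R (f_equal2 +%R (f_equal2 +%R erefl E1) E2) erefl) E4.
by apply: etrans E0 _; apply: etrans (X _ _) _; rewrite subr0 !addr0.
Qed.

Lemma bform_tensor w Th : Uspace Omega T w -> Hdivdivb Omega T Th ->
  B w (0, Th) = ipM Omega (tr_M w) (C Th) + ip Omega (tr_u w) (divdivb T Th) - pairing (tr_uhat w) Th.
Proof.
move=> hw hTh; have [Lu LM hu hq] := hw.
have [hz0 _] := V0.
have E0 := bformE hOmega hT cmp hw (conj hz0 hTh : Vspace Omega T (0, Th)).
have E1 : ipM Omega (tr_M w) (hessb T 0) = 0.
  have := ipM_hessbL hOmega hT 1 LM hz0 hz0; rewrite scale1r addr0 mul1r; lra.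
have E3 : pairing (tr_qhat w) 0 = 0.
  have := pairing_qL hOmega hT 1 hq hz0 hz0; rewrite scale1r addr0 mul1r; lra.
have X := f_equal2 (fun p q => p - q) (f_equal2 +%R (f_equal2 +%R (f_equal2 +%R E1 erefl) erefl) E3) erefl.
by apply: etrans E0 _; apply: etrans (X _ _ _) _; rewrite addr0 add0r.
Qed.

End mesh.

(** The fields are bounded by means of conforming test functions, which know
    nothing of the mesh; then the traces by means of broken ones. Hence the
    constant is the same for all meshes. *)
Theorem infsup : exists2 c1 : R, 0 < c1 & forall N (T : 'I_N -> set pt), is_mesh Omega T ->
  forall (w : trial R d N) (K : R), Uspace Omega T w -> 0 <= K ->
  (forall v, Vspace Omega T v -> `|bform Omega T E t nu w v| <= K * Num.sqrt (ipV T v v)) ->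
  nrmU Omega T w <= c1 * K.
Proof.
have c00 := cmp_pos cmp; have c20 := cmp_bound_ge0 cmp.
pose P := Num.sqrt (Cp + 1); have P0 : 0 <= P by exact: sqrtr_ge0.
pose cM := (1 + P * c2 + P) / c0 + 1.
have cM0 : 0 <= cM.
  apply: addr_ge0 => //; apply: divr_ge0; last exact: ltW.
  by have := mulr_ge0 P0 c20; lra.
pose cu := P * (1 + c2 * cM) + 1.
have cu0 : 0 <= cu by rewrite addr_ge0// mulr_ge0// addr_ge0// mulr_ge0.
have ccM : 0 <= c2 * cM by exact: mulr_ge0.
exists (cu + cM + (1 + c2 * cM + cu) + (1 + cM)); first by lra.
move=> N T hT w K hw K0 hB; have [Lu LM hu hq] := hw.
have h2b := H2b_semi_ip hOmega hT; have hddb := Hdivdivb_semi_ip hOmega hT.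
have conf z H Th g : hess_graph Omega (test_function Omega) z H -> divdiv_graph Omega Th g ->
    `|ipM Omega (tr_M w) H + ipM Omega (tr_M w) (C Th) + ip Omega (tr_u w) g| <=
    K * Num.sqrt (ip Omega z z + ipM Omega H H + (ipM Omega Th Th + ip Omega g g)).
  move=> hz hg; have hz2 := conforming_H2b hOmega hT hz; have hT2 := conforming_Hdivdivb hOmega hT hg.
  have := hB _ (conj hz2 hT2 : Vspace Omega T (z, Th)).
  rewrite (bform_conforming hT hw hz hg).
  by rewrite /ipV /= (conforming_ip2b hOmega hT hz) (conforming_ipddb hOmega hT hg).
have [hx hu'] := field_bounds Lu LM K0 conf; rewrite -/P -/cM in hx hu'.
set x := Num.sqrt (ipM Omega _ _) in hx hu'; have x0 : 0 <= x by exact: sqrtr_ge0.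
have c2x : c2 * x <= c2 * (cM * K) by exact: ler_wpM2l.
have uK : Num.sqrt (ip Omega (tr_u w) (tr_u w)) <= cu * K.
  apply: le_trans hu' _; rewrite /cu mulrDl mul1r lerD2r -mulrA ler_wpM2l//; lra.
set y := Num.sqrt (ip _ _ _) in uK; have y0 : 0 <= y by exact: sqrtr_ge0.
have qK : nrm_m32 Omega T (tr_qhat w) <= K + x.
  apply: (nrm_m32_le hOmega hT); first exact: addr_ge0.
  move=> z hz; have [_ hT0] := (sip_sub (V_semi_ip hOmega hT)).1.
  have := hB _ (conj hz hT0 : Vspace Omega T (z, 0)).
  rewrite (bform_scalar hT hw hz) /ipV /= (sip0l hddb hT0) addr0 => h1.
  have h2 : `|ipM Omega (tr_M w) (hessb T z)| <= x * Num.sqrt (ip2b T z z).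
    apply: le_trans (sip_CS hM LM (hessb_L2 hOmega hT hz.2)) _.
    rewrite ler_wpM2l// ler_wsqrtr//; exact: hessb_le_ip2b.
  move: h1 h2; rewrite !ler_norml => /andP[h3 h4] /andP[h5 h6]; rewrite mulrDl; lra.
have vK : nrm_32 Omega T (tr_uhat w) <= K + c2 * x + y.
  apply: (nrm_32_le hOmega hT); first by rewrite addr_ge0// addr_ge0// mulr_ge0.
  move=> Th hTh; have [hz0 _] := (sip_sub (V_semi_ip hOmega hT)).1.
  have := hB _ (conj hz0 hTh : Vspace Omega T (0, Th)).
  rewrite (bform_tensor hT hw hTh) /ipV /= (sip0l h2b hz0) add0r => h1.
  set s := Num.sqrt (ipddb T Th Th) in h1 *.
  have h2 : `|ipM Omega (tr_M w) (C Th)| <= x * (c2 * s).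
    apply: le_trans (sip_CS hM LM (cmp_L2 cmp hTh.1)) _; rewrite ler_wpM2l//.
    rewrite -[c2]ger0_norm// -sqrtr_sqr -sqrtrM ?sqr_ge0// ler_wsqrtr//.
    apply: le_trans (cmp_bounded cmp hTh.1) _; rewrite ler_wpM2l ?sqr_ge0//.
    exact: ipM_le_ipddb.
  have h3 : `|ip Omega (tr_u w) (divdivb T Th)| <= y * s.
    apply: le_trans (sip_CS hL Lu (divdivb_L2 hOmega hT hTh.2)) _.
    rewrite ler_wpM2l// ler_wsqrtr//; exact: divdivb_le_ipddb.
  move: h1 h2 h3; rewrite !ler_norml => /andP[h3 h4] /andP[h5 h6] /andP[h7 h8].
  rewrite (_ : (K + c2 * x + y) * s = K * s + x * (c2 * s) + y * s); last by ring.
  lra.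
apply: le_trans (nrmU_le hOmega hT hw) _; rewrite -/x -/y.
rewrite (_ : _ * K = cu * K + cM * K + (K + c2 * (cM * K) + cu * K) + (K + cM * K)); last by ring.
lra.
Qed.

End infsup.

(** * The discontinuous Petrov-Galerkin method *)

Lemma scaled_le_trans (R : realType) (a b p q r s : R) :
  0 <= a -> p <= a * q -> q <= r -> r <= b * s -> p <= a * b * s.
Proof.
move=> a0 pq qr rs; apply: le_trans pq _; rewrite -mulrA; apply: ler_wpM2l a0 _ _ _.
exact: le_trans qr rs.
Qed.

Section dpg.
Context {R : realType} {d : nat}.
Local Notation pt := 'rV[R]_d.
Context (Omega : set pt) (hOmega : plate_domain Omega).
Context {N : nat} (T : 'I_N -> set pt) (hT : is_mesh Omega T).
Context (E t nu c0 c2 : R) (cmp : @compliance R d E t nu Omega c0 c2).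
Variable c1 : R.
Hypothesis infsupP : forall (w : trial R d N) (K : R), Uspace Omega T w -> 0 <= K ->
  (forall v, Vspace Omega T v -> `|bform Omega T E t nu w v| <= K * Num.sqrt (ipV T v v)) ->
  nrmU Omega T w <= c1 * K.
Implicit Types (w : trial R d N) (v : test R d) (f : pt -> R).
#[local] Opaque smooth partial eps grad div rowdiv hess divdiv.

Let mO := domain_measurable hOmega.
Let hL : semi_ip (L2 Omega) (ip Omega) := L2_semi_ip mO.
Let hV := V_semi_ip hOmega hT.
Let hU := Uspace_subspace hOmega hT.
Local Notation B := (bform Omega T E t nu).
Local Notation TT := (trial_to_test Omega T E t nu).
Local Notation US := (Uspace Omega T).
Local Notation VS := (Vspace Omega T).
Local Notation ipv := (ipV T).

Lemma trial_to_test_V w : US w -> VS (TT w).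
Proof. by move=> hw; have [] := trial_to_testP hOmega hT cmp hw. Qed.

Lemma trial_to_testE w v : US w -> VS v -> ipv (TT w) v = B w v.
Proof. by move=> hw; have [_] := trial_to_testP hOmega hT cmp hw; exact. Qed.

Let energy w := Num.sqrt (ipv (TT w) (TT w)).

(** The energy norm is the dual norm of the functional [B w] on the test
    space. *)
Lemma nrmU_le_energy w : US w -> nrmU Omega T w <= c1 * energy w.
Proof.
move=> hw; apply: infsupP => //; first exact: sqrtr_ge0.
by move=> v hv; rewrite -(trial_to_testE hw hv); exact: (sip_CS hV (trial_to_test_V hw) hv).
Qed.

Lemma nrmU_ge0 w : 0 <= nrmU Omega T w.
Proof. exact: sqrtr_ge0. Qed.

Lemma energy_le_nrmU w : US w -> energy w <= (c2 + 4) * nrmU Omega T w.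
Proof.
move=> hw; have hv := trial_to_test_V hw; have c20 := cmp_bound_ge0 cmp.
apply: sqrt_le_of.
- by rewrite mulr_ge0 ?nrmU_ge0// addr_ge0.
- exact: (sip_ge0 hV hv).
- rewrite {1}(trial_to_testE hw hv); apply: le_trans (ler_norm _) _.
  exact: (bform_bound hOmega hT cmp hw hv).
Qed.

Lemma nrmU_null w : US w -> nrmU Omega T w <= 0 -> Ueq Omega w 0.
Proof.
move=> hw n0; have [h1 h2 h3 h4] := nrmU_ge hOmega hT hw; have [Lu LM hu hq] := hw.
split.
- apply: (ip_null mO Lu); apply/eqP; rewrite eq_le (sip_ge0 hL Lu) andbT.
  by rewrite -sqrtr_eq0 eq_le sqrtr_ge0 (le_trans h1 n0).
- apply: (ipM_null mO LM); apply/eqP; rewrite eq_le (sip_ge0 (L2sym_semi_ip mO) LM) andbT.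
  by rewrite -sqrtr_eq0 eq_le sqrtr_ge0 (le_trans h2 n0).
- apply: (nrm_32_null hOmega hT hu); apply/eqP.
  by rewrite eq_le (le_trans h3 n0) (nrm_32_ge0 hOmega hT hu).
- apply: (nrm_m32_null hOmega hT hq); apply/eqP.
  by rewrite eq_le (le_trans h4 n0) (nrm_m32_ge0 hOmega hT hq).
Qed.

Lemma bform_Ueq w w' v : US w -> US w' -> VS v -> Ueq Omega w w' -> B w v = B w' v.
Proof.
move=> hw hw' hv [e1 e2 e3 e4]; have [Lu LM hu hq] := hw; have [Lu' LM' hu' hq'] := hw'.
have [hz hTh] := hv; have hM := L2sym_semi_ip mO (d := d).
have Lh := hessb_L2 hOmega hT hz.2; have LC := cmp_L2 cmp hTh.1.
have LS := subspaceD (sip_sub hM) Lh LC.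
have Ld := divdivb_L2 hOmega hT hTh.2.
have E1 := ipM_ae_eq mO LM LS LM' LS e2 (ae_eq_refl _ _ _).
have E2 := ip_ae_eq mO Lu Ld Lu' Ld e1 (ae_eq_refl _ _ _).
have E3 := congr1 (fun q => pairing q v.1) e4.
have E4 := congr1 (fun q => pairing q v.2) e3.
exact: (f_equal2 (fun p q => p - q) (f_equal2 +%R (f_equal2 +%R E1 E2) E3) E4).
Qed.

Lemma bformBw w w' v : US w -> US w' -> VS v -> B (w - w') v = B w v - B w' v.
Proof.
move=> hw hw' hv; have := bformLw hOmega hT cmp (-1) hw' hw hv.
by rewrite scaleN1r [- w' + w]addrC mulN1r addrC => ->; rewrite addrC.
Qed.

Lemma bform_sum n (a : 'I_n -> R) (e : 'I_n -> trial R d N) v : (forall i, US (e i)) -> VS v ->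
  B (\sum_i a i *: e i) v = \sum_i a i * B (e i) v.
Proof.
move=> he hv; elim: n a e he => [|n IH] a e he.
  rewrite !big_ord0; have := bformLw hOmega hT cmp 1 hU.1 hU.1 hv.
  rewrite scale1r addr0 mul1r; lra.
have hr : US (\sum_i a (lift ord0 i) *: e (lift ord0 i)).
  by apply: (subspace_sum hU) => i; exact: (subspaceZ _ hU (he _)).
have E0 := bformLw hOmega hT cmp (a ord0) (he ord0) hr hv.
have E1 := IH (fun i => a (lift ord0 i)) (fun i => e (lift ord0 i)) (fun i => he _).
rewrite [in LHS]big_ord_recl [in RHS]big_ord_recl.
by apply: etrans E0 _; congr (_ + _); exact: E1.
Qed.

Lemma bform_sum_riesz n (a : 'I_n -> R) (e : 'I_n -> trial R d N) v : (forall i, US (e i)) -> VS v ->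
  B (\sum_i a i *: e i) v = ipv (\sum_i a i *: TT (e i)) v.
Proof.
move=> he hv; rewrite bform_sum// (sip_suml hV _ hv).
  by apply: eq_bigr => i _; rewrite (sipZl hV _ (trial_to_test_V (he i)) hv) trial_to_testE.
by move=> i; apply: (subspaceZ _ (sip_sub hV)); exact: trial_to_test_V.
Qed.

Lemma load_riesz f : L2 Omega f -> exists2 l, VS l & forall v, VS v -> ipv l v = load Omega f v.
Proof.
move=> Lf; apply: (riesz hV (C := Num.sqrt (ip Omega f f)) (V_complete hOmega hT)).
  move=> a v v' [[Lz _] _] [[Lz' _] _].
  have E1 := sipDr hL (subspaceZ a (sip_sub hL) Lz) Lz' Lf.
  have E2 := sipZr hL a Lz Lf.
  rewrite /load mulrN -opprD; congr (- _).
  by apply: etrans E1 _; congr (_ + _); exact: E2.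
move=> v hv; have [[Lz hz] _] := hv; rewrite /load normrN.
apply: le_trans (sip_CS hL Lf Lz) _; rewrite ler_wpM2l ?sqrtr_ge0// ler_wsqrtr//.
have [h _] := ipV_parts hOmega hT hv; apply: le_trans h.
exact: (ip_le_ip2b hOmega hT (conj Lz hz)).
Qed.

Lemma fin_dim_sub (Uh : set (trial R d N)) : fin_dim_subspace Omega T Uh ->
  forall w w', Uh w -> Uh w' -> Uh (w - w').
Proof.
move=> [n [e [he ->]]] w w' [hw [a [a1 a2 a3 a4]]] [hw' [b [b1 b2 b3 b4]]].
split; first exact: subspaceB.
exists (fun i => a i - b i).
rewrite (_ : \sum_i (a i - b i) *: e i = \sum_i a i *: e i - \sum_i b i *: e i); last first.
  by rewrite -sumrB; apply: eq_bigr => i _; rewrite scalerBl.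
split.
- by apply: filterS2 a1 b1 => x h h' Ox; rewrite -[LHS]/(tr_u w x - tr_u w' x) h// h'.
- by apply: filterS2 a2 b2 => x h h' Ox; rewrite -[LHS]/(tr_M w x - tr_M w' x) h// h'.
- by rewrite -[LHS]/(tr_uhat w - tr_uhat w') a3 b3.
- by rewrite -[LHS]/(tr_qhat w - tr_qhat w') a4 b4.
Qed.

(** The projection of the representative of the load onto the span of the
    [TT (e i)] gives the discrete solution. By Galerkin orthogonality its error
    is minimal in the energy norm, which is equivalent to the norm of the trial
    space. *)
Theorem dpg_quasi_optimal f (Uh : set (trial R d N)) : L2 Omega f -> fin_dim_subspace Omega T Uh ->
  0 < c1 ->
  exists uh : trial R d N,
      [/\ is_dpg_solution Omega T E t nu f Uh uh,
          forall uh' : trial R d N,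
            is_dpg_solution Omega T E t nu f Uh uh' -> Ueq Omega uh' uh
        & forall u : trial R d N, is_solution Omega T E t nu f u ->
          forall w : trial R d N, Uh w ->
            nrmU Omega T (u - uh) <= c1 * (c2 + 4) * nrmU Omega T (u - w)].
Proof.
move=> Lf hUh c10; have Usub := fin_dim_sub hUh.
have [n [e [he UhE]]] := hUh.
have UhU w : Uh w -> US w by rewrite UhE => -[].
have [l hl lE] := load_riesz Lf.
have hv i := trial_to_test_V (he i).
have [a ha] := finite_projection hV hv hl.
set s := \sum_i a i *: TT (e i) in ha.
have hs : VS s.
  by apply: (subspace_sum (sip_sub hV)) => i; exact: (subspaceZ (a i) (sip_sub hV) (hv i)).
pose uh := \sum_i a i *: e i.
have hs' : US uh by apply: (subspace_sum hU) => i; exact: (subspaceZ (a i) hU (he i)).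
have uhU : Uh uh.
  rewrite UhE; split => //; exists a; split => //; exact: ae_eq_refl.
have hls := subspaceB (sip_sub hV) hl hs.
have galerkin delta : Uh delta -> B uh (TT delta) = load Omega f (TT delta).
  move=> hd; have hdU := UhU _ hd; have hTd := trial_to_test_V hdU.
  move: hd; rewrite UhE => -[_ [b hb]].
  have hb' : US (\sum_i b i *: e i).
    by apply: (subspace_sum hU) => i; exact: (subspaceZ (b i) hU (he i)).
  have E0 : ipv (l - s) (TT delta) = 0.
    rewrite (sipC hV hls hTd) trial_to_testE// (bform_Ueq hdU hb' hls hb) bform_sum_riesz// (sip_suml hV _ hls).
      apply: big1 => i _; rewrite (sipZl hV _ (hv i) hls) (sipC hV (hv i) hls) ha.
      by rewrite mulr0.
    by move=> i; exact: (subspaceZ (b i) (sip_sub hV) (hv i)).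
  rewrite (sipBl hV hl hs hTd) lE// -(bform_sum_riesz a he hTd) in E0.
  by move/eqP: E0; rewrite subr_eq0 => /eqP ->.
exists uh; split.
- by split.
- move=> uh' [huh' gal']; have hw := Usub _ _ huh' uhU; have hwU := UhU _ hw.
  have hTw := trial_to_test_V hwU.
  have n0 : energy (uh' - uh) = 0.
    rewrite /energy trial_to_testE// (bformBw (UhU _ huh') hs' hTw) gal'// galerkin// subrr.
    exact: sqrtr0.
  have := nrmU_le_energy hwU; rewrite n0 mulr0 => /(nrmU_null hwU)[e1 e2 e3 e4].
  split.
  + by apply: filterS e1 => x h Ox; apply/eqP; rewrite -subr_eq0; apply/eqP; exact: h.
  + by apply: filterS e2 => x h Ox; apply/eqP; rewrite -subr_eq0; apply/eqP; exact: h.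
  + by apply/eqP; rewrite -subr_eq0; apply/eqP.
  + by apply/eqP; rewrite -subr_eq0; apply/eqP.
- move=> u [hu sol] w hw; have hwU := UhU _ hw.
  set x := u - uh; set y := u - w.
  have hx : US x by exact: subspaceB. have hy : US y by exact: subspaceB.
  have hz := Usub _ _ hw uhU; have hzU := UhU _ hz.
  have hTx := trial_to_test_V hx; have hTy := trial_to_test_V hy; have hTz := trial_to_test_V hzU.
  (* Galerkin orthogonality, by symmetry of the inner product *)
  have E0 : B (w - uh) (TT x) = 0.
    rewrite -(trial_to_testE hzU hTx) (sipC hV hTz hTx) (trial_to_testE hx hTz) (bformBw hu hs' hTz).
    by rewrite sol// galerkin// subrr.
  (* [y - x = uh - w] lies in [Uh] *)
  have E1 : ipv (TT x) (TT x) = ipv (TT y) (TT x).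
    rewrite (trial_to_testE hx hTx) (trial_to_testE hy hTx) (bformBw hu hs' hTx) (bformBw hu hwU hTx).
    rewrite (bformBw hwU hs' hTx) in E0; lra.
  have E2 : energy x <= energy y.
    apply: sqrt_le_of; [exact: sqrtr_ge0|exact: (sip_ge0 hV hTx)|].
    rewrite {1}E1; apply: le_trans (ler_norm _) _; exact: (sip_CS hV hTy hTx).
  exact: (scaled_le_trans (ltW c10) (nrmU_le_energy hx) E2 (energy_le_nrmU hy)).
Qed.

End dpg.

Theorem theorem12 (R : realType) (d : nat) (hd : d = 2%N \/ d = 3%N)
    (Omega : set 'rV[R]_d) (hOmega : plate_domain Omega)
    (E t nu : R) (hE : 0 < E) (ht : 0 < t) (hnu : -1 < nu) (hnu' : nu <= 2^-1)
    (hC : @Ctens_posdef R d E t nu) :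
  exists c : R, 0 < c /\
    forall (N : nat) (T : 'I_N -> set 'rV[R]_d), is_mesh Omega T ->
    forall f : 'rV[R]_d -> R, L2 Omega f ->
    forall Uh : set (trial R d N), fin_dim_subspace Omega T Uh ->
    exists uh : trial R d N,
      [/\ is_dpg_solution Omega T E t nu f Uh uh,
          forall uh' : trial R d N,
            is_dpg_solution Omega T E t nu f Uh uh' -> Ueq Omega uh' uh
        & forall u : trial R d N, is_solution Omega T E t nu f u ->
          forall w : trial R d N, Uh w ->
            nrmU Omega T (u - uh) <= c * nrmU Omega T (u - w)].
Proof.
have d0 : (0 < d)%N by case: hd => ->.
have [c0 [c2 cmp]] := compliance_exists d0 hE ht hnu hnu' hC (domain_measurable hOmega).
have [Cp Cp0 hP] := poincare (Ordinal d0) (domain_open hOmega) (domain_bounded hOmega).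
have [c1 c10 hinf] := infsup hOmega cmp Cp0 hP.
exists (c1 * (c2 + 4)); split.
  by rewrite mulr_gt0// ltr_wpDl//; exact: cmp_bound_ge0 cmp.
move=> N T hT f Lf Uh hUh.
exact: (dpg_quasi_optimal hOmega hT cmp (hinf N T hT) Lf hUh c10).
Qed.
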